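(* Let $1<p<\infty$, let $\theta\in(0,1)$ and let $\beta_0,\beta_1\in\mathbb{R}$ be such that $$\beta_\theta:=(1-\theta)\beta_0+\theta\beta_1\in(-\infty,-1]\cup(p-1,\infty).$$ Then $$[W_0^{1,p}(\mathbb{R}_+,t^{\beta_0},\mathbb{C}),W_0^{1,p}(\mathbb{R}_+,t^{\beta_1},\mathbb{C})]_\theta=[W^{1,p}(\mathbb{R}_+,t^{\beta_0},\mathbb{C}),W^{1,p}(\mathbb{R}_+,t^{\beta_1},\mathbb{C})]_\theta$$ $$=W^{1,p}(\mathbb{R}_+,t^{\beta_\theta},\mathbb{C})=Y^{1,p}_{t^{\beta_\theta}}\times iY^{1,p}_{t^{\beta_\theta}}.$$
   Context: $\mathbb{R}_+=(0,\infty)$. For $1\le p<\infty$ and $\beta\in\mathbb{R}$: $W^{1,p}(\mathbb{R}_+,t^\beta)$ is the Banach space of all real-valued $u\in W^{1,1}_{loc}(\mathbb{R}_+)$ with finite norm $$\|u\|_{W^{1,p}(\mathbb{R}_+,t^\beta)}=\Big(\int_{\mathbb{R}_+}|u(t)|^pt^\beta dt\Big)^{1/p}+\Big(\int_{\mathbb{R}_+}|u'(t)|^pt^\beta dt\Big)^{1/p}.$$ $Y^{1,p}_{t^\beta}$ is the Banach space of all real-valued $u\in W^{1,1}_{loc}(\mathbb{R}_+)$ with finite norm $$\|u\|_{Y^{1,p}_{t^\beta}}=\Big(\int_{\mathbb{R}_+}|u(t)|^pt^\beta\big(1+\tfrac{1}{t^p}\big)dt\Big)^{1/p}+\Big(\int_{\mathbb{R}_+}|u'(t)|^pt^\beta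 dt\Big)^{1/p}.$$ $W_0^{1,p}(\mathbb{R}_+,t^\beta)$ denotes the completion (closure) of $C_0^\infty(\mathbb{R}_+)$, the smooth functions with compact support in $(0,\infty)$, in $W^{1,p}(\mathbb{R}_+,t^\beta)$. For a space $X$ of real-valued functions, $X\times iX$ denotes the space of complex-valued functions $f_1+if_2$ with $f_1,f_2\in X$. Then $W^{1,p}(\mathbb{R}_+,t^\beta,\mathbb{C}):=W^{1,p}(\mathbb{R}_+,t^\beta)\times iW^{1,p}(\mathbb{R}_+,t^\beta)$ and $W_0^{1,p}(\mathbb{R}_+,t^\beta,\mathbb{C}):=W_0^{1,p}(\mathbb{R}_+,t^\beta)\times iW_0^{1,p}(\mathbb{R}_+,t^\beta)$. $[X,Y]_\theta$ denotes the complex interpolation space (Calderón's complex method) of the couple of complex Banach spaces $X,Y$ with parameter $\theta\in(0,1)$. *)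

(* Defs.v *)
From HB Require Import structures.
From mathcomp Require Import all_boot all_order all_algebra.
From mathcomp Require Import complex.
From mathcomp Require Import all_classical all_reals all_analysis.

Set Implicit Arguments.
Unset Strict Implicit.
Unset Printing Implicit Defensive.

Import Order.TTheory GRing.Theory Num.Theory.
Import numFieldNormedType.Exports.

Local Open Scope classical_set_scope.
Local Open Scope ring_scope.
Local Open Scope complex_scope.

(* A subspace of an ambient space [V], given by its elements and its norm.
   The value of [nrm] outside [carrier] is irrelevant.

   Function spaces are given through representatives: [V] is a space of
   functions on the real line of which only the restriction to (0, +oo) matters,
   the carriers are stable under measurable a.e. modification, and [nrm] is the norm of the
   a.e. class, i.e., a seminorm vanishing exactly on the functions that are null
   a.e. on (0, +oo). *)
Record nspace (R : realType) (V : Type) := NSpace {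
  carrier : set V ;
  nrm : V -> R }.

Definition space_eq (R : realType) (V : Type) (A B : nspace R V) : Prop :=
  carrier A = carrier B /\
  exists2 C : R, 0 < C &
    forall x, carrier A x -> nrm A x <= C * nrm B x /\ nrm B x <= C * nrm A x.

Section ComplexInterpolation.
Variables (R : realType) (V : lmodType R[i]) (X0 X1 : nspace R V).

Definition sum_space : nspace R V := NSpace
  [set x | exists x0 x1, [/\ carrier X0 x0, carrier X1 x1 & x = x0 + x1]]
  (fun x => inf [set r | exists x0 x1,
     [/\ carrier X0 x0, carrier X1 x1, x = x0 + x1 & r = nrm X0 x0 + nrm X1 x1]]).

Definition closed_strip : set R[i]^o := [set z | 0 <= complex.Re z <= 1].
Definition open_strip : set R[i]^o := [set z | 0 < complex.Re z < 1].

Definition bounded_continuous_on_strip (f : R[i] -> V) : Prop :=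
  [/\ forall z, closed_strip z -> carrier sum_space (f z),
      exists M : R, forall z, closed_strip z -> nrm sum_space (f z) <= M
    & forall z, closed_strip z ->
        nrm sum_space (f w - f z) @[w --> within closed_strip (nbhs z)] --> (0 : R)].

Definition holomorphic_on_strip (f : R[i] -> V) : Prop :=
  forall z, open_strip z -> exists2 d, carrier sum_space d &
    nrm sum_space (h^-1 *: (f (z + h) - f z) - d) @[h --> (0 : R[i]^o)^'] --> (0 : R).

Definition boundary_in (X : nspace R V) (g : R -> V) : Prop :=
  [/\ forall t, carrier X (g t),
      forall t, nrm X (g s - g t) @[s --> t] --> (0 : R),
      nrm X (g t) @[t --> +oo] --> (0 : R)
    & nrm X (g t) @[t --> -oo] --> (0 : R)].

(* The space F(X0, X1) of Calderon, with its norm. *)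
Definition calderon_class : nspace R (R[i] -> V) := NSpace
  [set f | [/\ bounded_continuous_on_strip f, holomorphic_on_strip f,
               boundary_in X0 (fun t => f (0 +i* t))
             & boundary_in X1 (fun t => f (1 +i* t))]]
  (fun f => Num.max (sup (range (fun t => nrm X0 (f (0 +i* t)))))
                    (sup (range (fun t => nrm X1 (f (1 +i* t)))))).

Definition complex_interp (theta : R) : nspace R V := NSpace
  [set x | exists2 f, carrier calderon_class f & f theta%:C = x]
  (fun x => inf [set nrm calderon_class f
                | f in [set f | carrier calderon_class f /\ f theta%:C = x]]).

End ComplexInterpolation.

Section FunctionSpaces.
Variable R : realType.
Implicit Types (p beta : R) (u v phi w : R -> R).

Local Notation mu := (@lebesgue_measure R).
Local Notation Rplus := (`]0, +oo[%classic : set R).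

(* C_0^oo(R_+), the functions being extended by 0 to the real line. *)
Definition test_function phi : Prop :=
  (forall n t, derivable (derive1n n phi) t 1) /\
  exists K : set R, [/\ compact K, K `<=` Rplus & forall t, ~ K t -> phi t = 0].

Definition weak_derivative u v : Prop :=
  locally_integrable Rplus v /\
  forall phi, test_function phi ->
    \int[mu]_(t in Rplus) (u t * derive1 phi t) = - \int[mu]_(t in Rplus) (v t * phi t).

Definition W11loc : set (R -> R) :=
  [set u | locally_integrable Rplus u /\ exists v, weak_derivative u v].

(* A representative of u', unique up to a.e. equality when [W11loc u]. *)
Definition wderiv u : R -> R := xget (fun=> 0) [set v | weak_derivative u v].

Definition weighted_norm p w u : \bar R :=
  ((\int[mu]_(t in Rplus) (`|u t| `^ p * w t)%:E) `^ p^-1)%E.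

Definition sobolev_norm p (w0 w1 u : R -> R) : \bar R :=
  (weighted_norm p w0 u + weighted_norm p w1 (wderiv u))%E.

Definition sobolev p (w0 w1 : R -> R) : nspace R (R -> R) := NSpace
  [set u | W11loc u /\ (sobolev_norm p w0 w1 u < +oo)%E]
  (fun u => fine (sobolev_norm p w0 w1 u)).

Definition W1p p beta : nspace R (R -> R) :=
  sobolev p (fun t => t `^ beta) (fun t => t `^ beta).

Definition Y1p p beta : nspace R (R -> R) :=
  sobolev p (fun t => t `^ beta * (1 + 1 / t `^ p)) (fun t => t `^ beta).

Definition W1p0 p beta : nspace R (R -> R) := NSpace
  [set u | carrier (W1p p beta) u /\
     forall e : R, 0 < e ->
       exists2 phi, test_function phi & nrm (W1p p beta) (u - phi) < e]
  (nrm (W1p p beta)).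

(* X x iX. The norm is the supremum over |l| = 1 of the norm of Re (l f): unlike
   the equivalent norm |f1| + |f2|, it is homogeneous for complex scalars. *)
Definition complexification (X : nspace R (R -> R)) : nspace R (R -> R[i]) := NSpace
  [set f | carrier X (fun t => complex.Re (f t)) /\
           carrier X (fun t => complex.Im (f t))]
  (fun f => sup [set nrm X (fun t => complex.Re (l * f t))
                | l in [set l : R[i] | `|l| = 1]]).

End FunctionSpaces.

(* Main.v *)
Require Import Defs.
From HB Require Import structures.
From mathcomp Require Import all_boot all_order all_algebra.
From mathcomp Require Import complex.
From mathcomp Require Import all_classical all_reals all_analysis.
From mathcomp Require Import measurable_realfun ring lra.

(** Write b for beta_theta, kap for (beta0 - beta1) / p, and W, W0, Y for the complexified
    spaces. The spaces of the statement are arranged in a cycle of bounded inclusions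

      [W0(beta0), W0(beta1)]  in  [W(beta0), W(beta1)]  in  W(b)  in  Y(b)  in  [W0(beta0), W0(beta1)]

    so they have the same elements and equivalent norms.

    First inclusion: W0 carries the norm of W, so an admissible function for the first couple
    is admissible for the second one with the same norm ([interp_mono]).

    Second inclusion ([interp_sub_W]). Let f be admissible with f(theta) = x, and let T be the
    identity or the weak derivative. The norm of T x in L^p(t^b) is recovered by pairing with
    bounded compactly supported g ([mass_duality]). Cut the half-line into the pieces
    [e^k, e^(k+1)), on which t^c is constant up to a factor e^|c|, and consider
    F(z) = sum_k exp (k ((1 - z) beta0 + z beta1) / p) int_(piece k) T (f z) g. This is a finite
    sum of entire functions times bounded linear functionals of f z, so it is a bounded scalar
    function that is analytic inside the strip. Hoelder's inequality bounds it on the line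
    Re z = j by the norm of f z in W(beta_j) times the L^q norm of g, the three lines theorem
    carries the bound to theta ([calderon_functional]), and there F is the pairing wanted.

    Third inclusion: Hardy's inequality ([hardy]) bounds the L^p(t^(b-p)) norm by the norm of W(b)
    exactly when b avoids the interval (-1, p - 1]. If b <= -1, finiteness of the norm forces u
    to come arbitrarily close to 0 near the origin, and u is controlled by int_0^t |u'|;
    if b > p - 1, it is controlled by a value at a point of [1, 2] and by int_t^2 |u'|.

    Fourth inclusion ([Y_sub_interp]). For x in Y(b) put
    f(z)(t) = ((theta + 2) / (z + 2))^2 t^(kap (z - theta)) x(t), so f(theta) = x. On Re z = j the
    factor t^(kap (j - theta)) turns the weight t^b into t^(beta_j); differentiating it produces
    kap (z - theta) x / t, which is what the norm of Y controls, and the rational factor absorbs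
    the growth in z and makes f vanish at infinity. Inside the strip f(z) belongs to neither
    space: it is split by a smooth partition of unity according to the sign of kap ln t, each
    half being estimated against the line on which it is smaller. That the values lie in W0, and
    that f is continuous up to the boundary, comes from the density of the test functions in
    Y(b) ([test_dense_Y]). *)

Set Implicit Arguments.
Unset Strict Implicit.
Unset Printing Implicit Defensive.

Import Order.TTheory GRing.Theory Num.Theory Normc.
Import numFieldNormedType.Exports.

Local Open Scope classical_set_scope.
Local Open Scope ring_scope.
Local Open Scope complex_scope.

(** * Complex modulus, derivative and exponential *)

Section ComplexModulus.
Variable R : realType.
Implicit Types z w : R[i].

Lemma normC_normc z : `|z| = (normc z)%:C.
Proof. by rewrite normc_def; case: z. Qed.

Lemma normc_ge0 z : 0 <= normc z.
Proof. by case: z => a b; exact: sqrtr_ge0. Qed.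

Lemma normc_real (r : R) : normc r%:C = `|r|.
Proof. by rewrite /= expr0n/= addr0 sqrtr_sqr. Qed.

Lemma normcB z w : normc (z - w) = normc (w - z).
Proof. by rewrite -normcN opprB. Qed.

Lemma ler_normcB z w : normc (z - w) <= normc z + normc w.
Proof. by rewrite (le_trans (le_normcD _ _))// normcN. Qed.

Lemma Re_le_normc z : `|complex.Re z| <= normc z.
Proof. by rewrite -lecR -normC_normc normc_ge_Re. Qed.

Lemma Im_le_normc z : `|complex.Im z| <= normc z.
Proof.
by case: z => a b /=; rewrite -sqrtr_sqr ler_sqrt ?addr_ge0 ?sqr_ge0// lerDr sqr_ge0.
Qed.

Lemma normc_le_ReIm z : normc z <= `|complex.Re z| + `|complex.Im z|.
Proof.
case: z => a b /=.
rewrite -[leRHS]ger0_norm ?addr_ge0// -sqrtr_sqr ler_sqrt ?sqr_ge0//.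
rewrite sqrrD !real_normK ?num_real// -addrA lerD2l lerDr.
by rewrite mulrn_wge0// mulr_ge0.
Qed.

Lemma sqr_normc z : normc z ^+ 2 = complex.Re z ^+ 2 + complex.Im z ^+ 2.
Proof. by case: z => a b /=; rewrite sqr_sqrtr// addr_ge0 ?sqr_ge0. Qed.

(** The norm of the complex field takes complex values; this passes to real radii. *)
Lemma nbhs_complexP (z : R[i]^o) (A : set R[i]) :
  nbhs z A <-> exists2 d : R, 0 < d & forall w, normc (w - z) < d -> A w.
Proof.
split=> [/nbhs_ballP[/= e e0 zA]|[d d0 zA]].
  have eE : e = (complex.Re e)%:C by rewrite RRe_real// gtr0_real.
  exists (complex.Re e); first by rewrite -ltcR -eE.
  move=> w wz; apply: zA; rewrite -ball_normE/=.
  by rewrite distrC normC_normc eE ltcR.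
apply/nbhs_ballP; exists d%:C; first by rewrite /= ltcR.
by move=> w; rewrite -ball_normE/= distrC normC_normc ltcR => /zA.
Qed.

End ComplexModulus.

Section ComplexDerivative.
Variable R : realType.
Implicit Types (F G : R[i] -> R[i]) (z w d : R[i]).

(** The little-o form of complex differentiability: the value h = 0 needs no exception, which
    makes composition and the Goursat estimate direct. *)
Definition cdiff F z d := forall e : R, 0 < e -> exists2 r : R, 0 < r &
  forall h, normc h < r -> normc (F (z + h) - F z - d * h) <= e * normc h.

Lemma cdiffP F z d : cdiff F z d <-> is_derive (z : R[i]^o) (1 : R[i]^o) (F : R[i]^o -> R[i]^o) d.
Proof.
have quo h : h != 0 ->
    normc (h^-1 * (F (h + z) - F z) - d) * normc h = normc (F (z + h) - F z - d * h).
  move=> h0; rewrite -normcM mulrBl mulrAC mulVf// mul1r; congr normc.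
  by rewrite (addrC h).
split=> [H|].
  have C : (fun h : R[i]^o => h^-1 *: ((F : R[i]^o -> R[i]^o) (h *: 1 + z) - F z)) @ 0^' --> (d : R[i]^o).
    apply/cvgrPdist_lt => e e0.
    have eE : e = (complex.Re e)%:C by rewrite RRe_real// gtr0_real.
    have re0 : 0 < complex.Re e by rewrite -ltcR -eE.
    have [r r0 Hr] := H _ (divr_gt0 re0 (ltr0n R 2)).
    rewrite /dnbhs /within/=; apply/nbhs_complexP; exists r => // h.
    rewrite subr0 => hr h0.
    rewrite distrC normC_normc eE ltcR.
    have nh0 : 0 < normc h.
      rewrite lt_neqAle normc_ge0 andbT eq_sym; apply/negP => /eqP/eq0_normc.
      by move/eqP; rewrite (negbTE h0).
    rewrite -(ltr_pM2r nh0) /GRing.scale/= mulr1 quo//.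
    apply: le_lt_trans (Hr _ hr) _; rewrite ltr_pM2r//.
    by rewrite ltr_pdivrMr// ltr_pMr// ltr1n.
  apply: DeriveDef; last exact: cvg_lim C.
  by apply/cvg_ex; exists d.
case=> dF dE e e0.
have C : (fun h : R[i]^o => h^-1 *: ((F : R[i]^o -> R[i]^o) (h *: 1 + z) - F z)) @ 0^' --> (d : R[i]^o).
  by rewrite -dE; exact: dF.
move/cvgrPdist_lt : C => /(_ e%:C); rewrite ltcR => /(_ e0).
rewrite /dnbhs /within/= => /nbhs_complexP[r r0 Hr].
exists r => // h hr.
have [->|h0] := eqVneq h 0.
  by rewrite addr0 subrr mulr0 subr0 normc0 mulr0.
have nh0 : 0 < normc h.
  rewrite lt_neqAle normc_ge0 andbT eq_sym; apply/negP => /eqP/eq0_normc.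
  by move/eqP; rewrite (negbTE h0).
have := Hr h; rewrite subr0 => /(_ hr h0).
rewrite distrC normC_normc ltcR => /ltW.
by rewrite -(ler_pM2r nh0) /GRing.scale/= mulr1 quo.
Qed.

Lemma cdiff_cst c z : cdiff (fun=> c) z 0.
Proof. by apply/cdiffP; exact: is_derive_cst. Qed.

Lemma cdiff_id z : cdiff id z 1.
Proof. by apply/cdiffP; exact: is_derive_id. Qed.

Lemma cdiffD F G z d d' : cdiff F z d -> cdiff G z d' ->
  cdiff (fun w => F w + G w) z (d + d').
Proof. by move=> /cdiffP ? /cdiffP ?; apply/cdiffP; exact: is_deriveD. Qed.

Lemma cdiffM F G z d d' : cdiff F z d -> cdiff G z d' ->
  cdiff (fun w => F w * G w) z (F z * d' + G z * d).
Proof. by move=> /cdiffP ? /cdiffP ?; apply/cdiffP; exact: is_deriveM. Qed.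

Lemma cdiffZ F z d c : cdiff F z d -> cdiff (fun w => c * F w) z (c * d).
Proof. by move=> /(cdiffM (cdiff_cst c z)); rewrite mulr0 addr0. Qed.

Lemma cdiff_sum n (F : 'I_n -> R[i] -> R[i]) z :
  (forall i, exists d, cdiff (F i) z d) ->
  exists d, cdiff (fun w => \sum_i F i w) z d.
Proof.
elim: n F => [|n IH] F HF.
  exists 0; rewrite (_ : (fun w => _) = fun=> 0); first exact: cdiff_cst.
  by apply/funext => w; rewrite big_ord0.
have [d Hd] := IH _ (fun i => HF (widen_ord (leqnSn n) i)).
have [d' Hd'] := HF ord_max.
exists (d + d'); rewrite (_ : (fun w => _) = fun w =>
  \sum_(i < n) F (widen_ord (leqnSn n) i) w + F ord_max w); first exact: cdiffD.
by apply/funext => w; rewrite big_ord_recr.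
Qed.

Lemma cdiffV F z d : F z != 0 -> cdiff F z d ->
  cdiff (fun w => (F w)^-1) z (- (F z) ^- 2 * d).
Proof.
move=> Fz /cdiffP[dF dE]; apply/cdiffP.
apply: DeriveDef; first exact: derivableV.
by rewrite deriveV// dE.
Qed.

Lemma cdiff_cont F z d : cdiff F z d -> forall e, 0 < e ->
  exists2 r, 0 < r & forall w, normc (w - z) < r -> normc (F w - F z) < e.
Proof.
move=> dF e e0; have [r r0 Hr] := dF 1 ltr01.
have k0 : 0 < 1 + normc d by rewrite ltr_pwDl// normc_ge0.
exists (Num.min r (e / (1 + normc d))); first by rewrite lt_min r0 divr_gt0.
move=> w; rewrite lt_min => /andP[wr we].
have := Hr _ wr; rewrite subrKC mul1r => H.
have -> : F w - F z = (F w - F z - d * (w - z)) + d * (w - z) by rewrite subrK.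
apply: le_lt_trans (le_normcD _ _) _; rewrite normcM.
apply: le_lt_trans (lerD H (lexx _)) _.
by rewrite -[X in X + _]mul1r -mulrDl mulrC -ltr_pdivlMr.
Qed.

Lemma cdiff_comp F G z d d' : cdiff G z d' -> cdiff F (G z) d ->
  cdiff (F \o G) z (d * d').
Proof.
move=> dG dF e e0.
have k0 : 0 < 1 + normc d' by rewrite ltr_pwDl// normc_ge0.
have l0 : 0 < 1 + normc d by rewrite ltr_pwDl// normc_ge0.
have e10 : 0 < e / 2 / (1 + normc d') by rewrite !divr_gt0.
have e20 : 0 < e / 2 / (1 + normc d) by rewrite !divr_gt0.
have [r1 r10 H1] := dF _ e10.
have [r2 r20 H2] := dG _ e20.
have [r3 r30 H3] := dG _ ltr01.
have [r4 r40 H4] := cdiff_cont dG r10.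
exists (Num.min (Num.min r2 r3) r4); first by rewrite !lt_min r20 r30 r40.
move=> h; rewrite !lt_min => /andP[/andP[hr2 hr3] hr4] /=.
pose k := G (z + h) - G z.
have kr : normc k < r1 by apply: H4; rewrite addrC addKr.
have {}H1 := H1 _ kr.
have GE : G (z + h) = G z + k by rewrite subrKC.
have -> : F (G (z + h)) - F (G z) - d * d' * h =
  (F (G z + k) - F (G z) - d * k) + d * (k - d' * h).
  by rewrite GE; ring.
apply: le_trans (le_normcD _ _) _; rewrite normcM.
have nk : normc k <= (1 + normc d') * normc h.
  have -> : k = (k - d' * h) + d' * h by rewrite subrK.
  apply: le_trans (le_normcD _ _) _; rewrite mulrDl lerD// ?normcM//.
  exact: H3.
have -> : e * normc h = e / 2 * normc h + e / 2 * normc h by field.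
apply: lerD.
  apply: le_trans H1 _; rewrite mulrAC ler_pdivrMr// -!mulrA.
  by rewrite !ler_pM2l ?invr_gt0// mulrC.
apply: (@le_trans _ _ ((1 + normc d) * normc (k - d' * h))).
  by rewrite ler_wpM2r ?normc_ge0// lerDr.
by apply: le_trans (ler_wpM2l (ltW l0) (H2 _ hr2)) _; rewrite mulrA mulrCA mulfV ?mulr1// gt_eqF.
Qed.

End ComplexDerivative.

Section ComplexExponential.
Variable R : realType.
Implicit Types (z w : R[i]).

Definition cexp z : R[i] :=
  (expR (complex.Re z) * cos (complex.Im z)) +i* (expR (complex.Re z) * sin (complex.Im z)).

Lemma cexp0 : cexp 0 = 1.
Proof. by rewrite /cexp /= expR0 cos0 sin0 mulr1 mulr0. Qed.

Lemma cexpD z w : cexp (z + w) = cexp z * cexp w.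
Proof.
case: z w => [a b] [c d]; rewrite /cexp /= expRD cosD sinD; simpc.
by congr (_ +i* _); ring.
Qed.

Lemma normc_cexp z : normc (cexp z) = expR (complex.Re z).
Proof.
by rewrite /cexp/= !exprMn -mulrDr cos2Dsin2 mulr1 sqrtr_sqr ger0_norm.
Qed.

Lemma cexp_real (r : R) : cexp r%:C = (expR r)%:C.
Proof. by rewrite /cexp/= cos0 sin0 mulr1 mulr0. Qed.

(** Apply the mean value theorem to g, and then to its derivative. *)
Lemma taylor_bound (g g' g'' : R -> R) (K : R) :
  (forall t : R, is_derive t (1 : R) g (g' t)) ->
  (forall t : R, is_derive t (1 : R) g' (g'' t)) ->
  (forall t, 0 <= t <= 1 -> `|g'' t| <= K) ->
  `|g 1 - g 0 - g' 0| <= K.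
Proof.
move=> dg dg' gK.
have mvt (f f' : R -> R) (b : R) : 0 < b -> (forall t : R, is_derive t (1 : R) f (f' t)) ->
    exists2 c, 0 < c < b & f b - f 0 = f' c * b.
  move=> b0 df; have [//|c + ->] := MVT b0 (fun x _ => df x).
    apply: derivable_within_continuous => x _; exact: ex_derive.
  by rewrite in_itv subr0 => ?; exists c.
have [c /andP[c0 c1]] := mvt g g' 1 ltr01 dg; rewrite mulr1 => ->.
have [c' /andP[c'0 c'c] ->] := mvt g' g'' c c0 dg'.
have H : `|g'' c'| <= K by apply: gK; rewrite (ltW c'0) (ltW (lt_trans c'c c1)).
rewrite normrM; apply: le_trans H.
by rewrite ler_piMr// gtr0_norm// ltW.
Qed.

(** Second order Taylor expansion along the segment from i s to a + i (b + s); with s = 0 and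
    s = - pi / 2 it gives the real and the imaginary part of the exponential. *)
Lemma taylor_expcos (a b s : R) :
  `|expR a * cos (b + s) - cos s - (a * cos s - b * sin s)| <=
    2 * (a ^+ 2 + b ^+ 2) * expR `|a|.
Proof.
pose g t := expR (t * a) * cos (t * b + s).
pose g' t := expR (t * a) * (a * cos (t * b + s) - b * sin (t * b + s)).
pose g'' t := expR (t * a) * ((a ^+ 2 - b ^+ 2) * cos (t * b + s)
   - 2 * a * b * sin (t * b + s)).
have dl (c e x : R) : is_derive x (1 : R) (fun t : R => t * c + e) c.
  have := is_deriveD (is_deriveM (is_derive_id x (1 : R)) (is_derive_cst c x 1)) (is_derive_cst e x 1).
  by rewrite scaler0 add0r addr0 /GRing.scale/= mulr1.
have dl0 (c x : R) : is_derive x (1 : R) (fun t : R => t * c) c.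
  have := dl c 0 x; congr is_derive; apply/funext => t; exact: addr0.
have de x := @is_derive1_comp _ _ (fun t : R => t * a) x _ _ (is_derive_expR (x * a)) (dl0 a x).
have dc x := @is_derive1_comp _ _ (fun t : R => t * b + s) x _ _ (is_derive_cos (x * b + s)) (dl b s x).
have ds x := @is_derive1_comp _ _ (fun t : R => t * b + s) x _ _ (is_derive_sin (x * b + s)) (dl b s x).
have dg x : is_derive x (1 : R) g (g' x).
  apply: (is_derive_eq (is_deriveM (de x) (dc x))).
  by rewrite /g' /GRing.scale/=; ring.
have dg' x : is_derive x (1 : R) g' (g'' x).
  apply: (is_derive_eq (is_deriveM (de x)
    (is_deriveB (is_deriveZ a (dc x)) (is_deriveZ b (ds x))))).
  rewrite -[LHS]/(expR (x * a) * (a * (- sin (x * b + s) * b) -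
    b * (cos (x * b + s) * b)) + (a * cos (x * b + s) - b * sin (x * b + s)) *
    (expR (x * a) * a)).
  by rewrite /g''; ring.
have := @taylor_bound g g' g'' (2 * (a ^+ 2 + b ^+ 2) * expR `|a|) dg dg' _.
rewrite /g /g' !mul1r !mul0r expR0 !add0r !mul1r; apply => t /andP[t0 t1].
rewrite /g'' normrM (ger0_norm (expR_ge0 _)) mulrC ler_pM ?normr_ge0 ?expR_ge0//.
  set u := t * b + s.
  apply: le_trans (ler_normB _ _) _; rewrite 2!normrM.
  have h1 : `|a ^+ 2 - b ^+ 2| <= a ^+ 2 + b ^+ 2.
    by apply: le_trans (ler_normB _ _) _; rewrite !ger0_norm ?sqr_ge0.
  have h2 : `|2 * a * b| <= a ^+ 2 + b ^+ 2.
    rewrite ler_norml; apply/andP; split.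
      rewrite -subr_ge0 (_ : _ - _ = (a + b) ^+ 2) ?sqr_ge0//; ring.
    rewrite -subr_ge0 (_ : _ - _ = (a - b) ^+ 2) ?sqr_ge0//; ring.
  rewrite [leRHS]mulr_natl [leRHS]mulr2n lerD//.
    by rewrite -[leRHS]mulr1 ler_pM// ler_norml cos_geN1 cos_le1.
  by rewrite -[leRHS]mulr1 ler_pM// ler_norml sin_geN1 sin_le1.
rewrite ler_expR (le_trans (ler_norm _))// normrM ler_piMl// ger0_norm//.
Qed.

Lemma cexp_taylor w : normc (cexp w - 1 - w) <= 4 * normc w ^+ 2 * expR (normc w).
Proof.
have N2 := sqr_normc w; have Rw := Re_le_normc w.
apply: (le_trans (normc_le_ReIm _)).
case: w N2 Rw => a b; move: (normc _) => N /= N2 Rw.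
have H1 := taylor_expcos a b 0.
have H2 := taylor_expcos a b (- (pi / 2)).
have sE x : cos (x - pi / 2) = sin x by rewrite cosBpihalf.
have : `|expR a * cos b - 1 - a| <= 2 * N ^+ 2 * expR N.
  move: H1; rewrite addr0 cos0 sin0 mulr1 mulr0 subr0 => /le_trans; apply.
  by rewrite N2 ler_wpM2l ?ler_expR// mulr_ge0// addr_ge0 ?sqr_ge0.
have : `|expR a * sin b - b| <= 2 * N ^+ 2 * expR N.
  move: H2; rewrite sE sinN cosN sin_pihalf cos_pihalf mulr0 sub0r mulrN1 opprK subr0 => /le_trans; apply.
  by rewrite N2 ler_wpM2l ?ler_expR// mulr_ge0// addr_ge0 ?sqr_ge0.
move=> X Y; rewrite ?oppr0 ?subr0 ?addr0; lra.
Qed.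

Lemma cdiff_cexp z : cdiff cexp z (cexp z).
Proof.
move=> e e0.
set K := normc (cexp z) * 4 * expR 1.
have K0 : 0 < K by rewrite /K normc_cexp !mulr_gt0// expR_gt0.
exists (Num.min 1 (e / K)); first by rewrite lt_min ltr01 divr_gt0.
move=> h; rewrite lt_min => /andP[h1 he].
rewrite cexpD (_ : _ - _ = cexp z * (cexp h - 1 - h)); last by ring.
rewrite normcM; apply: le_trans (ler_wpM2l (normc_ge0 _) (cexp_taylor h)) _.
apply: (@le_trans _ _ (K * normc h * normc h)).
  rewrite /K !mulrA -!(mulrA (_ * 4)) ler_wpM2l ?mulr_ge0 ?normc_ge0//.
  by rewrite mulrC -!mulrA ler_wpM2r ?mulr_ge0 ?normc_ge0// ler_expR ltW.
by rewrite ler_wpM2r ?normc_ge0// mulrC -ler_pdivlMr// ltW.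
Qed.

End ComplexExponential.

(** * The Goursat theorem on rectangles *)

Section Goursat.
Variable R : realType.
Notation mu := (@lebesgue_measure R).

Lemma integrable_segment (f : R -> R) (a b : R) :
  {in `[a, b], continuous f} -> mu.-integrable `[a, b] (EFin \o f).
Proof.
move=> cf; apply: continuous_compact_integrable; first exact: segment_compact.
by apply: continuous_in_subspaceT => x /[!inE] xab; apply: cf.
Qed.

Lemma Rintegral_segment_split (f : R -> R) (a b c : R) : a <= b -> b <= c ->
  {in `[a, c], continuous f} ->
  \int[mu]_(x in `[a, c]) f x = \int[mu]_(x in `[a, b]) f x + \int[mu]_(x in `[b, c]) f x.
Proof.
move=> ab bc cf; have fi := integrable_segment cf.
have := @Rintegral_itvB R f (BLeft a) (BRight c) b fi.
rewrite !bnd_simp => /(_ ab bc) H.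
apply/eqP; rewrite addrC -subr_eq H; apply/eqP.
apply: Rintegral_itv_obnd_cbnd; apply: integrableS fi => //.
by apply: subset_itvScc; rewrite bnd_simp.
Qed.

Lemma Rintegral_segment_cst (a b k : R) : a <= b ->
  \int[mu]_(x in `[a, b]) k = k * (b - a).
Proof.
move=> ab; rewrite Rintegral_cst//; congr (_ * _).
by rewrite /= lebesgue_measure_itv/= lte_fin; case: ltgtP ab => //= ->; rewrite subrr.
Qed.

Lemma Rintegral_segment_bound (f : R -> R) (a b K : R) : a <= b ->
  {in `[a, b], continuous f} -> (forall x, a <= x <= b -> `|f x| <= K) ->
  `|\int[mu]_(x in `[a, b]) f x| <= K * (b - a).
Proof.
move=> ab cf fK.
have mab : measurable (`[a, b] : set R) by [].
apply: (le_trans (le_normr_Rintegral _ _)) => //; first exact: integrable_segment.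
rewrite -(Rintegral_segment_cst K ab).
apply: le_Rintegral => //.
have : {in `[a, b], continuous (fun x => `|f x|)}.
    by move=> x xab; apply: (@continuous_comp _ _ _ f Num.norm); [exact: cf|exact: norm_continuous].
  by move=> /integrable_segment.
by apply: integrable_segment => x _; exact: cst_continuous.
Qed.

Lemma RintegralB_segment (f g : R -> R) (a b : R) :
  {in `[a, b], continuous f} -> {in `[a, b], continuous g} ->
  \int[mu]_(x in `[a, b]) (f x - g x) =
  \int[mu]_(x in `[a, b]) f x - \int[mu]_(x in `[a, b]) g x.
Proof. by move=> cf cg; rewrite RintegralB//; exact: integrable_segment. Qed.

Lemma RintegralB_cst_segment (f : R -> R) (a b k : R) : a <= b ->
  {in `[a, b], continuous f} ->
  \int[mu]_(x in `[a, b]) (f x - k) = \int[mu]_(x in `[a, b]) f x - k * (b - a).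
Proof.
move=> ab cf; rewrite RintegralB_segment//; last by move=> x _; exact: cst_continuous.
by rewrite Rintegral_segment_cst.
Qed.

Variables (H : R[i] -> R[i]) (B : R).
Hypothesis dH : forall z, complex.Re z < B -> exists d, cdiff H z d.

Let P x y := complex.Re (H (x +i* y)).
Let Q x y := complex.Im (H (x +i* y)).

Let contH (p : R[i] -> R) (l : R -> R[i]) (t : R) :
  (forall z w, `|p z - p w| <= normc (z - w)) ->
  (forall s u, normc (l s - l u) <= `|s - u|) ->
  complex.Re (l t) < B -> {for t, continuous (fun s => p (H (l s)))}.
Proof.
move=> pL lL ltB; have [d /cdiff_cont dd] := dH ltB.
apply/cvgrPdist_lt => e e0; have [r r0 Hr] := dd _ e0.
near=> s; apply: le_lt_trans (pL _ _) _.
rewrite normcB; apply: Hr; apply: le_lt_trans (lL _ _) _.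
rewrite distrC; near: s; exact: (@cvgr_dist_lt _ _ _ (nbhs t) _ id t).
Unshelve. all: by end_near. Qed.

Let pRe (z w : R[i]) : `|complex.Re z - complex.Re w| <= normc (z - w).
Proof. by apply: le_trans (Re_le_normc _); case: z w => [a b] [c d]. Qed.
Let pIm (z w : R[i]) : `|complex.Im z - complex.Im w| <= normc (z - w).
Proof. by apply: le_trans (Im_le_normc _); case: z w => [a b] [c d]. Qed.
Let lh (y s u : R) : normc ((s +i* y) - (u +i* y)) <= `|s - u|.
Proof. by apply: le_trans (normc_le_ReIm _) _; rewrite /= subrr normr0 addr0. Qed.
Let lv (x s u : R) : normc ((x +i* s) - (x +i* u)) <= `|s - u|.
Proof. by apply: le_trans (normc_le_ReIm _) _; rewrite /= subrr normr0 add0r. Qed.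

Let cP x y : x < B -> {for y, continuous (P x)}.
Proof. by move=> xB; apply: (contH (p := @complex.Re R)). Qed.
Let cQ y x : x < B -> {for x, continuous (Q ^~ y)}.
Proof. by move=> xB; apply: (contH (p := @complex.Im R) (l := fun s => s +i* y)). Qed.

(** The imaginary part of the integral of H along the boundary of a rectangle. Imaginary
    parts suffice: they carry the mean value property of Re H used below. *)
Let contour x1 x2 y1 y2 :=
  \int[mu]_(x in `[x1, x2]) (Q x y1 - Q x y2) +
  \int[mu]_(y in `[y1, y2]) (P x2 y - P x1 y).

Let cQQ x1 x2 y1 y2 : x2 < B -> {in `[x1, x2], continuous (fun x => Q x y1 - Q x y2)}.
Proof.
move=> xB x; rewrite in_itv/= => /andP[_ xx]; have xB' := le_lt_trans xx xB.
by apply: cvgB; exact: cQ.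
Qed.

Let cPP x1 x2 y1 y2 : x1 <= x2 -> x2 < B ->
  {in `[y1, y2], continuous (fun y => P x2 y - P x1 y)}.
Proof. by move=> x12 xB y _; apply: cvgB; apply: cP => //; exact: le_lt_trans xB. Qed.

Let contour_splitx x1 x x2 y1 y2 : x1 <= x -> x <= x2 -> x2 < B ->
  contour x1 x2 y1 y2 = contour x1 x y1 y2 + contour x x2 y1 y2.
Proof.
move=> x1x xx2 xB; rewrite /contour (Rintegral_segment_split x1x xx2); last exact: cQQ.
have cPi x' : x' <= x2 -> {in `[y1, y2], continuous (P x')}.
  by move=> ? y _; apply: cP; exact: le_lt_trans xB.
have xx1 := le_trans x1x xx2.
by rewrite !RintegralB_segment; do ?[exact: cPi]; first ring;
  (move=> u; rewrite in_itv/= => /andP[_ uu]; apply: cQ; apply: le_lt_trans xB; rewrite ?(le_trans uu)).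
Qed.

Let contour_splity x1 x2 y1 y y2 : x1 <= x2 -> y1 <= y -> y <= y2 -> x2 < B ->
  contour x1 x2 y1 y2 = contour x1 x2 y1 y + contour x1 x2 y y2.
Proof.
move=> x12 y1y yy2 xB; rewrite /contour (Rintegral_segment_split y1y yy2); last exact: cPP.
have cQi y' : {in `[x1, x2], continuous (Q ^~ y')}.
  by move=> u; rewrite in_itv/= => /andP[_ uu]; apply: cQ; exact: le_lt_trans xB.
have X : \int[mu]_(x in `[x1, x2]) (Q x y1 - Q x y2) =
    \int[mu]_(x in `[x1, x2]) (Q x y1 - Q x y) + \int[mu]_(x in `[x1, x2]) (Q x y - Q x y2).
  by rewrite !(RintegralB_segment (cQi _) (cQi _)); ring.
by rewrite X; ring.
Qed.

(** Near a point of differentiability the affine part of H integrates to 0 along the boundary, and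
    the remainder is at most e times the diameter, on a boundary of length 2 (w + h). *)
Let contour_small X Y e : X < B -> 0 < e -> exists2 r : R, 0 < r &
  forall x y w h, 0 <= w -> 0 <= h -> x <= X <= x + w -> y <= Y <= y + h ->
    x + w < B -> w + h < r ->
    `|contour x (x + w) y (y + h)| <= 2 * e * (w + h) ^+ 2.
Proof.
move=> XB e0; have [d dd] := dH (z := X +i* Y) XB.
have [r r0 Hr] := dd _ e0; exists r => // x y w h w0 h0 /andP[xX Xx] /andP[yY Yy] xB wh.
have near_ u v : x <= u <= x + w -> y <= v <= y + h ->
    normc (H (u +i* v) - H (X +i* Y) - d * ((u - X) +i* (v - Y))) <= e * (w + h).
  move=> /andP[xu ux] /andP[yv vy].
  have -> : u +i* v = X +i* Y + ((u - X) +i* (v - Y)) by simpc; rewrite !subrKC.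
  have n : normc ((u - X) +i* (v - Y)) <= w + h.
    apply: le_trans (normc_le_ReIm _) _ => /=; apply: lerD; rewrite ler_norml; lra.
  apply: le_trans (Hr _ (le_lt_trans n wh)) _; first by rewrite ler_pM2l.
have ReE u v u' v' : complex.Re (H (u +i* v) - H (X +i* Y) - d * ((u - X) +i* (v - Y)))
   - complex.Re (H (u' +i* v') - H (X +i* Y) - d * ((u' - X) +i* (v' - Y))) =
   P u v - P u' v' - (complex.Re d * (u - u') - complex.Im d * (v - v')).
  rewrite /P; case: (H _) (H _) (H _) d {dd Hr near_} => [a b] [a' b'] [a'' b''] [d1 d2] /=.
  by simpc => /=; ring.
have ImE u v u' v' : complex.Im (H (u +i* v) - H (X +i* Y) - d * ((u - X) +i* (v - Y)))
   - complex.Im (H (u' +i* v') - H (X +i* Y) - d * ((u' - X) +i* (v' - Y))) =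
   Q u v - Q u' v' - (complex.Re d * (v - v') + complex.Im d * (u - u')).
  rewrite /Q; case: (H _) (H _) (H _) d {dd Hr near_ ReE} => [a b] [a' b'] [a'' b''] [d1 d2] /=.
  by simpc => /=; ring.
have xw : x <= x + w by rewrite lerDl.
have yh : y <= y + h by rewrite lerDl.
have two a b K : `|a| <= K -> `|b| <= K -> `|a - b : R| <= 2 * K.
  by move=> aK bK; rewrite (le_trans (ler_normB _ _))// mulr_natl mulr2n lerD.
set a := complex.Re d.
have cB (f : R -> R) (I : interval R) (k : R) :
    {in I, continuous f} -> {in I, continuous (fun t => f t - k)}.
  by move=> cf t tI; apply: cvgB; [exact: cf|exact: cvg_cst].
have Qb : `|\int[mu]_(t in `[x, x + w]) (Q t y - Q t (y + h) - - (a * h))| <= 2 * (e * (w + h)) * (x + w - x).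
  apply: Rintegral_segment_bound => //.
    have cb : {in `[x, x + w], continuous (fun t => Q t y - Q t (y + h))} by exact: cQQ.
    exact: (cB _ _ _ cb).
  move=> t tI.
  have -> : Q t y - Q t (y + h) - - (a * h) = complex.Im (H (t +i* y) - H (X +i* Y) - d * ((t - X) +i* (y - Y)))
   - complex.Im (H (t +i* (y + h)) - H (X +i* Y) - d * ((t - X) +i* (y + h - Y))).
    by rewrite ImE -/a; ring.
  by apply: two; apply: le_trans (Im_le_normc _) _; apply: near_ => //; rewrite ?lexx ?yh.
have Pb : `|\int[mu]_(t in `[y, y + h]) (P (x + w) t - P x t - a * w)| <= 2 * (e * (w + h)) * (y + h - y).
  apply: Rintegral_segment_bound => //.
    have cb : {in `[y, y + h], continuous (fun t => P (x + w) t - P x t)} by exact: cPP.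
    exact: (cB _ _ _ cb).
  move=> t tI.
  have -> : P (x + w) t - P x t - a * w = complex.Re (H ((x + w) +i* t) - H (X +i* Y) - d * ((x + w - X) +i* (t - Y)))
   - complex.Re (H (x +i* t) - H (X +i* Y) - d * ((x - X) +i* (t - Y))).
    by rewrite ReE -/a; ring.
  by apply: two; apply: le_trans (Re_le_normc _) _; apply: near_ => //; rewrite ?lexx ?xw.
move: Qb Pb; rewrite (RintegralB_cst_segment _ xw (cQQ (x1 := x) xB)).
rewrite (RintegralB_cst_segment _ yh (cPP xw xB)) => Qb Pb.
rewrite /contour -[X in `|X|](_ : (\int[mu]_(x0 in `[x, (x + w)]) (Q x0 y - Q x0 (y + h)) - - (a * h) * (x + w - x)) +
  (\int[mu]_(x0 in `[y, (y + h)]) (P (x + w) x0 - P x x0) - a * w * (y + h - y)) = _); last by ring.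
apply: (le_trans (ler_normD _ _)); apply: (le_trans (lerD Qb Pb)).
by rewrite le_eqVlt; apply/orP; left; apply/eqP; ring.
Qed.

Let contour_quarter x y w h : 0 <= w -> 0 <= h -> x + w < B ->
  exists2 q : R * R, (x <= q.1 <= x + w / 2) && (y <= q.2 <= y + h / 2) &
    `|contour x (x + w) y (y + h)| <= 4 * `|contour q.1 (q.1 + w / 2) q.2 (q.2 + h / 2)|.
Proof.
move=> w0 h0 xB.
pose c x y := contour x (x + w / 2) y (y + h / 2).
have wE : w / 2 + w / 2 = w by field.
have hE : h / 2 + h / 2 = h by field.
have cE : contour x (x + w) y (y + h) =
    c x y + c x (y + h / 2) + (c (x + w / 2) y + c (x + w / 2) (y + h / 2)).
  rewrite (contour_splitx (x := x + w / 2)) //; try lra.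
  rewrite (@contour_splity x (x + w / 2) y (y + h / 2) (y + h)); try lra.
  rewrite (@contour_splity (x + w / 2) (x + w) y (y + h / 2) (y + h)); try lra.
  by rewrite /c -!(addrA x) -!(addrA y) wE hE.
have [q qP] : exists q : R * R, [/\ x <= q.1 <= x + w / 2, y <= q.2 <= y + h / 2,
    `|c x y| <= `|c q.1 q.2| & `|c x (y + h / 2)| <= `|c q.1 q.2|] /\
    (`|c (x + w / 2) y| <= `|c q.1 q.2| /\ `|c (x + w / 2) (y + h / 2)| <= `|c q.1 q.2|).
  pose f (i : bool * bool) := `|c (if i.1 then x + w / 2 else x) (if i.2 then y + h / 2 else y)|.
  have [i _ fi] := arg_maxP (P := xpredT) f (i0 := (true, true)) isT.
  exists (if i.1 then x + w / 2 else x, if i.2 then y + h / 2 else y); split; first split => /=.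
  - by case: ifP => _; lra.
  - by case: ifP => _; lra.
  - exact: (fi (false, false)).
  - exact: (fi (false, true)).
  - by split; [exact: (fi (true, false))|exact: (fi (true, true))].
case: qP => -[q1 q2 c1 c2] [c3 c4]; exists q; first by rewrite q1 q2.
rewrite cE -/(c q.1 q.2).
do 3?(apply: le_trans (ler_normD _ _) _).
have [n1 n2] := (ler_normD (c x y) (c x (y + h / 2)), ler_normD (c (x + w / 2) y) (c (x + w / 2) (y + h / 2))).
lra.
Qed.

(** Quarter the rectangle repeatedly, keeping a quarter whose contour integral is largest in modulus: the
    integral decreases at most like 4^-k, while [contour_small] at the common point of the nested
    rectangles makes it smaller than any multiple of 4^-k. *)
Lemma goursat x y w h : 0 <= w -> 0 <= h -> x + w < B ->
  \int[mu]_(u in `[x, x + w]) (complex.Im (H (u +i* y)) - complex.Im (H (u +i* (y + h)))) +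
  \int[mu]_(v in `[y, y + h]) (complex.Re (H ((x + w) +i* v)) - complex.Re (H (x +i* v))) = 0.
Proof.
move=> w0 h0 xB; rewrite -/(contour x (x + w) y (y + h)).
apply/eqP/negPn/negP => c0.
have {c0} : 0 < `|contour x (x + w) y (y + h)| by rewrite normr_gt0.
set c := `| _ | => c0.
pose ok k (q : R * R) := q.1 + w / 2 ^+ k < B.
have step k (q : R * R) : exists q' : R * R, q.1 + w / 2 ^+ k < B ->
   (q.1 <= q'.1 <= q.1 + w / 2 ^+ k.+1) && (q.2 <= q'.2 <= q.2 + h / 2 ^+ k.+1) /\
    `|contour q.1 (q.1 + w / 2 ^+ k) q.2 (q.2 + h / 2 ^+ k)| <=
     4 * `|contour q'.1 (q'.1 + w / 2 ^+ k.+1) q'.2 (q'.2 + h / 2 ^+ k.+1)|.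
  case: (ltP (q.1 + w / 2 ^+ k) B) => [qB|_]; last by exists q.
  have [||q' q'1 q'2] := @contour_quarter q.1 q.2 (w / 2 ^+ k) (h / 2 ^+ k) _ _ qB.
  - by rewrite divr_ge0// exprn_ge0.
  - by rewrite divr_ge0// exprn_ge0.
  by exists q' => _; rewrite !exprSr !invfM !mulrA; split.
(* A choice function for the quarters; outside the half-plane Re z < B the choice is arbitrary. *)
have [f Hf] : {f : nat -> R * R -> R * R & forall k (q : R * R), q.1 + w / 2 ^+ k < B ->
   (q.1 <= (f k q).1 <= q.1 + w / 2 ^+ k.+1) && (q.2 <= (f k q).2 <= q.2 + h / 2 ^+ k.+1) /\
    `|contour q.1 (q.1 + w / 2 ^+ k) q.2 (q.2 + h / 2 ^+ k)| <=
     4 * `|contour (f k q).1 ((f k q).1 + w / 2 ^+ k.+1) (f k q).2 ((f k q).2 + h / 2 ^+ k.+1)|}.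
  exists (fun k q => projT1 (cid (step k q))) => k q.
  exact: (projT2 (cid (step k q))).
pose q := fix q k := if k is k'.+1 then f k' (q k') else (x, y).
have half k (a : R) : a / 2 ^+ k = a / 2 ^+ k.+1 + a / 2 ^+ k.+1.
  by rewrite exprSr invfM mulrA; field; rewrite expf_neq0.
have dec k (a : R) : 0 <= a -> 0 <= a / 2 ^+ k by move=> a0; rewrite divr_ge0// exprn_ge0.
have qB k : (q k).1 + w / 2 ^+ k <= x + w.
  elim: k => [|k IH] /=; first by rewrite expr0 divr1.
  have [/andP[/andP[_ q1] _] _] := Hf k (q k) (le_lt_trans IH xB).
  by apply: le_trans IH; rewrite (half k w) addrA lerD2r.
have qs k := Hf k (q k) (le_lt_trans (qB k) xB).
have cq k : c <= 4 ^+ k * `|contour (q k).1 ((q k).1 + w / 2 ^+ k) (q k).2 ((q k).2 + h / 2 ^+ k)|.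
  elim: k => [|k IH]; first by rewrite !expr0 !divr1 mul1r.
  apply: le_trans IH _; rewrite (exprSr 4) -mulrA ler_wpM2l ?exprn_ge0//.
  by case: (qs k).
(* Nested segments have a common point, the supremum of their left ends. *)
have nested (g : nat -> R) (a : R) : 0 <= a ->
    (forall k, g k <= g k.+1 <= g k + a / 2 ^+ k.+1) ->
    exists X, forall k, g k <= X <= g k + a / 2 ^+ k.
  move=> a0 gS.
  have mono k m : (k <= m)%N -> g k <= g m /\ g m + a / 2 ^+ m <= g k + a / 2 ^+ k.
    elim: m => [|m IH]; first by rewrite leqn0 => /eqP ->.
    rewrite leq_eqVlt => /predU1P[->//|]; rewrite ltnS => /IH[i1 i2].
    have /andP[s1 s2] := gS m; have hm := half m a; split; lra.
  have bnd k m : g m <= g k + a / 2 ^+ k.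
    have := dec m a a0; have := dec k a a0.
    by case: (leqP k m) => [/mono[]|/ltnW/mono[]]; lra.
  exists (sup (range g)) => k; apply/andP; split.
    by apply: ub_le_sup; [exists (g 0%N + a / 2 ^+ 0) => _ [m _ <-]|exists k].
  by apply: ge_sup; [exists (g 0%N), 0%N|move=> _ [m _ <-]].
have [X HX] := nested (fun k => (q k).1) w w0 (fun k => proj1 (andP (proj1 (qs k)))).
have [Y HY] := nested (fun k => (q k).2) h h0 (fun k => proj2 (andP (proj1 (qs k)))).
have XB : X < B.
  by have /andP[_ ] := HX 0%N; rewrite /= expr0 divr1 => /le_lt_trans; apply.
pose e := c / (4 * (1 + (w + h) ^+ 2)).
have e0 : 0 < e by rewrite divr_gt0// mulr_gt0// ltr_pwDl// sqr_ge0.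
have [r r0 Hr] := contour_small Y XB e0.
have [k wk] : exists k : nat, (w + h) / 2 ^+ k < r.
  have := @cvg_geometric R (w + h) 2^-1; rewrite ger0_norm// invf_lt1// ltr1n => /(_ isT).
  move=> /cvgrPdist_lt /(_ _ r0) [k _ /(_ k (leqnn k))] /=.
  rewrite sub0r normrN => /(le_lt_trans (ler_norm _)); rewrite exprVn => ?.
  by exists k.
have := Hr (q k).1 (q k).2 (w / 2 ^+ k) (h / 2 ^+ k) (dec k w w0) (dec k h h0) (HX k) (HY k).
rewrite -mulrDl => /(_ (le_lt_trans (qB k) xB) wk) small.
have := le_trans (cq k) (ler_wpM2l (exprn_ge0 k (ler0n R 4)) small).
have -> : (4 : R) ^+ k = (2 ^+ k) ^+ 2 by rewrite -exprM mulnC exprM; congr (_ ^+ _); ring.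
have -> : (2 ^+ k) ^+ 2 * (2 * e * ((w + h) / 2 ^+ k) ^+ 2) = 2 * e * (w + h) ^+ 2.
  by field; rewrite expf_neq0.
apply/negP; rewrite -ltNge /e.
have D0 : 0 < 1 + (w + h) ^+ 2 by rewrite ltr_pwDl// sqr_ge0.
rewrite -subr_gt0 (_ : _ - _ = c * (2 + (w + h) ^+ 2) / (2 * (1 + (w + h) ^+ 2))); last first.
  by field; rewrite gt_eqF.
by rewrite divr_gt0// mulr_gt0// ltr_pwDl// sqr_ge0.
Qed.

End Goursat.

(** * Maximum modulus and the three lines theorem *)

Section MaximumModulus.
Variable R : realType.
Notation mu := (@lebesgue_measure R).
Implicit Types (F : R[i] -> R[i]) (z : R[i]).

(** The change of variable z = z0 + exp w turns concentric circles into vertical segments of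
    length 2 pi. By [goursat] and periodicity, the integrals of Re F over all these segments are
    equal; on small circles they are close to 2 pi Re F(z0). *)
Lemma mean_value_le F z0 (r rho K : R) : 0 < r -> r < rho ->
  (forall z, normc (z - z0) < rho -> exists d, cdiff F z d) ->
  (forall v, complex.Re (F (z0 + cexp (ln r +i* v))) <= K) ->
  complex.Re (F z0) <= K.
Proof.
move=> r0 rrho dF FK; rewrite leNgt; apply/negP => KF.
have rho0 := lt_trans r0 rrho.
pose H w := F (z0 + cexp w).
have dH w : complex.Re w < ln rho -> exists d, cdiff H w d.
  move=> wr; have [|d dd] := dF (z0 + cexp w).
    by rewrite addrC addKr normc_cexp -[X in _ < X]lnK ?posrE// ltr_expR.
  have dz : cdiff (fun w => z0 + cexp w) w (0 + cexp w).
    by apply: cdiffD; [exact: cdiff_cst|exact: cdiff_cexp].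
  by eexists; exact: (cdiff_comp dz dd).
pose e := (complex.Re (F z0) - K) / 2.
have e0 : 0 < e by rewrite divr_gt0// subr_gt0.
have [d /cdiff_cont/(_ _ e0)[s s0 Hs]] : exists d, cdiff F z0 d.
  by apply: dF; rewrite subrr normc0.
(* The left side of the rectangle is a circle so small that F varies by less than e on it. *)
pose a := Num.min (ln r) (ln (s / 2)).
have ar : a <= ln r by rewrite ge_min lexx.
have eas : expR a < s.
  apply: (@le_lt_trans _ _ (s / 2)); last by rewrite ltr_pdivrMr// ltr_pMr// ltr1n.
  by rewrite -[leRHS]lnK ?posrE ?divr_gt0// ler_expR ge_min lexx orbT.
have Ha v : complex.Re (F z0) - e < complex.Re (H (a +i* v)).
  have := Hs (z0 + cexp (a +i* v)); rewrite addrC addKr normc_cexp => /(_ eas).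
  rewrite addrC => /(le_lt_trans (Re_le_normc _)); rewrite -/(H _).
  case: (H _) (F z0) => [p q] [p' q'] /=; rewrite ltr_norml; lra.
have lnr : ln r < ln rho by rewrite ltr_ln ?posrE.
have pi20 : (0 : R) <= 2 * pi by rewrite mulr_ge0// pi_ge0.
have := @goursat R H (ln rho) dH a 0 (ln r - a) (2 * pi).
rewrite subrKC add0r subr_ge0 => /(_ ar pi20 lnr).
have per u : H (u +i* 0) = H (u +i* (2 * pi)).
  by rewrite /H /cexp/= -[2 * pi]add0r mulr_natl cosD2pi sinD2pi.
have -> : \int[mu]_(u in `[a, ln r]) (complex.Im (H (u +i* 0)) - complex.Im (H (u +i* (2 * pi)))) = 0.
  under eq_Rintegral do rewrite per subrr.
  by rewrite Rintegral_cst// mul0r.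
rewrite add0r.
have cH (x : R) : x < ln rho -> {in `[0, 2 * pi], continuous (fun v => complex.Re (H (x +i* v)))}.
  move=> xr v _; have [d' /cdiff_cont dd] := dH (x +i* v) xr.
  apply/cvgrPdist_lt => e' e'0; have [s' s'0 Hs'] := dd _ e'0.
  near=> v'; apply: le_lt_trans (_ : normc (H (x +i* v') - H (x +i* v)) < _).
    rewrite distrC; apply: le_trans (Re_le_normc _).
    by case: (H _) (H _) => [? ?] [? ?].
  apply: Hs'; apply: le_lt_trans (normc_le_ReIm _) _ => /=.
  rewrite subrr normr0 add0r distrC.
  by near: v'; exact: (@cvgr_dist_lt _ _ _ (nbhs v) _ id v).
have arho := le_lt_trans ar lnr.
rewrite RintegralB_segment; do ?[exact: cH].
move=> /eqP; rewrite subr_eq0 => /eqP E.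
have eE : K + e = complex.Re (F z0) - e by rewrite /e; field.
have : \int[mu]_(x in `[0, 2 * pi]) complex.Re (H (ln r +i* x)) <=
       \int[mu]_(x in `[0, 2 * pi]) (complex.Re (H (a +i* x)) - e).
  apply: le_Rintegral.
  - exact: measurable_itv.
  - exact/integrable_segment/cH.
  - apply: integrable_segment => v vI; apply: cvgB; last exact: cvg_cst.
    exact: (cH a arho v vI).
  move=> v _; apply: le_trans (FK v) _.
  by rewrite lerBrDr eE ltW.
rewrite (RintegralB_cst_segment _ pi20 (cH a arho)) E subr0 lerDl oppr_ge0 leNgt.
by rewrite (mulr_gt0 e0 (mulr_gt0 (ltr0n R 2) (pi_gt0 R))).
Unshelve. all: by end_near. Qed.

(** If |F(z)| exceeded M, then G = |F|^2 + e |w|^2 would have, for small e > 0, a maximum at an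
    interior point z0. The function Phi below is analytic, and by the polarisation identity
    2 Re Phi(w) is G(w) plus a constant minus |F(w) - F(z0)|^2 - e |w - z0|^2, so that the mean
    value inequality on a circle around z0 contradicts the maximality. *)
Lemma max_modulus F (x1 x2 y1 y2 M : R) :
  (forall z, x1 < complex.Re z < x2 -> y1 < complex.Im z < y2 -> exists d, cdiff F z d) ->
  (forall z, x1 <= complex.Re z <= x2 -> y1 <= complex.Im z <= y2 -> forall e, 0 < e ->
    exists2 r, 0 < r & forall w, x1 <= complex.Re w <= x2 -> y1 <= complex.Im w <= y2 ->
      normc (w - z) < r -> normc (F w - F z) < e) ->
  (forall z, x1 <= complex.Re z <= x2 -> y1 <= complex.Im z <= y2 ->
    complex.Re z = x1 \/ complex.Re z = x2 \/ complex.Im z = y1 \/ complex.Im z = y2 ->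
    normc (F z) <= M) ->
  forall z, x1 <= complex.Re z <= x2 -> y1 <= complex.Im z <= y2 -> normc (F z) <= M.
Proof.
move=> dF cF bF z zx zy; rewrite leNgt; apply/negP => MF.
have M0 : 0 <= M.
  apply: le_trans (bF (x1 +i* complex.Im z) _ zy (or_introl erefl)); first exact: normc_ge0.
  by rewrite /= lexx; case/andP: zx => /le_trans h /h.
pose S := (`|x1| + `|x2|) ^+ 2 + (`|y1| + `|y2|) ^+ 2.
have S0 : 0 <= S by rewrite addr_ge0// sqr_ge0.
have absb (a b u : R) : a <= u <= b -> u ^+ 2 <= (`|a| + `|b|) ^+ 2.
  move=> /andP[au ub]; rewrite -real_normK ?num_real// ler_pXn2r ?nnegrE ?addr_ge0//.
  have := ler_norm b; have := ler_norm (- a); rewrite normrN => na bb.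
  rewrite ler_norml; apply/andP; split; have := normr_ge0 a; have := normr_ge0 b; lra.
have SP w : x1 <= complex.Re w <= x2 -> y1 <= complex.Im w <= y2 -> normc w ^+ 2 <= S.
  by move=> wx wy; rewrite sqr_normc lerD// absb.
pose e := (normc (F z) ^+ 2 - M ^+ 2) / (2 * (1 + S)).
have zM : 0 < normc (F z) ^+ 2 - M ^+ 2.
  by rewrite subr_gt0 ltr_pXn2r// nnegrE ?normc_ge0.
have e0 : 0 < e by rewrite divr_gt0// mulr_gt0// ltr_pwDl.
have eS : e * S < normc (F z) ^+ 2 - M ^+ 2.
  rewrite /e mulrAC ltr_pdivrMr ?mulr_gt0 ?ltr_pwDl// ltr_pM2l//; lra.
pose G (w : R[i]) := normc (F w) ^+ 2 + e * normc w ^+ 2.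
pose A := [set` `[x1, x2]] `*` [set` `[y1, y2]] : set (R * R).
have cA : compact A by apply: compact_setX; exact: segment_compact.
have A0 : A !=set0 by exists (complex.Re z, complex.Im z); split; rewrite /= in_itv.
have cG : {within A, continuous (fun q : R * R => G (q.1 +i* q.2))}.
  apply/subspace_continuousP => -[u v] [/=]; rewrite !in_itv/= => ux vy.
  have nc (f : R[i] -> R[i]) : (forall e', 0 < e' ->
    exists2 r, 0 < r & forall w, x1 <= complex.Re w <= x2 -> y1 <= complex.Im w <= y2 ->
      normc (w - u +i* v) < r -> normc (f w - f (u +i* v)) < e') ->
    normc (f (q.1 +i* q.2)) @[q --> within A (nbhs (u, v))] --> normc (f (u +i* v)).
    move=> cf; apply/cvgrPdist_lt => e' e'0; have [r r0 Hr] := cf _ e'0.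
    have r20 : 0 < r / 2 by rewrite divr_gt0.
    rewrite near_withinE; near=> q => -[]; rewrite /= !in_itv/= => q1 q2.
    have : normc (f (q.1 +i* q.2) - f (u +i* v)) < e'.
      apply: Hr => //; apply: le_lt_trans (normc_le_ReIm _) _ => /=.
      rewrite [r]splitr ltrD//; rewrite distrC; near: q.
        exact: (@cvgr_dist_lt _ _ _ (nbhs (u, v)) _ fst u (@cvg_fst _ _ _ _ _)).
      exact: (@cvgr_dist_lt _ _ _ (nbhs (u, v)) _ snd v (@cvg_snd _ _ _ _ _)).
    apply: le_lt_trans; rewrite ler_norml; apply/andP; split.
      rewrite lerNl opprB lerBlDr.
      by apply: le_trans (le_normcD _ _); rewrite subrK.
    rewrite lerBlDr normcB; apply: le_trans (le_normcD _ _); rewrite subrK//.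
  apply: cvgD; last apply: cvgM; [|exact: cvg_cst|].
    rewrite expr2 /=; under eq_fun do rewrite expr2.
    by apply: cvgM; apply: nc; apply: cF.
  rewrite expr2 /=; under eq_fun do rewrite expr2.
  by apply: cvgM; apply: (nc id) => e' e'0; exists e'.
have [[u v]] := compact_EVT_max A0 cA cG.
rewrite inE => -[/=]; rewrite !in_itv/= => ux vy maxG.
set z0 := u +i* v in maxG *.
have {}maxG w : x1 <= complex.Re w <= x2 -> y1 <= complex.Im w <= y2 -> G w <= G z0.
  by case: w => a b /= ax bY; apply: (maxG (a, b)); rewrite inE; split; rewrite /= in_itv.
have Gz : M ^+ 2 + e * S < G z0.
  apply: lt_le_trans (maxG z zx zy); rewrite /G.
  have : 0 <= e * normc z ^+ 2 by rewrite mulr_ge0 ?(ltW e0)// sqr_ge0.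
  by move: eS; clear; lra.
have int : (x1 < u < x2) && (y1 < v < y2).
  apply/negPn/negP => nint; move: Gz; apply/negP; rewrite -leNgt; apply: lerD; last first.
    by rewrite ler_pM2l// SP.
  rewrite ler_pXn2r ?nnegrE ?normc_ge0//; apply: bF => //=.
  move: ux vy nint => /andP[a1 a2] /andP[b1 b2].
  rewrite !lt_neqAle a1 a2 b1 b2 !andbT !negb_and !negbK.
  by case/orP => /orP[] /eqP ->; auto.
case/andP: int => /andP[xu ux2] /andP[yv vy2].
pose rho := Num.min (Num.min (u - x1) (x2 - u)) (Num.min (v - y1) (y2 - v)).
have rho0 : 0 < rho by rewrite !lt_min !subr_gt0 xu ux2 yv vy2.
have inside w : normc (w - z0) < rho -> (x1 < complex.Re w < x2) /\ (y1 < complex.Im w < y2).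
  case: w => a b wr.
  have := le_lt_trans (Re_le_normc _) wr; have := le_lt_trans (Im_le_normc _) wr.
  by rewrite /= !lt_min !ltr_norml; split; lra.
have r0 : 0 < rho / 2 by rewrite divr_gt0.
have rr : rho / 2 < rho by rewrite ltr_pdivrMr// ltr_pMr// ltr1n.
pose Phi w := (F z0)^*%C * F w + (e%:C * z0^*%C) * w.
have ReC (a b : R[i]) : 2 * complex.Re (a^*%C * b) = normc a ^+ 2 + normc b ^+ 2 - normc (b - a) ^+ 2.
  by rewrite !sqr_normc; case: a b => [p q] [p' q'] /=; ring.
have RePhi w : 2 * complex.Re (Phi w) = normc (F z0) ^+ 2 + normc (F w) ^+ 2 - normc (F w - F z0) ^+ 2
   + e * (normc z0 ^+ 2 + normc w ^+ 2 - normc (w - z0) ^+ 2).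
  have gen (f f' a b : R[i]) : 2 * complex.Re (f^*%C * f' + e%:C * a^*%C * b) =
      2 * complex.Re (f^*%C * f') + e * (2 * complex.Re (a^*%C * b)).
    by case: f f' a b => [a1 b1] [a2 b2] [a3 b3] [a4 b4] /=; rewrite !mul0r; ring.
  by rewrite -!ReC; exact: gen.
have : complex.Re (Phi z0) <= G z0 - e / 2 * (rho / 2) ^+ 2.
  apply: (mean_value_le r0 rr).
    move=> w wr; have [wx wy] := inside _ wr; have [d dd] := dF _ wx wy.
    by eexists; apply: cdiffD; [exact: cdiffZ dd|exact: (cdiffZ _ (cdiff_id w))].
  move=> t; set w := z0 + _.
  have wz : w - z0 = cexp (ln (rho / 2) +i* t) by rewrite addrC addKr.
  have nw : normc (w - z0) = rho / 2 by rewrite wz normc_cexp/= lnK.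
  have [/andP[/ltW wx1 /ltW wx2] /andP[/ltW wy1 /ltW wy2]] : (x1 < complex.Re w < x2) /\ (y1 < complex.Im w < y2).
    by apply: inside; rewrite nw.
  have Gw : G w <= G z0 by apply: maxG; apply/andP.
  have := RePhi w; rewrite nw => E.
  have := sqr_ge0 (normc (F w - F z0)); move: Gw E; rewrite /G; lra.
have n0 : (0 : R) ^+ 2 = 0 by rewrite expr0n.
have := RePhi z0; rewrite !subrr normc0 n0 => E.
have : 0 < e / 2 * (rho / 2) ^+ 2 := mulr_gt0 (divr_gt0 e0 (ltr0n R 2)) (exprn_gt0 2 r0).
move: E; rewrite /G; lra.
Unshelve. all: by end_near. Qed.

(** For bounded F the quotient F(w) / (1 + e w) is at most M + e on the boundary of a rectangle
    tall enough, by boundedness on the horizontal sides; let e tend to 0. *)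
Lemma three_lines F (M : R) :
  (forall z, 0 < complex.Re z < 1 -> exists d, cdiff F z d) ->
  (forall z, 0 <= complex.Re z <= 1 -> forall e, 0 < e ->
    exists2 r, 0 < r & forall w, 0 <= complex.Re w <= 1 ->
      normc (w - z) < r -> normc (F w - F z) < e) ->
  (exists K, forall z, 0 <= complex.Re z <= 1 -> normc (F z) <= K) ->
  (forall t, normc (F (0 +i* t)) <= M) -> (forall t, normc (F (1 +i* t)) <= M) ->
  forall z, 0 <= complex.Re z <= 1 -> normc (F z) <= M.
Proof.
move=> dF cF [K bK] F0 F1 z zx.
have M0 : 0 <= M by apply: le_trans (F0 0); exact: normc_ge0.
have K0 : 0 <= K by apply: le_trans (bK z zx); exact: normc_ge0.
suff main e : 0 < e -> normc (F z) <= (M + e) * (1 + e * normc z).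
  apply/ler_addgt0Pr => e e0.
  have z0 := normc_ge0 z.
  pose k := 1 + normc z * (M + 1).
  have k0 : 0 < k by rewrite /k ltr_pwDl// mulr_ge0// addr_ge0.
  pose e' := Num.min 1 (e / (2 * k)).
  have e'0 : 0 < e' by rewrite lt_min ltr01 divr_gt0// mulr_gt0.
  have e'1 : e' <= 1 by rewrite ge_min lexx.
  have e'e : e' * k <= e / 2.
    rewrite -ler_pdivlMr// ge_min; apply/orP; right.
    by rewrite le_eqVlt; apply/orP; left; apply/eqP; field; rewrite gt_eqF.
  apply: le_trans (main _ e'0) _.
  have : e' * (e' * normc z) <= 1 * (e' * normc z) by rewrite ler_wpM2r// mulr_ge0// ltW.
  move: e'e; rewrite /k; lra.
move=> e0.
have Me : 0 < M + e by rewrite ltr_wpDl.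
(* The height at which K / |1 + e w| drops below M + e. *)
pose T := 1 + `|complex.Im z| + K / (e * (M + e)).
have T0 : 0 < T 
  by rewrite /T -addrA ltr_pwDl// addr_ge0// divr_ge0// mulr_ge0// ltW.
pose q (w : R[i]) := 1 + e%:C * w.
have Req w : complex.Re (q w) = 1 + e * complex.Re w by case: w => a b; rewrite /q /=; ring.
have Imq w : complex.Im (q w) = e * complex.Im w by case: w => a b; rewrite /q /=; ring.
have q1 w : 0 <= complex.Re w -> 1 <= normc (q w).
  move=> w0; apply: le_trans (Re_le_normc _); rewrite Req.
  by apply: le_trans (ler_norm _); rewrite lerDl mulr_ge0// ltW.
have q0 w : 0 <= complex.Re w -> q w != 0.
  by move=> /q1; apply: contraTneq => ->; rewrite normc0 ler10.
have dq w : cdiff q w (0 + e%:C * 1).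
  by apply: cdiffD; [exact: cdiff_cst|exact: (cdiffZ _ (cdiff_id w))].
have dFq w d : 0 <= complex.Re w -> cdiff F w d -> exists d', cdiff (fun w => F w * (q w)^-1) w d'.
  by move=> w0 dd; eexists; apply: cdiffM; [exact: dd|apply: cdiffV; [exact: q0|exact: dq]].
have nFq w : 0 <= complex.Re w -> normc (F w * (q w)^-1) <= normc (F w).
  move=> w0; rewrite normcM normcV ler_pdivrMr ?(lt_le_trans ltr01 (q1 _ w0))//.
  by rewrite ler_peMr ?normc_ge0// q1.
have Fq : normc (F z * (q z)^-1) <= M + e.
  apply: (@max_modulus (fun w => F w * (q w)^-1) 0 1 (- T) T) => //.
  - move=> w wx _; have [d dd] := dF w wx; apply: dFq dd.
    by case/andP: wx => /ltW.
  - move=> w wx _ e' e'0; have /andP[w0 w1] := wx.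
    have nq := normc_ge0 (F w).
    have c2 : 0 < e' / (2 * (1 + normc (F w))) by rewrite divr_gt0// mulr_gt0// ltr_pwDl.
    have e20 : 0 < e' / 2 by rewrite divr_gt0.
    have [r1 r10 H1] := cF w wx _ e20.
    have /cdiff_cont/(_ _ c2)[r2 r20 H2] := cdiffV (q0 w w0) (dq w).
    exists (Num.min r1 r2); first by rewrite lt_min r10.
    move=> w' w'x _; rewrite lt_min => /andP[wr1 wr2]; have /andP[w'0 _] := w'x.
    have -> : F w' * (q w')^-1 - F w * (q w)^-1 = (F w' - F w) * (q w')^-1 + F w * ((q w')^-1 - (q w)^-1).
      by ring.
    apply: le_lt_trans (le_normcD _ _) _; rewrite !normcM [e']splitr.
    apply: ltr_leD.
      apply: le_lt_trans (H1 _ w'x wr1); rewrite ler_piMr ?normc_ge0//.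
      by rewrite normcV invf_le1 ?q1// (lt_le_trans ltr01 (q1 _ w'0)).
    apply: le_trans (ler_wpM2l nq (ltW (H2 _ wr2))) _.
    have n1 : 0 < 1 + normc (F w) by rewrite ltr_pwDl.
    have -> : normc (F w) * (e' / (2 * (1 + normc (F w)))) =
        e' / 2 * (normc (F w) / (1 + normc (F w))) by field; rewrite gt_eqF.
    by rewrite ler_piMr ?(ltW e20)// ler_pdivrMr// mul1r lerDr.
  - move=> w wx wy; have /andP[w0 w1] := wx; case=> [|[]].
    + move=> w0'; apply: le_trans (nFq _ w0) _.
      by case: w w0' {wx wy w0 w1} => a b /= ->; rewrite (le_trans (F0 b))// lerDl ltW.
    + move=> w0'; apply: le_trans (nFq _ w0) _.
      by case: w w0' {wx wy w0 w1} => a b /= ->; rewrite (le_trans (F1 b))// lerDl ltW.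
    + move=> wT; have {wT} : `|complex.Im w| = T.
        by case: wT => ->; rewrite ?normrN gtr0_norm.
      move=> wT; rewrite normcM normcV ler_pdivrMr ?(lt_le_trans ltr01 (q1 _ w0))//.
      apply: le_trans (bK _ wx) _.
      rewrite -ler_pdivrMl//; apply: le_trans (Im_le_normc _); rewrite Imq normrM wT (gtr0_norm e0).
      rewrite -ler_pdivrMl// mulrA -invfM mulrC.
      by rewrite /T lerDr addr_ge0.
  - rewrite -ler_norml /T; have : 0 <= K / (e * (M + e)) by rewrite divr_ge0// mulr_ge0 ?(ltW e0)// ltW.
    by move=> ?; lra.
have /andP[z0 _] := zx.
have -> : F z = F z * (q z)^-1 * q z by rewrite mulfVK// q0.
rewrite normcM; apply: le_trans (ler_wpM2r (normc_ge0 _) Fq) _.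
rewrite ler_pM2l//; apply: le_trans (le_normcD _ _) _.
by rewrite normc1 normcM normc_real gtr0_norm.
Qed.

End MaximumModulus.

(** * Smooth functions on the half-line and test functions *)

Section SmoothFunctions.
Variable R : realType.
Implicit Types (f g : R -> R) (n : nat).

(** Differentiability of order n on (0, +oo), with the derivative given at each stage: products
    and compositions are then handled by induction on n, and nothing is asked at t <= 0. *)
Fixpoint posC n f : Prop := if n is m.+1 then
  exists2 g : R -> R, (forall t : R, 0 < t -> is_derive t (1 : R) f (g t)) & posC m g else True.

Lemma pos_near (t : R) : 0 < t -> \forall u \near t, 0 < u.
Proof. by move=> t0; exact: lt_nbhsr. Qed.

Lemma posC_eq n f g : (forall t, 0 < t -> f t = g t) -> posC n f -> posC n g.
Proof.
case: n => [//|n] fg [f' df cf']; exists f' => // t t0.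
apply: near_eq_is_derive (df t t0).
by near=> u; apply: fg; near: u; exact: pos_near.
Unshelve. all: by end_near. Qed.

Lemma posCS n f : posC n.+1 f -> posC n f.
Proof.
by elim: n f => [//|n IH] f [f' df /IH cf']; exists f'.
Qed.

Lemma posC_cst n (c : R) : posC n (fun=> c).
Proof.
elim: n c => [//|n IH] c; exists (fun=> 0); last exact: IH.
by move=> t _; exact: is_derive_cst.
Qed.

Lemma posCD n f g : posC n f -> posC n g -> posC n (fun t => f t + g t).
Proof.
elim: n f g => [//|n IH] f g [f' df cf'] [g' dg cg'].
exists (fun t => f' t + g' t); last exact: IH.
by move=> t t0; exact: is_deriveD (df t t0) (dg t t0).
Qed.

Lemma posCM n f g : posC n f -> posC n g -> posC n (fun t => f t * g t).
Proof.
elim: n f g => [//|n IH] f g cf cg.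
have [f' df cf'] := cf; have [g' dg cg'] := cg.
exists (fun t => f t * g' t + g t * f' t).
  by move=> t t0; exact: is_deriveM (df t t0) (dg t t0).
by apply: posCD; apply: IH => //; exact: posCS.
Qed.

Lemma posC_scale n f (c : R) : 0 < c -> posC n f -> posC n (fun t => f (c * t)).
Proof.
move=> c0; elim: n f => [//|n IH] f [f' df cf'].
exists (fun t => c * f' (c * t)); last by apply: posCM; [exact: posC_cst|exact: IH].
move=> t t0.
have dl : is_derive t (1 : R) (fun u : R => c * u) c.
  by apply: (is_derive_eq (is_deriveZ c (is_derive_id t 1))); rewrite /GRing.scale/= mulr1.
apply: (is_derive_eq (@is_derive1_comp _ f (fun u : R => c * u) t _ _ (df _ _) dl)).
  by rewrite mulr_gt0.
exact: mulrC.
Qed.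

Lemma posC_derive1n n f : posC n f ->
  forall k, (k < n)%N -> forall t, 0 < t -> derivable (derive1n k f) t 1.
Proof.
elim: n f => [//|n IH] f [f' df cf'] [_ t t0|k kn t t0]; first by have [] := df t t0.
rewrite /derive1n iterSr -/(derive1n k _); apply: (IH _ _ k kn t t0).
apply: posC_eq cf' => u u0; rewrite derive1E.
by have [_ ->] := df u u0.
Qed.

Lemma derive1n_posC f : (forall k t, derivable (derive1n k f) t 1) -> forall n, posC n f.
Proof.
move=> df n; elim: n f df => [//|n IH] f df; exists (derive1 f); last first.
  by apply: IH => k t; have := df k.+1 t; rewrite /derive1n iterSr.
by move=> t t0; rewrite derive1E; apply/derivableP; exact: (df 0%N).
Qed.

(** The function x^-k e^(-1/x), extended by 0: closed under differentiation up to linear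
    combinations, hence smooth, and flat at 0. *)
Definition flat k (x : R) : R := if 0 < x then x^-1 ^+ k * expR (- x^-1) else 0.

(** From (1/x)^(k+2) / (k+2)! <= e^(1/x). *)
Lemma flat_bound k (x : R) : `|flat k x| <= (k.+2)`!%:R * `|x| ^+ 2.
Proof.
rewrite /flat; case: ifPn => [x0|_]; last by rewrite normr0 mulr_ge0// exprn_ge0.
have y0 : 0 < x^-1 by rewrite invr_gt0.
rewrite ger0_norm; last by rewrite mulr_ge0 ?expR_ge0// exprn_ge0// ltW.
rewrite (gtr0_norm x0) expRN ler_pdivrMr ?expR_gt0//.
have fact0 : (0 : R) < (k.+2)`!%:R by rewrite ltr0n fact_gt0.
have H := le_trans (ler_wpDl ler01 (lexx _)) (expR_ge1Dxn k.+1 (ltW y0)).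
apply: le_trans (_ : (k.+2)`!%:R * x ^+ 2 * (x^-1 ^+ k.+2 / (k.+2)`!%:R) <= _).
  rewrite le_eqVlt; apply/orP; left; apply/eqP.
  rewrite -addn2 exprD !exprVn; field.
  by rewrite addn2 !gt_eqF// exprn_gt0.
by rewrite ler_wpM2l// mulr_ge0 ?exprn_ge0// ltW.
Qed.

Lemma is_derive_flat k (x : R) : is_derive x (1 : R) (flat k) (flat k.+2 x - k%:R * flat k.+1 x).
Proof.
have [x0|x0|->] := ltgtP x 0.
- have -> : flat k.+2 x - k%:R * flat k.+1 x = 0.
    by rewrite /flat ltNge (ltW x0)/= mulr0 subr0.
  apply: near_eq_is_derive (is_derive_cst (0 : R) x 1).
  near=> u; rewrite /flat ltNge.
  suff -> : u <= 0 by [].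
  by apply/ltW; near: u; exact: lt_nbhsl.
- have dV : is_derive x (1 : R) (fun u : R => u^-1) (- x^-1 ^+ 2).
    apply: (is_derive_eq (is_deriveV (lt0r_neq0 x0) (is_derive_id x 1))).
    by rewrite /GRing.scale/= mulr1 exprVn.
  have dE := @is_derive1_comp _ expR (fun u : R => - u^-1) x _ _ (is_derive_expR (- x^-1)) (is_deriveN dV).
  have dX : is_derive x (1 : R) (fun u : R => u^-1 ^+ k) (- k%:R * x^-1 ^+ k.+1).
    have -> : (fun u : R => u^-1 ^+ k) = (fun u : R => u^-1) ^+ k.
      by apply/funext => u; rewrite exprfctE.
    apply: (is_derive_eq (is_deriveX k dV)); rewrite /GRing.scale/=.
    by case: (k) => [|m]; rewrite ?mul0r ?oppr0 ?mul0r//= mulrN -mulrA -exprD addn2 mulNr.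
  apply: near_eq_is_derive (is_derive_eq (is_deriveM dX dE) _).
    near=> u; rewrite /flat; suff -> : 0 < u by [].
    by near: u; exact: pos_near.
  rewrite /flat x0 /GRing.scale/= -[in RHS]addn2 exprD; ring.
rewrite {2 3}/flat ltxx mulr0 subr0.
have C : (fun h : R => h^-1 *: ((flat k) (h *: 1 + 0) - flat k 0)) @ 0^' --> (0 : R).
  apply/cvgrPdist_le => e e0.
  pose K : R := (k.+2)`!%:R; have K0 : 0 < K by rewrite ltr0n fact_gt0.
  have d0 : 0 < e / K by rewrite divr_gt0.
  rewrite /dnbhs near_withinE; near=> h => h0.
  rewrite sub0r normrN {2}/flat ltxx subr0 addr0 /GRing.scale/= mulr1 normrM normfV.
  have hn : 0 < `|h| by rewrite normr_gt0.
  rewrite ler_pdivrMl//; apply: le_trans (flat_bound k h) _.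
  rewrite expr2 mulrA mulrC ler_pM2l// mulrC.
  by rewrite -ler_pdivlMr.
by apply: DeriveDef; [apply/cvg_ex; exists 0|exact: cvg_lim C].
Unshelve. all: by end_near. Qed.

Lemma flat_posC n k (c d : R) : posC n (fun t => flat k (c * t + d)).
Proof.
elim: n k => [//|n IH] k.
exists (fun t => c * (flat k.+2 (c * t + d) + - k%:R * flat k.+1 (c * t + d))).
  move=> t _.
  have dl : is_derive t (1 : R) (fun u : R => c * u + d) c.
    apply: (is_derive_eq (is_deriveD (is_deriveZ c (is_derive_id t 1)) (is_derive_cst d t 1))).
    by rewrite /GRing.scale/= mulr1 addr0.
  apply: (is_derive_eq (@is_derive1_comp _ (flat k) (fun u : R => c * u + d) t _ _
    (is_derive_flat k _) dl)); ring.
by apply: posCM; [exact: posC_cst|apply: posCD; [|apply: posCM; [exact: posC_cst|]]; exact: IH].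
Qed.

Lemma flat0_ge0 (x : R) : 0 <= flat 0 x.
Proof. by rewrite /flat; case: ifP => // _; rewrite expr0 mul1r expR_ge0. Qed.

Lemma flat0_le1 (x : R) : flat 0 x <= 1.
Proof.
rewrite /flat; case: ifPn => // x0.
by rewrite expr0 mul1r -[leRHS]expR0 ler_expR oppr_le0 invr_ge0 ltW.
Qed.

Lemma flat0_gt0 (x : R) : (0 < flat 0 x) = (0 < x).
Proof. by rewrite /flat; case: ifP; rewrite ?ltxx// expr0 mul1r expR_gt0. Qed.

Lemma flat0_cvg1 (x : R) : 0 < x -> flat 0 (n.+1%:R * x) @[n --> \oo] --> (1 : R).
Proof.
move=> x0; rewrite /flat.
have -> : (fun n : nat => if 0 < n.+1%:R * x then (n.+1%:R * x)^-1 ^+ 0 * expR (- (n.+1%:R * x)^-1) else 0)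
   = (fun n => expR (- (n.+1%:R^-1 * x^-1))).
  by apply/funext => n; rewrite mulr_gt0// expr0 mul1r invfM.
rewrite -[X in _ --> X]expR0; apply: continuous_cvg; first exact: continuous_expR.
rewrite -oppr0; apply: cvgN; rewrite -[X in _ --> X](mul0r x^-1).
by apply: cvgMr_tmp; exact: cvg_harmonic.
Qed.

(** Up to sign and phase, the real and the imaginary part of the complex power t^(a + i b). *)
Definition powcos (a b c : R) (t : R) : R := expR (a * ln t) * cos (b * ln t + c).

Lemma powcos_is_derive (a b c t : R) : 0 < t -> is_derive t (1 : R) (powcos a b c)
  (a * powcos (a - 1) b c t + b * powcos (a - 1) b (c + pi / 2) t).
Proof.
move=> t0.
have dl (a' b' : R) : is_derive t (1 : R) (fun u : R => a' * ln u + b') (a' * t^-1).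
  apply: (is_derive_eq (is_deriveD (is_deriveZ a' (is_derive1_ln t0)) (is_derive_cst b' t 1))).
  by rewrite /GRing.scale/= addr0.
have dl0 : is_derive t (1 : R) (fun u : R => a * ln u) (a * t^-1).
  by apply: (is_derive_eq (is_deriveZ a (is_derive1_ln t0))).
have de := @is_derive1_comp _ expR (fun u : R => a * ln u) t _ _ (is_derive_expR _) dl0.
have dc := @is_derive1_comp _ cos (fun u : R => b * ln u + c) t _ _ (is_derive_cos _) (dl b c).
apply: (is_derive_eq (is_deriveM de dc)); rewrite /GRing.scale/= /powcos.
rewrite addrA cosDpihalf mulrBl mul1r expRD expRN lnK ?posrE//; ring.
Qed.

Lemma powcos_posC n (a b c : R) : posC n (powcos a b c).
Proof.
elim: n a b c => [//|n IH] a b c.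
exists (fun t => a * powcos (a - 1) b c t + b * powcos (a - 1) b (c + pi / 2) t).
  by move=> t; exact: powcos_is_derive.
by apply: posCD; apply: posCM => //; exact: posC_cst.
Qed.

End SmoothFunctions.

Section TestFunctions.
Variable R : realType.
Notation mu := (@lebesgue_measure R).
Local Notation Rplus := (`]0, +oo[%classic : set R).
Implicit Types (phi psi : R -> R).

Lemma test_functionP phi : test_function phi <->
  (forall n, posC n phi) /\
  exists a b : R, [/\ 0 < a, a < b & forall t, ~ (a <= t <= b) -> phi t = 0].
Proof.
split=> [[dphi [K [cK K0 phi0]]]|[cphi [a [b [a0 ab phi0]]]]].
  split; first exact: derive1n_posC.
  have [KE|/set0P Kn0] := eqVneq K set0.
    rewrite KE in phi0; by exists 1, 2; split => //; [lra|move=> t _; exact: phi0].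
  have cid : {within K, continuous (id : R -> R)} by apply: continuous_subspaceT => x; exact: cvg_id.
  have [a aK amin] := compact_EVT_min Kn0 cK cid.
  have [b bK bmax] := compact_EVT_max Kn0 cK cid.
  have a0 : 0 < a by have := K0 _ (set_mem aK); rewrite /= in_itv/= andbT.
  exists a, (b + 1); split => //.
    by rewrite (le_lt_trans (amin _ bK))// ltrDl.
  move=> t tab; apply: phi0 => tK; apply: tab; rewrite amin ?inE//=.
  by apply: le_trans (bmax t _) _; rewrite ?inE// lerDl.
split; last first.
  exists `[a, b]%classic; split; first exact: segment_compact.
    by move=> t /=; rewrite !in_itv/= andbT => /andP[at_ _]; exact: lt_le_trans at_.
  by move=> t tab; apply: phi0 => tab'; apply: tab; rewrite /= in_itv.
move=> n t; have [t0|t0] := ltP 0 t; first exact: (posC_derive1n (cphi n.+1)).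
have {}t0 := le_lt_trans t0 a0.
suff : forall s : R, s < a -> is_derive s (1 : R) (derive1n n phi) 0 by move=> /(_ t t0)[].
elim: n => [|n IH] s sa.
  apply: near_eq_is_derive (is_derive_cst (0 : R) s 1).
  near=> u; rewrite /= phi0// => /andP[+ _]; apply/negP; rewrite -ltNge.
  by near: u; exact: lt_nbhsl.
apply: near_eq_is_derive (is_derive_cst (0 : R) s 1).
near=> u; rewrite /= derive1E; suff /IH[_ ->] : u < a by [].
by near: u; exact: lt_nbhsl.
Unshelve. all: by end_near. Qed.

Lemma test_posC phi n : test_function phi -> posC n phi.
Proof. by case/test_functionP. Qed.

Lemma test_is_derive phi t : test_function phi -> is_derive t (1 : R) phi (derive1 phi t).
Proof. by case=> /(_ 0%N t) d _; rewrite derive1E; exact/derivableP. Qed.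

Lemma test_continuous phi : test_function phi -> continuous phi.
Proof.
move=> tp t; have [d _] := test_is_derive t tp.
exact/differentiable_continuous/derivable1_diffP.
Qed.

Lemma test_derive1 phi : test_function phi -> test_function (derive1 phi).
Proof.
move=> [dphi [K [cK K0 phi0]]]; split.
  by move=> n t; have := dphi n.+1 t; rewrite /derive1n iterSr.
exists K; split => // t Kt; rewrite derive1E.
have oK : open (~` K) by rewrite openC; exact: compact_closed.
have : is_derive t (1 : R) phi 0; last by case.
apply: near_eq_is_derive (is_derive_cst (0 : R) t 1).
near=> u; rewrite phi0//; near: u; exact: open_nbhs_nbhs.
Unshelve. all: by end_near. Qed.

Lemma test_supp phi : test_function phi ->
  exists a b : R, [/\ 0 < a, a < b & forall t, ~ (a <= t <= b) -> phi t = 0].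
Proof. by case/test_functionP. Qed.

Lemma test_bounded phi : test_function phi -> exists M : R, forall t, `|phi t| <= M.
Proof.
move=> tp; have [a [b [a0 ab phi0]]] := test_supp tp.
have cn : {within `[a, b], continuous (fun t => `|phi t|)}.
  apply: continuous_subspaceT => t.
  by apply: (@continuous_comp _ _ _ phi Num.norm); [exact: test_continuous|exact: norm_continuous].
have [c cab Hc] := EVT_max (ltW ab) cn.
exists `|phi c| => t; have [tab|tab] := boolP (a <= t <= b).
  by apply: Hc; rewrite in_itv.
by rewrite phi0 ?normr0//; exact/negP.
Qed.

Lemma testMl (m phi : R -> R) : (forall n, posC n m) -> test_function phi ->
  test_function (fun t => m t * phi t).
Proof.
move=> cm /test_functionP[cphi [a [b [a0 ab phi0]]]]; apply/test_functionP; split.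
  by move=> n; exact: posCM.
by exists a, b; split=> // t /phi0 ->; rewrite mulr0.
Qed.

Lemma testD phi psi : test_function phi -> test_function psi ->
  test_function (fun t => phi t + psi t).
Proof.
move=> /test_functionP[cphi [a [b [a0 ab phi0]]]] /test_functionP[cpsi [c [d [c0 cd psi0]]]].
apply/test_functionP; split; first by move=> n; exact: posCD.
exists (Num.min a c), (Num.max b d); split.
- by rewrite lt_min a0.
- by rewrite gt_min !lt_max ab.
move=> t tab; rewrite phi0 ?psi0 ?addr0// => tI; apply: tab.
  by rewrite ge_min le_max; case/andP: tI => -> ->; rewrite !orbT.
by rewrite ge_min le_max; case/andP: tI => -> ->.
Qed.

Lemma testZ (c : R) phi : test_function phi -> test_function (fun t => c * phi t).
Proof. by apply: (testMl (m := fun=> c)) => n; exact: posC_cst. Qed.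

Lemma test0 : test_function (fun _ : R => 0 : R).
Proof.
apply/test_functionP; split; first by move=> n; exact: posC_cst.
by exists 1, 2; split => //; lra.
Qed.

(** Smooth functions supported in [a, b] that tend to the indicator function of (a, b). *)
Definition bump (a b : R) (n : nat) (t : R) : R :=
  flat 0 (n.+1%:R * (t - a)) * flat 0 (n.+1%:R * (b - t)).

Lemma bump_ge0 a b n t : 0 <= bump a b n t.
Proof. by rewrite mulr_ge0// flat0_ge0. Qed.

Lemma bump_le1 a b n t : bump a b n t <= 1.
Proof. by rewrite -[leRHS]mulr1 ler_pM ?flat0_ge0// flat0_le1. Qed.

Lemma bump_out a b n t : ~ (a < t < b) -> bump a b n t = 0.
Proof.
move/negP; rewrite negb_and -!leNgt /bump => /orP[ta|bt].
  by rewrite [X in X * _]/flat pmulr_rgt0 ?ltr0n// subr_gt0 ltNge ta mul0r.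
by rewrite [X in _ * X]/flat pmulr_rgt0 ?ltr0n// subr_gt0 ltNge bt mulr0.
Qed.

Lemma bump_gt0 a b n t : a < t < b -> 0 < bump a b n t.
Proof. by move=> /andP[at_ tb]; rewrite mulr_gt0// flat0_gt0 mulr_gt0// subr_gt0. Qed.

Lemma bump_cvg a b t : a < t < b -> bump a b n t @[n --> \oo] --> (1 : R).
Proof.
by move=> /andP[at_ tb]; rewrite -[X in _ --> X]mulr1; apply: cvgM; apply: flat0_cvg1; rewrite subr_gt0.
Qed.

Lemma bump_test a b n : 0 < a -> a < b -> test_function (bump a b n).
Proof.
move=> a0 ab; apply/test_functionP; split.
  move=> m; apply: posCM.
    apply: posC_eq (flat_posC m 0 n.+1%:R (- (n.+1%:R * a))) => t _; congr flat; ring.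
  apply: posC_eq (flat_posC m 0 (- n.+1%:R) (n.+1%:R * b)) => t _; congr flat; ring.
exists a, b; split => // t tab; apply: bump_out => /andP[at_ tb].
by apply: tab; rewrite !ltW.
Qed.

Lemma eq_set_Rintegral (A B : set R) (f : R -> R) :
  (forall x, f x != 0 -> (A x <-> B x)) ->
  \int[mu]_(x in A) f x = \int[mu]_(x in B) f x.
Proof.
move=> AB; rewrite (Rintegral_mkcond mu A) (Rintegral_mkcond mu B).
congr Rintegral; apply/funext => x; rewrite !patchE.
have [->|fx] := eqVneq (f x) 0; first by do 2 case: ifP.
by have [ab ba] := AB x fx; congr (if _ then _ else _); apply/idP/idP; rewrite !inE.
Qed.

(** The primitive vanishes to the left of the support, and to its right because the mean is 0. *)
Lemma test_primitive psi a b : 0 < a -> a < b -> test_function psi ->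
  (forall t, ~ (a <= t <= b) -> psi t = 0) -> \int[mu]_(t in `[a, b]) psi t = 0 ->
  exists phi, [/\ test_function phi, derive1 phi = psi &
    forall t, ~ (a <= t <= b) -> phi t = 0].
Proof.
move=> a0 ab tpsi psi0 int0.
pose c := a / 2; have c0 : 0 < c by rewrite divr_gt0.
have ca : c < a by rewrite ltr_pdivrMr// ltr_pMr// ltr1n.
pose phi t := \int[mu]_(s in `[c, t]) psi s.
have cpsi := test_continuous tpsi.
have psiN t : psi t != 0 -> a <= t <= b.
  by apply: contra_neqT => /negP; exact: psi0.
have phi_l t : t < a -> phi t = 0.
  move=> ta; rewrite /phi (@eq_set_Rintegral _ set0) ?Rintegral_set0// => s /psiN /andP[as_ _].
  split => //=; rewrite in_itv/= => /andP[_ st].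
  by move: (lt_le_trans ta as_); rewrite ltNge st.
have dphi t : is_derive t (1 : R) phi (psi t).
  have [ta|at_] := ltP t a.
    rewrite psi0; last by move=> /andP[]; rewrite leNgt ta.
    apply: near_eq_is_derive (is_derive_cst (0 : R) t 1).
    by near=> u; rewrite phi_l//; near: u; exact: lt_nbhsl.
  have [||||d E] := @continuous_FTC1_closed R psi c t (t + 1).
  - by rewrite ltrDl.
  - by apply: integrable_segment => ? _; exact: cpsi.
  - exact: lt_le_trans ca at_.
  - exact: cpsi.
  by split; [exact: d|rewrite -derive1E; exact: E].
have phi_out t : ~ (a <= t <= b) -> phi t = 0.
  move=> tab; have [/phi_l//|at_] := ltP t a.
  have bt : b < t by rewrite ltNge; apply/negP => tb; apply: tab; rewrite at_.
  rewrite -int0; apply: eq_set_Rintegral => s /psiN /andP[as_ sb] /=; rewrite !in_itv/=.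
  by rewrite as_ sb (le_trans (ltW ca) as_) (le_trans sb (ltW bt)).
exists phi; split => //.
  apply/test_functionP; split; last by exists a, b.
  case=> [//|n]; exists psi; last exact: test_posC.
  by move=> t _; exact: dphi.
by apply/funext => t; rewrite derive1E; have [_ ->] := dphi t.
Unshelve. all: by end_near. Qed.

Lemma unit_bump a b : 0 < a -> a < b -> exists psi, [/\ test_function psi,
  forall t, 0 <= psi t, forall t, ~ (a <= t <= b) -> psi t = 0 &
  \int[mu]_(t in `[a, b]) psi t = 1].
Proof.
move=> a0 ab; have tb := bump_test 0 a0 ab.
pose c := (a + b) / 2.
have ac : a < c by rewrite /c; lra.
have cb : c < b by rewrite /c; lra.
have cbump := test_continuous tb.
have iab : mu.-integrable `[a, b] (EFin \o bump a b 0).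
  by apply: integrable_segment => ? _; exact: cbump.
have I0 : 0 < \int[mu]_(t in `[a, b]) bump a b 0 t.
  pose c1 := (a + c) / 2; pose c2 := (c + b) / 2.
  have [ac1 c12 c2b] : [/\ a < c1, c1 < c2 & c2 < b] by rewrite /c1 /c2; split; lra.
  have cn : {within `[c1, c2], continuous (bump a b 0)}.
    by apply: continuous_subspaceT => t; exact: cbump.
  have [m mI mmin] := EVT_min (ltW c12) cn.
  have m0 : 0 < bump a b 0 m.
    apply: bump_gt0; move: mI; rewrite in_itv/= => /andP[m1 m2].
    by rewrite (lt_le_trans ac1 m1) (le_lt_trans m2 c2b).
  have ci (u v : R) : {in `[u, v], continuous (bump a b 0)} by move=> ? _; exact: cbump.
  rewrite (Rintegral_segment_split (ltW (lt_trans ac1 c12)) (ltW c2b) (ci _ _)).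
  rewrite (Rintegral_segment_split (ltW ac1) (ltW c12) (ci _ _)).
  have ge0 (u v : R) : 0 <= \int[mu]_(x in `[u, v]) bump a b 0 x.
    by apply: Rintegral_ge0 => x _; exact: bump_ge0.
  have : 0 < \int[mu]_(x in `[c1, c2]) bump a b 0 x.
    apply: lt_le_trans (_ : bump a b 0 m * (c2 - c1) <= _).
      by rewrite mulr_gt0// subr_gt0.
    rewrite -(Rintegral_segment_cst _ (ltW c12)); apply: le_Rintegral => //.
    by apply: integrable_segment => ? _; exact: cst_continuous.
    exact: integrable_segment.
  by move=> pos; apply: ltr_wpDr; [exact: ge0|apply: ltr_wpDl; [exact: ge0|]].
set I := Rintegral _ _ _ in I0.
exists (fun t => I^-1 * bump a b 0 t); split.
- exact: testZ.
- by move=> t; rewrite mulr_ge0 ?bump_ge0// invr_ge0 ltW.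
- by move=> t tab; rewrite bump_out ?mulr0// => /andP[at_ tb']; apply: tab; rewrite !ltW.
by rewrite RintegralZl// mulVf// gt_eqF.
Qed.

(** One minus the primitive of a normalised bump supported in [1, 2]. *)
Lemma cutoff_exists : exists chi chi' : R -> R, exists K : R,
  [/\ forall n, posC n chi, forall t : R, 0 < t -> is_derive t (1 : R) chi (chi' t),
     forall t, 0 <= chi t <= 1 & forall t, `|chi' t| <= K] /\
  [/\ forall t, 0 < t -> t <= 1 -> chi t = 1, forall t, 2 <= t -> chi t = 0,
     forall t, ~ (1 <= t <= 2) -> chi' t = 0 & forall n, posC n chi'].
Proof.
have lt12 : (1 : R) < 2 by lra.
have [psi [tpsi psi0 psio psi1]] := unit_bump ltr01 lt12.
have cpsi := test_continuous tpsi.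
have [M HM] := test_bounded tpsi.
pose I t := \int[mu]_(s in `]0, t]) psi s.
have ip (u v : R) : mu.-integrable `[u, v] (EFin \o psi).
  by apply: integrable_segment => ? _; exact: cpsi.
have ip' (u v : R) : mu.-integrable `]u, v] (EFin \o psi).
  by apply: (integrableS _ _ _ (ip u v)) => //; exact: subset_itv_oc_cc.
have psi_1 t : t <= 1 -> psi t = 0.
  rewrite le_eqVlt => /predU1P[->|t1]; last by rewrite psio// => /andP[]; rewrite leNgt t1.
  have H : psi t @[t --> (1 : R)^'-] --> psi 1 by apply: cvg_at_left_filter; exact: cpsi.
  apply: (cvg_unique _ H); rewrite ?Rhausdorff//.
  apply: cvg_near_cst; near=> u; rewrite psio// => /andP[+ _]; apply/negP; rewrite -ltNge.
  by near: u; exact: nbhs_left_lt.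
have psiN t : psi t != 0 -> 1 < t <= 2.
  move=> nz; rewrite ltNge; apply/andP; split.
    by apply: contra_neqN nz => /psi_1.
  by apply: contraTT nz => t2; rewrite negbK psio// => /andP[_]; apply/negP.
have Il t : t <= 1 -> I t = 0.
  move=> t1; rewrite /I (@eq_set_Rintegral _ set0) ?Rintegral_set0// => s /psiN /andP[s1 s2].
  split => //=; rewrite in_itv/= => /andP[_ st].
  by move: (lt_le_trans s1 (le_trans st t1)); rewrite ltxx.
have Ir t : 2 <= t -> I t = 1.
  move=> t2; rewrite /I -psi1; apply: eq_set_Rintegral => s /psiN /andP[s1 s2].
  rewrite /= !in_itv/= (ltW s1) s2 (lt_trans ltr01 s1) (le_trans s2 t2) //.
have I0 t : 0 <= I t by apply: Rintegral_ge0.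
have I1 t : I t <= 1.
  have [t2|/ltW/Ir ->//] := leP t 2.
  have [t1|t1] := leP t 1; first by rewrite Il.
  have tI : (BRight (0 : R) <= BRight t)%O by rewrite bnd_simp (le_trans ler01)// ltW.
  have tI2 : (BRight t <= BRight (2 : R))%O by rewrite bnd_simp.
  have := Rintegral_itvB (ip' 0 2) tI tI2; rewrite -!/(I _) (Ir 2)// => E.
  by rewrite -subr_ge0 E Rintegral_ge0.
have dI (t : R) : 0 < t -> is_derive t (1 : R) I (psi t).
  move=> t0.
  have [||||d E] := @continuous_FTC1_closed R psi 0 t (t + 1).
  - by rewrite ltrDl.
  - exact: ip.
  - exact: t0.
  - exact: cpsi.
  have IE : (fun x => \int[mu]_(s in `[0, x]) psi s) = I.
    by apply/funext => x; rewrite /I Rintegral_itv_obnd_cbnd.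
  by rewrite -IE; split; [exact: d|rewrite -derive1E; exact: E].
exists (fun t => 1 + -1 * I t), (fun t => -1 * psi t), M; split; split.
- move=> n; apply: posCD; first exact: posC_cst.
  apply: posCM; first exact: posC_cst.
  by apply: posCS; exists psi => //; exact: test_posC.
- move=> t t0.
  have := is_deriveD (is_derive_cst (1 : R) t 1) (is_deriveZ (-1) (dI t t0)).
  by rewrite add0r.
- by move=> t; have := I0 t; have := I1 t; lra.
- by move=> t; rewrite mulN1r normrN.
- by move=> t _ /Il ->; rewrite mulr0 addr0.
- by move=> t /Ir ->; rewrite mulr1 subrr.
- by move=> t /psio ->; rewrite mulr0.
by move=> n; apply: posCM; [exact: posC_cst|exact: test_posC].
Unshelve. all: by end_near. Qed.

End TestFunctions.

(** * Locally integrable functions and weak derivatives *)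

Section LocallyIntegrable.
Variable R : realType.
Notation mu := (@lebesgue_measure R).
Local Notation Rplus := (`]0, +oo[%classic : set R).
Implicit Types (u v w g : R -> R).

Lemma ae_imply (P Q : R -> Prop) : (forall t, P t -> Q t) ->
  {ae mu, forall t, P t} -> {ae mu, forall t, Q t}.
Proof. by move=> PQ; apply: filterS => //; exact: (ae_filter_ringOfSetsType mu). Qed.

Lemma integrableZ (D : set R) (f : R -> R) (k : R) : measurable D ->
  mu.-integrable D (EFin \o f) -> mu.-integrable D (EFin \o (fun t => k * f t)).
Proof. by move=> mD; exact: integrableZl. Qed.

Lemma integrable_diff (D : set R) (f g : R -> R) : measurable D ->
  mu.-integrable D (EFin \o f) -> mu.-integrable D (EFin \o g) ->
  mu.-integrable D (EFin \o (fun t => f t - g t)).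
Proof.
move=> mD fi gi.
have : mu.-integrable D ((EFin \o f) \- (EFin \o g))%E by exact: integrableB.
by apply: eq_integrable => // t _; rewrite /= EFinB.
Qed.

Lemma integrable_sub (D E : set R) (f : R -> R) : measurable D -> measurable E ->
  D `<=` E -> mu.-integrable E (EFin \o f) -> mu.-integrable D (EFin \o f).
Proof. by move=> mD mE DE; exact: integrableS. Qed.

Lemma mRplus : measurable Rplus. Proof. exact: measurable_itv. Qed.

Lemma oRplus : open Rplus. Proof. exact: interval_open. Qed.

Lemma RplusE (t : R) : Rplus t <-> 0 < t.
Proof. by rewrite /= in_itv/= andbT. Qed.

Lemma segment_Rplus (a b : R) : 0 < a -> `[a, b] `<=` Rplus.
Proof.
by move=> a0 t /=; rewrite !in_itv/= andbT => /andP[at_ _]; exact: lt_le_trans at_.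
Qed.

Lemma loc_measurable u : locally_integrable Rplus u -> measurable_fun Rplus u.
Proof. by case. Qed.

Lemma loc_segment u (a b : R) : locally_integrable Rplus u -> 0 < a ->
  mu.-integrable `[a, b] (EFin \o u).
Proof.
move=> [mu_ _ iu] a0; apply/integrableP; split.
  apply/measurable_EFinP; apply: measurable_funS mu_ => //.
  exact: segment_Rplus.
exact: iu (segment_Rplus a0) (@segment_compact _ a b).
Qed.

Lemma integrable_mul_bounded u g (a b M : R) : locally_integrable Rplus u ->
  measurable_fun Rplus g -> 0 < a -> (forall t, 0 < t -> `|g t| <= M) ->
  (forall t, 0 < t -> ~ (a <= t <= b) -> g t = 0) ->
  mu.-integrable Rplus (EFin \o (fun t => u t * g t)).
Proof.
move=> lu mg a0 gM g0.
have mug : measurable_fun Rplus (fun t => u t * g t).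
  by apply: measurable_funM => //; exact: loc_measurable.
apply/integrableP; split; first exact/measurable_EFinP.
rewrite (_ : (\int[mu]_(x in _) _)%E = (\int[mu]_(x in `[a, b]) `|(u x * g x)%:E|)%E); last first.
  rewrite integral_mkcond [RHS]integral_mkcond; congr integral; apply/funext => t.
  rewrite !patchE; case: ifPn => [|tP]; rewrite ?inE.
    move=> /RplusE t0; case: ifPn => //; rewrite notin_setE /= in_itv/= => tab.
    by rewrite g0 ?mulr0 ?normr0.
  case: ifPn => //; rewrite inE => /(segment_Rplus a0)/mem_set.
  by rewrite (negbTE tP).
have := integrableZ M (measurable_itv `[a, b]) (loc_segment b lu a0).
move=> /integrableP[mMu]; apply: le_lt_trans.
apply: ge0_le_integral => //.
- apply: measurableT_comp => //; apply/measurable_EFinP; apply: measurable_funS mug => //.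
  exact: segment_Rplus.
- exact: measurableT_comp.
move=> t /(segment_Rplus a0)/RplusE t0; rewrite /= lee_fin !normrM mulrC ler_wpM2r//.
by apply: le_trans (gM t t0) (ler_norm _).
Qed.

Lemma continuous_loc_measurable g : (forall t, 0 < t -> {for t, continuous g}) ->
  measurable_fun Rplus g.
Proof.
move=> cg; apply: open_continuous_measurable_fun; first exact: oRplus.
by move=> t; rewrite inE => /RplusE; exact: cg.
Qed.

Lemma continuous_bounded_segment g (a b : R) : 0 < a ->
  (forall t, 0 < t -> {for t, continuous g}) ->
  exists M : R, forall t, a <= t <= b -> `|g t| <= M.
Proof.
move=> a0 cg; have [ab|ba] := leP a b; last first.
  by exists 0 => t /andP[at_ tb]; move: (lt_le_trans ba at_); rewrite ltNge tb.
have cn : {within `[a, b], continuous (fun t => `|g t|)}.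
  apply: continuous_in_subspaceT => t; rewrite inE /= in_itv/= => /andP[at_ _].
  by apply: (@continuous_comp _ _ _ g Num.norm); [apply/cg/(lt_le_trans a0)|exact: norm_continuous].
have [c cab Hc] := EVT_max ab cn.
by exists `|g c| => t tab; apply: Hc; rewrite in_itv.
Qed.

Lemma compact_Rplus (K : set R) : compact K -> K `<=` Rplus ->
  exists a b : R, [/\ 0 < a, a < b & K `<=` `[a, b]].
Proof.
move=> cK K0.
have [->|/set0P Kn0] := eqVneq K set0.
  by exists 1, 2; split => //; lra.
have cid : {within K, continuous (id : R -> R)}.
  by apply: continuous_subspaceT => x; exact: cvg_id.
have [a aK amin] := compact_EVT_min Kn0 cK cid.
have [b bK bmax] := compact_EVT_max Kn0 cK cid.
exists a, (b + 1); split.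
- by apply/RplusE/K0; rewrite -inE.
- by rewrite (le_lt_trans (amin _ bK))// ltrDl.
move=> t /mem_set tK; rewrite /= in_itv/= (amin _ tK).
by rewrite (le_trans (bmax _ tK))// lerDl.
Qed.

Lemma locally_integrable_mull g u : (forall t, 0 < t -> {for t, continuous g}) ->
  locally_integrable Rplus u -> locally_integrable Rplus (fun t => g t * u t).
Proof.
move=> cg lu; split; last 2 first.
- exact: oRplus.
- move=> K K0 cK; have [a [b [a0 ab Kab]]] := compact_Rplus cK K0.
  have [M gM] := continuous_bounded_segment b a0 cg.
  have mK := compact_measurable cK.
  have := integrableZ M (measurable_itv `[a, b]) (loc_segment b lu a0).
  move=> /(integrable_sub mK (measurable_itv _) Kab) /integrableP[mMu]; apply: le_lt_trans.
  apply: ge0_le_integral => //.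
  - apply/measurable_EFinP/measurableT_comp => //; apply: measurable_funM.
      by apply: measurable_funS (continuous_loc_measurable cg) => //; exact: mRplus.
    by apply: measurable_funS (loc_measurable lu) => //; exact: mRplus.
  - exact: measurableT_comp.
  move=> t /Kab; rewrite /= in_itv/= => tab; rewrite lee_fin !normrM ler_wpM2r//.
  exact: le_trans (gM t tab) (ler_norm _).
by apply: measurable_funM; [exact: continuous_loc_measurable|exact: loc_measurable].
Qed.

Lemma continuous_loc g : (forall t, 0 < t -> {for t, continuous g}) ->
  locally_integrable Rplus g.
Proof.
move=> cg; have -> : g = (fun t => g t * 1) by apply/funext => t; rewrite mulr1.
apply: locally_integrable_mull => //; split; last 2 first.
- exact: oRplus.
- move=> K _ cK; have mK := compact_measurable cK.
  rewrite normr1 integral_cst// mul1e.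
  exact: compact_finite_measure.
exact: measurable_cst.
Qed.

Lemma Rdominated_cvg (D : set R) (f_ : nat -> R -> R) (f g : R -> R) :
  measurable D -> (forall n, measurable_fun D (f_ n)) -> measurable_fun D f ->
  {ae mu, forall x, D x -> f_ n x @[n --> \oo] --> f x} ->
  mu.-integrable D (EFin \o g) -> (forall n x, D x -> `|f_ n x| <= g x) ->
  \int[mu]_(x in D) f_ n x @[n --> \oo] --> \int[mu]_(x in D) f x.
Proof.
move=> mD mf_ mf cf ig fg.
have cfE : {ae mu, forall x, D x -> (EFin \o f_ n) x @[n --> \oo] --> (EFin \o f) x}.
  apply: ae_imply cf => x H Dx; apply: cvg_EFin; last exact: H.
  by apply: nearW.
have fgE : {ae mu, forall x n, D x -> (`|(EFin \o f_ n) x| <= (EFin \o g) x)%E}.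
  by apply: aeW => x n Dx; rewrite /= lee_fin fg.
have [iF _ C] := @dominated_convergence _ _ _ mu D mD (fun n => EFin \o f_ n) (EFin \o f) (EFin \o g)
  (fun n => (measurable_EFinP _ _).2 (mf_ n)) ((measurable_EFinP _ _).2 mf)
  cfE ig fgE.
have iF' : (\int[mu]_(x in D) (EFin \o f) x)%E \is a fin_num by exact: integrable_fin_num.
by apply: fine_cvg; rewrite /Rintegral fineK.
Qed.

(** A locally integrable function is almost everywhere the derivative of its primitive, here 0. *)
Lemma ae_zero_segments w : locally_integrable Rplus w ->
  (forall a b : R, 0 < a -> a < b -> \int[mu]_(t in `[a, b]) w t = 0) ->
  w = cst 0 %[ae mu in Rplus].
Proof.
move=> lw w0.
suff H n : {ae mu, forall t, n.+1%:R^-1 < t < n.+1%:R -> w t = 0}.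
  have := ae_foralln H; apply: ae_imply => t tw /RplusE t0 /=.
  pose n := Num.truncn (Num.max t t^-1).
  have nt : Num.max t t^-1 < n.+1%:R by apply: truncnS_gt.
  move: nt; rewrite gt_max => /andP[nt nt'].
  apply: (tw n); rewrite nt andbT.
  by rewrite -[ltRHS]invrK ltf_pV2 ?posrE ?invr_gt0.
set c := n.+1%:R^-1; set d := n.+1%:R.
have c0 : 0 < c by rewrite invr_gt0.
pose f := w \_ `[c, d].
have fi : mu.-integrable setT (EFin \o f).
  rewrite -restrict_EFin; apply/integrable_restrict => //; rewrite setTI.
  exact: loc_segment.
have := @FTC1 R f (BRight c) _ _.
have fiy (y : R) : mu.-integrable [set` Interval (BRight c) (BRight y)] (EFin \o f).
  by apply: integrableS fi.
have lf : locally_integrable setT f by apply: open_integrable_locally => //; exact: openT.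
move=> /(_ fiy lf); apply: ae_imply => t H /andP[ct td].
have {H} [//|_ E] := H.
have <- : f t = w t by rewrite /f patchE mem_set//= in_itv/= !ltW.
rewrite -E derive1E.
suff : is_derive t (1 : R) (fun x => \int[mu]_(t0 in `]c, x]) f t0) 0 by case.
apply: near_eq_is_derive (is_derive_cst (0 : R) t 1).
near=> x; have cx : c < x by near: x; exact: lt_nbhsr.
have xd : x <= d by apply/ltW; near: x; exact: lt_nbhsl.
rewrite Rintegral_itv_obnd_cbnd; last exact: fiy.
rewrite -(w0 c x c0 cx); apply: eq_Rintegral => s; rewrite inE /= in_itv/= => /andP[cs sx].
by rewrite /f patchE mem_set//= in_itv/= cs (le_trans sx).
Unshelve. all: by end_near. Qed.

End LocallyIntegrable.

Section WeakDerivatives.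
Variable R : realType.
Notation mu := (@lebesgue_measure R).
Local Notation Rplus := (`]0, +oo[%classic : set R).
Implicit Types (u v w g phi psi : R -> R).

Lemma test_measurable phi (D : set R) : measurable D -> test_function phi -> measurable_fun D phi.
Proof.
move=> mD tphi; apply: measurable_funTS; apply: continuous_measurable_fun.
exact: test_continuous.
Qed.

Lemma test_integrable u phi : locally_integrable Rplus u -> test_function phi ->
  mu.-integrable Rplus (EFin \o (fun t => u t * phi t)).
Proof.
move=> lu tphi; have [a [b [a0 ab phi0]]] := test_supp tphi.
have [M HM] := test_bounded tphi.
apply: (@integrable_mul_bounded _ u phi a b M) => //.
  exact: test_measurable (@mRplus R) tphi.
by move=> t _; exact: phi0.
Qed.

Lemma Rplus_segment g (a b : R) : 0 < a -> (forall t, 0 < t -> ~ (a <= t <= b) -> g t = 0) ->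
  \int[mu]_(t in Rplus) g t = \int[mu]_(t in `[a, b]) g t.
Proof.
move=> a0 g0; rewrite (Rintegral_mkcond mu Rplus) (Rintegral_mkcond mu `[a, b]).
congr Rintegral; apply/funext => t; rewrite !patchE.
case: ifPn => [|tP]; rewrite ?inE.
  move=> /RplusE t0; case: ifPn => //; rewrite notin_setE /= in_itv/= => tab.
  by rewrite g0.
case: ifPn => //; rewrite inE => /(segment_Rplus a0)/mem_set.
by rewrite (negbTE tP).
Qed.

(** The fundamental lemma of the calculus of variations: bumps tend to the indicator function of
    a segment, so all integrals over segments vanish. *)
Lemma test_orthogonal_zero w : locally_integrable Rplus w ->
  (forall phi, test_function phi -> \int[mu]_(t in Rplus) (w t * phi t) = 0) ->
  w = cst 0 %[ae mu in Rplus].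
Proof.
move=> lw w0; apply: ae_zero_segments => // a b a0 ab.
have iw := loc_segment b lw a0.
have mw : measurable_fun `[a, b] w by case/integrableP: iw => /measurable_EFinP.
have mb n : measurable_fun `[a, b] (bump a b n).
  exact: test_measurable (measurable_itv _) (bump_test n a0 ab).
have iw' : mu.-integrable `[a, b] (EFin \o (fun t => `|w t|)) by exact: integrable_norm iw.
have cw : {ae mu, forall t, `[a, b]%classic t -> w t * bump a b n t @[n --> \oo] --> w t}.
  exists [set a; b]; split => [||t /=].
  - by apply: measurableU; exact: measurable_set1.
  - by apply: countable_lebesgue_measure0; apply: finite_set_countable; exact: finite_set2.
  - move=> ntw; apply: contra_notP ntw => tab; rewrite /= in_itv/= => /andP[at_ tb].
    rewrite -[X in _ --> X]mulr1; apply: cvgM; first exact: cvg_cst.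
    apply: bump_cvg; rewrite !lt_neqAle at_ tb !andbT.
    by apply/andP; split; apply/eqP => E; apply: tab; rewrite E; [left|right].
have := Rdominated_cvg (measurable_itv `[a, b]) (fun n => measurable_funM mw (mb n)) mw cw iw'.
move=> /(_ _)/cvg_lim => <- //; last first.
  by move=> n t _; rewrite normrM ler_piMr// ger0_norm ?bump_ge0// bump_le1.
apply: lim_near_cst => //; near=> n.
rewrite -(w0 _ (bump_test n a0 ab)); apply/esym/Rplus_segment => // t t0 tab.
by rewrite bump_out ?mulr0// => /andP[at_ tb]; apply: tab; rewrite !ltW.
Unshelve. all: by end_near. Qed.

Lemma weak_derivative_unique u v v' : weak_derivative u v -> weak_derivative u v' ->
  v = v' %[ae mu in Rplus].
Proof.
move=> [lv dv] [lv' dv'].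
have := test_orthogonal_zero (locally_integrableB lv lv').
have H phi : test_function phi -> \int[mu]_(t in Rplus) ((v \- v') t * phi t) = 0.
  move=> tphi; under eq_Rintegral do rewrite /= mulrBl.
  rewrite RintegralB; [|exact: mRplus|exact: test_integrable|exact: test_integrable].
  by apply/eqP; rewrite subr_eq0 -eqr_opp -dv// -dv'.
by move=> /(_ H); apply: ae_imply => t E /E/eqP; rewrite /= subr_eq0 => /eqP.
Qed.

Lemma weak_derivativeD u v u' v' :
  locally_integrable Rplus u -> locally_integrable Rplus u' ->
  weak_derivative u v -> weak_derivative u' v' ->
  weak_derivative (fun t => u t + u' t) (fun t => v t + v' t).
Proof.
move=> lu lu' [lv dv] [lv' dv']; split; first exact: (locally_integrableD lv lv').
move=> phi tphi; have tphi' := test_derive1 tphi.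
under eq_Rintegral do rewrite mulrDl.
under [in RHS]eq_Rintegral do rewrite mulrDl.
rewrite RintegralD; [|exact: mRplus|exact: test_integrable|exact: test_integrable].
rewrite RintegralD; [|exact: mRplus|exact: test_integrable|exact: test_integrable].
by rewrite dv// dv'// opprD.
Qed.

Lemma weak_derivativeZ u v (c : R) : locally_integrable Rplus u ->
  weak_derivative u v -> weak_derivative (fun t => c * u t) (fun t => c * v t).
Proof.
move=> lu [lv dv]; split.
  by apply: (@locally_integrable_mull _ (fun=> c)) => // t _; exact: cst_continuous.
move=> phi tphi; have tphi' := test_derive1 tphi.
under eq_Rintegral do rewrite -mulrA.
under [in RHS]eq_Rintegral do rewrite -mulrA.
rewrite RintegralZl; [|exact: mRplus|exact: test_integrable].
rewrite RintegralZl; [|exact: mRplus|exact: test_integrable].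
by rewrite dv// mulrN.
Qed.

(** The product rule, read off from the test function m phi. *)
Lemma weak_derivativeM (m m' u v : R -> R) : (forall n, posC n m) ->
  (forall t : R, 0 < t -> is_derive t (1 : R) m (m' t)) -> (forall n, posC n m') ->
  locally_integrable Rplus u -> weak_derivative u v ->
  locally_integrable Rplus (fun t => m t * u t) /\
  weak_derivative (fun t => m t * u t) (fun t => m' t * u t + m t * v t).
Proof.
move=> cm dm cm' lu [lv dv].
have cont (f : R -> R) : (forall n, posC n f) -> forall t, 0 < t -> {for t, continuous f}.
  move=> cf t t0; have [f' df _] := cf 1%N; have [d _] := df t t0.
  exact/differentiable_continuous/derivable1_diffP.
have lmu := locally_integrable_mull (cont _ cm) lu.
have lmv := locally_integrable_mull (cont _ cm) lv.
have lm'u := locally_integrable_mull (cont _ cm') lu.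
split => //; split; first exact: (locally_integrableD lm'u lmv).
move=> phi tphi; have tphi' := test_derive1 tphi.
have tmphi := testMl cm tphi.
have E t : 0 < t -> derive1 (fun s => m s * phi s) t = m' t * phi t + m t * derive1 phi t.
  move=> t0; rewrite derive1E; have [_ ->] := is_deriveM (dm t t0) (test_is_derive t tphi).
  by rewrite /GRing.scale/=; ring.
have mphi : \int[mu]_(t in Rplus) (u t * derive1 (fun s => m s * phi s) t) =
   - \int[mu]_(t in Rplus) (v t * (m t * phi t)) by exact: dv.
have {}E : \int[mu]_(t in Rplus) (u t * derive1 (fun s => m s * phi s) t) =
   \int[mu]_(t in Rplus) (m' t * u t * phi t) + \int[mu]_(t in Rplus) (m t * u t * derive1 phi t).
  rewrite -RintegralD; [|exact: mRplus|exact: test_integrable|exact: test_integrable].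
  by apply: eq_Rintegral => t; rewrite inE => /RplusE t0; rewrite E//; ring.
under [in RHS]eq_Rintegral do rewrite mulrDl.
rewrite RintegralD; [|exact: mRplus|exact: test_integrable|exact: test_integrable].
have -> : \int[mu]_(t in Rplus) (m t * v t * phi t) = \int[mu]_(t in Rplus) (v t * (m t * phi t)).
  by apply: eq_Rintegral => t _; ring.
by rewrite opprD -mphi E addKr.
Qed.

Lemma test_loc phi : test_function phi -> locally_integrable Rplus phi.
Proof. by move=> tphi; apply: continuous_loc => t _; exact: test_continuous. Qed.

Lemma test_weak_derivative phi : test_function phi -> weak_derivative phi (derive1 phi).
Proof.
move=> tphi; split; first exact/test_loc/test_derive1.
move=> psi tpsi.
have [a [b [a0 ab out]]] := test_supp tphi.
have ca : a / 2 < a by rewrite ltr_pdivrMr// ltr_pMr// ltr1n.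
have c0 : 0 < a / 2 by rewrite divr_gt0.
have ab' : a / 2 < b + 1 by rewrite (lt_trans ca)// (lt_trans ab)// ltrDl.
have out' t : 0 < t -> ~ (a / 2 <= t <= b + 1) -> phi t = 0.
  move=> _ tab; apply: out => /andP[at_ tb]; apply: tab.
  by rewrite (le_trans (ltW ca))//= (le_trans tb)// lerDl.
have out1 t : 0 < t -> ~ (a / 2 <= t <= b + 1) -> derive1 phi t = 0.
  move=> t0 tab; rewrite derive1E.
  suff : is_derive t (1 : R) phi 0 by case.
  apply: near_eq_is_derive (is_derive_cst (0 : R) t 1).
  have [tc|tc] := ltP t (a / 2).
    near=> s; rewrite out// => /andP[+ _]; apply/negP; rewrite -ltNge.
    by rewrite (lt_trans _ ca)//; near: s; exact: lt_nbhsl.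
  have bt : b < t.
    by rewrite ltNge; apply/negP => tb; apply: tab; rewrite tc/= (le_trans tb)// lerDl.
  near=> s; rewrite out// => /andP[_]; apply/negP; rewrite -ltNge.
  by near: s; exact: lt_nbhsr.
rewrite (@Rplus_segment (fun t => phi t * derive1 psi t) (a / 2) (b + 1))//; last first.
  by move=> t t0 /(out' t t0) ->; rewrite mul0r.
rewrite (@Rplus_segment (fun t => derive1 phi t * psi t) (a / 2) (b + 1))//; last first.
  by move=> t t0 /(out1 t t0) ->; rewrite mul0r.
have LR f : test_function f -> derivable_oo_LRcontinuous f (a / 2) (b + 1).
  move=> tf; split.
  - by move=> t _; have [] := test_is_derive t tf.
  - by apply: cvg_at_right_filter; exact: test_continuous.
  - by apply: cvg_at_left_filter; exact: test_continuous.
have C f : test_function f -> {within `[a / 2, b + 1], continuous f}.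
  by move=> tf; apply: continuous_subspaceT => t; exact: test_continuous.
rewrite (@Rintegration_by_parts R phi psi (derive1 phi) (derive1 psi) _ _ ab'); do ?by [|exact: C|exact: LR|exact/C/test_derive1].
rewrite out; last by move=> /andP[_]; rewrite leNgt ltrDl ltr01.
by rewrite [phi (a / 2)]out ?mul0r ?subrr ?sub0r// => /andP[]; rewrite leNgt ca.
Unshelve. all: by end_near. Qed.

(** Fubini's theorem on the triangle s <= t: an integration by parts without derivatives. *)
Lemma fubini_triangle v phi (a b : R) : a < b -> mu.-integrable `[a, b] (EFin \o v) ->
  mu.-integrable `[a, b] (EFin \o phi) ->
  \int[mu]_(t in `[a, b]) (phi t * \int[mu]_(s in `[a, t]) v s) =
  \int[mu]_(s in `[a, b]) (v s * \int[mu]_(t in `[s, b]) phi t).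
Proof.
move=> ab iv ip.
pose v1 := v \_ `[a, b]; pose p1 := phi \_ `[a, b].
have iv1 : mu.-integrable setT (EFin \o v1).
  by rewrite /v1 -restrict_EFin; apply/integrable_restrict => //; rewrite setTI.
have ip1 : mu.-integrable setT (EFin \o p1).
  by rewrite /p1 -restrict_EFin; apply/integrable_restrict => //; rewrite setTI.
have mv1 : measurable_fun setT v1 by case/integrableP: iv1 => /measurable_EFinP.
have mp1 : measurable_fun setT p1 by case/integrableP: ip1 => /measurable_EFinP.
pose f (z : R * R) := if z.1 <= z.2 then v1 z.1 * p1 z.2 else 0.
have mf : measurable_fun setT (EFin \o f).
  apply/measurable_EFinP; apply: measurable_fun_ifT => //.
    by apply: measurable_fun_ler.
  by apply: measurable_funM; apply: measurableT_comp.
have L1 h : mu.-integrable setT (EFin \o h) -> (\int[mu]_s `|(h s)%:E| = (\int[mu]_s `|h s|)%:E)%E.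
  move=> ih; rewrite /Rintegral fineK//.
  by apply: integrable_fin_num => //; exact: integrable_norm ih.
have if_ : (mu \x mu)%E.-integrable setT (EFin \o f).
  apply/integrable12ltyP => //.
  apply: (@le_lt_trans _ _ (\int[mu]_s (`|v1 s|%:E * \int[mu]_t `|(p1 t)%:E|))%E).
    apply: ge0_le_integral => //.
    - by move=> s _; apply: integral_ge0.
    - apply: (@measurable_fun_fubini_tonelli_F _ _ _ _ _ mu (abse \o (EFin \o f))) => //.
        by apply: measurableT_comp => //; exact: mf.
      by move=> x; rewrite /= lee_fin.
    - rewrite L1//; under eq_fun do rewrite -EFinM.
      by apply/measurable_EFinP; apply: measurable_funM => //; exact: measurableT_comp.
    move=> s _; rewrite -ge0_integralZl//; last first.
      by apply: measurableT_comp => //; exact/measurable_EFinP.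
    apply: ge0_le_integral => //.
    - apply: measurableT_comp => //; apply/measurable_EFinP.
      move/measurable_EFinP: mf => mf; exact: (measurableT_comp mf (measurable_pair1 s)).
    - under eq_fun do rewrite -EFinM.
      by apply/measurable_EFinP; apply: measurable_funM => //; exact: measurableT_comp.
    by move=> t _; rewrite /= /f /=; case: ifP => _; rewrite -?EFinM ?lee_fin ?normrM// normr0 mulr_ge0.
  rewrite L1//; under eq_integral do rewrite muleC.
  have iv1' := integrable_norm iv1.
  rewrite ge0_integralZl//; last 2 first.
  - by case/integrableP: iv1'.
  - by rewrite lee_fin Rintegral_ge0.
  by rewrite (L1 v1)// -EFinM ltry.
have := Fubini if_.
have subl s : a <= s -> `[s, b] `<=` `[a, b].
  by move=> as_; apply: subset_itvScc; rewrite bnd_simp.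
have subr t : t <= b -> `[a, t] `<=` `[a, b].
  by move=> tb; apply: subset_itvScc; rewrite bnd_simp.
have inner (h : R -> R) (c : R) (D : set R) : measurable D -> mu.-integrable D (EFin \o h) ->
    (\int[mu]_y (c * (h \_ D) y)%:E)%E = (c * \int[mu]_(y in D) h y)%:E.
  move=> mD ih.
  have ihD : mu.-integrable setT (EFin \o (h \_ D)).
    by rewrite -restrict_EFin; apply/integrable_restrict => //; rewrite setTI.
  rewrite Rintegral_mkcond -RintegralZl// /Rintegral fineK//.
  exact/integrable_fin_num/integrableZ.
have -> : (fun s => \int[mu]_t (EFin \o f) (s, t))%E = (fun s => (v1 s * \int[mu]_(t in `[s, b]) phi t)%:E).
  apply/funext => s; rewrite /v1 patchE; case: ifPn => [|sab].
    rewrite inE /= in_itv/= => /andP[as_ sb].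
    rewrite -inner//; last exact: integrable_sub (subl s as_) ip.
    have sI : s \in `[a, b]%classic by rewrite inE /= in_itv/= as_ sb.
    congr integral; apply/funext => t; rewrite /= /f /v1 /= patchE sI.
    rewrite /p1 !patchE; case: (boolP (s <= t)) => st.
      congr (_%:E); congr (_ * _); congr (if _ then _ else _).
      by apply/idP/idP; rewrite !inE /= !in_itv/= => /andP[x1 ->]; rewrite ?andbT// (le_trans as_).
    by rewrite ifF ?mulr0//; apply/negbTE; rewrite notin_setE /= in_itv/= (negbTE st).
  rewrite -[point]/(0 : R) mul0r; apply: integral0_eq => t _; rewrite /= /f /v1 /= patchE (negbTE sab) -[point]/(0 : R) mul0r.
  by case: ifP.
have -> : (fun t => \int[mu]_s (EFin \o f) (s, t))%E = (fun t => (p1 t * \int[mu]_(s in `[a, t]) v s)%:E).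
  apply/funext => t; rewrite /p1 patchE; case: ifPn => [|tab].
    rewrite inE /= in_itv/= => /andP[at_ tb].
    rewrite -inner//; last exact: integrable_sub (subr t tb) iv.
    have tI : t \in `[a, b]%classic by rewrite inE /= in_itv/= at_ tb.
    congr integral; apply/funext => s; rewrite /= /f /p1 /= patchE tI.
    rewrite /v1 !patchE [phi t * _]mulrC; case: (boolP (s <= t)) => st.
      congr (_%:E); congr (_ * _); congr (if _ then _ else _).
      by apply/idP/idP; rewrite !inE /= !in_itv/= => /andP[-> x1]//=; rewrite (le_trans st).
    by rewrite ifF ?mul0r//; apply/negbTE; rewrite notin_setE /= in_itv/= (negbTE st) andbF.
  rewrite -[point]/(0 : R) mul0r; apply: integral0_eq => s _; rewrite /= /f /p1 /= patchE (negbTE tab) -[point]/(0 : R) mulr0.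
  by case: ifP.
move=> /(congr1 fine); rewrite -!/(Rintegral _ _ _) => E.
rewrite (Rintegral_mkcond mu `[a, b] (fun t => phi t * _)) (Rintegral_mkcond mu `[a, b] (fun s => v s * _)).
transitivity (\int[mu]_t (p1 t * \int[mu]_(s in `[a, t]) v s)).
  by congr Rintegral; apply/funext => t; rewrite /p1 !patchE; case: ifP; rewrite ?mul0r.
rewrite -E; congr Rintegral; apply/funext => s; rewrite /v1 !patchE; case: ifP; rewrite ?mul0r//.
Qed.

Lemma test_derive1_mean phi (s b : R) : test_function phi -> s <= b -> phi b = 0 ->
  \int[mu]_(t in `[s, b]) derive1 phi t = - phi s.
Proof.
move=> tphi; rewrite le_eqVlt => /predU1P[-> ->|sb b0].
  by rewrite set_itv1 Rintegral_set1 oppr0.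
have := @continuous_FTC2 R (derive1 phi) phi s b sb.
rewrite /Rintegral => -> //.
- by rewrite -EFinB b0 sub0r.
- by apply: continuous_subspaceT => t; exact/test_continuous/test_derive1.
split.
- by move=> t _; have [] := test_is_derive t tphi.
- by apply: cvg_at_right_filter; exact: test_continuous.
- by apply: cvg_at_left_filter; exact: test_continuous.
Qed.

(** A function with weak derivative 0 is constant (du Bois-Reymond): any test function minus a
    multiple of a fixed normalised bump has mean 0, so it is the derivative of a test function. *)
Lemma weak_derivative0_cst w : locally_integrable Rplus w ->
  (forall phi, test_function phi -> \int[mu]_(t in Rplus) (w t * derive1 phi t) = 0) ->
  exists c, w = cst c %[ae mu in Rplus].
Proof.
move=> lw w0.
have lt12 : (1 : R) < 2 by lra.
have [psi0 [tpsi0 _ out0 int0]] := unit_bump ltr01 lt12.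
pose c := \int[mu]_(t in Rplus) (w t * psi0 t); exists c.
have lc : locally_integrable Rplus (fun=> - c : R).
  by apply: continuous_loc => t _; exact: cst_continuous.
have l1 : locally_integrable Rplus (fun=> 1 : R).
  by apply: continuous_loc => t _; exact: cst_continuous.
have := test_orthogonal_zero (locally_integrableD lw lc).
have H phi : test_function phi -> \int[mu]_(t in Rplus) ((w t + - c) * phi t) = 0.
  move=> tphi; have [a [b [a0 ab out]]] := test_supp tphi.
  pose a' := Num.min a 1; pose b' := Num.max b 2.
  have a'0 : 0 < a' by rewrite lt_min a0 ltr01.
  have ab' : a' < b' by rewrite lt_max gt_min ab.
  have outa t : ~ (a' <= t <= b') -> phi t = 0.
    move=> tab; apply: out => /andP[at_ tb]; apply: tab.
    by rewrite ge_min at_/= le_max tb.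
  have outb t : ~ (a' <= t <= b') -> psi0 t = 0.
    move=> tab; apply: out0 => /andP[at_ tb]; apply: tab.
    by rewrite ge_min at_ orbT/= le_max tb orbT.
  pose I := \int[mu]_(t in `[a', b']) phi t.
  have tpsi : test_function (fun t => phi t + - I * psi0 t) by apply: testD => //; exact: testZ.
  have is_ f : test_function f -> mu.-integrable `[a', b'] (EFin \o f).
    by move=> tf; apply: integrable_segment => t _; exact: test_continuous.
  have int1 : \int[mu]_(t in `[a', b']) psi0 t = 1.
    rewrite -int0; apply: eq_set_Rintegral => t nz.
    have /andP[t1 t2] : 1 <= t <= 2 by apply: contra_neqT nz => /negP; exact: out0.
    by rewrite /= !in_itv/= ge_min le_max t1 t2 !orbT.
  have [||chi [tchi dchi _]] := test_primitive a'0 ab' tpsi.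
  - by move=> t tab; rewrite outa// outb// mulr0 addr0.
  - rewrite RintegralD//; [|exact: is_|exact/is_/testZ].
    by rewrite RintegralZl//; [rewrite int1 mulr1 subrr|exact: is_].
  have := w0 _ tchi; rewrite dchi.
  under eq_Rintegral do rewrite mulrDr mulrCA.
  rewrite RintegralD; [|exact: mRplus|exact: test_integrable|]; last first.
    by apply: integrableZ; [exact: mRplus|exact: test_integrable].
  rewrite RintegralZl; [|exact: mRplus|exact: test_integrable].
  rewrite -/c => wphi.
  under eq_Rintegral do rewrite mulrDl.
  have i1 : mu.-integrable Rplus (EFin \o phi).
    have := test_integrable l1 tphi; apply: eq_integrable => // t _.
    by rewrite /= mul1r.
  rewrite RintegralD; [|exact: mRplus|exact: test_integrable|]; last first.
    by apply: integrableZ; [exact: mRplus|exact: i1].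
  rewrite RintegralZl; [|exact: mRplus|exact: i1].
  rewrite (@Rplus_segment phi a' b')// -/I; last by move=> t _; exact: outa.
  by rewrite -[RHS]wphi; congr (_ + _); ring.
by move=> /(_ H); apply: ae_imply => t E /E/eqP; rewrite /= subr_eq0 => /eqP.
Qed.

Lemma primitive_continuous v (a : R) : (forall b, mu.-integrable `[a, b] (EFin \o v)) ->
  forall t, a < t -> {for t, continuous (fun x => \int[mu]_(s in `[a, x]) v s)}.
Proof.
move=> iv t at_.
have at1 : a <= t + 1 by rewrite (le_trans (ltW at_))// lerDl.
have := parameterized_integral_continuous at1 (iv (t + 1)).
move=> /continuous_within_itvP; rewrite (lt_le_trans at_) ?lerDl// => /(_ isT)[+ _ _].
by apply; rewrite in_itv/= at_ ltrDl ltr01.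
Qed.

(** Any primitive of v has weak derivative v by [fubini_triangle], so it differs from u by a
    constant. *)
Lemma absolutely_continuous_representative u v : locally_integrable Rplus u ->
  weak_derivative u v -> exists U, [/\ u = U %[ae mu in Rplus],
    forall t, 0 < t -> {for t, continuous U} &
    forall s t, 0 < s -> s <= t -> U t - U s = \int[mu]_(x in `[s, t]) v x].
Proof.
move=> lu [lv dv].
have iv (a b : R) : 0 < a -> mu.-integrable `[a, b] (EFin \o v) by exact: loc_segment.
have split a b c : 0 < a -> a <= b -> b <= c ->
    \int[mu]_(x in `[a, c]) v x = \int[mu]_(x in `[a, b]) v x + \int[mu]_(x in `[b, c]) v x.
  move=> a0 ab bc.
  have [abE bcE] : (BLeft a <= BRight b)%O /\ (BRight b <= BRight c)%O by rewrite !bnd_simp.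
  have := Rintegral_itvB (iv a c a0) abE bcE.
  rewrite Rintegral_itv_obnd_cbnd => [<-|]; first by rewrite addrC subrK.
  by apply: integrable_sub (iv b c (lt_le_trans a0 ab)) => //; exact: subset_itv_oc_cc.
(* A primitive of v based at 1; the two cases avoid oriented integrals. *)
pose U t := if 1 <= t then \int[mu]_(x in `[1, t]) v x else - \int[mu]_(x in `[t, 1]) v x.
have UE s t : 0 < s -> s <= t -> U t - U s = \int[mu]_(x in `[s, t]) v x.
  move=> s0 st; rewrite /U; case: (leP 1 t) => t1; case: (leP 1 s) => s1.
  - by rewrite (split 1 s t)// addrC addKr.
  - by rewrite opprK (split s 1 t)//; [ring|exact: ltW].
  - by move: (le_lt_trans (le_trans s1 st) t1); rewrite ltxx.
  - by rewrite opprK (split s t 1)//; [ring|exact: ltW].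
have cU t : 0 < t -> {for t, continuous U}.
  move=> t0; pose a := t / 2.
  have a0 : 0 < a by rewrite divr_gt0.
  have at_ : a < t by rewrite ltr_pdivrMr// ltr_pMr// ltr1n.
  have cI := primitive_continuous (fun b => iv a b a0) at_.
  have : {for t, continuous (fun x => U a + \int[mu]_(s in `[a, x]) v s)}.
    by apply: continuousD => //; exact: cst_continuous.
  rewrite /prop_for /continuous_at -UE//; last exact: ltW.
  rewrite subrKC => C; apply: cvg_trans C; apply: near_eq_cvg.
  near=> x; rewrite -UE ?subrKC//; apply/ltW; near: x; exact: lt_nbhsr.
have lU := continuous_loc cU.
have dU phi : test_function phi ->
    \int[mu]_(t in Rplus) (U t * derive1 phi t) = - \int[mu]_(t in Rplus) (v t * phi t).
  move=> tphi; have [a' [b' [a'0 ab' out']]] := test_supp tphi.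
  pose a := a' / 2; pose b := b' + 1.
  have a0 : 0 < a by rewrite divr_gt0.
  have aa' : a < a' by rewrite ltr_pdivrMr// ltr_pMr// ltr1n.
  have bb' : b' < b by rewrite ltrDl.
  have ab : a < b by rewrite (lt_trans aa')// (lt_trans ab').
  have out t : ~ (a < t < b) -> phi t = 0.
    move=> tab; apply: out' => /andP[h1 h2]; apply: tab.
    by rewrite (lt_le_trans aa' h1) (le_lt_trans h2 bb').
  have phia : phi a = 0 by apply: out => /andP[]; rewrite ltxx.
  have phib : phi b = 0 by apply: out => /andP[_]; rewrite ltxx.
  have tphi' := test_derive1 tphi.
  have out1 t : 0 < t -> ~ (a <= t <= b) -> derive1 phi t = 0.
    move=> t0 tab; rewrite derive1E.
    suff : is_derive t (1 : R) phi 0 by case.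
    apply: near_eq_is_derive (is_derive_cst (0 : R) t 1).
    have [ta|at_] := ltP t a.
      near=> s; rewrite out// => /andP[+ _]; apply/negP; rewrite -leNgt ltW//.
      by near: s; exact: lt_nbhsl.
    have bt : b < t by rewrite ltNge; apply/negP => tb; apply: tab; rewrite at_.
    near=> s; rewrite out// => /andP[_]; apply/negP; rewrite -leNgt ltW//.
    by near: s; exact: lt_nbhsr.
  rewrite (@Rplus_segment _ a b)//; last by move=> t t0 /(out1 t t0) ->; rewrite mulr0.
  rewrite [in RHS](@Rplus_segment _ a b)//; last first.
    move=> t t0 tab; rewrite out ?mulr0// => /andP[at_ tb]; apply: tab; rewrite !ltW//.
  have is_ f : test_function f -> mu.-integrable `[a, b] (EFin \o f).
    by move=> tf; apply: integrable_segment => t _; exact: test_continuous.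
  have : \int[mu]_(t in `[a, b]) (U t * derive1 phi t) =
     \int[mu]_(t in `[a, b]) (U a * derive1 phi t + derive1 phi t * \int[mu]_(s in `[a, t]) v s).
    apply: eq_Rintegral => t; rewrite inE /= in_itv/= => /andP[at_ tb].
    by rewrite -UE//; ring.
  move=> ->; rewrite RintegralD//; last 2 first.
  - exact/integrableZ/is_.
  - have : mu.-integrable `[a, b] (EFin \o (fun t => U t * derive1 phi t - U a * derive1 phi t)).
      have iUp : mu.-integrable `[a, b] (EFin \o (fun t => U t * derive1 phi t)).
        apply: integrable_sub (test_integrable lU tphi') => //; exact: segment_Rplus.
      have iUa : mu.-integrable `[a, b] (EFin \o (fun t => U a * derive1 phi t)).
        exact/integrableZ/is_.
      exact: integrable_diff.
    apply: eq_integrable => // t; rewrite inE /= in_itv/= => /andP[at_ tb].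
    by rewrite /= -UE//; congr (_%:E); ring.
  rewrite RintegralZl//; last exact: is_.
  rewrite test_derive1_mean// ?(ltW ab)// phia oppr0 mulr0 add0r.
  rewrite fubini_triangle//; [|exact: iv|exact: is_].
  rewrite -[RHS]mulN1r -RintegralZl//; last first.
    apply: integrable_sub (test_integrable lv tphi) => //; exact: segment_Rplus.
  apply: eq_Rintegral => s; rewrite inE /= in_itv/= => /andP[as_ sb].
  by rewrite test_derive1_mean//; ring.
have [c wc] : exists c, u \- U = cst c %[ae mu in Rplus].
  apply: weak_derivative0_cst; first exact: locally_integrableB.
  move=> phi tphi; have tphi' := test_derive1 tphi.
  under eq_Rintegral do rewrite mulrBl.
  rewrite RintegralB; [|exact: mRplus|exact: test_integrable|exact: test_integrable].
  by rewrite dv// dU// subrr.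
exists (fun t => U t + c); split.
- by apply: ae_imply wc => t E /E /= <-; rewrite subrKC.
- by move=> t t0; apply: continuousD; [exact: cU|exact: cst_continuous].
by move=> s t s0 st; rewrite -UE//; ring.
Unshelve. all: by end_near. Qed.

End WeakDerivatives.

(** * Weighted norms and Sobolev spaces *)

Section WeightedNorms.
Variable R : realType.
Notation mu := (@lebesgue_measure R).
Local Notation Rplus := (`]0, +oo[%classic : set R).
Implicit Types (u v w g : R -> R) (p q : R).

Definition weight w := measurable_fun Rplus w /\ forall t, 0 < t -> 0 <= w t.

(** The p-th power of the weighted norm: additive in the weight and monotone in |u|, it is
    easier to estimate than the norm. *)
Definition mass p w u : \bar R := (\int[mu]_(t in Rplus) (`|u t| `^ p * w t)%:E)%E.

Lemma weighted_normE p w u : weighted_norm p w u = (mass p w u `^ p^-1)%E.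
Proof. by []. Qed.

Lemma weighted_norm_ge0 p w u : (0 <= weighted_norm p w u)%E.
Proof. exact: poweR_ge0. Qed.

Lemma mass_measurable p w u : weight w -> measurable_fun Rplus u ->
  measurable_fun Rplus (fun t => `|u t| `^ p * w t).
Proof.
move=> [mw _] mu_; apply: measurable_funM => //.
by apply: (measurableT_comp (measurable_powR _)) => //; exact: measurableT_comp.
Qed.

Lemma emass_measurable p w u : weight w -> measurable_fun Rplus u ->
  measurable_fun Rplus (fun t => (`|u t| `^ p * w t)%:E).
Proof. by move=> Ww mu_; apply/measurable_EFinP; exact: mass_measurable. Qed.

Lemma mass_ge0 p w u : weight w -> (0 <= mass p w u)%E.
Proof.
move=> [_ w0]; apply: integral_ge0 => t /RplusE t0.
by rewrite lee_fin mulr_ge0 ?powR_ge0// w0.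
Qed.

Lemma le_mass p w w' u u' : weight w -> weight w' ->
  measurable_fun Rplus u -> measurable_fun Rplus u' ->
  (forall t, 0 < t -> `|u t| `^ p * w t <= `|u' t| `^ p * w' t) ->
  (mass p w u <= mass p w' u')%E.
Proof.
move=> Ww Ww' mu_ mu' H; apply: ge0_le_integral => //.
- by move=> t /RplusE t0; rewrite lee_fin mulr_ge0 ?powR_ge0//; case: Ww => _; apply.
- exact: emass_measurable.
- exact: emass_measurable.
- by move=> t /RplusE t0; rewrite lee_fin H.
Qed.

Lemma ae_weighted_norm p w u u' : weight w ->
  measurable_fun Rplus u -> measurable_fun Rplus u' ->
  u = u' %[ae mu in Rplus] -> weighted_norm p w u = weighted_norm p w u'.
Proof.
move=> Ww mu_ mu' E; rewrite !weighted_normE.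
suff -> : mass p w u = mass p w u' by [].
apply: ae_eq_integral => //.
- exact: emass_measurable.
- exact: emass_measurable.
by apply: ae_imply E => t E Dt; rewrite E.
Qed.

Lemma weighted_normZ p w u (c : R) : 0 < p -> weight w -> measurable_fun Rplus u ->
  weighted_norm p w (fun t => c * u t) = (`|c|%:E * weighted_norm p w u)%E.
Proof.
move=> p0 Ww mu_; rewrite !weighted_normE /mass.
have -> : (\int[mu]_(t in Rplus) (`|c * u t|%R `^ p * w t)%:E =
    (`|c| `^ p)%:E * mass p w u)%E.
  rewrite -ge0_integralZl//.
  - by apply: eq_integral => t _; rewrite -EFinM normrM powRM// mulrA.
  - exact: emass_measurable.
  - by move=> t /RplusE t0; rewrite lee_fin mulr_ge0 ?powR_ge0//; case: Ww => _; apply.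
rewrite poweRM ?lee_fin ?powR_ge0 ?mass_ge0// poweR_EFin -powRrM mulfV ?gt_eqF//.
by rewrite powRr1.
Qed.

Let wfun p w u := (fun t => u t * w t `^ p^-1) \_ Rplus.

Let wfun_measurable p w u : weight w -> measurable_fun Rplus u -> measurable_fun setT (wfun p w u).
Proof.
move=> [mw _] mu_; apply/(measurable_restrictT _ _).1 => //.
by apply: measurable_funM => //; apply: (measurableT_comp (measurable_powR _)).
Qed.

Let Lnorm_wfun p w u : 0 < p -> weight w ->
  weighted_norm p w u = Lnorm mu p%:E (EFin \o wfun p w u).
Proof.
move=> p0 [_ w0]; rewrite weighted_normE unlock /Lnorm.
suff -> : mass p w u = (\int[mu]_t (`|(EFin \o wfun p w u) t| `^ p))%E by [].
rewrite /mass [LHS]integral_mkcond; congr integral; apply/funext => t.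
rewrite /wfun /= !patchE; case: ifPn; last first.
  move=> _; transitivity (0%E : \bar R) => //.
  by rewrite (_ : point = 0 :> R)// normr0 powR0// gt_eqF.
rewrite inE => /RplusE t0; rewrite normrM powRM//; congr (_ * _)%:E.
by rewrite ger0_norm ?powR_ge0// -powRrM mulVf ?gt_eqF// powRr1// w0.
Qed.

(** Minkowski's inequality for u w^(1/p). *)
Lemma weighted_normD p w u v : 1 <= p -> weight w ->
  measurable_fun Rplus u -> measurable_fun Rplus v ->
  (weighted_norm p w (fun t => (u t + v t)%R) <= weighted_norm p w u + weighted_norm p w v)%E.
Proof.
move=> p1 Ww mu_ mv; have p0 := lt_le_trans ltr01 p1.
rewrite !Lnorm_wfun//; set f := wfun p w u; set g := wfun p w v.
have -> : EFin \o wfun p w (fun t => u t + v t) = EFin \o (f \+ g).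
  apply/funext => t; rewrite /= /f /g /wfun !patchE; case: ifP => _; rewrite ?mulrDl//.
  by rewrite -[point]/(0 : R) addr0.
by apply: minkowski_EFin => //; exact: wfun_measurable.
Qed.

Lemma hoelder_Rplus p q u g : 0 < p -> 0 < q -> p^-1 + q^-1 = 1 ->
  measurable_fun Rplus u -> measurable_fun Rplus g ->
  (\int[mu]_(t in Rplus) (`|u t * g t|%R)%:E <=
   weighted_norm p (cst 1%R) u * weighted_norm q (cst 1%R) g)%E.
Proof.
move=> p0 q0 pq mu_ mg.
have W1 : weight (cst 1) by split => //; exact: measurable_cst.
have := @hoelder _ _ _ mu (wfun p (cst 1) u) (wfun q (cst 1) g) p q
  (wfun_measurable p W1 mu_) (wfun_measurable q W1 mg) p0 q0 pq.
rewrite -!Lnorm_wfun//; apply: le_trans.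
rewrite Lnorm1 le_eqVlt; apply/orP; left; apply/eqP; rewrite [LHS]integral_mkcond.
congr integral; apply/funext => t; rewrite /wfun /= !patchE.
case: ifP => _; rewrite ?powR1 ?mulr1//.
by transitivity (0%E : \bar R) => //; rewrite -[point]/(0 : R) mul0r normr0.
Qed.

Lemma weighted_norm_finP p w u : 0 < p -> (weighted_norm p w u < +oo)%E <-> (mass p w u < +oo)%E.
Proof.
move=> p0; rewrite weighted_normE; split => [|/poweR_lty//].
by apply: lty_poweRy; rewrite invr_neq0// gt_eqF.
Qed.

Lemma weight_powR (b : R) : weight (fun t => t `^ b).
Proof.
split; last by move=> t _; exact: powR_ge0.
exact: measurable_funTS (measurable_powR b).
Qed.

Lemma weightM w w' : weight w -> weight w' -> weight (fun t => w t * w' t).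
Proof.
move=> [mw w0] [mw' w'0]; split; first exact: measurable_funM.
by move=> t t0; rewrite mulr_ge0 ?w0 ?w'0.
Qed.

Lemma weight_Y p (b : R) : weight (fun t => t `^ b * (1 + 1 / t `^ p)).
Proof.
apply: weightM; first exact: weight_powR.
have [mp p0] := weight_powR (- p); split.
  apply: measurable_funD; first exact: measurable_cst.
  by apply: eq_measurable_fun mp => t _; rewrite powRN div1r.
by move=> t _; rewrite addr_ge0// divr_ge0// powR_ge0.
Qed.

End WeightedNorms.

(** What is used of the real function spaces: a subspace, with a seminorm that is nonnegative
    also off the space. *)
Record rspace (R : realType) (X : nspace R (R -> R)) : Prop := RSpace {
  rs0 : carrier X (fun=> 0) ;
  rsD : forall u v, carrier X u -> carrier X v -> carrier X (fun t => u t + v t) ;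
  rsZ : forall (c : R) u, carrier X u -> carrier X (fun t => c * u t) ;
  rs_ge0 : forall u, 0 <= nrm X u ;
  rs_tri : forall u v, carrier X u -> carrier X v ->
    nrm X (fun t => u t + v t) <= nrm X u + nrm X v ;
  rs_hom : forall (c : R) u, carrier X u -> nrm X (fun t => c * u t) = `|c| * nrm X u }.

Lemma fine_le_add (R : realType) (x y z : \bar R) : (0 <= x)%E -> (0 <= y)%E ->
  (0 <= z)%E -> (y < +oo)%E -> (z < +oo)%E -> (x <= y + z)%E -> fine x <= fine y + fine z.
Proof. by case: x y z => [x||] [y||] [z||]//=; rewrite -EFinD lee_fin. Qed.

Section SobolevSpaces.
Variable R : realType.
Notation mu := (@lebesgue_measure R).
Local Notation Rplus := (`]0, +oo[%classic : set R).
Implicit Types (u v w phi : R -> R).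
Variables (p : R) (w0 w1 : R -> R).
Hypotheses (p1 : 1 <= p) (W0 : weight w0) (W1 : weight w1).

Let p0 : 0 < p. Proof. exact: lt_le_trans ltr01 p1. Qed.

Lemma wderivP u : W11loc u -> weak_derivative u (wderiv u).
Proof. by move=> [_ H]; exact: (xgetPex (fun=> 0) H). Qed.

Lemma weak_derivative_measurable u v : weak_derivative u v -> measurable_fun Rplus v.
Proof. by move=> [/loc_measurable]. Qed.

Lemma sobolev_normE u v : weak_derivative u v ->
  sobolev_norm p w0 w1 u = (weighted_norm p w0 u + weighted_norm p w1 v)%E.
Proof.
move=> uv; rewrite /sobolev_norm.
suff -> : weighted_norm p w1 (wderiv u) = weighted_norm p w1 v by [].
have uv' : weak_derivative u (wderiv u) by apply: (xgetPex (fun=> 0)); exists v.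
apply: ae_weighted_norm => //; first last.
- exact: weak_derivative_unique uv' uv.
- exact: weak_derivative_measurable uv.
- exact: weak_derivative_measurable uv'.
Qed.

Let S := sobolev p w0 w1.

(** Any weak derivative may replace the chosen one, by uniqueness. *)
Lemma sobolev_carrierP u : carrier S u <-> locally_integrable Rplus u /\
  exists v, [/\ weak_derivative u v, (weighted_norm p w0 u < +oo)%E &
    (weighted_norm p w1 v < +oo)%E].
Proof.
split=> [[[lu [v uv]]]|[lu [v [uv u0 v1]]]].
  rewrite (sobolev_normE uv) => H; split => //; exists v.
  have ge (w f : R -> R) := weighted_norm_ge0 p w f; split => //.
    by apply: le_lt_trans H; rewrite leeDl.
  by apply: le_lt_trans H; rewrite leeDr.
split; first by split => //; exists v.
by rewrite (sobolev_normE uv) lte_add_pinfty.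
Qed.

Lemma sobolev_nrmE u v : weak_derivative u v -> (weighted_norm p w0 u < +oo)%E ->
  (weighted_norm p w1 v < +oo)%E ->
  nrm S u = fine (weighted_norm p w0 u) + fine (weighted_norm p w1 v).
Proof.
move=> uv u0 v1; rewrite /= (sobolev_normE uv) fineD//.
  by rewrite ge0_fin_numE// weighted_norm_ge0.
by rewrite ge0_fin_numE// weighted_norm_ge0.
Qed.

Lemma sobolev_rspace : rspace S.
Proof.
have ge (w f : R -> R) := weighted_norm_ge0 p w f.
have fz (w u : R -> R) : (weighted_norm p w u < +oo)%E -> weighted_norm p w u \is a fin_num.
  by rewrite ge0_fin_numE.
have l0 : locally_integrable Rplus (fun=> 0 : R).
  by apply: continuous_loc => t _; exact: cst_continuous.
have add u u' v v' : locally_integrable Rplus u -> locally_integrable Rplus u' ->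
    weak_derivative u v -> weak_derivative u' v' ->
    [/\ weak_derivative (fun t => u t + u' t) (fun t => v t + v' t),
     (weighted_norm p w0 (fun t => (u t + u' t)%R) <= weighted_norm p w0 u + weighted_norm p w0 u')%E &
     (weighted_norm p w1 (fun t => (v t + v' t)%R) <= weighted_norm p w1 v + weighted_norm p w1 v')%E].
  move=> lu lu' uv uv'; split; first exact: weak_derivativeD.
    by apply: weighted_normD => //; exact: loc_measurable.
  by apply: weighted_normD => //; [exact: weak_derivative_measurable uv|exact: weak_derivative_measurable uv'].
have scal c u v : locally_integrable Rplus u -> weak_derivative u v ->
    [/\ weak_derivative (fun t => c * u t) (fun t => c * v t),
     (weighted_norm p w0 (fun t => (c * u t)%R) = `|c|%:E * weighted_norm p w0 u)%E &
     (weighted_norm p w1 (fun t => (c * v t)%R) = `|c|%:E * weighted_norm p w1 v)%E].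
  move=> lu uv; split; first exact: weak_derivativeZ.
    by rewrite weighted_normZ//; exact: loc_measurable.
  by rewrite weighted_normZ//; exact: weak_derivative_measurable uv.
have Z u c : carrier S u -> carrier S (fun t => c * u t).
  move=> /sobolev_carrierP[lu [v [uv u0 v1]]]; have [cuv cu cv] := scal c _ _ lu uv.
  apply/sobolev_carrierP; split.
    by apply: (@locally_integrable_mull _ (fun=> c)) => // t _; exact: cst_continuous.
  exists (fun t => c * v t); rewrite cu cv; split => //.
    by rewrite -(fineK (fz _ _ u0)) -EFinM ltry.
  by rewrite -(fineK (fz _ _ v1)) -EFinM ltry.
split.
- apply/sobolev_carrierP; split => //; exists (fun=> 0).
  have z w : weight w -> weighted_norm p w (fun=> 0) = 0%E.
    move=> Ww; rewrite weighted_normE /mass integral0_eq ?poweR0r ?invr_neq0 ?gt_eqF//.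
    by move=> t _; rewrite normr0 powR0 ?mul0r// gt_eqF.
  rewrite !z//; split => //; split => // phi tphi.
  have mul0 (f : R -> R) : \int[mu]_(t in Rplus) (0 * f t) = 0.
    by under eq_Rintegral do rewrite mul0r; rewrite Rintegral_cst ?mul0r//; exact: mRplus.
  by rewrite !mul0 oppr0.
- move=> u u' /sobolev_carrierP[lu [v [uv u0 v1]]] /sobolev_carrierP[lu' [v' [uv' u'0 v'1]]].
  have [uuvv nu nv] := add _ _ _ _ lu lu' uv uv'.
  apply/sobolev_carrierP; split; first exact: locally_integrableD lu lu'.
  exists (fun t => v t + v' t); split; first exact: uuvv.
    exact: (le_lt_trans nu (lte_add_pinfty u0 u'0)).
  exact: (le_lt_trans nv (lte_add_pinfty v1 v'1)).
- by move=> c u; exact: Z.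
- by move=> u; rewrite fine_ge0// adde_ge0.
- move=> u u' /sobolev_carrierP[lu [v [uv u0 v1]]] /sobolev_carrierP[lu' [v' [uv' u'0 v'1]]].
  have [uuvv nu nv] := add _ _ _ _ lu lu' uv uv'.
  have fu : (weighted_norm p w0 (fun t => (u t + u' t)%R) < +oo)%E.
    exact: (le_lt_trans nu (lte_add_pinfty u0 u'0)).
  have fv : (weighted_norm p w1 (fun t => (v t + v' t)%R) < +oo)%E.
    exact: (le_lt_trans nv (lte_add_pinfty v1 v'1)).
  rewrite (sobolev_nrmE uuvv fu fv) (sobolev_nrmE uv u0 v1) (sobolev_nrmE uv' u'0 v'1).
  rewrite addrACA; apply: lerD.
    exact: (fine_le_add (ge _ _) (ge _ _) (ge _ _) u0 u'0 nu).
  exact: (fine_le_add (ge _ _) (ge _ _) (ge _ _) v1 v'1 nv).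
move=> c u Su; have Scu := Z u c Su.
move: Su Scu => /sobolev_carrierP[lu [v [uv u0 v1]]] _.
have [cuv cu cv] := scal c _ _ lu uv.
rewrite (sobolev_nrmE uv u0 v1) (sobolev_nrmE cuv) ?cu ?cv; last 2 first.
- by rewrite -(fineK (fz _ _ u0)) -EFinM ltry.
- by rewrite -(fineK (fz _ _ v1)) -EFinM ltry.
by rewrite !fineM ?fz// mulrDr.
Qed.

End SobolevSpaces.

(** * Hardy's inequality *)

Section Hardy.
Variable R : realType.
Notation mu := (@lebesgue_measure R).
Local Notation Rplus := (`]0, +oo[%classic : set R).
Implicit Types (u v w g h : R -> R) (p q : R).

(** Monotone convergence for an exhaustion of the domain. *)
Lemma ge0_exhaust (F : (set R)^nat) (D : set R) (f : R -> R) (M : \bar R) :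
  (forall n, measurable (F n)) -> nondecreasing_seq F -> \bigcup_n F n = D ->
  measurable_fun D f -> (forall t, D t -> 0 <= f t) ->
  (forall n, \int[mu]_(t in F n) (f t)%:E <= M)%E -> (\int[mu]_(t in D) (f t)%:E <= M)%E.
Proof.
move=> mF nF FD mf f0 H.
have FDn n : F n `<=` D by rewrite -FD; exact: bigcup_sup.
have mD : measurable D by rewrite -FD; exact: bigcup_measurable.
have C : (\int[mu]_(t in F n) (f t)%:E)%E @[n --> \oo] --> (\int[mu]_(t in D) (f t)%:E)%E.
  rewrite -FD; apply: ge0_nondecreasing_set_cvg_integral => //.
  - by move=> i; apply/measurable_EFinP; apply: measurable_funS mf.
  - by move=> i t /FDn Dt; rewrite /= lee_fin f0.
rewrite -(cvg_lim _ C)//; apply: lime_le; last by apply: nearW.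
by apply/cvg_ex; eexists; exact: C.
Qed.

Lemma le_integral_segment (b : R -> bool) (f : R -> R) (x y : R) : 0 < x ->
  measurable_fun Rplus f -> measurable_fun Rplus b -> (forall t : R, 0 < t -> 0 <= f t) ->
  (forall t : R, 0 < t -> b t -> x <= t <= y) ->
  (\int[mu]_(t in Rplus) ((b t)%:R * f t)%:E <= \int[mu]_(t in `[x, y]) (f t)%:E)%E.
Proof.
move=> x0 mf mb f0 bxy.
have mfs : measurable_fun `[x, y] f by apply: measurable_funS mf => //; exact: segment_Rplus.
apply: (@le_trans _ _ (\int[mu]_(t in Rplus) ((f \_ `[x, y]) t)%:E)%E); last first.
  rewrite integral_mkcond [leRHS]integral_mkcond le_eqVlt; apply/orP; left; apply/eqP.
  congr integral; apply/funext => t; rewrite !patchE; case: ifPn => tP.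
    by case: ifPn => //.
  case: ifPn => //; rewrite inE => /(segment_Rplus x0)/mem_set.
  by rewrite (negbTE tP).
have mb' : measurable_fun Rplus (fun t => (b t)%:R : R).
  apply: (@measurableT_comp _ _ _ _ _ _ (fun c : bool => c%:R : R)) => //.
apply: ge0_le_integral => //.
- by move=> t /RplusE t0; rewrite lee_fin mulr_ge0 ?f0.
- by apply/measurable_EFinP; apply: measurable_funM.
- apply/measurable_EFinP; apply: measurable_funTS; apply/(measurable_restrictT _ _).1 => //.
move=> t /RplusE t0; rewrite lee_fin patchE.
case: (boolP (b t)) => bt; last first.
  by rewrite mul0r; case: ifP => // _; rewrite ?f0// -[point]/(0 : R).
by rewrite mem_set ?mul1r//= in_itv/= bxy.
Qed.

Lemma integral_powR (x y g : R) : 0 < x -> x <= y -> g != 0 ->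
  (\int[mu]_(t in `[x, y]) (t `^ (g - 1))%:E = ((y `^ g - x `^ g) / g)%:E)%E.
Proof.
move=> x0; rewrite le_eqVlt => /predU1P[->|xy] g0.
  by rewrite subrr mul0r set_itv1 integral_set1.
have dg (t : R) : 0 < t -> is_derive t (1 : R) (fun t => t `^ g / g) (t `^ (g - 1)).
  move=> t0; have := is_derive1_powR g t0 => H.
  have -> : t `^ (g - 1) = g^-1 *: (g * t `^ (g - 1)).
    by rewrite [LHS](_ : _ = g^-1 * (g * t `^ (g - 1))) // mulrA mulVf// mul1r.
  rewrite (_ : (fun t : R => t `^ g / g) = g^-1 *: (fun t : R => t `^ g)); last first.
    by apply/funext => s; rewrite mulrC.
  exact: is_deriveZ.
have cont (a t : R) : 0 < t -> {for t, continuous (fun t => t `^ a)}.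
  move=> t0; apply: differentiable_continuous; apply/derivable1_diffP.
  by have [] := is_derive1_powR a t0.
rewrite (@continuous_FTC2 _ _ (fun t => t `^ g / g))//.
- by rewrite -EFinB mulrBl.
- apply: continuous_in_subspaceT => t; rewrite inE /= in_itv/= => /andP[xt _].
  exact/cont/(lt_le_trans x0).
- have cF (t : R) : 0 < t -> {for t, continuous (fun t => t `^ g / g)}.
    by move=> t0; apply: continuousM; [exact: cont|exact: cst_continuous].
  split.
  - by move=> t; rewrite in_itv/= => /andP[xt _]; have [] := dg t (lt_trans x0 xt).
  - apply: cvg_at_right_filter; exact: cF.
  - apply: cvg_at_left_filter; exact/cF/(lt_trans x0).
move=> t; rewrite in_itv/= => /andP[xt _].
by rewrite derive1E; have [_ ->] := dg t (lt_trans x0 xt).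
Qed.

Lemma integral_powR_pos (x y g : R) : 0 < x -> 0 < y -> 0 < g ->
  (\int[mu]_(t in `[x, y]) (t `^ (g - 1))%:E <= (y `^ g / g)%:E)%E.
Proof.
move=> x0 y0 g0; have [xy|yx] := leP x y.
  rewrite integral_powR ?gt_eqF// lee_fin ler_pM2r ?invr_gt0//.
  by rewrite gerBl powR_ge0.
by rewrite set_itv_ge ?bnd_simp -?ltNge// integral_set0 lee_fin divr_ge0 ?powR_ge0// ltW.
Qed.

Lemma integral_powR_neg (x y g : R) : 0 < x -> g < 0 ->
  (\int[mu]_(t in `[x, y]) (t `^ (g - 1))%:E <= (x `^ g / - g)%:E)%E.
Proof.
move=> x0 g0; have [xy|yx] := leP x y.
  rewrite integral_powR ?lt_eqF// lee_fin -[leLHS]opprK -mulrN -invrN -mulNr opprB ler_pM2r ?invr_gt0 ?oppr_gt0//.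
  by rewrite gerBl powR_ge0.
by rewrite set_itv_ge ?bnd_simp -?ltNge// integral_set0 lee_fin divr_ge0 ?powR_ge0// oppr_ge0 ltW.
Qed.

(** Schur's test for the operator with kernel the indicator function of b: split |v s| as
    (|v s| s^c) s^-c, apply Hoelder's inequality in s, and exchange the integrals. The exponent c
    is chosen by each application so that both one-variable integrals converge. *)
Lemma hardy_kernel p (c beta C1 C2 : R) (b : R -> R -> bool) v h : 1 < p -> 0 <= C1 -> 0 <= C2 ->
  measurable_fun setT (fun z : R * R => b z.1 z.2) ->
  measurable_fun Rplus v -> measurable_fun Rplus h ->
  (forall t : R, (0 < t)%R -> \int[mu]_(s in Rplus) ((b t s)%:R * s `^ (- (c * (p / (p - 1)))))%:E <=
     (C1 * t `^ (1 - c * (p / (p - 1))))%:E)%E ->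
  (forall s : R, (0 < s)%R -> \int[mu]_(t in Rplus) ((b t s)%:R * t `^ (beta - 1 - c * p))%:E <=
     (C2 * s `^ (beta - c * p))%:E)%E ->
  (forall t : R, (0 < t)%R -> (`|h t|%:E <= \int[mu]_(s in Rplus) ((b t s)%:R * `|v s|)%:E)%E) ->
  (mass p (fun t => (t `^ (beta - p))%R) h <=
    (C1 `^ (p - 1) * C2)%:E * mass p (fun t => (t `^ beta)%R) v)%E.
Proof.
move=> p1 C10 C20 mb mv mh H1 H2 hH.
have p0 : 0 < p by lra.
have pm1 : 0 < p - 1 by lra.
pose q := p / (p - 1).
have q0 : 0 < q by rewrite divr_gt0.
have pq : p^-1 + q^-1 = 1 by rewrite /q invf_div; field; rewrite gt_eqF.
pose k z : R := (b z.1 z.2)%:R.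
have kE : k = (fun z => if b z.1 z.2 then 1 else 0) by apply/funext => z; rewrite /k; case: (b _ _).
have mk : measurable_fun setT k by rewrite kE; apply: measurable_fun_ifT.
have mk1 t : measurable_fun setT (fun s => k (t, s)) by exact: (measurableT_comp mk (measurable_pair1 t)).
have mpow (e : R) D : measurable_fun D (fun s : R => s `^ e).
  by apply: measurable_funTS; exact: measurable_powR.
have mvp D : measurable D -> D `<=` Rplus -> measurable_fun D (fun s => `|v s| `^ p * s `^ (c * p)).
  move=> mD DR; apply: measurable_funS (mass_measurable p (weight_powR _) mv) => //; exact: mRplus.
have kp t s : k (t, s) `^ p = k (t, s) by rewrite /k; case: (b _ _); rewrite ?powR1 ?powR0// gt_eqF.
have kq t s : k (t, s) `^ q = k (t, s) by rewrite /k; case: (b _ _); rewrite ?powR1 ?powR0// gt_eqF.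
have k0 z : 0 <= k z by rewrite /k.
pose Hp t := (\int[mu]_(s in Rplus) (k (t, s) * (`|v s| `^ p * s `^ (c * p)))%:E)%E.
have mHp (t : R) : measurable_fun Rplus (fun s => k (t, s) * (`|v s| `^ p * s `^ (c * p))).
  by apply: measurable_funM; [exact: measurable_funTS|apply: mvp; [exact: mRplus|]].
have Hp0 t : (0 <= Hp t)%E.
  by apply: integral_ge0 => s /RplusE s0; rewrite lee_fin !mulr_ge0 ?powR_ge0.
have pw (t : R) : 0 < t -> ((`|h t| `^ p * t `^ (beta - p))%:E <=
    (C1 `^ (p - 1) * t `^ (beta - 1 - c * p))%:E * Hp t)%E.
  move=> t0.
  have : (`|h t|%:E <= Hp t `^ p^-1 * (C1 * t `^ (1 - c * q))%:E `^ q^-1)%E.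
    apply: (le_trans (hH t t0)).
    have := @hoelder_Rplus R p q (fun s => k (t, s) * (v s * s `^ c)) (fun s => k (t, s) * s `^ (- c))
      p0 q0 pq.
    have m1 : measurable_fun Rplus (fun s => k (t, s) * (v s * s `^ c)).
      by apply: measurable_funM; [exact: measurable_funTS|exact: measurable_funM].
    have m2 : measurable_fun Rplus (fun s => k (t, s) * s `^ (- c)).
      by apply: measurable_funM => //; exact: measurable_funTS.
    move=> /(_ m1 m2).
    have -> : (\int[mu]_(s in Rplus) (`|k (t, s) * (v s * s `^ c) * (k (t, s) * s `^ (- c))|%R)%:E =
       \int[mu]_(s in Rplus) ((b t s)%:R * `|v s|)%:E)%E.
      apply: eq_integral => s; rewrite inE => /RplusE s0; congr (_%:E).
      rewrite -[(b t s)%:R]/(k (t, s)).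
      have kk : k (t, s) * k (t, s) = k (t, s) by rewrite /k; case: (b _ _); rewrite ?mul1r ?mul0r.
      rewrite mulrACA kk powRN -mulrA mulfV ?mulr1 ?normrM ?(ger0_norm (k0 _))//.
      by rewrite gt_eqF// powR_gt0.
    move=> /le_trans; apply; rewrite !weighted_normE.
    apply: lee_pmul; try exact: poweR_ge0.
      have -> // : mass p (cst 1%R) (fun s => (k (t, s) * (v s * s `^ c))%R) = Hp t.
      apply: eq_integral => s; rewrite inE => /RplusE s0; congr (_%:E).
      rewrite mulr1 !normrM !(ger0_norm (k0 _)) (ger0_norm (powR_ge0 _ _)).
      by rewrite !powRM ?mulr_ge0 ?powR_ge0// kp -powRrM.
    apply: gt0_ler_poweR; rewrite ?invr_ge0 ?(ltW q0)//.
    - rewrite in_itv/= leey andbT; apply: integral_ge0 => s _.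
      by rewrite lee_fin mulr1 powR_ge0.
    - by rewrite in_itv/= leey andbT lee_fin mulr_ge0 ?powR_ge0.
    apply: le_trans (H1 t t0).
    rewrite le_eqVlt; apply/orP; left; apply/eqP.
    apply: eq_integral => s; rewrite inE => /RplusE s0; congr (_%:E).
    rewrite mulr1 !normrM !(ger0_norm (k0 _)) (ger0_norm (powR_ge0 _ _)).
    by rewrite !powRM ?powR_ge0// kq -powRrM mulNr.
  move=> H.
  have Hpow : ((`|h t| `^ p)%:E <= Hp t * ((C1 * t `^ (1 - c * q)) `^ (p - 1))%:E)%E.
    have -> : (Hp t * ((C1 * t `^ (1 - c * q)) `^ (p - 1))%:E =
       (Hp t `^ p^-1 * (C1 * t `^ (1 - c * q))%:E `^ q^-1) `^ p)%E.
      rewrite poweRM ?poweR_ge0// -!poweRrM mulVf ?gt_eqF// poweRe1//.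
      by rewrite (_ : q^-1 * p = p - 1)//; rewrite /q; field; rewrite !gt_eqF.
    rewrite -poweR_EFin; apply: gt0_ler_poweR => //; first exact: ltW.
      by rewrite in_itv/= leey lee_fin normr_ge0.
    by rewrite in_itv; apply/andP; split; [exact: mule_ge0 (poweR_ge0 _ _) (poweR_ge0 _ _)|exact: leey].
  rewrite [X in X%:E]mulrC EFinM.
  apply: le_trans (lee_wpmul2l _ Hpow) _; first by rewrite lee_fin powR_ge0.
  rewrite (muleC (Hp t)) muleA -EFinM le_eqVlt; apply/orP; left; apply/eqP.
  congr (_%:E * _)%E; rewrite powRM ?powR_ge0// mulrCA; congr (_ * _).
  rewrite -powRrM -powRD ?(gt_eqF t0)/= ?implybT//; congr (_ `^ _).
  by rewrite /q; field; rewrite gt_eqF.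
pose F (z : R * R) : R := (if 0 < z.1 then z.1 `^ (beta - 1 - c * p) else 0) *
   (k z * ((fun s => `|v s| `^ p * s `^ (c * p)) \_ Rplus) z.2).
have F0 z : 0 <= F z.
  rewrite /F mulr_ge0//; first by case: ifP => _; rewrite ?powR_ge0.
  by rewrite mulr_ge0// patchE; case: ifP => _; rewrite ?mulr_ge0 ?powR_ge0// -[point]/(0:R).
have mF : measurable_fun setT (EFin \o F).
  apply/measurable_EFinP; apply: measurable_funM; last first.
    apply: measurable_funM => //.
    apply: (measurableT_comp _ measurable_snd); apply/(measurable_restrictT _ _).1 => //.
    by apply: mvp.
  apply: (@measurableT_comp _ _ _ _ _ _ (fun t : R => if 0 < t then t `^ (beta - 1 - c * p) else 0) _ fst) => //.
  by apply: measurable_fun_ifT => //; apply: measurable_fun_ltr.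
have HpF (t : R) : 0 < t -> ((t `^ (beta - 1 - c * p))%:E * Hp t)%E = (\int[mu]_s (EFin \o F) (t, s))%E.
  move=> t0; rewrite /Hp -ge0_integralZl//.
  - rewrite integral_mkcond; congr integral; apply/funext => s.
    rewrite /= /F /= t0 !patchE; case: ifP => _; first by rewrite -EFinM.
    by transitivity (0%E : \bar R) => //; rewrite -[point]/(0:R) !mulr0.
  - apply/measurable_EFinP; exact: mHp.
  - by move=> s _; rewrite lee_fin !mulr_ge0 ?powR_ge0.
  - by rewrite lee_fin powR_ge0.
have mFF := @measurable_fun_fubini_tonelli_F _ _ _ _ _ mu (EFin \o F) mF (fun z => F0 z).
apply: (@le_trans _ _ ((C1 `^ (p - 1))%:E * \int[mu]_t \int[mu]_s (EFin \o F) (t, s))%E).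
  rewrite -ge0_integralZl//; last 2 first.
  - by move=> t _; apply: integral_ge0 => s _; rewrite /= lee_fin F0.
  - by rewrite lee_fin powR_ge0.
  rewrite /mass [leLHS]integral_mkcond; apply: ge0_le_integral => //.
  - move=> t _; rewrite patchE; case: ifP => // _; rewrite lee_fin mulr_ge0 ?powR_ge0//.
  - apply/(measurable_restrictT _ _).1 => //; apply: emass_measurable => //; exact: weight_powR.
  - exact: measurable_funeM.
  move=> t _; rewrite patchE; case: ifP => [|_].
    rewrite inE => /RplusE t0; apply: (le_trans (pw t t0)).
    by rewrite EFinM -muleA HpF.
  apply: mule_ge0; first by rewrite lee_fin powR_ge0.
  by apply: integral_ge0 => s _; rewrite /= lee_fin F0.
rewrite EFinM -muleA; apply: lee_wpmul2l; first by rewrite lee_fin powR_ge0.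
rewrite (_ : (\int[mu]_t \int[mu]_s (EFin \o F) (t, s))%E = (\int[mu]_s \int[mu]_t (EFin \o F) (t, s))%E); last first.
  by apply: fubini_tonelli => // z; rewrite /= lee_fin F0.
pose G := (fun s : R => C2%:E * (`|v s| `^ p * s `^ beta)%:E)%E.
have mass_m := emass_measurable p (weight_powR beta) mv.
have mG : measurable_fun Rplus G by apply: measurable_funeM.
have G0 s : (0 <= G s)%E by rewrite mule_ge0// lee_fin ?mulr_ge0 ?powR_ge0.
have -> : (C2%:E * mass p (fun t => (t `^ beta)%R) v = \int[mu]_s (G \_ Rplus) s)%E.
  rewrite /mass -ge0_integralZl//; first by rewrite integral_mkcond.
  by move=> s _; rewrite lee_fin mulr_ge0 ?powR_ge0.
apply: ge0_le_integral.
- exact: measurableT.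
- by move=> s _; apply: integral_ge0 => t _; rewrite /= lee_fin F0.
- exact: (@measurable_fun_fubini_tonelli_G _ _ _ _ _ mu (EFin \o F) mF (fun z => F0 z)).
- exact: ((measurable_restrictT _ _).1 mG).
move=> s _; rewrite patchE; case: ifPn => [|sR].
  rewrite inE => /RplusE s0.
  have -> : (\int[mu]_t (EFin \o F) (t, s) = (`|v s| `^ p * s `^ (c * p))%:E *
     \int[mu]_(t in Rplus) ((b t s)%:R * t `^ (beta - 1 - c * p))%:E)%E.
    rewrite -ge0_integralZl//.
    - rewrite [RHS]integral_mkcond; congr integral; apply/funext => t.
      rewrite /= /F /= patchE mem_set; last by apply/RplusE.
      case: ifP => t0.
        rewrite patchE mem_set; last by apply/RplusE.
        by rewrite -EFinM -[(b t s)%:R]/(k (t, s)); congr (_%:E); ring.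
      rewrite mul0r patchE ifF//; apply/negbTE; rewrite notin_setE => /RplusE.
      by rewrite t0.
    - apply/measurable_EFinP; apply: measurable_funM => //.
      by apply: measurable_funTS; exact: (measurableT_comp mk (measurable_pair2 s)).
      exact: mpow.
    - by move=> t _; rewrite lee_fin mulr_ge0 ?powR_ge0.
    - by rewrite lee_fin mulr_ge0 ?powR_ge0.
  apply: (le_trans (lee_wpmul2l _ (H2 s s0))); first by rewrite lee_fin mulr_ge0 ?powR_ge0.
  have -> : G s = (C2 * (`|v s| `^ p * (s `^ (c * p) * s `^ (beta - c * p))))%:E.
    by rewrite -powRD ?(gt_eqF s0) ?implybT// addrC subrK.
  by rewrite -EFinM lee_fin le_eqVlt; apply/orP; left; apply/eqP; ring.
rewrite (@integral0_eq) // => t _; rewrite /= /F /= patchE (negbTE sR) -[point]/(0:R).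
by rewrite !mulr0.
Qed.

Lemma ge_integral_segment (b : R -> bool) (f : R -> R) (x y : R) : 0 < x ->
  measurable_fun Rplus f -> measurable_fun Rplus b -> (forall t : R, 0 < t -> 0 <= f t) ->
  (forall t : R, x <= t <= y -> b t) ->
  (\int[mu]_(t in `[x, y]) (f t)%:E <= \int[mu]_(t in Rplus) ((b t)%:R * f t)%:E)%E.
Proof.
move=> x0 mf mb f0 bxy.
have mbf : measurable_fun Rplus (fun t => (b t)%:R * f t).
  apply: measurable_funM => //.
  apply: (@measurableT_comp _ _ _ _ _ _ (fun c : bool => c%:R : R)) => //.
have -> : (\int[mu]_(t in `[x, y]) (f t)%:E = \int[mu]_(t in `[x, y]) ((b t)%:R * f t)%:E)%E.
  by apply: eq_integral => t; rewrite inE /= in_itv/= => /bxy ->; rewrite mul1r.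
apply: ge0_subset_integral => //.
- exact/measurable_EFinP.
- by move=> t /RplusE t0; rewrite lee_fin mulr_ge0 ?f0.
exact: segment_Rplus.
Qed.

Lemma powRD_le p (x y : R) : 0 < p -> 0 <= x -> 0 <= y ->
  (x + y) `^ p <= 2 `^ p * (x `^ p + y `^ p).
Proof.
move=> p0 x0 y0; have [xy|yx] := leP x y.
  apply: (@le_trans _ _ ((2 * y) `^ p)).
    by apply: ge0_ler_powR; rewrite ?nnegrE ?(ltW p0)//; lra.
  by rewrite powRM ?ler0n// ler_wpM2l ?powR_ge0// lerDr powR_ge0.
apply: (@le_trans _ _ ((2 * x) `^ p)).
  by apply: ge0_ler_powR; rewrite ?nnegrE ?(ltW p0)//; lra.
by rewrite powRM ?ler0n// ler_wpM2l ?powR_ge0// lerDl powR_ge0.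
Qed.

(** [hardy_kernel] applied to the excess of |U| over a constant delta, restricted to [a, 1]; the
    lower end a > 0 keeps everything away from the singularity of the weight. *)
Lemma hardy_step p (c beta C1 C2 a delta : R) (b : R -> R -> bool) v (U : R -> R) :
  1 < p -> 0 <= C1 -> 0 <= C2 -> 0 < a -> 0 <= delta ->
  measurable_fun setT (fun z : R * R => b z.1 z.2) ->
  measurable_fun Rplus v -> measurable_fun Rplus U ->
  (forall t : R, (0 < t)%R -> \int[mu]_(s in Rplus) ((b t s)%:R * s `^ (- (c * (p / (p - 1)))))%:E <=
     (C1 * t `^ (1 - c * (p / (p - 1))))%:E)%E ->
  (forall s : R, (0 < s)%R -> \int[mu]_(t in Rplus) ((b t s)%:R * t `^ (beta - 1 - c * p))%:E <=
     (C2 * s `^ (beta - c * p))%:E)%E ->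
  (forall t : R, (a <= t <= 1)%R ->
    (`|U t|%:E <= delta%:E + \int[mu]_(s in Rplus) ((b t s)%:R * `|v s|)%:E)%E) ->
  (\int[mu]_(t in `[a, 1%R]) (`|U t| `^ p * t `^ (beta - p))%:E <=
    (2 `^ p * delta `^ p)%:E * \int[mu]_(t in `[a, 1%R]) (t `^ (beta - p))%:E +
    (2 `^ p * (C1 `^ (p - 1) * C2))%:E * mass p (fun t => (t `^ beta)%R) v)%E.
Proof.
move=> p1 C10 C20 a0 d0 mb mv mU H1 H2 HU.
have p0 : 0 < p by lra.
have sR : `[a, 1%R]%classic `<=` Rplus by exact: segment_Rplus.
(* The excess of |U| over delta, to which the kernel estimate applies. *)
pose h t : R := if a <= t <= 1 then Num.max (`|U t| - delta) 0 else 0.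
have h0 t : 0 <= h t by rewrite /h; case: ifP => // _; rewrite le_max lexx orbT.
have mh : measurable_fun Rplus h.
  apply: measurable_fun_if => //.
    by apply: measurable_and; apply: measurable_fun_ler.
  have mm : measurable_fun Rplus (fun t => Num.max (`|U t| - delta) 0).
    apply: measurable_maxr => //; apply: measurable_funB => //; exact: measurableT_comp.
  by apply: measurable_funS mm => //; move=> t [].
have K := @hardy_kernel p c beta C1 C2 b v h p1 C10 C20 mb mv mh H1 H2.
have {}K : (mass p (fun t => (t `^ (beta - p))%R) h <=
    (C1 `^ (p - 1) * C2)%:E * mass p (fun t => (t `^ beta)%R) v)%E.
  apply: K => t t0; rewrite (ger0_norm (h0 t)) /h; case: ifP => tI; last first.
    by apply: integral_ge0 => s _; rewrite lee_fin mulr_ge0.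
  rewrite EFin_max ge_max; apply/andP; split; last first.
    by apply: integral_ge0 => s _; rewrite lee_fin mulr_ge0.
  by rewrite EFinB leeBlDl//; exact: HU.
have mpow (e : R) D : measurable_fun D (fun s : R => s `^ e).
  by apply: measurable_funTS; exact: measurable_powR.
have mpowE (e : R) D : measurable_fun D (fun s : R => (s `^ e)%:E).
  by apply/measurable_EFinP; exact: mpow.
have mph : measurable_fun Rplus (fun t => `|h t| `^ p * t `^ (beta - p)).
  by apply: mass_measurable => //; exact: weight_powR.
have mpU : measurable_fun Rplus (fun t => `|U t| `^ p * t `^ (beta - p)).
  by apply: mass_measurable => //; exact: weight_powR.
have S f : measurable_fun Rplus f -> measurable_fun `[a, 1%R] (EFin \o f).
  by move=> mf; apply/measurable_EFinP; apply: measurable_funS mf.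
apply: (@le_trans _ _ (\int[mu]_(t in `[a, 1%R]) ((2 `^ p * delta `^ p)%:E * (t `^ (beta - p))%:E +
    (2 `^ p)%:E * (`|h t| `^ p * t `^ (beta - p))%:E))%E).
  apply: ge0_le_integral => //.
  - by move=> t _; rewrite lee_fin mulr_ge0 ?powR_ge0.
  - exact: S.
  - apply: emeasurable_funD; apply: measurable_funeM; first exact: mpowE.
    exact: S.
  move=> t; rewrite /= in_itv/= => tI; rewrite -!EFinM -EFinD lee_fin.
  rewrite [leRHS](_ : _ = 2 `^ p * (delta `^ p + `|h t| `^ p) * t `^ (beta - p)); last by ring.
  rewrite ler_wpM2r ?powR_ge0//; apply: le_trans (powRD_le p0 d0 (normr_ge0 (h t))).
  apply: ge0_ler_powR; rewrite ?nnegrE ?(ltW p0) ?addr_ge0//.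
  by rewrite (ger0_norm (h0 t)) /h tI -lerBlDl le_max lexx.
rewrite ge0_integralD//; last 4 first.
- by move=> t _; rewrite -EFinM lee_fin !mulr_ge0 ?powR_ge0.
- apply: measurable_funeM; exact: mpowE.
- by move=> t _; rewrite -EFinM lee_fin !mulr_ge0 ?powR_ge0.
- apply: measurable_funeM; exact: S.
rewrite ge0_integralZl//; last 3 first.
- exact: mpowE.
- by move=> t _; rewrite lee_fin powR_ge0.
- by rewrite lee_fin mulr_ge0 ?powR_ge0.
rewrite ge0_integralZl//; last 2 first.
- exact: S.
- by move=> t _; rewrite lee_fin mulr_ge0 ?powR_ge0.
apply: leeD => //; rewrite [(2 `^ p * (_ * _))%:E]EFinM -muleA.
apply: lee_wpmul2l; first by rewrite lee_fin powR_ge0.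
apply: le_trans K; apply: ge0_subset_integral => //.
- exact/measurable_EFinP.
- by move=> t _; rewrite lee_fin mulr_ge0 ?powR_ge0.
Qed.

Lemma primitive_increment_le v (U : R -> R) (s t : R) : locally_integrable Rplus v -> 0 < s -> s <= t ->
  U t - U s = \int[mu]_(x in `[s, t]) v x ->
  (`|U t - U s|%:E <= \int[mu]_(x in `[s, t]) `|v x|%:E)%E.
Proof.
move=> lv s0 st ->; have iv := loc_segment t lv s0.
rewrite /Rintegral -[X in (X <= _)%E]/(`|(fine (\int[mu]_(x in `[s, t]) (v x)%:E))%:E|%E).
rewrite fineK; last exact: integrable_fin_num.
by apply: le_abse_integral => //; case/integrableP: iv.
Qed.

(** For beta <= -1 the weight t^beta is not integrable at 0, so that U, whose mass is finite, takes
    arbitrarily small values near 0: up to an error delta, |U t| is at most the integral of |v| over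
    (0, t). *)
Lemma hardy_neg p (beta a : R) v (U : R -> R) : 1 < p -> beta <= -1 -> 0 < a <= 1 ->
  locally_integrable Rplus v -> locally_integrable Rplus U ->
  (forall s t, 0 < s -> s <= t -> U t - U s = \int[mu]_(x in `[s, t]) v x) ->
  (mass p (fun t => (t `^ beta)%R) U < +oo)%E ->
  (\int[mu]_(t in `[a, 1%R]) (`|U t| `^ p * t `^ (beta - p))%:E <=
    (2 `^ p / - beta)%:E * mass p (fun t => (t `^ beta)%R) v)%E.
Proof.
move=> p1 b1 /andP[a0 a1] lv lU AC fU.
have p0 : 0 < p by lra.
have mv := loc_measurable lv; have mU := loc_measurable lU.
have bn : beta < 0 by lra.
(* Otherwise |U| > e on (0, a), and the mass would exceed e^p times the integral of 1 / t. *)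
have small e : 0 < e -> exists2 r, 0 < r < a & `|U r| <= e.
  move=> e0; apply: contrapT => H.
  have big r : 0 < r -> r < a -> e < `|U r|.
    by move=> r0 ra; rewrite ltNge; apply/negP => le; apply: H; exists r; rewrite ?r0.
  have mUfin : mass p (fun t => (t `^ beta)%R) U \is a fin_num.
    rewrite ge0_fin_numE//; apply: mass_ge0; exact: weight_powR.
  set M := fine (mass p (fun t => (t `^ beta)%R) U).
  have ep : 0 < e `^ p by exact: powR_gt0.
  have M0 : 0 <= M by apply: fine_ge0; apply: mass_ge0; exact: weight_powR.
  pose y := a / 2; have y0 : 0 < y by rewrite /y; lra.
  have ya : y < a by rewrite /y; lra.
  (* Chosen so that ln y - ln x exceeds M / e^p. *)
  pose x := y * expR (- (M / e `^ p + 1)).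
  have x0 : 0 < x by rewrite mulr_gt0// expR_gt0.
  have xy : x <= y.
    rewrite ger_pMr// -[leRHS]expR0 ler_expR oppr_le0 addr_ge0// divr_ge0// ltW//.
  have : ((e `^ p * (ln y - ln x))%:E <= M%:E)%E.
    rewrite /M fineK//.
    apply: (@le_trans _ _ (\int[mu]_(t in `[x, y]) (`|U t| `^ p * t `^ beta)%:E)%E); last first.
      apply: ge0_subset_integral => //; last exact: segment_Rplus.
      - apply: emass_measurable => //; exact: weight_powR.
      - by move=> t _; rewrite lee_fin mulr_ge0 ?powR_ge0.
    have cont (t : R) : 0 < t -> {for t, continuous (fun t : R => t^-1)}.
      by move=> t0; apply: continuousV; rewrite ?gt_eqF//; exact: cvg_id.
    have il : (\int[mu]_(t in `[x, y]) (t^-1)%:E = (ln y - ln x)%:E)%E.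
      have [xy'|xy'] := eqVneq x y.
        by rewrite xy' subrr set_itv1 integral_set1.
      have {}xy' : x < y by rewrite lt_neqAle xy' xy.
      have cl (t : R) : 0 < t -> {for t, continuous (@ln R)} by move=> t0; exact: continuous_ln.
      rewrite (@continuous_FTC2 _ _ (@ln R)) ?EFinB//.
      - apply: continuous_in_subspaceT => t; rewrite inE /= in_itv/= => /andP[xt _].
        exact/cont/(lt_le_trans x0).
      - split.
        + by move=> t; rewrite in_itv/= => /andP[xt _]; have [] := is_derive1_ln (lt_trans x0 xt).
        + apply: cvg_at_right_filter; exact: cl.
        + apply: cvg_at_left_filter; exact/cl/(lt_trans x0).
      move=> t; rewrite in_itv/= => /andP[xt _]; rewrite derive1E.
      by have [_ ->] := is_derive1_ln (lt_trans x0 xt).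
    have mi : measurable_fun `[x, y] (fun t : R => (t^-1)%:E).
      apply/measurable_EFinP; apply: measurable_funS (continuous_loc_measurable cont) => //.
      exact: segment_Rplus.
    rewrite EFinM -il -ge0_integralZl//; last 2 first.
    - by move=> t; rewrite /= in_itv/= => /andP[xt _]; rewrite lee_fin invr_ge0 (le_trans (ltW x0)).
    - by rewrite lee_fin ltW.
    apply: ge0_le_integral => //.
    - by move=> t; rewrite /= in_itv/= => /andP[xt _]; rewrite lee_fin mulr_ge0 ?invr_ge0 ?(ltW ep)// (le_trans (ltW x0)).
    - exact: measurable_funeM.
    - apply: measurable_funS (emass_measurable p (weight_powR beta) mU) => //.
      exact: segment_Rplus.
    move=> t; rewrite /= in_itv/= => /andP[xt ty]; rewrite lee_fin.
    have t0 : 0 < t by exact: lt_le_trans xt.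
    apply: ler_pM; rewrite ?(ltW ep) ?invr_ge0 ?(ltW t0)//.
      apply: ge0_ler_powR; rewrite ?nnegrE ?(ltW p0) ?(ltW e0)//.
      by apply/ltW/big => //; apply: le_lt_trans ya.
    rewrite -powR_inv1 ?(ltW t0)//; apply: ger_powR => //.
    by rewrite t0 (le_trans ty)// (le_trans (ltW ya)).
  have lx : ln x = ln y - (M / e `^ p + 1).
    by rewrite /x (@lnM R y) ?posrE ?expR_gt0// expRK.
  rewrite lee_fin lx opprB addrCA subrr addr0 mulrDr mulr1.
  rewrite mulrCA mulfV ?gt_eqF// mulr1 gerDl leNgt.
  by rewrite ep.
have ip : (\int[mu]_(t in `[a, 1%R]) (t `^ (beta - p))%:E < +oo)%E.
  have -> : beta - p = (beta - p + 1) - 1 by ring.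
  apply: (le_lt_trans (@integral_powR_neg a 1 (beta - p + 1) a0 _)); last by rewrite ltry.
  by lra.
have ip0 : (0 <= \int[mu]_(t in `[a, 1%R]) (t `^ (beta - p))%:E)%E.
  by apply: integral_ge0 => t _; rewrite lee_fin powR_ge0.
set I := (\int[mu]_(t in `[a, 1%R]) (t `^ (beta - p))%:E)%E in ip ip0.
set M := (_ * mass p _ v)%E.
have step e : 0 < e -> (\int[mu]_(t in `[a, 1%R]) (`|U t| `^ p * t `^ (beta - p))%:E <=
    (2 `^ p * e `^ p)%:E * I + M)%E.
  move=> e0; have [r /andP[r0 ra] Ur] := small e e0.
  pose b t s := [&& r <= s, s <= t, a <= t & t <= 1].
  have := @hardy_step p 0 beta 1 (- beta)^-1 a e b v U p1 ler01 _ a0 (ltW e0) _ mv mU.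
  rewrite powR1 mul1r -/I -/M; apply.
  - by rewrite invr_ge0; lra.
  - apply: measurable_and; first exact: measurable_fun_ler.
    apply: measurable_and; first exact: measurable_fun_ler.
    by apply: measurable_and; exact: measurable_fun_ler.
  - move=> t t0; rewrite !mul0r oppr0 addr0 mul1r.
    have mbt : measurable_fun Rplus (b t).
      apply: measurable_and; first exact: measurable_fun_ler.
      by apply: measurable_and; first exact: measurable_fun_ler.
    apply: (le_trans (@le_integral_segment (b t) (fun s => s `^ 0) r t r0 _ mbt _ _)).
    + by apply: measurable_funTS; exact: measurable_powR.
    + by move=> s _; exact: powR_ge0.
    + by move=> s _ /and4P[-> ->].
    have -> : (0 : R) = 1 - 1 by rewrite subrr.
    by apply: (le_trans (@integral_powR_pos r t 1 r0 t0 ltr01)); rewrite divr1.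
  - move=> s s0; rewrite mul0r !subr0.
    have mbs : measurable_fun Rplus (fun t => b t s).
      apply: measurable_and => //.
      apply: measurable_and; first exact: measurable_fun_ler.
      by apply: measurable_and; exact: measurable_fun_ler.
    apply: (le_trans (@le_integral_segment (fun t => b t s) (fun t => t `^ (beta - 1)) s 1 s0 _ mbs _ _)).
    + by apply: measurable_funTS; exact: measurable_powR.
    + by move=> t _; exact: powR_ge0.
    + by move=> t _ /and4P[_ -> _ ->].
    by rewrite [leRHS]EFinM muleC -EFinM; exact: integral_powR_neg.
  move=> t /andP[at_ t1]; have rt : r <= t by rewrite (le_trans (ltW ra)).
  have mbt : measurable_fun Rplus (b t).
    apply: measurable_and; first exact: measurable_fun_ler.
    by apply: measurable_and; first exact: measurable_fun_ler.
  apply: (@le_trans _ _ (`|U r|%:E + `|U t - U r|%:E)%E).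
    by rewrite -EFinD lee_fin -{1}(subrKC (U r) (U t)); exact: ler_normD.
  apply: leeD; first by rewrite lee_fin.
  apply: (le_trans (primitive_increment_le lv r0 rt (AC r t r0 rt))).
  apply: ge_integral_segment => //; first exact: measurableT_comp.
  by move=> s /andP[rs st]; rewrite /b rs st at_.
have M0 : (0 <= M)%E.
  rewrite mule_ge0 ?mass_ge0//; last exact: weight_powR.
  by rewrite lee_fin divr_ge0 ?powR_ge0//; lra.
apply/lee_addgt0Pr => e e0.
pose d := (e / (2 `^ p * (fine I + 1))) `^ p^-1.
have I1 : 0 < fine I + 1 by rewrite ltr_wpDl// fine_ge0.
have d0 : 0 < d by rewrite powR_gt0// divr_gt0// mulr_gt0 ?powR_gt0.
apply: (le_trans (step d d0)); rewrite addeC leeD2l//.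
have -> : I = (fine I)%:E by rewrite fineK// ge0_fin_numE.
rewrite -EFinM lee_fin /d -powRrM mulVf ?gt_eqF// powRr1; last first.
  by rewrite divr_ge0 ?(ltW e0)// mulr_ge0 ?powR_ge0// ltW.
have : fine I / (fine I + 1) <= 1 by rewrite ler_pdivrMr// mul1r lerDl.
move=> /(ler_wpM2l (ltW e0)); rewrite mulr1; apply: le_trans.
have ep : 2 `^ p != 0 :> R by rewrite gt_eqF// powR_gt0.
by rewrite le_eqVlt; apply/orP; left; apply/eqP; field; rewrite ep gt_eqF.
Qed.

(** Collects the two terms of [hardy_step] into a multiple of the sum of the masses. *)
Lemma lee_two_terms (x I A B : \bar R) (c d g k : R) : (0 <= A)%E -> (0 <= B)%E ->
  0 <= c -> 0 <= d -> 0 <= g -> 0 <= k -> (I <= g%:E)%E -> (d%:E <= A)%E ->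
  (x <= (c * d)%:E * I + k%:E * B)%E -> (x <= (c * g + k)%:E * (A + B))%E.
Proof.
move=> A0 B0 c0 d0 g0 k0 Ig dA /le_trans; apply.
rewrite EFinD ge0_muleDl ?lee_fin ?mulr_ge0//; apply: leeD.
  apply: (@le_trans _ _ ((c * d)%:E * g%:E)%E).
    by apply: lee_wpmul2l => //; rewrite lee_fin mulr_ge0.
  rewrite -EFinM mulrAC EFinM; apply: lee_wpmul2l; first by rewrite lee_fin mulr_ge0.
  by apply: (le_trans dA); rewrite leeDl.
by apply: lee_wpmul2l; rewrite ?lee_fin// leeDr.
Qed.

(** For beta > p - 1 integrate from the right: |U t| is at most |U r| plus the integral of |v| over
    [t, 2], where r is a point of [1, 2] at which |U| is minimal, so that |U r|^p is at most the mass
    of U. *)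
Lemma hardy_pos p (beta : R) : 1 < p -> p - 1 < beta -> exists2 C : R, 0 <= C &
  forall (a : R) v (U : R -> R), 0 < a <= 1 ->
  locally_integrable Rplus v -> (forall t, 0 < t -> {for t, continuous U}) ->
  (forall s t, 0 < s -> s <= t -> U t - U s = \int[mu]_(x in `[s, t]) v x) ->
  (\int[mu]_(t in `[a, 1%R]) (`|U t| `^ p * t `^ (beta - p))%:E <=
    C%:E * (mass p (fun t => (t `^ beta)%R) U + mass p (fun t => (t `^ beta)%R) v))%E.
Proof.
move=> p1 bp.
have p0 : 0 < p by lra.
have b0 : 0 < beta by lra.
have g0 : 0 < beta - p + 1 by lra.
(* The middle of the interval of exponents for which both kernel integrals converge. *)
pose c := (p - 1 + beta) / (2 * p).
have c1 : c * (p / (p - 1)) - 1 = (beta - p + 1) / (2 * (p - 1)).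
  by rewrite /c; field; rewrite !gt_eqF//; lra.
have c2 : beta - c * p = (beta - p + 1) / 2 by rewrite /c; field; rewrite gt_eqF.
have c1p : 0 < c * (p / (p - 1)) - 1 by rewrite c1 divr_gt0// mulr_gt0//; lra.
have c2p : 0 < beta - c * p by rewrite c2 divr_gt0.
pose K := 2 `^ p * (((c * (p / (p - 1)) - 1)^-1) `^ (p - 1) * (beta - c * p)^-1).
have K0 : 0 <= K by rewrite !mulr_ge0 ?powR_ge0// invr_ge0 ltW.
have L0 : 0 <= 2 `^ p / (beta - p + 1) by rewrite divr_ge0 ?powR_ge0// ltW.
exists (2 `^ p / (beta - p + 1) + K); first exact: addr_ge0.
move=> a v U /andP[a0 a1] lv cU AC.
have mv := loc_measurable lv.
have mU : measurable_fun Rplus U by exact: continuous_loc_measurable.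
have [r rI rmin] : exists2 r, 1 <= r <= 2 & forall t, 1 <= t <= 2 -> `|U r| <= `|U t|.
  have cn : {within `[1 : R, 2 : R], continuous (fun t => `|U t|)}.
    apply: continuous_in_subspaceT => t; rewrite inE /= in_itv/= => /andP[t1 _].
    by apply: (@continuous_comp _ _ _ U Num.norm); [apply/cU/(lt_le_trans ltr01)|exact: norm_continuous].
  have [d cI Hc] := EVT_min (ler1n R 2) cn.
  by exists d => [|t tI]; [rewrite in_itv/= in cI|apply: Hc; rewrite in_itv].
have /andP[r1 r2] := rI.
have Ur : ((`|U r| `^ p)%:E <= mass p (fun t => (t `^ beta)%R) U)%E.
  apply: (@le_trans _ _ (\int[mu]_(t in `[1%R, 2%R]) (`|U t| `^ p * t `^ beta)%:E)%E); last first.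
    apply: ge0_subset_integral => //; last exact: segment_Rplus.
    - apply: emass_measurable => //; exact: weight_powR.
    - by move=> t _; rewrite lee_fin mulr_ge0 ?powR_ge0.
  apply: (@le_trans _ _ (\int[mu]_(t in `[1%R, 2%R]) (`|U r| `^ p)%:E)%E).
    rewrite integral_cst//= lebesgue_measure_itv/= lte_fin ltr1n -EFinB -EFinM lee_fin.
    by rewrite ler_peMr ?powR_ge0//; lra.
  apply: ge0_le_integral => //.
  - apply: measurable_funS (emass_measurable p (weight_powR beta) mU) => //.
    exact: segment_Rplus.
  move=> t; rewrite /= in_itv/= => tI; rewrite lee_fin -[leLHS]mulr1.
  have t1 : 1 <= t by case/andP: tI.
  apply: ler_pM; rewrite ?powR_ge0//; last by rewrite -(powRr0 t) ler_powR// ltW.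
  by apply: ge0_ler_powR; rewrite ?nnegrE ?(ltW p0)// rmin.
pose b t s := [&& a <= t, t <= 1, t <= s & s <= 2].
have mbt t : measurable_fun Rplus (b t).
  apply: measurable_and => //.
  apply: measurable_and => //.
  by apply: measurable_and; exact: measurable_fun_ler.
have mbs s : measurable_fun Rplus (fun t => b t s).
  apply: measurable_and; first exact: measurable_fun_ler.
  apply: measurable_and; first exact: measurable_fun_ler.
  by apply: measurable_and; first exact: measurable_fun_ler.
have S : (\int[mu]_(t in `[a, 1%R]) (`|U t| `^ p * t `^ (beta - p))%:E <=
     (2 `^ p * `|U r| `^ p)%:E * \int[mu]_(t in `[a, 1%R]) (t `^ (beta - p))%:E +
     (2 `^ p * (((c * (p / (p - 1)) - 1)^-1) `^ (p - 1) * (beta - c * p)^-1))%:E *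
     mass p (fun t => (t `^ beta)%R) v)%E.
  apply: (@hardy_step p c beta (c * (p / (p - 1)) - 1)^-1 (beta - c * p)^-1 a `|U r| b v U) => //.
  - by rewrite invr_ge0 ltW.
  - by rewrite invr_ge0 ltW.
  - apply: measurable_and; first exact: measurable_fun_ler.
    apply: measurable_and; first exact: measurable_fun_ler.
    by apply: measurable_and; exact: measurable_fun_ler.
  - move=> t t0.
    apply: (le_trans (@le_integral_segment (b t) (fun s => s `^ (- (c * (p / (p - 1))))) t 2 t0 _ (mbt t) _ _)).
    + by apply: measurable_funTS; exact: measurable_powR.
    + by move=> s _; exact: powR_ge0.
    + by move=> s _ /and4P[_ _ -> ->].
    have := @integral_powR_neg t 2 (1 - c * (p / (p - 1))) t0.
    rewrite (_ : 1 - c * (p / (p - 1)) - 1 = - (c * (p / (p - 1)))); last by ring.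
    by rewrite opprB [(c * _ - 1)^-1 * _]mulrC; apply; lra.
  - move=> s s0.
    apply: (le_trans (@le_integral_segment (fun t => b t s) (fun t => t `^ (beta - 1 - c * p)) a s a0 _ (mbs s) _ _)).
    + by apply: measurable_funTS; exact: measurable_powR.
    + by move=> t _; exact: powR_ge0.
    + by move=> t _ /and4P[-> _ -> _].
    have -> : beta - 1 - c * p = beta - c * p - 1 by ring.
    by rewrite [(beta - _)^-1 * _]mulrC; exact: integral_powR_pos.
  move=> t /andP[at_ t1]; have t0 : 0 < t by exact: lt_le_trans at_.
  have tr : t <= r by rewrite (le_trans t1).
  apply: (@le_trans _ _ (`|U r|%:E + `|U r - U t|%:E)%E).
    by rewrite -EFinD lee_fin distrC -{1}(subrKC (U r) (U t)); exact: ler_normD.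
  apply: leeD; first by rewrite lee_fin.
  apply: (le_trans (primitive_increment_le lv t0 tr (AC t r t0 tr))).
  apply: ge_integral_segment => //; first exact: measurableT_comp.
  by move=> s /andP[ts sr]; rewrite /b at_ t1 ts (le_trans sr).
have mU0 : (0 <= mass p (fun t => (t `^ beta)%R) U)%E by apply: mass_ge0; exact: weight_powR.
have mv0 : (0 <= mass p (fun t => (t `^ beta)%R) v)%E by apply: mass_ge0; exact: weight_powR.
apply: (@lee_two_terms _ _ _ _ _ _ _ _ mU0 mv0 _ _ _ K0 _ Ur S).
- exact: powR_ge0.
- exact: powR_ge0.
- by rewrite invr_ge0 ltW.
have := @integral_powR_pos a 1 (beta - p + 1) a0 ltr01 g0.
by rewrite powR1 mul1r addrK.
Qed.

(** On (1, +oo) the weight t^(beta - p) is at most t^beta; on (0, 1] apply [hardy_neg] or [hardy_pos]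
    to the absolutely continuous representative on [1 / n, 1]. *)
Theorem hardy p (beta : R) : 1 < p -> beta <= -1 \/ p - 1 < beta -> exists2 C : R, 0 <= C &
  forall u v, locally_integrable Rplus u -> weak_derivative u v ->
    (mass p (fun t => (t `^ beta)%R) u < +oo)%E ->
    (mass p (fun t => (t `^ (beta - p))%R) u <=
      C%:E * (mass p (fun t => (t `^ beta)%R) u + mass p (fun t => (t `^ beta)%R) v))%E.
Proof.
move=> p1 hb.
have [C C0 HC] : exists2 C : R, 0 <= C &
  forall (a : R) v (U : R -> R), 0 < a <= 1 -> locally_integrable Rplus v ->
  locally_integrable Rplus U -> (forall t, 0 < t -> {for t, continuous U}) ->
  (forall s t, 0 < s -> s <= t -> U t - U s = \int[mu]_(x in `[s, t]) v x) ->
  (mass p (fun t => (t `^ beta)%R) U < +oo)%E ->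
  (\int[mu]_(t in `[a, 1%R]) (`|U t| `^ p * t `^ (beta - p))%:E <=
    C%:E * (mass p (fun t => (t `^ beta)%R) U + mass p (fun t => (t `^ beta)%R) v))%E.
  case: hb => hb; last first.
    by have [C C0 H] := hardy_pos p1 hb; exists C => // a v U aI lv lU cU AC _; exact: H.
  have c0 : 0 <= 2 `^ p / - beta by rewrite divr_ge0 ?powR_ge0//; lra.
  exists (2 `^ p / - beta) => // a v U aI lv lU cU AC fU.
  apply: (le_trans (hardy_neg p1 hb aI lv lU AC fU)).
  apply: lee_wpmul2l; first by rewrite lee_fin.
  by rewrite leeDr// mass_ge0//; exact: weight_powR.
exists (C + 1); first by rewrite addr_ge0.
move=> u v lu uv fu.
have [U [uU cU AC]] := absolutely_continuous_representative lu uv.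
have lU := continuous_loc cU.
have mu_ := loc_measurable lu; have mU := loc_measurable lU.
have massE b : mass p (fun t => (t `^ b)%R) u = mass p (fun t => (t `^ b)%R) U.
  apply: ae_eq_integral => //.
  - by apply: emass_measurable => //; exact: weight_powR.
  - by apply: emass_measurable => //; exact: weight_powR.
  by apply: ae_imply uU => t E Dt; rewrite E.
rewrite !massE in fu *.
have lv : locally_integrable Rplus v by case: uv.
have mmass b D : D `<=` Rplus -> measurable D ->
    measurable_fun D (fun t : R => `|U t| `^ p * t `^ b).
  by move=> DR mD; apply: measurable_funS (mass_measurable p (weight_powR b) mU).
have emmass b D : D `<=` Rplus -> measurable D ->
    measurable_fun D (fun t : R => (`|U t| `^ p * t `^ b)%:E).
  by move=> DR mD; apply/measurable_EFinP; exact: mmass.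
have sub1 : `]0%R, 1%R]%classic `<=` Rplus.
  by move=> t; rewrite /= !in_itv/= andbT => /andP[].
have sub2 : `]1%R, +oo[%classic `<=` Rplus.
  by move=> t; rewrite /= !in_itv/= !andbT; exact: lt_trans.
have -> : mass p (fun t => (t `^ (beta - p))%R) U =
   (\int[mu]_(t in `]0%R, 1%R]) (`|U t| `^ p * t `^ (beta - p))%:E +
    \int[mu]_(t in `]1%R, +oo[) (`|U t| `^ p * t `^ (beta - p))%:E)%E.
  rewrite /mass -ge0_integral_setU//.
  - by congr integral; rewrite -itv_bndbnd_setU ?bnd_simp.
  - by apply: emmass; [move=> t [/sub1|/sub2]|exact: measurableU].
  - by move=> t _; rewrite lee_fin mulr_ge0 ?powR_ge0.
  apply/disj_setPS => t [] /=; rewrite !in_itv/= andbT => /andP[_ t1].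
  by rewrite ltNge t1.
have mU0 : (0 <= mass p (fun t => (t `^ beta)%R) U)%E by apply: mass_ge0; exact: weight_powR.
have mv0 : (0 <= mass p (fun t => (t `^ beta)%R) v)%E by apply: mass_ge0; exact: weight_powR.
rewrite EFinD ge0_muleDl ?lee_fin// mul1e; apply: leeD.
  apply: (@ge0_exhaust (fun n => `[n.+1%:R^-1, 1%R]%classic)) => //.
  - apply/nondecreasing_seqP => n; apply/subsetPset => t; rewrite /= !in_itv/= => /andP[nt ->].
    by rewrite andbT (le_trans _ nt)// lef_pV2 ?posrE// ler_nat.
  - apply/seteqP; split => [t [n _]|t].
      rewrite /= !in_itv/= => /andP[nt ->]; rewrite andbT (lt_le_trans _ nt)//.
    rewrite /= in_itv/= => /andP[t0 t1]; exists (Num.truncn t^-1) => //.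
    rewrite /= in_itv/= t1 andbT -[leRHS]invrK lef_pV2 ?posrE ?invr_gt0//.
    by apply/ltW/truncnS_gt.
  - exact: mmass.
  - by move=> t _; rewrite mulr_ge0 ?powR_ge0.
  move=> n; apply: HC => //; rewrite invr_gt0 ltr0Sn/=.
  by rewrite invf_le1// ler1n.
apply: (@le_trans _ _ (mass p (fun t => (t `^ beta)%R) U)); last by rewrite leeDl.
apply: (@le_trans _ _ (\int[mu]_(t in `]1%R, +oo[) (`|U t| `^ p * t `^ beta)%:E)%E).
  apply: ge0_le_integral => //.
  - by move=> t _; rewrite lee_fin mulr_ge0 ?powR_ge0.
  - exact: emmass.
  - exact: emmass.
  move=> t; rewrite /= in_itv/= andbT => t1; rewrite lee_fin ler_wpM2l ?powR_ge0//.
  by apply: ler_powR; [exact: ltW|lra].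
apply: ge0_subset_integral => //.
- exact: emmass.
- by move=> t _; rewrite lee_fin mulr_ge0 ?powR_ge0.
Qed.

End Hardy.

Import HBNNSimple.

(** * Density of the test functions *)

Section LpApproximation.
Variable R : realType.
Notation mu := (@lebesgue_measure R).
Local Notation Rplus := (`]0, +oo[%classic : set R).
Implicit Types (u v w g h f phi psi : R -> R).

Lemma weight1 : weight (fun=> 1 : R).
Proof. by split => //; exact: measurable_cst. Qed.

Lemma massD p w u v : 0 < p -> weight w -> measurable_fun Rplus u -> measurable_fun Rplus v ->
  (mass p w (fun t => (u t + v t)%R) <= (2 `^ p)%:E * (mass p w u + mass p w v))%E.
Proof.
move=> p0 Ww mu_ mv; have [_ w0] := Ww.
have eu := emass_measurable p Ww mu_; have ev := emass_measurable p Ww mv.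
have ge0 f t : 0 < t -> (0 <= (`|f t| `^ p * w t)%:E)%E.
  by move=> t0; rewrite lee_fin mulr_ge0 ?powR_ge0// w0.
rewrite /mass -ge0_integralD//; last 2 first.
- by move=> t /RplusE; exact: ge0.
- by move=> t /RplusE; exact: ge0.
rewrite -ge0_integralZl//; last 2 first.
- exact: emeasurable_funD.
- by move=> t /RplusE t0; rewrite adde_ge0 ?ge0.
apply: ge0_le_integral => //.
- by move=> t /RplusE; exact: (ge0 (fun t => u t + v t)).
- by apply: emass_measurable => //; exact: measurable_funD.
- by apply: measurable_funeM; exact: emeasurable_funD.
move=> t /RplusE t0; rewrite -EFinD -EFinM lee_fin -mulrDl mulrA ler_wpM2r ?w0//.
apply: le_trans (powRD_le p0 (normr_ge0 _) (normr_ge0 _)).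
by apply: ge0_ler_powR; rewrite ?nnegrE ?(ltW p0) ?addr_ge0 ?ler_normD.
Qed.

Lemma massD_le p w u v (d e : R) : 0 < p -> weight w ->
  measurable_fun Rplus u -> measurable_fun Rplus v ->
  (mass p w u <= d%:E)%E -> (mass p w v <= e%:E)%E ->
  (mass p w (fun t => (u t + v t)%R) <= (2 `^ p * (d + e))%:E)%E.
Proof.
move=> p0 Ww mu_ mv; have := massD p0 Ww mu_ mv.
have P : (0 <= (2 `^ p)%:E :> \bar R)%E by rewrite lee_fin powR_ge0.
move: (mass p w u) (mass p w v) => A B H Ad Be; apply: (le_trans H).
by rewrite EFinM EFinD; exact: (lee_wpmul2l P (leeD Ad Be)).
Qed.

Lemma massZ p w u (c : R) : weight w -> measurable_fun Rplus u ->
  mass p w (fun t => c * u t) = ((`|c| `^ p)%:E * mass p w u)%E.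
Proof.
move=> Ww mu_; have [_ w0] := Ww; rewrite /mass -ge0_integralZl//.
- by apply: eq_integral => t _; rewrite -EFinM normrM powRM// mulrA.
- exact: emass_measurable.
- by move=> t /RplusE t0; rewrite lee_fin mulr_ge0 ?powR_ge0// w0.
Qed.

(** Dominated convergence for masses. *)
Lemma mass_cvg0 p w (f_ : nat -> R -> R) g : 0 < p -> weight w ->
  (forall n, measurable_fun Rplus (f_ n)) -> measurable_fun Rplus g ->
  (\int[mu]_(t in Rplus) (g t)%:E < +oo)%E ->
  (forall n t, 0 < t -> `|f_ n t| `^ p * w t <= g t) ->
  (forall t, 0 < t -> f_ n t @[n --> \oo] --> (0 : R)) ->
  forall e : R, 0 < e -> exists N, forall n, (N <= n)%N -> (mass p w (f_ n) <= e%:E)%E.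
Proof.
move=> p0 Ww mf mg gfin fg f0 e e0; have [_ w0] := Ww.
have g0 t : 0 < t -> 0 <= g t.
  by move=> t0; apply: le_trans (fg 0%N t t0); rewrite mulr_ge0 ?powR_ge0// w0.
have ig : mu.-integrable Rplus (EFin \o g).
  apply/integrableP; split; first exact/measurable_EFinP.
  apply: le_lt_trans gfin; rewrite le_eqVlt; apply/orP; left; apply/eqP.
  by apply: eq_integral => t; rewrite inE => /RplusE t0; rewrite gee0_abs// lee_fin g0.
have C := @Rdominated_cvg R Rplus (fun n t => `|f_ n t| `^ p * w t) (fun=> 0) g
  (@mRplus R) (fun n => mass_measurable p Ww (mf n)) (measurable_cst _) _ ig _.
have /cvgrPdist_le/(_ e e0) : \int[mu]_(t in Rplus) (`|f_ n t| `^ p * w t) @[n --> \oo] -->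
    \int[mu]_(t in Rplus) (0 : R).
  apply: C; last first.
    by move=> n t /RplusE t0; rewrite ger0_norm ?fg// mulr_ge0 ?powR_ge0// w0.
  apply: aeW => t /RplusE t0; rewrite -[X in _ --> X](mul0r (w t)); apply: cvgM; last exact: cvg_cst.
  apply/cvgrPdist_le => d d0.
  have dp : 0 < d `^ p^-1 by rewrite powR_gt0.
  have /cvgrPdist_le/(_ _ dp) := f0 t t0; apply: filterS => n; rewrite !sub0r !normrN => H.
  rewrite (ger0_norm (powR_ge0 _ _)) -[leRHS]powRr1 ?(ltW d0)// -(@mulVf _ p) ?gt_eqF// powRrM.
  by apply: ge0_ler_powR; rewrite ?nnegrE ?(ltW p0) ?(ltW dp).
rewrite Rintegral_cst ?mul0r//.
move=> [N _ HN]; exists N => n Nn; have := HN n Nn.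
have m0 : (0 <= mass p w (f_ n))%E by exact: mass_ge0.
have mfin : (mass p w (f_ n) < +oo)%E.
  apply: le_lt_trans gfin; apply: ge0_le_integral => //.
  - by move=> t /RplusE t0; rewrite lee_fin mulr_ge0 ?powR_ge0// w0.
  - exact: emass_measurable.
  - exact/measurable_EFinP.
  - by move=> t /RplusE t0; rewrite lee_fin fg.
rewrite sub0r normrN -[\int[mu]_(_ in _) _]/(fine (mass p w (f_ n))) ger0_norm ?fine_ge0//.
by rewrite -lee_fin fineK// ge0_fin_numE.
Qed.

Variables (p a b : R).
Hypotheses (p0 : 0 < p) (a0 : 0 < a) (ab : a < b).

(** Being in the L^p closure of the test functions supported in [a, b]. *)
Definition test_approx f := measurable_fun Rplus f /\ forall e : R, 0 < e ->
  exists phi, [/\ test_function phi, forall t, ~ (a <= t <= b) -> phi t = 0 &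
    (mass p (fun=> 1%R) (fun t => (f t - phi t)%R) <= e%:E)%E].

Lemma test_approx0 : test_approx (fun=> 0).
Proof.
split; first exact: measurable_cst.
move=> e e0; exists (fun=> 0); split => //; first exact: test0.
rewrite /mass integral0_eq ?lee_fin ?(ltW e0)// => t _.
by rewrite subrr normr0 powR0 ?mul0r// gt_eqF.
Qed.

Lemma test_approx_lim (f_ : nat -> R -> R) f g : (forall n, test_approx (f_ n)) ->
  measurable_fun Rplus f -> measurable_fun Rplus g -> (mass p (fun=> 1%R) g < +oo)%E ->
  (forall n t, 0 < t -> `|f_ n t| <= g t) -> (forall t, 0 < t -> `|f t| <= g t) ->
  (forall t, 0 < t -> f_ n t @[n --> \oo] --> f t) -> test_approx f.
Proof.
move=> Tf mf mg gfin fg fg' cf; split => // e e0.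
have mf_ n : measurable_fun Rplus (f_ n) by case: (Tf n).
have mfn n : measurable_fun Rplus (fun t => f t - f_ n t) by exact: measurable_funB.
have k0 : 0 < 2 `^ p * 2 :> R by rewrite mulr_gt0// powR_gt0.
pose d := e / (2 `^ p * 2).
have d0 : 0 < d by rewrite divr_gt0.
have gmeas : measurable_fun Rplus (fun t => (2 `^ p * 2) * (`|g t| `^ p * 1)).
  by apply: measurable_funM => //; exact: (mass_measurable p weight1 mg).
have gint : (\int[mu]_(t in Rplus) ((2 `^ p * 2) * (`|g t| `^ p * 1))%:E < +oo)%E.
  rewrite (_ : (\int[mu]_(t in _) _)%E = ((2 `^ p * 2)%:E * mass p (fun=> 1%R) g)%E); last first.
    by rewrite /mass -ge0_integralZl//; exact: (emass_measurable p weight1 mg).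
  have -> : mass p (fun=> 1%R) g = (fine (mass p (fun=> 1%R) g))%:E.
    by rewrite fineK// ge0_fin_numE// mass_ge0//; exact: weight1.
  by rewrite -EFinM ltry.
have dom n t : 0 < t -> `|f t - f_ n t| `^ p * 1 <= (2 `^ p * 2) * (`|g t| `^ p * 1).
  move=> t0; rewrite !mulr1 -mulrA mulr_natl mulr2n.
  have gg : `|f t - f_ n t| <= `|g t| + `|g t|.
    apply: (le_trans (ler_normB _ _)); apply: lerD.
      by apply: (le_trans (fg' t t0)); exact: ler_norm.
    by apply: (le_trans (fg n t t0)); exact: ler_norm.
  apply: le_trans (powRD_le p0 (normr_ge0 _) (normr_ge0 _)).
  by apply: ge0_ler_powR; rewrite ?nnegrE ?(ltW p0) ?addr_ge0.
have cv t : 0 < t -> f t - f_ n t @[n --> \oo] --> (0 : R).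
  move=> t0; rewrite -(subrr (f t)); apply: cvgB; first exact: cvg_cst.
  exact: cf.
have [N /(_ N (leqnn N)) HN] := mass_cvg0 p0 weight1 mfn gmeas gint dom cv d0.
have [_ /(_ d d0)[phi [tphi sphi mphi]]] := Tf N.
exists phi; split => //.
have mphi' : measurable_fun Rplus phi by apply: test_measurable => //; exact: mRplus.
have := @massD_le p (fun=> 1) (fun t => f t - f_ N t) (fun t => f_ N t - phi t) d d p0 weight1
  (mfn N) (measurable_funB (mf_ N) mphi') HN mphi.
have -> : (fun t => f t - f_ N t + (f_ N t - phi t)) = (fun t => f t - phi t).
  by apply/funext => t; rewrite addrA subrK.
suff -> : 2 `^ p * (d + d) = e by [].
by rewrite /d; field; rewrite gt_eqF// powR_gt0.
Qed.

Lemma test_approxD f f' : test_approx f -> test_approx f' -> test_approx (fun t => f t + f' t).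
Proof.
move=> [mf Tf] [mf' Tf']; split; first exact: measurable_funD.
move=> e e0; have k0 : 0 < 2 `^ p * 2 :> R by rewrite mulr_gt0// powR_gt0.
pose d := e / (2 `^ p * 2).
have d0 : 0 < d by rewrite divr_gt0.
have [phi [tphi sphi Hphi]] := Tf d d0; have [psi [tpsi spsi Hpsi]] := Tf' d d0.
exists (fun t => phi t + psi t); split.
- exact: testD.
- by move=> t tab; rewrite sphi// spsi// addr0.
have mphi : measurable_fun Rplus phi by apply: test_measurable => //; exact: mRplus.
have mpsi : measurable_fun Rplus psi by apply: test_measurable => //; exact: mRplus.
have := @massD_le p (fun=> 1) (fun t => f t - phi t) (fun t => f' t - psi t) d d p0 weight1
  (measurable_funB mf mphi) (measurable_funB mf' mpsi) Hphi Hpsi.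
have -> : (fun t => f t - phi t + (f' t - psi t)) = (fun t => f t + f' t - (phi t + psi t)).
  by apply/funext => t; ring.
suff -> : 2 `^ p * (d + d) = e by [].
by rewrite /d; field; rewrite gt_eqF// powR_gt0.
Qed.

Lemma test_approxZ (c : R) f : test_approx f -> test_approx (fun t => c * f t).
Proof.
move=> [mf Tf]; split; first exact: measurable_funM.
move=> e e0; have k0 : 0 < `|c| `^ p + 1 by rewrite ltr_wpDl ?powR_ge0.
have [phi [tphi sphi Hphi]] := Tf (e / (`|c| `^ p + 1)) (divr_gt0 e0 k0).
exists (fun t => c * phi t); split.
- exact: testZ.
- by move=> t tab; rewrite sphi// mulr0.
have mphi : measurable_fun Rplus phi by apply: test_measurable => //; exact: mRplus.
have -> : (fun t => c * f t - c * phi t) = (fun t => c * (f t - phi t)).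
  by apply/funext => t; rewrite mulrBr.
rewrite (massZ p c weight1 (measurable_funB mf mphi)).
apply: (@le_trans _ _ ((`|c| `^ p)%:E * (e / (`|c| `^ p + 1))%:E)%E).
  by apply: lee_wpmul2l => //; rewrite lee_fin powR_ge0.
rewrite -EFinM lee_fin mulrA ler_pdivrMr// mulrC ler_wpM2l ?(ltW e0)//.
by rewrite lerDl.
Qed.

Lemma mass_segment_fin (M : R) : (mass p (fun=> 1%R) (fun t => (M * \1_(`[a, b]%classic) t)%R) < +oo)%E.
Proof.
have mI : measurable_fun Rplus (\1_(`[a, b]%classic) : R -> R).
  by apply: measurable_funTS; exact: measurable_indic.
rewrite (massZ p M weight1 mI).
have -> : mass p (fun=> 1%R) (\1_(`[a, b]%classic) : R -> R) = (b - a)%:E.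
  rewrite /mass.
  have -> : (\int[mu]_(t in Rplus) (`|\1_(`[a, b]%classic) t| `^ p * 1)%:E =
     \int[mu]_(t in Rplus) ((\1_(`[a, b]%classic) t)%:E : \bar R))%E.
    apply: eq_integral => t _; rewrite mulr1 indicE; congr (_%:E).
    by case: (_ \in _); rewrite ?normr1 ?normr0 ?powR1 ?powR0// gt_eqF.
  transitivity (mu `[a, b]%classic).
    by rewrite integral_indic//; congr (_ _); apply/setIidPl; exact: segment_Rplus.
  by rewrite lebesgue_measure_itv/= lte_fin ab -EFinB.
by rewrite -EFinM ltry.
Qed.

Lemma test_approx_itv (c d : R) : a <= c -> d <= b -> test_approx (\1_(`]c, d[%classic)).
Proof.
move=> ac db; have [cd|dc] := ltP c d; last first.
  by rewrite set_itv_ge ?bnd_simp -?leNgt// indic0; exact: test_approx0.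
have c0 : 0 < c by exact: lt_le_trans ac.
have bs n t : ~ (a <= t <= b) -> bump c d n t = 0.
  move=> tab; apply: bump_out => /andP[ct td]; apply: tab.
  by rewrite (le_trans ac (ltW ct)) (le_trans (ltW td) db).
have mb n : measurable_fun Rplus (bump c d n).
  by apply: test_measurable; [exact: mRplus|exact: bump_test].
apply: (@test_approx_lim (bump c d) _ (fun t => 1 * \1_(`[a, b]%classic) t)).
- move=> n; split => // e e0; exists (bump c d n); split => //; first exact: bump_test.
    by move=> t; exact: bs.
  rewrite /mass integral0_eq ?lee_fin ?(ltW e0)// => t _.
  by rewrite subrr normr0 powR0 ?mul0r// gt_eqF.
- by apply: measurable_funTS; exact: measurable_indic.
- by apply: measurable_funM => //; apply: measurable_funTS; exact: measurable_indic.
- exact: mass_segment_fin.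
- move=> n t t0; rewrite mul1r indicE; case: (boolP (t \in _)) => tab.
    by rewrite ger0_norm ?bump_ge0// bump_le1.
  by rewrite bs ?normr0// => /= tI; move: tab; rewrite notin_setE /= in_itv/= tI.
- move=> t t0; rewrite mul1r !indicE; case: (boolP (t \in `]c, d[%classic)) => tcd; last by rewrite normr0.
  rewrite mem_set ?normr1//; move: tcd; rewrite inE /= !in_itv/= => /andP[ct td].
  by rewrite (le_trans ac (ltW ct)) (le_trans (ltW td) db).
move=> t t0; rewrite indicE; case: (boolP (t \in _)) => tcd.
  by apply: bump_cvg; move: tcd; rewrite inE /= in_itv.
rewrite (_ : (fun n => bump c d n t) = (fun=> 0)); first exact: cvg_cst.
apply/funext => n; apply: bump_out => tI.
by move: tcd; rewrite notin_setE /= in_itv/= tI.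
Qed.

(** A Dynkin class argument: the sets whose trace on (a, b) is approximable form a Dynkin class
    containing the open intervals, which are stable under intersection. *)
Lemma test_approx_set (E : set R) : measurable E -> test_approx (\1_(E `&` `]a, b[%classic)).
Proof.
pose H := [set E : set R | measurable E /\ test_approx (\1_(E `&` `]a, b[%classic))].
have mI (A : set R) : measurable A -> measurable_fun Rplus (\1_A : R -> R).
  by move=> mA; apply: measurable_funTS; exact: measurable_indic.
have dH : dynkin H.
  split.
  - split => //; rewrite setTI; exact: test_approx_itv.
  - move=> A [mA TA]; split; first exact: measurableC.
    have -> : \1_(~` A `&` `]a, b[%classic) = (fun t => \1_(`]a, b[%classic) t + -1 * \1_(A `&` `]a, b[%classic) t) :> (R -> R).
      apply/funext => t; rewrite !indicE !in_setI in_setC.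
      by case: (t \in A); case: (t \in _); rewrite /= ?mulr0 ?mulr1 ?addr0 ?subrr.
    by apply: test_approxD; [exact: test_approx_itv|exact: test_approxZ].
  move=> F tF HF.
  have mF n : measurable (F n) by case: (HF n).
  split; first exact: bigcup_measurable.
  apply: (@test_approx_lim (fun n => \1_((\big[setU/set0]_(i < n) F i) `&` `]a, b[%classic)) _
    (fun t => 1 * \1_(`[a, b]%classic) t)).
  - elim=> [|n IH]; first by rewrite big_ord0 set0I indic0; exact: test_approx0.
    rewrite big_ord_recr/=.
    have -> : \1_((\big[setU/set0]_(i < n) F i `|` F n) `&` `]a, b[%classic) =
       (fun t => \1_((\big[setU/set0]_(i < n) F i) `&` `]a, b[%classic) t + \1_(F n `&` `]a, b[%classic) t) :> (R -> R).
      apply/funext => t; rewrite !indicE !in_setI in_setU.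
      case: (boolP (t \in F n)) => [tn|_]; last by rewrite orbF addr0.
      suff -> : t \in \big[setU/set0]_(i < n) F i = false by rewrite /= add0r.
      apply/negbTE/negP; rewrite inE -bigcup_mkord => -[i /= ni Fit].
      move/trivIsetP: tF => /(_ i n I I).
      rewrite neq_ltn ni => /(_ isT) /seteqP[/(_ t) H1 _].
      by apply: H1; split => //; rewrite -inE.
    have [_ Tn] := HF n; exact: test_approxD IH Tn.
  - by apply: mI; apply: measurableI => //; exact: bigcup_measurable.
  - by apply: measurable_funM => //; exact: mI.
  - exact: mass_segment_fin.
  - move=> n t t0; rewrite mul1r !indicE in_setI; case: (boolP (t \in `]a, b[%classic)) => tab; last first.
      by rewrite andbF normr0.
    have -> : (t \in `[a, b]%classic) by move: tab; rewrite !inE; exact: subset_itv_oo_cc.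
    by case: (_ \in _); rewrite ?normr1 ?normr0.
  - move=> t t0; rewrite mul1r !indicE in_setI; case: (boolP (t \in `]a, b[%classic)) => tab; last first.
      by rewrite andbF normr0.
    have -> : (t \in `[a, b]%classic) by move: tab; rewrite !inE; exact: subset_itv_oo_cc.
    by case: (_ \in _); rewrite ?normr1 ?normr0.
  move=> t t0; apply: cvg_near_cst.
  have [tF'|tF'] := boolP (t \in \bigcup_k F k).
    have [k _ Fk] : (\bigcup_k F k) t by rewrite -inE.
    near=> n; rewrite !indicE !in_setI tF'; congr ((_ && _)%:R).
    apply/mem_set; rewrite -bigcup_mkord; exists k => //=.
    by near: n; exact: nbhs_infty_gt.
  near=> n; rewrite !indicE !in_setI (negbTE tF') (_ : t \in _ = false)//.
  apply/negbTE; apply: contra tF'; rewrite !inE -bigcup_mkord => -[k _ Fk].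
  by exists k.
move=> mE; suff [] : H E by [].
move: mE; rewrite -[X in X -> _]/((@ocitv R).-sigma.-measurable E) RGenOInfty.measurableE.
rewrite /measurable/= -setI_closed_g_dynkin_g_sigma_algebra; last first.
  move=> _ _ [x ->] [y ->]; exists (Num.max x y).
  by apply/seteqP; split => t /=; rewrite !in_itv/= !andbT gt_max => /andP.
move: E; apply: smallest_sub => // _ [x ->].
split; first exact: measurable_itv.
have -> : `]x, +oo[ `&` `]a, b[ = `]Num.max x a, b[%classic.
  apply/seteqP; split => t /=; rewrite !in_itv/= andbT gt_max.
    by move=> [-> /andP[-> ->]].
  by move=> /andP[/andP[-> ->] ->].
by apply: test_approx_itv => //; rewrite le_max lexx orbT.
Unshelve. all: by end_near. Qed.

(** By simple functions increasing to f. *)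
Lemma test_approx_nneg f : measurable_fun setT f -> (forall t, 0 <= f t) ->
  (forall t, ~ (a < t < b) -> f t = 0) -> (mass p (fun=> 1%R) f < +oo)%E -> test_approx f.
Proof.
move=> mf f0 fout ffin.
have mfE : measurable_fun setT (EFin \o f) by exact/measurable_EFinP.
pose g := nnsfun_approx measurableT mfE.
have fE0 x : setT x -> (0 <= (EFin \o f) x)%E by move=> _; rewrite /= lee_fin f0.
have gf n t : g n t <= f t.
  by rewrite -lee_fin; rewrite nnsfun_approxE; exact: le_approx.
have cg t : g n t @[n --> \oo] --> f t.
  by have := @cvg_nnsfun_approx _ _ _ _ measurableT _ mfE fE0 t I => /fine_cvgP[_].
have mfR : measurable_fun Rplus f by exact: measurable_funTS.
have g0 n t : 0 <= g n t by [].
apply: (@test_approx_lim (fun n t => g n t) f f) => //.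
- move=> n.
  have -> : (fun t => g n t) = (fun t => \sum_(y <- finmap.enum_fset (fset_set (range (g n))))
      (y * \1_(g n @^-1` [set y] `&` `]a, b[%classic) t)).
    apply/funext => t; have [tI|tI] := boolP (t \in `]a, b[%classic).
      rewrite {1}(fimfunE (g n) t) fsbig_finite//=; apply: eq_bigr => y _.
      by rewrite !indicE in_setI tI andbT.
    have -> : g n t = 0.
      apply/eqP; rewrite eq_le g0 andbT (le_trans (gf n t))// fout// => tab.
      by move: tI; rewrite notin_setE /= in_itv/= tab.
    by rewrite big1// => y _; rewrite indicE in_setI (negbTE tI) andbF mulr0.
  elim: (finmap.enum_fset _) => [|y s IH].
    rewrite (_ : (fun t => _) = (fun=> 0)); first exact: test_approx0.
    by apply/funext => t; rewrite big_nil.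
  rewrite (_ : (fun t => _) = (fun t => y * \1_(g n @^-1` [set y] `&` `]a, b[%classic) t +
     \sum_(y0 <- s) (y0 * \1_(g n @^-1` [set y0] `&` `]a, b[%classic) t))); last first.
    by apply/funext => t; rewrite big_cons.
  have mgy : measurable (g n @^-1` [set y]) by exact: measurable_sfunP.
  exact: test_approxD (test_approxZ y (test_approx_set mgy)) IH.
- by move=> n t _; rewrite ger0_norm// gf.
- by move=> t _; rewrite ger0_norm.
Qed.

Lemma test_approxP f : measurable_fun Rplus f -> (forall t, ~ (a < t < b) -> f t = 0) ->
  (mass p (fun=> 1%R) f < +oo)%E -> test_approx f.
Proof.
move=> mf fout ffin.
have fR : f = f \_ Rplus.
  apply/funext => t; rewrite patchE; case: ifPn => // tR; rewrite fout// => /andP[at_ _].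
  by move: tR; rewrite notin_setE; apply; apply/RplusE; exact: lt_trans at_.
have mT : measurable_fun setT f by rewrite fR; apply/(measurable_restrictT _ _).1 => //; exact: mRplus.
have le (h : R -> R) : measurable_fun Rplus h -> (forall t, `|h t| <= `|f t|) ->
    (mass p (fun=> 1%R) h < +oo)%E.
  move=> mh hf; apply: le_lt_trans ffin; apply: le_mass => //; try exact: weight1.
  move=> t _; rewrite ler_wpM2r//; apply: ge0_ler_powR; rewrite ?nnegrE ?(ltW p0)//.
have -> : f = (fun t => Num.max (f t) 0 + -1 * Num.max (- f t) 0).
  by apply/funext => t; rewrite mulN1r; case: (leP (f t) 0); case: (leP (- f t) 0) => h1 h2; lra.
apply: test_approxD; last apply: test_approxZ.
  apply: test_approx_nneg.
  - by apply: measurable_maxr.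
  - by move=> t; rewrite le_max lexx orbT.
  - by move=> t /fout ->; rewrite maxxx.
  apply: le; first by apply: measurable_maxr.
  by move=> t; case: (leP (f t) 0) => h; rewrite ?normr0.
have mN D : measurable_fun D f -> measurable_fun D (fun t => - f t) by exact: measurable_funN.
apply: test_approx_nneg.
- by apply: measurable_maxr => //; exact: mN.
- by move=> t; rewrite le_max lexx orbT.
- by move=> t /fout ->; rewrite oppr0 maxxx.
apply: le; first by apply: measurable_maxr => //; exact: mN.
by move=> t; case: (leP (- f t) 0) => h; rewrite ?normr0 ?normrN.
Qed.

End LpApproximation.

Section Density.
Variable R : realType.
Notation mu := (@lebesgue_measure R).
Local Notation Rplus := (`]0, +oo[%classic : set R).
Implicit Types (u v w g h f phi psi : R -> R).

Lemma is_derive_scale (f : R -> R) (c df t : R) : is_derive (c * t) (1 : R) f df ->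
  is_derive t (1 : R) (fun s => f (c * s)) (c * df).
Proof.
move=> H; have L : is_derive t (1 : R) (fun s : R => c * s) c.
  have := is_deriveZ c (is_derive_id t (1 : R)).
  by rewrite /GRing.scale/= mulr1.
have := is_derive1_comp H L.
by rewrite mulrC.
Qed.

(** A product of two rescaled cut-offs, one for each end of the half-line. The bound on
    t zeta_n' does not depend on n, by the scaling invariance of t d/dt. *)
Lemma plateau_family : exists K : R, exists zeta : nat -> R -> R, 0 <= K /\ forall n,
  [/\ test_function (zeta n), forall t, 0 <= zeta n t <= 1,
     forall t, 0 < t -> `|t * derive1 (zeta n) t| <= K &
     forall t : R, 2 / n.+1%:R < t < n.+1%:R -> zeta n t = 1 /\ derive1 (zeta n) t = 0].
Proof.
have [chi [chi' [K [[cchi dchi chi01 chiK] [chi1 chi0 chi'0 cchi']]]]] := cutoff_exists R.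
have K0 : 0 <= K by apply: le_trans (chiK 0).
have sK s : `|s * chi' s| <= 2 * K.
  have [/andP[s1 s2]|sI] := boolP (1 <= s <= 2); last by rewrite chi'0 ?mulr0 ?normr0 ?mulr_ge0//; exact/negP.
  by rewrite normrM ler_pM// ger0_norm ?(le_trans ler01).
exists (4 * K), (fun n t => if 0 < t then chi (n.+1%:R^-1 * t) * (1 + -1 * chi (n.+1%:R * t)) else 0).
split; first by rewrite mulr_ge0.
move=> n; set N : R := n.+1%:R; set c := N^-1; set z := (fun t : R => if _ then _ else _).
have N0 : 0 < N by rewrite ltr0n.
have c0 : 0 < c by rewrite invr_gt0.
pose z0 t := chi (c * t) * (1 + -1 * chi (N * t)).
have zE t : 0 < t -> z0 t = z t by move=> t0; rewrite /z t0.
have dz (t : R) : 0 < t -> is_derive t (1 : R) z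
    (chi (c * t) * (-1 * (N * chi' (N * t))) + (1 + -1 * chi (N * t)) * (c * chi' (c * t))).
  move=> t0.
  have d1 := is_derive_scale (dchi (c * t) (mulr_gt0 c0 t0)).
  have d2 := is_derive_scale (dchi (N * t) (mulr_gt0 N0 t0)).
  have d3 := is_deriveD (is_derive_cst (1 : R) t 1) (is_deriveZ (-1) d2).
  rewrite add0r in d3.
  have d4 := is_deriveM d1 d3.
  apply: near_eq_is_derive d4.
  by near=> u; rewrite -zE//; near: u; exact: pos_near.
have dzE t : 0 < t -> derive1 z t =
    chi (c * t) * (-1 * (N * chi' (N * t))) + (1 + -1 * chi (N * t)) * (c * chi' (c * t)).
  by move=> t0; rewrite derive1E; have [_ ->] := dz t t0.
split.
- apply/test_functionP; split.
    move=> k; apply: posC_eq zE _; apply: posCM; first exact: posC_scale.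
    apply: posCD; first exact: posC_cst.
    by apply: posCM; [exact: posC_cst|exact: posC_scale].
  exists c, (2 * N); split => //.
    have N1 : 1 <= N by rewrite ler1n.
    by have : c <= 1 by [rewrite invf_le1]; lra.
  move=> t tI; rewrite /z; case: ifP => // t0.
  have [tc|ct] := ltP t c.
    rewrite (chi1 (N * t)) ?mulr_gt0//; first by rewrite mulr1 subrr mulr0.
    by rewrite -(@mulfV _ N) ?gt_eqF// ler_wpM2l ?ltW.
  have Nt : 2 * N < t by rewrite ltNge; apply/negP => tN; apply: tI; rewrite ct.
  by rewrite chi0 ?mul0r// mulrC ler_pdivlMr// ltW.
- move=> t; rewrite /z; case: ifP => // t0; last by rewrite lexx ler01.
  have /andP[h1 h2] := chi01 (c * t); have /andP[h3 h4] := chi01 (N * t).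
  have h5 : 0 <= 1 + -1 * chi (N * t) by lra.
  have h6 : 1 + -1 * chi (N * t) <= 1 by lra.
  by rewrite mulr_ge0//= mulr_ile1.
- move=> t t0; rewrite dzE//.
  have /andP[h1 h2] := chi01 (c * t); have /andP[h3 h4] := chi01 (N * t).
  have -> : t * (chi (c * t) * (-1 * (N * chi' (N * t))) + (1 + -1 * chi (N * t)) * (c * chi' (c * t))) =
    - (chi (c * t) * (N * t * chi' (N * t))) + (1 - chi (N * t)) * (c * t * chi' (c * t)) by ring.
  apply: (le_trans (ler_normD _ _)); rewrite normrN.
  have := sK (N * t); have := sK (c * t).
  rewrite [`|chi _ * _|]normrM [`|(1 - _) * _|]normrM.
  move: (`|N * t * _|) (`|c * t * _|) (normr_ge0 (N * t * chi' (N * t))) (normr_ge0 (c * t * chi' (c * t))) => A B A0 B0 hB hA.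
  rewrite !ger0_norm ?subr_ge0//.
  have : chi (c * t) * A <= 1 * A by rewrite ler_wpM2r.
  have : (1 - chi (N * t)) * B <= 1 * B by rewrite ler_wpM2r//; lra.
  by lra.
move=> t /andP[t1 t2].
have t0 : 0 < t by apply: lt_trans t1; rewrite divr_gt0.
have ct1 : c * t < 1 by rewrite mulrC ltr_pdivrMr// mul1r.
have Nt2 : 2 < N * t by rewrite mulrC -ltr_pdivrMr.
rewrite dzE// /z t0 (chi1 (c * t)) ?mulr_gt0 ?(ltW ct1)// (chi0 (N * t)) ?(ltW Nt2)//.
rewrite (chi'0 (N * t)); last by move=> /andP[_]; rewrite leNgt Nt2.
rewrite (chi'0 (c * t)); last by move=> /andP[+ _]; rewrite leNgt ct1.
by split; ring.
Unshelve. all: by end_near. Qed.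

Lemma integrable_add (D : set R) f g : measurable D ->
  mu.-integrable D (EFin \o f) -> mu.-integrable D (EFin \o g) ->
  mu.-integrable D (EFin \o (fun t => f t + g t)).
Proof.
move=> mD fi gi.
have : mu.-integrable D ((EFin \o f) \+ (EFin \o g))%E by exact: integrableD.
by apply: eq_integrable => // t _; rewrite /= EFinD.
Qed.

Lemma ge0_integrable f : measurable_fun Rplus f -> (forall t, 0 < t -> 0 <= f t) ->
  (\int[mu]_(t in Rplus) (f t)%:E < +oo)%E -> mu.-integrable Rplus (EFin \o f).
Proof.
move=> mf f0 ffin; apply/integrableP; split; first exact/measurable_EFinP.
apply: le_lt_trans ffin; rewrite le_eqVlt; apply/orP; left; apply/eqP.
by apply: eq_integral => t; rewrite inE => /RplusE t0; rewrite gee0_abs// lee_fin f0.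
Qed.

Lemma integrable_fin f : (forall t, 0 < t -> 0 <= f t) -> mu.-integrable Rplus (EFin \o f) ->
  (\int[mu]_(t in Rplus) (f t)%:E < +oo)%E.
Proof.
move=> f0 /integrableP[_]; apply: le_lt_trans; rewrite le_eqVlt; apply/orP; left; apply/eqP.
by apply: eq_integral => t; rewrite inE => /RplusE t0; rewrite gee0_abs// lee_fin f0.
Qed.

Lemma subset_Rintegral (D E : set R) f : measurable D -> measurable E -> D `<=` E ->
  mu.-integrable E (EFin \o f) -> (forall t, 0 <= f t) ->
  \int[mu]_(t in D) f t <= \int[mu]_(t in E) f t.
Proof.
move=> mD mE DE iE f0; have iD := integrable_sub mD mE DE iE.
rewrite -lee_fin /Rintegral !fineK; try exact: integrable_fin_num.
apply: ge0_subset_integral => //; first by case/integrableP: iE.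
by move=> t _; rewrite lee_fin.
Qed.

Lemma powR_continuous (b t : R) : 0 < t -> {for t, continuous (fun s => s `^ b)}.
Proof.
move=> t0; apply: differentiable_continuous; apply/derivable1_diffP.
by have [] := is_derive1_powR b t0.
Qed.

(** A set of positive measure meets the set where the two functions agree. *)
Lemma ae_eq_witness u v (c d : R) : u = v %[ae mu in Rplus] -> 0 <= c -> c < d ->
  exists2 s, c < s < d & u s = v s.
Proof.
move=> uv c0 cd; apply: contrapT => H.
have [N [mN N0 subN]] := uv.
have : (mu `]c, d[%classic <= mu N)%E.
  apply: le_measure; rewrite ?inE//.
  move=> s; rewrite /= in_itv/= => /andP[cs sd]; apply: subN => /= E.
  by apply: H; exists s; rewrite ?cs// E//; apply/RplusE; exact: le_lt_trans cs.
rewrite N0 lebesgue_measure_itv/= lte_fin cd -EFinB lee_fin subr_le0.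
by rewrite leNgt cd.
Qed.

(** Hoelder's inequality, with the crude bound max (1, b - a) <= b - a + 1. *)
Lemma Lp_L1 p f (a b eta : R) : 1 < p -> 0 < a -> a < b -> 0 < eta ->
  measurable_fun Rplus f -> (mass p (fun=> 1%R) f <= (eta `^ p)%:E)%E ->
  (\int[mu]_(t in `[a, b]) `|f t|%:E <= (eta * (b - a + 1))%:E)%E.
Proof.
move=> p1 a0 ab e0 mf Hf.
have p0 : 0 < p by lra.
have mfs : measurable_fun `[a, b] f by apply: measurable_funS mf => //; exact: segment_Rplus.
have mm : measurable_fun Rplus (fun t => `|f t| `^ p * 1) by exact: (mass_measurable p (@weight1 R) mf).
have mms : measurable_fun `[a, b] (fun t => (`|f t| `^ p * 1)%:E).
  by apply/measurable_EFinP; apply: measurable_funS mm => //; exact: segment_Rplus.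
have en : 0 <= eta `^ (1 - p) by exact: powR_ge0.
apply: (@le_trans _ _ (\int[mu]_(t in `[a, b]) (eta%:E + (eta `^ (1 - p))%:E * (`|f t| `^ p * 1)%:E))%E).
  apply: ge0_le_integral => //.
  - by apply/measurable_EFinP; exact: measurableT_comp.
  - by apply: emeasurable_funD => //; exact: measurable_funeM.
  move=> t _; rewrite -EFinM -EFinD lee_fin mulr1.
  have [fe|ef] := leP `|f t| eta.
    by apply: (le_trans fe); rewrite lerDl mulr_ge0 ?powR_ge0.
  have f0 : 0 < `|f t| by exact: lt_trans ef.
  apply: (@le_trans _ _ (`|f t| `^ (1 - p) * `|f t| `^ p)).
    by rewrite -powRD ?(gt_eqF f0) ?implybT// subrK powRr1.
  have : `|f t| `^ (1 - p) <= eta `^ (1 - p).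
    rewrite -(opprB p 1) !powRN lef_pV2 ?posrE ?powR_gt0//.
    by apply: ge0_ler_powR; rewrite ?nnegrE ?subr_ge0 ?(ltW p1) ?(ltW e0) ?(ltW f0) ?(ltW ef).
  move=> /(ler_wpM2r (powR_ge0 `|f t| p))/le_trans; apply.
  by rewrite lerDr ltW.
rewrite ge0_integralD//; last 3 first.
- by move=> t _; rewrite lee_fin ltW.
- by move=> t _; rewrite -EFinM lee_fin !mulr_ge0 ?powR_ge0.
- exact: measurable_funeM.
rewrite integral_cst//= lebesgue_measure_itv/= lte_fin ab -EFinB -EFinM.
rewrite ge0_integralZl//.
rewrite (_ : eta * (b - a + 1) = eta * (b - a) + eta); last by ring.
rewrite EFinD; apply: leeD => //.
apply: (@le_trans _ _ ((eta `^ (1 - p))%:E * (eta `^ p)%:E)%E).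
  apply: lee_wpmul2l => //; apply: le_trans Hf; apply: ge0_subset_integral => //.
  - exact/measurable_EFinP.
  - exact: segment_Rplus.
by rewrite -EFinM -powRD ?(gt_eqF e0) ?implybT// subrK powRr1// ltW.
Qed.

(** Approximate v in L^p by a test function, correct its mean, which is small because v has mean 0,
    and take the primitive; on a compact segment the primitives are then close as well. *)
Lemma compact_density p u v (a b : R) : 1 < p -> 0 < a -> a < b ->
  locally_integrable Rplus u -> weak_derivative u v ->
  (forall t, 0 < t -> ~ (a <= t <= b) -> u t = 0) ->
  (forall t, ~ (a <= t <= b) -> v t = 0) ->
  (mass p (fun=> 1%R) v < +oo)%E -> forall e : R, 0 < e ->
  exists phi, [/\ test_function phi, forall t, ~ (a / 2 <= t <= b + 1) -> phi t = 0,
    (mass p (fun=> 1%R) (fun t => (u t - phi t)%R) <= e%:E)%E &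
    (mass p (fun=> 1%R) (fun t => (v t - derive1 phi t)%R) <= e%:E)%E].
Proof.
move=> p1 a0 ab lu uv u0 v0 vfin e e0.
have p0 : 0 < p by lra.
have [U [uU cU AC]] := absolutely_continuous_representative lu uv.
have lv : locally_integrable Rplus v by case: uv.
have mv := loc_measurable lv; have mu_ := loc_measurable lu.
have mU := continuous_loc_measurable cU.
have U0 s t : 0 < s -> s <= t -> (forall x, s <= x <= t -> ~ (a <= x <= b)) -> U t = U s.
  move=> s0 st out; apply/eqP; rewrite -subr_eq0 AC//; apply/eqP.
  rewrite -[RHS](Rintegral_set0 mu v); apply: eq_set_Rintegral => x vx.
  split => //=; rewrite in_itv/= => /out; move/v0 => vx0.
  by rewrite vx0 eqxx in vx.
have Ua t : 0 < t -> t < a -> U t = 0.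
  move=> t0 ta; have [s /andP[s0 st] us] := ae_eq_witness uU (lexx 0) t0.
  rewrite (U0 s)//; last 2 first.
  - exact: ltW.
  - by move=> x /andP[_ xt] /andP[ax _]; move: (le_lt_trans xt ta); rewrite ltNge ax.
  by rewrite -us u0// => /andP[as_ _]; move: (lt_trans st ta); rewrite ltNge as_.
have Ub t : b < t -> U t = 0.
  move=> bt; have t0 : 0 < t by rewrite (lt_trans a0)// (lt_trans ab).
  have b0 : 0 <= b by rewrite ltW// (lt_trans a0).
  have [s /andP[bs st] us] := ae_eq_witness uU b0 bt.
  have s0 : 0 < s by exact: le_lt_trans bs.
  rewrite (U0 s)//; last 2 first.
  - exact: ltW.
  - by move=> x /andP[sx _] /andP[_ xb]; move: (lt_le_trans bs sx); rewrite ltNge xb.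
  by rewrite -us u0// => /andP[_ sb]; move: bs; rewrite ltNge sb.
pose c := a / 2; pose d := b + 1.
have c0 : 0 < c by rewrite divr_gt0.
have ca : c < a by rewrite /c; lra.
have bd : b < d by rewrite /d; lra.
have cd : c < d by lra.
have out t : ~ (c <= t <= d) -> ~ (a <= t <= b).
  by move=> tI /andP[h1 h2]; apply: tI; rewrite (le_trans (ltW ca) h1) (le_trans h2 (ltW bd)).
have [theta [ttheta theta0 thetaO theta1]] := unit_bump c0 cd.
have mtheta : measurable_fun Rplus theta by apply: test_measurable => //; exact: mRplus.
have [B HB] := test_bounded ttheta.
have B0 : 0 <= B by apply: le_trans (HB 0).
pose l := d - c.
have l0 : 0 < l by rewrite subr_gt0.
have Mseg (f : R -> R) (M : R) : measurable_fun Rplus f -> 0 <= M -> (forall t, 0 < t -> `|f t| <= M) ->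
    (forall t, 0 < t -> ~ (c <= t <= d) -> f t = 0) -> (mass p (fun=> 1%R) f <= (M `^ p * l)%:E)%E.
  move=> mf M0 fM f0.
  have mms : measurable_fun Rplus (fun t => (`|f t| `^ p * 1)%:E).
    exact: (emass_measurable p (@weight1 R) mf).
  rewrite /mass (_ : (\int[mu]_(t in Rplus) _)%E = (\int[mu]_(t in `[c, d]) (`|f t| `^ p * 1)%:E)%E).
    apply: (@le_trans _ _ (\int[mu]_(t in `[c, d]) (M `^ p)%:E)%E).
      apply: ge0_le_integral => //.
      - by apply: measurable_funS mms => //; exact: segment_Rplus.
      move=> t; rewrite /= in_itv/= => /andP[ct _]; rewrite lee_fin mulr1.
      apply: ge0_ler_powR; rewrite ?nnegrE ?(ltW p0)//; apply: fM; exact: lt_le_trans ct.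
    by rewrite integral_cst//= lebesgue_measure_itv/= lte_fin cd -EFinB -EFinM.
  rewrite integral_mkcond [RHS]integral_mkcond; congr integral; apply/funext => t.
  rewrite !patchE; case: ifPn => [|tP]; rewrite ?inE.
    move=> /RplusE t0; case: ifPn => //; rewrite notin_setE /= in_itv/= => tI.
    by rewrite f0// normr0 powR0 ?mul0r// gt_eqF.
  case: ifPn => //; rewrite inE => /(segment_Rplus c0)/mem_set.
  by rewrite (negbTE tP).
pose C := 2 `^ p * (1 + ((l + 1) * B) `^ p * l) + (2 * (l + 1)) `^ p * l.
have C0 : 0 < C.
  have P2 : 0 < 2 `^ p :> R by exact: powR_gt0.
  have : 0 <= ((l + 1) * B) `^ p * l by rewrite mulr_ge0 ?powR_ge0 ?ltW.
  have : 0 <= (2 * (l + 1)) `^ p * l by rewrite mulr_ge0 ?powR_ge0 ?ltW.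
  by rewrite /C => h1 h2; apply: ltr_pwDl => //; rewrite mulr_gt0//; lra.
pose eta := (e / C) `^ p^-1.
have eta0 : 0 < eta by rewrite powR_gt0 ?divr_gt0.
have etap : eta `^ p = e / C by rewrite -powRrM mulVf ?gt_eqF// powRr1// divr_ge0 ?(ltW e0) ?(ltW C0).
have [_ /(_ (eta `^ p) (powR_gt0 _ eta0))[psi [tpsi psi0 Hpsi]]] : test_approx p c d v.
  apply: test_approxP => //.
  move=> t tI; apply: v0 => /andP[h1 h2]; apply: tI.
  by rewrite (lt_le_trans ca h1) (le_lt_trans h2 bd).

have mpsi : measurable_fun Rplus psi by apply: test_measurable => //; exact: mRplus.
pose f t := v t - psi t.
have mf : measurable_fun Rplus f by exact: measurable_funB.
have ivs (a' b' : R) : 0 < a' -> mu.-integrable `[a', b'] (EFin \o v) by exact: loc_segment.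
have its (g : R -> R) (a' b' : R) : test_function g -> mu.-integrable `[a', b'] (EFin \o g).
  by move=> tg; apply: integrable_segment => t _; exact: test_continuous.
have L1f := Lp_L1 p1 c0 cd eta0 mf Hpsi; rewrite -/l in L1f.
pose m := \int[mu]_(t in `[c, d]) psi t.
have mE : m = - \int[mu]_(t in `[c, d]) f t.
  rewrite RintegralB//; [|exact: ivs|exact: its].
  by rewrite -AC ?(ltW cd)// (Ua c)// (Ub d)// subrr sub0r opprK.
have iff_ : mu.-integrable `[c, d] (EFin \o f) by apply: integrable_diff => //; [exact: ivs|exact: its].
have Rf : \int[mu]_(t in `[c, d]) `|f t| <= eta * (l + 1).
  rewrite -lee_fin /Rintegral fineK//; apply: integrable_fin_num => //.
  exact: integrable_norm iff_.
have m_le : `|m| <= eta * (l + 1).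
  by rewrite mE normrN; apply: le_trans Rf; exact: le_normr_Rintegral.
(* Subtracting a multiple of the normalised bump theta makes the mean 0, so that the primitive is
   a test function; m is small because v has mean 0. *)
pose psit t := psi t + (- m) * theta t.
have tpsit : test_function psit by apply: testD => //; exact: testZ.
have psit0 t : ~ (c <= t <= d) -> psit t = 0.
  by move=> tI; rewrite /psit psi0// thetaO// mulr0 addr0.
have int0 : \int[mu]_(t in `[c, d]) psit t = 0.
  rewrite RintegralD//; [|exact: its|apply: integrableZ => //; exact: its].
  by rewrite RintegralZl ?theta1 ?mulr1 ?subrr//; exact: its.
have [phi [tphi dphi phi0]] := test_primitive c0 cd tpsit psit0 int0.
have mphi : measurable_fun Rplus phi by apply: test_measurable => //; exact: mRplus.
have l1 : 0 <= l + 1 by rewrite addr_ge0// ltW.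
have l2 : 0 <= 2 * (l + 1) by exact: mulr_ge0.
have l3 : 0 <= (l + 1) * B by exact: mulr_ge0.
exists phi; split => //.
  have -> : mass p (fun=> 1%R) (fun t => (u t - phi t)%R) = mass p (fun=> 1%R) (fun t => (U t - phi t)%R).
    apply: ae_eq_integral => //.
    - by apply: emass_measurable; [exact: weight1|exact: measurable_funB].
    - by apply: emass_measurable; [exact: weight1|exact: measurable_funB].
    by apply: ae_imply uU => t E Dt; rewrite E.
  have bp : 0 <= eta * (2 * (l + 1)) by apply: mulr_ge0; [exact: ltW|exact: mulr_ge0].
  have bnd t : 0 < t -> `|U t - phi t| <= eta * (2 * (l + 1)).
    move=> t0; have [tI|tI] := boolP (c <= t <= d); last first.
      rewrite phi0; last exact/negP.
      have [tc|ct] := ltP t c; first by rewrite (Ua t t0 (lt_trans tc ca)) subrr normr0.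
      have dt : d < t by rewrite ltNge; apply: contra tI => ->; rewrite ct.
      by rewrite (Ub t (lt_trans bd dt)) subrr normr0.
    case/andP: (tI) => ct td.
    have phid : phi d = 0.
      apply: (cvg_unique _ (cvg_at_right_filter (test_continuous tphi (x := d)))); rewrite ?Rhausdorff//.
      apply: cvg_near_cst; near=> x; apply: phi0 => /andP[_]; apply/negP; rewrite -ltNge.
      by near: x; exact: nbhs_right_gt.
    have Eq : U t - phi t = - \int[mu]_(x in `[t, d]) (v x - psit x).
      rewrite RintegralB//; [|exact: ivs|exact: its].
      have -> : \int[mu]_(x in `[t, d]) psit x = - phi t.
        by rewrite -(test_derive1_mean tphi td phid) dphi.
      by rewrite -AC// (Ub d)//; ring.
    have iv2 : mu.-integrable `[c, d] (EFin \o (fun x => v x - psit x)).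
      by apply: integrable_diff => //; [exact: ivs|exact: its].
    have sub : `[t, d] `<=` `[c, d] by apply: subset_itvScc; rewrite bnd_simp.
    have ntheta : mu.-integrable `[c, d] (EFin \o (fun x => `|m| * theta x)) by apply: integrableZ => //; exact: its.
    rewrite Eq normrN.
    apply: (@le_trans _ _ (\int[mu]_(x in `[t, d]) `|v x - psit x|)).
      by apply: le_normr_Rintegral => //; apply: integrable_sub iv2.
    apply: (@le_trans _ _ (\int[mu]_(x in `[c, d]) `|v x - psit x|)).
      by apply: (subset_Rintegral _ _ sub) => //; exact: integrable_norm iv2.
    apply: (@le_trans _ _ (\int[mu]_(x in `[c, d]) (`|f x| + `|m| * theta x))).
      apply: le_Rintegral => //.
      - exact: integrable_norm iv2.
      - by apply: integrable_add => //; exact: integrable_norm iff_.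
      move=> x _; rewrite /psit opprD addrA mulNr opprK.
      apply: (le_trans (ler_normD _ _)).
      by rewrite normrM (ger0_norm (theta0 x)).
    rewrite RintegralD//; last exact: integrable_norm iff_.
    rewrite RintegralZl//; last exact: its.
    by rewrite theta1 mulr1 mulrCA mulr_natl mulr2n lerD.
  have := Mseg (fun t => U t - phi t) (eta * (2 * (l + 1))).
  move=> H; apply: le_trans (H _ _ bnd _) _.
  - exact: measurable_funB.
  - exact: bp.
  - move=> t t0 tI; rewrite phi0// subr0.
    have [tc|ct] := ltP t c; first by rewrite Ua// (lt_trans tc).
    by rewrite Ub// (lt_trans bd)// ltNge; apply/negP => td; apply: tI; rewrite ct.
  rewrite lee_fin (powRM p (ltW eta0) l2) etap -mulrA mulrAC ler_pdivrMr// ler_wpM2l ?(ltW e0)//.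
  rewrite /C lerDr mulr_ge0 ?powR_ge0// addr_ge0// mulr_ge0 ?powR_ge0// ltW//.
rewrite dphi.
have -> : (fun t => v t - psit t) = (fun t => f t + m * theta t).
  by apply/funext => t; rewrite /psit /f; ring.
have Hth : (mass p (fun=> 1%R) (fun t => (m * theta t)%R) <= ((eta * ((l + 1) * B)) `^ p * l)%:E)%E.
  apply: Mseg.
  - exact: measurable_funM.
  - by apply: mulr_ge0; [exact: ltW|apply: mulr_ge0 => //; rewrite addr_ge0// ltW].
  - by move=> t _; rewrite normrM mulrA ler_pM.
  - by move=> t _ tI; rewrite thetaO ?mulr0.
have := massD_le p0 (@weight1 R) mf (measurable_funM (measurable_cst m) mtheta) Hpsi Hth.
move=> /le_trans; apply; rewrite lee_fin (powRM p (ltW eta0) l3) etap.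
have -> : 2 `^ p * (e / C + e / C * ((l + 1) * B) `^ p * l) = e / C * (2 `^ p * (1 + ((l + 1) * B) `^ p * l)) by ring.
rewrite mulrAC ler_pdivrMr// ler_wpM2l ?(ltW e0)//.
by rewrite /C lerDl mulr_ge0 ?powR_ge0 ?ltW.
Unshelve. all: by end_near. Qed.

Lemma poweR_le_root p (m : \bar R) (d : R) : 0 < p -> 0 <= d -> (0 <= m)%E ->
  (m <= d%:E)%E -> (m `^ p^-1 <= (d `^ p^-1)%:E)%E.
Proof.
move=> p0 d0 m0 md; rewrite -poweR_EFin; apply: gt0_ler_poweR => //.
- by rewrite invr_ge0 ltW.
- by rewrite in_itv/= m0 leey.
- by rewrite in_itv/= lee_fin d0 leey.
Qed.

Lemma sobolev_small p (w0 w1 : R -> R) u v (d e : R) : 1 <= p -> weight w0 -> weight w1 ->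
  locally_integrable Rplus u -> weak_derivative u v -> 0 <= d -> 0 <= e ->
  (mass p w0 u <= d%:E)%E -> (mass p w1 v <= e%:E)%E ->
  carrier (sobolev p w0 w1) u /\ nrm (sobolev p w0 w1) u <= d `^ p^-1 + e `^ p^-1.
Proof.
move=> p1 W0 W1 lu uv d0 e0 ud ve.
have p0 : 0 < p by exact: lt_le_trans p1.
have u_d : (weighted_norm p w0 u <= (d `^ p^-1)%:E)%E.
  by rewrite weighted_normE; apply: poweR_le_root => //; exact: mass_ge0.
have v_e : (weighted_norm p w1 v <= (e `^ p^-1)%:E)%E.
  by rewrite weighted_normE; apply: poweR_le_root => //; exact: mass_ge0.
have ufin : (weighted_norm p w0 u < +oo)%E by apply: (le_lt_trans u_d); exact: ltry.
have vfin : (weighted_norm p w1 v < +oo)%E by apply: (le_lt_trans v_e); exact: ltry.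
split; first by apply/sobolev_carrierP => //; split => //; exists v.
rewrite (sobolev_nrmE W1 uv)//; apply: lerD; rewrite -lee_fin fineK// ge0_fin_numE//;
  exact: weighted_norm_ge0.
Qed.

Lemma sobolev_mass p (w0 w1 : R -> R) u : 1 <= p -> weight w0 -> weight w1 ->
  carrier (sobolev p w0 w1) u -> exists v, [/\ locally_integrable Rplus u, weak_derivative u v,
    (mass p w0 u <= ((nrm (sobolev p w0 w1) u) `^ p)%:E)%E &
    (mass p w1 v <= ((nrm (sobolev p w0 w1) u) `^ p)%:E)%E].
Proof.
move=> p1 W0 W1 /(sobolev_carrierP _ _ W1)[lu [v [uv u0 v1]]].
have p0 : 0 < p by exact: lt_le_trans p1.
exists v; rewrite (sobolev_nrmE W1 uv)//.
have H w f (b : R) : weight w -> 0 <= b -> (weighted_norm p w f < +oo)%E ->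
    (mass p w f <= ((fine (weighted_norm p w f) + b) `^ p)%:E)%E.
  move=> Ww b0 ffin; have n0 := weighted_norm_ge0 p w f.
  have -> : mass p w f = (weighted_norm p w f `^ p)%E.
    by rewrite weighted_normE -poweRrM mulVf ?gt_eqF// poweRe1// mass_ge0.
  have fn0 := fine_ge0 n0; rewrite -[in leLHS](@fineK _ (weighted_norm p w f)) ?ge0_fin_numE//.
  rewrite poweR_EFin lee_fin; apply: ge0_ler_powR; rewrite ?nnegrE ?(ltW p0) ?addr_ge0//=.
  by rewrite lerDl.
split => //.
- by apply: H => //; rewrite fine_ge0// weighted_norm_ge0.
- by rewrite addrC; apply: H => //; rewrite fine_ge0// weighted_norm_ge0.
Qed.

Variables (p beta : R).
Hypotheses (p1 : 1 < p).
Let p0 : 0 < p. Proof. exact: lt_trans ltr01 p1. Qed.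
Let wb := (fun t : R => t `^ beta).
Let wY := (fun t : R => t `^ beta * (1 + 1 / t `^ p)).
Let Wb : weight wb. Proof. exact: weight_powR. Qed.
Let WY : weight wY. Proof. exact: weight_Y. Qed.

Lemma wY_E (t : R) : 0 < t -> wY t = t `^ beta + t `^ (beta - p).
Proof.
move=> t0; rewrite /wY mulrDr mulr1 div1r -powRN -powRD//.
by rewrite (gt_eqF t0) implybT.
Qed.

(** The cut-offs have t zeta_n' bounded, so the error zeta_n' u is dominated by |u| / t, which
    the weight of Y makes integrable; conclude by dominated convergence. *)
Lemma cutoff_error u v : locally_integrable Rplus u -> weak_derivative u v ->
  (mass p wY u < +oo)%E -> (mass p wb v < +oo)%E -> forall e : R, 0 < e ->
  exists zeta, [/\ test_function zeta,
    (mass p wY (fun t => (u t - zeta t * u t)%R) <= e%:E)%E &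
    (mass p wb (fun t => (v t - (derive1 zeta t * u t + zeta t * v t))%R) <= e%:E)%E].
Proof.
move=> lu uv ufin vfin e e0.
have [K [zeta [K0 Hz]]] := plateau_family.
have lv : locally_integrable Rplus v by case: uv.
have mv := loc_measurable lv; have mu_ := loc_measurable lu.
have tz n : test_function (zeta n) by case: (Hz n).
have mz n : measurable_fun Rplus (zeta n) by apply: test_measurable => //; exact: mRplus.
have mz' n : measurable_fun Rplus (derive1 (zeta n)).
  by apply: test_measurable; [exact: mRplus|exact: test_derive1].
have near1 (t : R) : 0 < t -> \forall n \near \oo, zeta n t = 1 /\ derive1 (zeta n) t = 0.
  move=> t0; near=> n; have [_ _ _] := Hz n; apply.
  have n1 : t + 2 / t < n.+1%:R.
    apply: (@lt_trans _ _ n%:R); last by rewrite ltr_nat.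
    by near: n; exact: nbhs_infty_gtr.
  have t2 : 0 < 2 / t by rewrite divr_gt0.
  apply/andP; split; last by lra.
  by rewrite ltr_pdivrMr ?ltr0n// mulrC -ltr_pdivrMr//; lra.
have [N1 HN1] : exists N, forall n, (N <= n)%N -> (mass p wY (fun t => (u t - zeta n t * u t)%R) <= e%:E)%E.
  apply: (@mass_cvg0 R p wY (fun n t => u t - zeta n t * u t) (fun t => `|u t| `^ p * wY t)) => //.
  - by move=> n; exact: measurable_funB mu_ (measurable_funM (mz n) mu_).
  - exact: mass_measurable.
  - move=> n t t0; have [_ wY0] := WY; rewrite ler_wpM2r ?wY0//.
    apply: ge0_ler_powR; rewrite ?nnegrE ?(ltW p0)//.
    have [_ /(_ t)/andP[z0 z1] _ _] := Hz n.
    rewrite -{1}[u t]mul1r -mulrBl normrM ger0_norm ?subr_ge0// ler_piMl//; lra.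
  - move=> t t0; apply: cvg_near_cst; apply: filterS (near1 t t0) => n [-> _].
    by rewrite mul1r subrr.
have [N2 HN2] : exists N, forall n, (N <= n)%N ->
    (mass p wb (fun t => (v t - (derive1 (zeta n) t * u t + zeta n t * v t))%R) <= e%:E)%E.
  apply: (@mass_cvg0 R p wb (fun n t => v t - (derive1 (zeta n) t * u t + zeta n t * v t))
    (fun t => 2 `^ p * (`|v t| `^ p * wb t + K `^ p * (`|u t| `^ p * wY t)))) => //.
  - by move=> n; exact: measurable_funB mv (measurable_funD (measurable_funM (mz' n) mu_) (measurable_funM (mz n) mv)).
  - apply: measurable_funM => //; apply: measurable_funD; first exact: (mass_measurable p Wb mv).
    by apply: measurable_funM => //; exact: (mass_measurable p WY mu_).
  - have [_ wb0] := Wb; have [_ wY0] := WY.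
    have iv := ge0_integrable (mass_measurable p Wb mv)
      (fun t t0 => mulr_ge0 (powR_ge0 _ _) (wb0 t t0)) vfin.
    have iu := ge0_integrable (mass_measurable p WY mu_)
      (fun t t0 => mulr_ge0 (powR_ge0 _ _) (wY0 t t0)) ufin.
    apply: integrable_fin.
      move=> t t0; apply: mulr_ge0; first exact: powR_ge0.
      apply: addr_ge0; apply: mulr_ge0; rewrite ?powR_ge0 ?wb0//.
      by rewrite mulr_ge0 ?powR_ge0 ?wY0.
    by apply: integrableZ => //; apply: integrable_add => //; exact: integrableZ.
  - move=> n t t0; have [_ /(_ t)/andP[z0 z1] /(_ t t0) zK _] := Hz n.
    have -> : v t - (derive1 (zeta n) t * u t + zeta n t * v t) =
      (1 - zeta n t) * v t + (- (t * derive1 (zeta n) t) * (u t / t)) by field; rewrite gt_eqF.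
    have wb0 : 0 <= wb t by exact: powR_ge0.
    have h1 : `|(1 - zeta n t) * v t| <= `|v t|.
      by rewrite normrM ger0_norm ?subr_ge0// ler_piMl//; lra.
    have h2 : `|- (t * derive1 (zeta n) t) * (u t / t)| <= K * (`|u t| / t).
      by rewrite normrM normrN normf_div (gtr0_norm t0) ler_wpM2r// divr_ge0// ltW.
    have pw x y : 0 <= x -> x <= y -> x `^ p <= y `^ p.
      by move=> x0 xy; apply: ge0_ler_powR; rewrite ?nnegrE ?(ltW p0)// (le_trans x0).
    apply: (@le_trans _ _ (2 `^ p * (`|v t| `^ p + (K * (`|u t| / t)) `^ p) * wb t)).
      rewrite ler_wpM2r//.
      apply: le_trans (powRD_le p0 (normr_ge0 _) _); last by rewrite mulr_ge0// divr_ge0// ltW.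
      apply: pw => //; apply: (le_trans (ler_normD _ _)); exact: lerD.
    rewrite -mulrA ler_wpM2l ?powR_ge0// mulrDl lerD2l.
    rewrite powRM ?divr_ge0 ?(ltW t0)// -mulrA ler_wpM2l ?powR_ge0//.
    rewrite powRM ?invr_ge0 ?(ltW t0)// -mulrA ler_wpM2l ?powR_ge0//.
    rewrite wY_E// -powR_inv1 ?(ltW t0)// -powRrM mulN1r /wb -powRD ?(gt_eqF t0) ?implybT//.
    by rewrite addrC lerDr powR_ge0.
  - move=> t t0; apply: cvg_near_cst; apply: filterS (near1 t t0) => n [-> ->].
    by rewrite mul0r add0r mul1r subrr.
exists (zeta (maxn N1 N2)); split => //.
  by apply: HN1; exact: leq_maxl.
by apply: HN2; exact: leq_maxr.
Unshelve. all: by end_near. Qed.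

(** Cut off by [cutoff_error], then approximate the compactly supported function by
    [compact_density]; on a compact subset of (0, +oo) all the weights are comparable to 1. *)
Theorem test_dense_Y u : carrier (Y1p p beta) u -> forall e : R, 0 < e ->
  exists phi, test_function phi /\ carrier (Y1p p beta) (fun t => u t - phi t) /\
    nrm (Y1p p beta) (fun t => u t - phi t) <= e.
Proof.
move=> Yu e e0; have p1' := ltW p1.
have [v [lu uv umass vmass]] := sobolev_mass p1' WY Wb Yu.
have ufin : (mass p wY u < +oo)%E by apply: (le_lt_trans umass); exact: ltry.
have vfin : (mass p wb v < +oo)%E by apply: (le_lt_trans vmass); exact: ltry.
have lv : locally_integrable Rplus v by case: uv.
have mv := loc_measurable lv; have mu_ := loc_measurable lu.
have P2 : 0 < 2 `^ p :> R by exact: powR_gt0.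
pose d := (e / 2) `^ p / (2 `^ p * 2).
have d0 : 0 < d by rewrite divr_gt0 ?powR_gt0 ?divr_gt0 ?mulr_gt0.
have [zeta [tz zu zv]] := cutoff_error lu uv ufin vfin d0.
have tz' := test_derive1 tz.
have [a1 [b1 [a10 ab1 z1]]] := test_supp tz.
have [a2 [b2 [a20 ab2 z2]]] := test_supp tz'.
pose a := Num.min a1 a2; pose b := Num.max b1 b2.
have a0 : 0 < a by rewrite lt_min a10.
have ab : a < b by rewrite /a /b gt_min !lt_max ab1.
have z1' t : ~ (a <= t <= b) -> zeta t = 0.
  move=> tI; apply: z1 => /andP[h1 h2]; apply: tI.
  by rewrite /a /b ge_min le_max h1 h2.
have z2' t : ~ (a <= t <= b) -> derive1 zeta t = 0.
  move=> tI; apply: z2 => /andP[h1 h2]; apply: tI.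
  by rewrite /a /b ge_min le_max h1 h2 !orbT.
have [lzu dzu] := weak_derivativeM (fun n => test_posC n tz) (fun t _ => test_is_derive t tz)
  (fun n => test_posC n tz') lu uv.
set zu' := (fun t => zeta t * u t) in lzu dzu.
set zv' := (fun t => derive1 zeta t * u t + zeta t * v t) in dzu.
have mzv : measurable_fun Rplus zv' by case: dzu => /loc_measurable.
have mzu := loc_measurable lzu.
have [W HW] : exists W, forall t, a / 2 <= t <= b + 1 -> wY t <= W /\ wb t <= W.
  have cb t : 0 < t -> {for t, continuous (fun t => t `^ beta + t `^ (beta - p))}.
    by move=> t0; apply: continuousD; exact: powR_continuous.
  have a20' : 0 < a / 2 by rewrite divr_gt0.
  have [W HW] := continuous_bounded_segment (b + 1) a20' cb.
  exists W => t tI; have t0 : 0 < t by case/andP: tI => h _; exact: lt_le_trans h.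
  have := HW t tI; rewrite ger0_norm ?addr_ge0 ?powR_ge0// -wY_E// => h; split => //.
  by apply: le_trans h; rewrite wY_E// lerDl powR_ge0.
have [V HV] : exists V, forall t, a <= t <= b -> t `^ (- beta) <= V.
  have [V HV] := continuous_bounded_segment b a0 (fun t => @powR_continuous (- beta) t).
  by exists V => t /HV; rewrite ger0_norm ?powR_ge0.
have zvfin : (mass p wb zv' < +oo)%E.
  have -> : zv' = (fun t => v t + (-1) * (v t - zv' t)) by apply/funext => t; ring.
  have mvz : measurable_fun Rplus (fun t => v t - zv' t) by exact: measurable_funB.
  have h1 : (mass p wb (fun t => (-1 * (v t - zv' t))%R) <= d%:E)%E.
    by rewrite massZ// normrN normr1 powR1 mul1e.
  apply: le_lt_trans (massD_le p0 Wb mv (measurable_funM (measurable_cst _) mvz) vmass h1) _.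
  exact: ltry.
have zv0 t : ~ (a <= t <= b) -> zv' t = 0.
  by move=> tI; rewrite /zv' z1'// z2'// !mul0r addr0.
have zvfin1 : (mass p (fun=> 1%R) zv' < +oo)%E.
  have V0 : 0 <= V by apply: le_trans (powR_ge0 a (- beta)) (HV a _); rewrite lexx ltW.
  apply: (@le_lt_trans _ _ (mass p wb (fun t => (V `^ p^-1 * zv' t)%R))).
    apply: le_mass => //; first exact: measurable_funM.
    move=> t t0; have [tI|tI] := boolP (a <= t <= b); last first.
      by rewrite zv0 ?mulr0 ?normr0 ?powR0 ?mul0r ?gt_eqF//; exact/negP.
    rewrite normrM powRM// (ger0_norm (powR_ge0 _ _)) -powRrM mulVf ?gt_eqF// powRr1//.
    rewrite mulrAC mulrC ler_wpM2r ?powR_ge0//.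
    apply: (@le_trans _ _ (t `^ (- beta) * t `^ beta)); last by rewrite ler_wpM2r ?powR_ge0 ?HV.
    by rewrite -powRD ?addNr ?powRr0// (gt_eqF t0) implybT.
  rewrite massZ//; have f1 : mass p wb zv' \is a fin_num by rewrite ge0_fin_numE// mass_ge0.
  by rewrite -(fineK f1) -EFinM ltry.
pose dW := d / (`|W| + 1).
have W1 : 0 < `|W| + 1 by rewrite ltr_wpDl.
have dW0 : 0 < dW by rewrite divr_gt0.
have zu0 t : 0 < t -> ~ (a <= t <= b) -> zu' t = 0 by move=> _ tI; rewrite /zu' z1'// mul0r.
have [phi [tphi phi0 phiu phiv]] := compact_density p1 a0 ab lzu dzu zu0 zv0 zvfin1 dW0.
have tphi' := test_derive1 tphi.
have mphi : measurable_fun Rplus phi by apply: test_measurable => //; exact: mRplus.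
have mphi' : measurable_fun Rplus (derive1 phi) by apply: test_measurable => //; exact: mRplus.
have ab12 t : ~ (a / 2 <= t <= b + 1) -> ~ (a <= t <= b).
  move=> tI /andP[h1 h2]; apply: tI; apply/andP; split; last by lra.
  by apply: le_trans h1; rewrite ler_pdivrMr// ler_peMr ?ltW//; lra.
have small w f : weight w -> measurable_fun Rplus f ->
    (forall t, a / 2 <= t <= b + 1 -> w t <= W) ->
    (forall t, ~ (a / 2 <= t <= b + 1) -> 0 < t -> f t = 0) ->
    (mass p (fun=> 1%R) f <= dW%:E)%E -> (mass p w f <= d%:E)%E.
  move=> Ww mf wW f0 fd; have [_ w0] := Ww.
  apply: (@le_trans _ _ (mass p (fun=> 1%R) (fun t => (`|W| `^ p^-1 * f t)%R))).
    apply: le_mass => //; first exact: measurable_funM.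
    move=> t t0; rewrite mulr1; have [tI|tI] := boolP (a / 2 <= t <= b + 1); last first.
      by rewrite f0 ?normr0 ?mulr0 ?normr0 ?powR0 ?mul0r ?gt_eqF//; exact/negP.
    rewrite normrM powRM// (ger0_norm (powR_ge0 _ _)) -powRrM mulVf ?gt_eqF// powRr1//.
    rewrite mulrC ler_wpM2r ?powR_ge0//; apply: le_trans (ler_norm W); exact: wW.
  rewrite (massZ p _ (@weight1 R) mf) (ger0_norm (powR_ge0 _ _)) -powRrM mulVf ?gt_eqF// powRr1//.
  apply: (@le_trans _ _ (`|W|%:E * dW%:E)%E).
    by apply: lee_wpmul2l => //; rewrite lee_fin.
  rewrite -EFinM lee_fin /dW mulrA ler_pdivrMr// mulrC ler_wpM2l ?(ltW d0)//.
  by rewrite lerDl.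
have hu : (mass p wY (fun t => (zu' t - phi t)%R) <= d%:E)%E.
  apply: (small _ _ WY (measurable_funB mzu mphi) _ _ phiu).
    by move=> t /HW[].
  by move=> t tI t0 /=; rewrite zu0//; [rewrite phi0// subrr|exact: ab12].
have phi'0 t : ~ (a / 2 <= t <= b + 1) -> 0 < t -> derive1 phi t = 0.
  move=> tI t0; rewrite derive1E.
  suff : is_derive t (1 : R) phi 0 by case.
  apply: near_eq_is_derive (is_derive_cst (0 : R) t 1).
  have [ta|at_] := ltP t (a / 2).
    near=> s; rewrite phi0// => /andP[+ _]; apply/negP; rewrite -ltNge.
    by near: s; exact: lt_nbhsl.
  have bt : b + 1 < t by rewrite ltNge; apply/negP => tb; apply: tI; rewrite at_.
  near=> s; rewrite phi0// => /andP[_]; apply/negP; rewrite -ltNge.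
  by near: s; exact: lt_nbhsr.
have hv : (mass p wb (fun t => (zv' t - derive1 phi t)%R) <= d%:E)%E.
  apply: (small _ _ Wb (measurable_funB mzv mphi') _ _ phiv).
    by move=> t /HW[].
  by move=> t tI t0 /=; rewrite zv0 ?phi'0 ?subrr//; exact: ab12.
have lphi := test_loc tphi.
have luphi : locally_integrable Rplus (fun t => u t - phi t) by exact: locally_integrableB.
have dphi : weak_derivative (fun t => u t - phi t) (fun t => v t - derive1 phi t).
  have := weak_derivativeD lu (_ : locally_integrable Rplus (fun t => -1 * phi t)) uv
    (weak_derivativeZ (-1) lphi (test_weak_derivative tphi)).
  have -> : (fun t => u t - phi t) = (fun t => u t + -1 * phi t) by apply/funext => t; rewrite mulN1r.
  have -> : (fun t => v t - derive1 phi t) = (fun t => v t + -1 * derive1 phi t).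
    by apply/funext => t; rewrite mulN1r.
  by apply; apply: test_loc; exact: testZ.
have dd : 2 `^ p * (d + d) = (e / 2) `^ p.
  by rewrite /d; field; rewrite gt_eqF.
have e2 : 0 <= (e / 2) `^ p by exact: powR_ge0.
have := @sobolev_small p wY wb (fun t => u t - phi t) (fun t => v t - derive1 phi t)
  _ _ p1' WY Wb luphi dphi e2 e2.
rewrite -{1 2}dd -powRrM mulfV ?gt_eqF// powRr1 ?divr_ge0 ?(ltW e0)// => H.
have [] := H.
- have -> : (fun t => (u t - phi t)%R) = (fun t => (u t - zu' t) + (zu' t - phi t)).
    by apply/funext => t; rewrite addrA subrK.
  exact: massD_le p0 WY (measurable_funB mu_ mzu) (measurable_funB mzu mphi) zu hu.
- have -> : (fun t => (v t - derive1 phi t)%R) = (fun t => (v t - zv' t) + (zv' t - derive1 phi t)).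
    by apply/funext => t; rewrite addrA subrK.
  exact: massD_le p0 Wb (measurable_funB mv mzv) (measurable_funB mzv mphi') zv hv.
move=> h1 h2; exists phi; split => //; split => //.
by apply: (le_trans h2); rewrite -splitr.
Unshelve. all: by end_near. Qed.

End Density.

(** * Comparison of the spaces and smooth multipliers *)

Section RealSpaces.
Variable R : realType.
Notation mu := (@lebesgue_measure R).
Local Notation Rplus := (`]0, +oo[%classic : set R).
Implicit Types (u v w g h f m x phi psi : R -> R).
Variable p : R.
Hypothesis p1 : 1 < p.
Let p0 : 0 < p. Proof. exact: lt_trans ltr01 p1. Qed.

Lemma W1p_rspace (b : R) : rspace (W1p p b).
Proof. by apply: sobolev_rspace; [exact: ltW|exact: weight_powR|exact: weight_powR]. Qed.

Lemma Y1p_rspace (b : R) : rspace (Y1p p b).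
Proof. by apply: sobolev_rspace; [exact: ltW|exact: weight_Y|exact: weight_powR]. Qed.

Lemma test_W1p (b : R) phi : test_function phi -> carrier (W1p p b) phi.
Proof.
move=> tphi; have tphi' := test_derive1 tphi.
apply/(sobolev_carrierP _ _ (weight_powR _)); split; first exact: test_loc.
have fin psi : test_function psi -> (weighted_norm p (fun t => (t `^ b)%R) psi < +oo)%E.
  move=> tpsi; apply/weighted_norm_finP => //.
  have mpsi : measurable_fun Rplus psi by apply: test_measurable => //; exact: mRplus.
  apply: integrable_fin; first by move=> t t0; rewrite mulr_ge0 ?powR_ge0.
  have [a1 [b1 [a0 ab out]]] := test_supp tpsi; have [M HM] := test_bounded tpsi.
  have lb : locally_integrable Rplus (fun t => t `^ b).
    by apply: continuous_loc => t; exact: powR_continuous.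
  have := @integrable_mul_bounded R (fun t => t `^ b) (fun t => `|psi t| `^ p) a1 b1 (M `^ p) lb.
  have -> : (fun t => `|psi t| `^ p * t `^ b) = (fun t => t `^ b * `|psi t| `^ p).
    by apply/funext => t; rewrite mulrC.
  apply => //.
  - by apply: (measurableT_comp (measurable_powR _)); exact: measurableT_comp.
  - move=> t t0; rewrite ger0_norm ?powR_ge0//; apply: ge0_ler_powR; rewrite ?nnegrE ?(ltW p0)//.
    by apply: le_trans (HM 0).
  - by move=> t t0 /out ->; rewrite normr0 powR0 ?gt_eqF.
exists (derive1 phi); split; [exact: test_weak_derivative|exact: fin|exact: fin].
Qed.

Lemma W1p0_rspace (b : R) : rspace (W1p0 p b).
Proof.
have [z D Z ge0 tri hom] := W1p_rspace b.
split.
- split => // e e0; exists (fun=> 0); first exact: test0.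
  have -> : ((fun=> 0) - (fun=> 0) : R -> R) = (fun t => 0 * 0 : R).
    by apply/funext => t; rewrite mul0r; exact: subrr.
  by rewrite (hom 0 (fun=> 0) z) normr0 mul0r.
- move=> u v [Wu Hu] [Wv Hv]; split; first exact: D.
  move=> e e0; have e2 : 0 < e / 2 by rewrite divr_gt0.
  have [phi tphi Hphi] := Hu _ e2; have [psi tpsi Hpsi] := Hv _ e2.
  exists (fun t => phi t + psi t); first exact: testD.
  have Wsub f g : carrier (W1p p b) f -> test_function g -> carrier (W1p p b) (f - g).
    move=> Wf tg; have -> : (f - g) = (fun t => f t + -1 * g t).
      by apply/funext => t; rewrite mulN1r.
    exact: D Wf (Z _ _ (test_W1p b tg)).
  have -> : ((fun t => u t + v t) - (fun t => phi t + psi t) : R -> R) = (fun t => (u - phi) t + (v - psi) t).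
    apply/funext => t; rewrite -[LHS]/((u t + v t) - (phi t + psi t)) -[RHS]/((u t - phi t) + (v t - psi t)).
    by ring.
  apply: le_lt_trans (tri _ _ _ _) _; try exact: Wsub.
  by rewrite [ltRHS]splitr; exact: (ltrD Hphi Hpsi).
- move=> c u [Wu Hu]; split; first exact: Z.
  move=> e e0; have c0 : 0 < `|c| + 1 by rewrite ltr_wpDl.
  have [phi tphi Hphi] := Hu (e / (`|c| + 1)) (divr_gt0 e0 c0).
  exists (fun t => c * phi t); first exact: testZ.
  have -> : ((fun t => c * u t) - (fun t => c * phi t) : R -> R) = (fun t => c * (u - phi) t).
    by apply/funext => t; exact: esym (mulrBr _ _ _).
  have Wsub : carrier (W1p p b) (u - phi).
    have -> : (u - phi) = (fun t => u t + -1 * phi t).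
      by apply/funext => t; rewrite mulN1r.
    exact: D Wu (Z _ _ (test_W1p b tphi)).
  rewrite (hom c _ Wsub).
  apply: (@le_lt_trans _ _ (`|c| * (e / (`|c| + 1)))); first by rewrite ler_wpM2l// ltW.
  by rewrite mulrA ltr_pdivrMr// mulrC ltr_pM2l// ltrDl.
- exact: ge0.
- by move=> u v [Wu _] [Wv _]; exact: tri.
- by move=> c u [Wu _]; exact: hom.
Qed.

(** The weight of Y dominates that of W. *)
Lemma Y1p_sub_W1p (b : R) u : carrier (Y1p p b) u ->
  carrier (W1p p b) u /\ nrm (W1p p b) u <= 2 * nrm (Y1p p b) u.
Proof.
move=> Yu; have N0 := rs_ge0 (Y1p_rspace b) u.
have [v [lu uv umass vmass]] := sobolev_mass (ltW p1) (weight_Y p b) (weight_powR b) Yu.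
have Np : 0 <= nrm (Y1p p b) u `^ p by exact: powR_ge0.
have um : (mass p (fun t => (t `^ b)%R) u <= (nrm (Y1p p b) u `^ p)%:E)%E.
  apply: (le_trans _ umass); apply: le_mass; [exact: weight_powR|exact: weight_Y| | |].
  - exact: loc_measurable.
  - exact: loc_measurable.
  by move=> t t0; rewrite ler_wpM2l ?powR_ge0// -[leLHS]mulr1 ler_wpM2l ?powR_ge0// lerDl divr_ge0 ?powR_ge0.
have := sobolev_small (ltW p1) (weight_powR b) (weight_powR b) lu uv Np Np um vmass.
rewrite -powRrM mulfV ?gt_eqF// powRr1// => -[? h]; split => //.
by rewrite mulr_natl mulr2n.
Qed.

(** The weight of Y is t^b + t^(b - p), and the second term is Hardy's inequality. *)
Lemma W1p_sub_Y1p (b : R) : b <= -1 \/ p - 1 < b -> exists2 C : R, 0 < C & forall u,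
  carrier (W1p p b) u -> carrier (Y1p p b) u /\ nrm (Y1p p b) u <= C * nrm (W1p p b) u.
Proof.
move=> hb; have [C C0 H] := hardy p1 hb.
have c0 : 0 <= (1 + C * 2) `^ p^-1 by exact: powR_ge0.
exists ((1 + C * 2) `^ p^-1 + 1); first by rewrite ltr_wpDl.
move=> u Wu; have N0 := rs_ge0 (W1p_rspace b) u.
have [v [lu uv umass vmass]] := sobolev_mass (ltW p1) (weight_powR b) (weight_powR b) Wu.
have mu_ := loc_measurable lu.
have mv : measurable_fun Rplus v by case: uv => /loc_measurable.
have ufin : (mass p (fun t => (t `^ b)%R) u < +oo)%E by apply: (le_lt_trans umass); exact: ltry.
have Hu := H u v lu uv ufin.
set N := nrm (W1p p b) u in N0 umass vmass *.
have Np : 0 <= N `^ p by exact: powR_ge0.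
have K0 : 0 <= (1 + C * 2) * N `^ p by rewrite mulr_ge0// addr_ge0// mulr_ge0.
have YE : mass p (fun t => (t `^ b * (1 + 1 / t `^ p))%R) u =
    (mass p (fun t => (t `^ b)%R) u + mass p (fun t => (t `^ (b - p))%R) u)%E.
  rewrite /mass -ge0_integralD//.
  - by apply: eq_integral => t; rewrite inE => /RplusE t0; rewrite -EFinD -mulrDr wY_E.
  - by move=> t _; rewrite lee_fin mulr_ge0 ?powR_ge0.
  - by apply: emass_measurable => //; exact: weight_powR.
  - by move=> t _; rewrite lee_fin mulr_ge0 ?powR_ge0.
  - by apply: emass_measurable => //; exact: weight_powR.
have um : (mass p (fun t => (t `^ b * (1 + 1 / t `^ p))%R) u <= ((1 + C * 2) * N `^ p)%:E)%E.
  rewrite YE; move: umass vmass Hu; move: (mass _ _ _) (mass _ _ _) (mass _ _ _) => A B D AN BN DAB.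
  rewrite mulrDl mul1r EFinD; apply: leeD => //; apply: (le_trans DAB).
  rewrite -mulrA EFinM; apply: lee_wpmul2l; first by rewrite lee_fin.
  by rewrite mulr_natl mulr2n EFinD; exact: leeD.
have [Yu YN] := sobolev_small (ltW p1) (weight_Y p b) (weight_powR b) lu uv K0 Np um vmass.
split => //; apply: (le_trans YN); rewrite powRM ?addr_ge0 ?mulr_ge0//.
by rewrite -powRrM mulfV ?gt_eqF// powRr1// mulrDl mul1r.
Qed.

(** If m and t m' grow at most like t^g, then (m x)' = m' x + m x' is controlled by x / t and x':
    the space Y is made for this estimate. *)
Lemma smooth_multiplier (b b' g A : R) m (m' : R -> R) x : b' + g * p = b -> 0 <= A ->
  (forall n, posC n m) -> (forall t : R, 0 < t -> is_derive t (1 : R) m (m' t)) ->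
  (forall t, 0 < t -> `|m t| <= A * t `^ g) -> (forall t, 0 < t -> `|t * m' t| <= A * t `^ g) ->
  carrier (Y1p p b) x -> carrier (W1p p b') (fun t => m t * x t) /\
    nrm (W1p p b') (fun t => m t * x t) <= 5 * A * nrm (Y1p p b) x.
Proof.
move=> bb A0 cm dm mA mA' Yx; have N0 := rs_ge0 (Y1p_rspace b) x.
have [v [lx xv xmass vmass]] := sobolev_mass (ltW p1) (weight_Y p b) (weight_powR b) Yx.
set N := nrm (Y1p p b) x in N0 xmass vmass *.
have cm' n : posC n m'.
  have [f df cf] := cm n.+1; apply: posC_eq cf => t t0.
  by have [_ <-] := df t t0; have [_ <-] := dm t t0.
have [lmx dmx] := weak_derivativeM cm dm cm' lx xv.
have mx := loc_measurable lx.
have mv : measurable_fun Rplus v by case: xv => /loc_measurable.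
have mm : measurable_fun Rplus m.
  apply: continuous_loc_measurable => t t0; apply: differentiable_continuous.
  by apply/derivable1_diffP; have [] := dm t t0.
have mm' : measurable_fun Rplus m'.
  have [f df _] := cm' 1%N; apply: continuous_loc_measurable => t t0; apply: differentiable_continuous.
  by apply/derivable1_diffP; have [] := df t t0.
have Wb' := weight_powR b'; have Wb := weight_powR b; have WY := weight_Y p b.
have pw (y z : R) : 0 <= y -> y <= z -> y `^ p <= z `^ p.
  by move=> y0 yz; apply: ge0_ler_powR; rewrite ?nnegrE ?(ltW p0)// (le_trans y0).
have tg (t c : R) : 0 < t -> (t `^ g) `^ p * t `^ (b' + c) = t `^ (b + c).
  by move=> t0; rewrite -powRrM -powRD ?(gt_eqF t0) ?implybT// -bb; congr (_ `^ _); ring.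
have gA (t c : R) : 0 < t -> (A * t `^ g) `^ p * c * t `^ b' = A `^ p * c * t `^ b.
  by move=> t0; have := tg t 0 t0; rewrite !addr0 powRM ?powR_ge0// => <-; ring.
have NA : 0 <= (A * N) `^ p by exact: powR_ge0.
have m1 : (mass p (fun t => (t `^ b')%R) (fun t => (m t * x t)%R) <= ((A * N) `^ p)%:E)%E.
  apply: (@le_trans _ _ (mass p (fun t => (t `^ b * (1 + 1 / t `^ p))%R) (fun t => (A * x t)%R))).
    apply: le_mass => //; [exact: measurable_funM|exact: measurable_funM|].
    move=> t t0; rewrite wY_E// !normrM (ger0_norm A0) !powRM//.
    apply: (@le_trans _ _ ((A * t `^ g) `^ p * `|x t| `^ p * t `^ b')).
      by rewrite ler_wpM2r ?powR_ge0// ler_wpM2r ?powR_ge0// pw// mA.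
    rewrite gA// ler_wpM2l ?mulr_ge0 ?powR_ge0//.
    by rewrite lerDl powR_ge0.
  rewrite (massZ p A WY mx) (ger0_norm A0) powRM// EFinM.
  by apply: lee_wpmul2l => //; rewrite lee_fin powR_ge0.
have m21 : (mass p (fun t => (t `^ b')%R) (fun t => (m' t * x t)%R) <= ((A * N) `^ p)%:E)%E.
  apply: (@le_trans _ _ (mass p (fun t => (t `^ b * (1 + 1 / t `^ p))%R) (fun t => (A * x t)%R))).
    apply: le_mass => //; [exact: measurable_funM|exact: measurable_funM|].
    move=> t t0; rewrite wY_E// !normrM (ger0_norm A0) !powRM//.
    have : `|m' t| <= A * t `^ g / t.
      by rewrite ler_pdivlMr// mulrC -{1}(gtr0_norm t0) -normrM mA'.
    move=> /(pw _ _ (normr_ge0 _)) h.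
    apply: (@le_trans _ _ ((A * t `^ g / t) `^ p * `|x t| `^ p * t `^ b')).
      by rewrite ler_wpM2r ?powR_ge0// ler_wpM2r ?powR_ge0.
    have -> : (A * t `^ g / t) `^ p = A `^ p * (t `^ g) `^ p * t `^ (- p).
      rewrite powRM ?mulr_ge0 ?powR_ge0 ?invr_ge0 ?(ltW t0)// powRM ?powR_ge0//.
      suff -> : t^-1 `^ p = t `^ (- p) by [].
      by rewrite -powR_inv1 ?(ltW t0)// -powRrM mulN1r.
    rewrite [leLHS](_ : _ = A `^ p * `|x t| `^ p * ((t `^ g) `^ p * (t `^ b' * t `^ (- p)))); last by ring.
    rewrite -powRD ?(gt_eqF t0) ?implybT// tg// ler_wpM2l ?mulr_ge0 ?powR_ge0//.
    by rewrite lerDr powR_ge0.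
  rewrite (massZ p A WY mx) (ger0_norm A0) powRM// EFinM.
  by apply: lee_wpmul2l => //; rewrite lee_fin powR_ge0.
have m22 : (mass p (fun t => (t `^ b')%R) (fun t => (m t * v t)%R) <= ((A * N) `^ p)%:E)%E.
  apply: (@le_trans _ _ (mass p (fun t => (t `^ b)%R) (fun t => (A * v t)%R))).
    apply: le_mass => //; [exact: measurable_funM|exact: measurable_funM|].
    move=> t t0; rewrite !normrM (ger0_norm A0) !powRM//.
    apply: (@le_trans _ _ ((A * t `^ g) `^ p * `|v t| `^ p * t `^ b')).
      by rewrite ler_wpM2r ?powR_ge0// ler_wpM2r ?powR_ge0// pw// mA.
    by rewrite gA.
  rewrite (massZ p A Wb mv) (ger0_norm A0) powRM// EFinM.
  by apply: lee_wpmul2l => //; rewrite lee_fin powR_ge0.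
have m2 : (mass p (fun t => (t `^ b')%R) (fun t => (m' t * x t + m t * v t)%R) <= (2 `^ p * ((A * N) `^ p + (A * N) `^ p))%:E)%E.
  exact: massD_le p0 Wb' (measurable_funM mm' mx) (measurable_funM mm mv) m21 m22.
have AN : 0 <= A * N by exact: mulr_ge0.
have K0 : 0 <= 2 `^ p * ((A * N) `^ p + (A * N) `^ p) by rewrite mulr_ge0 ?addr_ge0 ?powR_ge0.
have [Wx nx] := sobolev_small (ltW p1) Wb' Wb' lmx dmx NA K0 m1 m2.
split => //; apply: (le_trans nx).
have r (y : R) : 0 <= y -> (y `^ p) `^ p^-1 = y.
  by move=> y0; rewrite -powRrM mulfV ?gt_eqF// powRr1.
rewrite (r _ AN).
have : (2 `^ p * ((A * N) `^ p + (A * N) `^ p)) `^ p^-1 <= 4 * (A * N).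
  rewrite -(r (4 * (A * N))) ?mulr_ge0//; apply: ge0_ler_powR; rewrite ?nnegrE ?invr_ge0 ?(ltW p0) ?powR_ge0//.
  have -> : 4 * (A * N) = 2 * (2 * (A * N)) by ring.
  rewrite [leRHS]powRM ?mulr_ge0// ler_wpM2l ?powR_ge0//.
  rewrite (@powRM _ 2 (A * N))// -mulr2n -[leLHS]mulr_natl ler_wpM2r ?powR_ge0//.
  by rewrite -[leLHS]powRr1// ler_powR ?ler1n// ltW.
by rewrite -mulrA; lra.
Qed.

(** A smooth multiple of a test function is a test function, so the previous estimate and
    [test_dense_Y] put the product in the closure. *)
Lemma smooth_multiplier0 (b b' g A : R) m (m' : R -> R) x : b' + g * p = b -> 0 <= A ->
  (forall n, posC n m) -> (forall t : R, 0 < t -> is_derive t (1 : R) m (m' t)) ->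
  (forall t, 0 < t -> `|m t| <= A * t `^ g) -> (forall t, 0 < t -> `|t * m' t| <= A * t `^ g) ->
  carrier (Y1p p b) x -> carrier (W1p0 p b') (fun t => m t * x t) /\
    nrm (W1p0 p b') (fun t => m t * x t) <= 5 * A * nrm (Y1p p b) x.
Proof.
move=> bb A0 cm dm mA mA' Yx.
have [Wx nx] := smooth_multiplier bb A0 cm dm mA mA' Yx; split => //; split => // e e0.
have A5 : 0 < 5 * A + 1 by lra.
have [phi [tphi [Yphi nphi]]] := test_dense_Y p1 Yx (divr_gt0 e0 A5).
exists (fun t => m t * phi t); first exact: testMl.
have -> : ((fun t => m t * x t) - (fun t => m t * phi t) : R -> R) = (fun t => m t * (x t - phi t)).
  by apply/funext => t; exact: esym (mulrBr _ _ _).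
have [_ n2] := smooth_multiplier bb A0 cm dm mA mA' Yphi.
apply: (le_lt_trans n2); apply: (@le_lt_trans _ _ (5 * A * (e / (5 * A + 1)))).
  by rewrite ler_wpM2l// mulr_ge0.
by rewrite mulrA ltr_pdivrMr// mulrC ltr_pM2l// ltrDl.
Qed.

End RealSpaces.

(** * Complexifications and sums of spaces *)

Section InfSup.
Variable R : realType.
Implicit Types E : set R.

Lemma inf_nneg E : (forall x, E x -> 0 <= x) -> 0 <= inf E.
Proof.
move=> H; have [->|/set0P E0] := eqVneq E set0; first by rewrite inf0.
by apply: lb_le_inf => // x /H.
Qed.

Lemma sup_nneg E : (forall x, E x -> 0 <= x) -> 0 <= sup E.
Proof.
move=> H; have [hs|ns] := pselect (has_sup E); last by rewrite sup_out.
have [[x Ex] _] := hs; apply: (le_trans (H x Ex)).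
exact: (sup_upper_bound hs).
Qed.

Lemma inf_le_mem E x : (forall y, E y -> 0 <= y) -> E x -> inf E <= x.
Proof.
move=> H Ex; have hi : has_lbound E by exists 0.
exact: (ge_inf hi).
Qed.

Lemma inf_approx E x e : (forall y, E y -> 0 <= y) -> E x -> 0 < e ->
  exists2 y, E y & y < inf E + e.
Proof.
by move=> H Ex e0; apply: inf_adherent => //; split; [exists x|exists 0].
Qed.

Lemma mem_le_sup E x M : (forall y, E y -> y <= M) -> E x -> x <= sup E.
Proof.
move=> H Ex; have hs : has_sup E by split; [exists x|exists M].
exact: (sup_upper_bound hs).
Qed.

End InfSup.

Section Complexification.
Variables (R : realType) (X : nspace R (R -> R)).
Hypothesis rX : rspace X.
Local Notation XC := (complexification X).
Implicit Types (f g : R -> R[i]) (l c : R[i]).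

Let rot l f : nrm X (fun t => complex.Re (l * f t)) =
  nrm X (fun t => complex.Re l * complex.Re (f t) + - complex.Im l * complex.Im (f t)).
Proof.
suff -> : (fun t => complex.Re (l * f t)) =
  (fun t => complex.Re l * complex.Re (f t) + - complex.Im l * complex.Im (f t)) by [].
by apply/funext => t; case: l => a b; case: (f t) => x y /=; rewrite mulNr.
Qed.

Lemma normC1 l : `|l| = 1 <-> normc l = 1.
Proof. by rewrite normC_normc; split=> [[]|->]. Qed.

(** The norm of a complexification is a supremum over rotations; this bounds each of them, so that
    the supremum is finite. *)
Lemma crot_le l f : carrier XC f -> normc l = 1 ->
  nrm X (fun t => complex.Re (l * f t)) <=
  nrm X (fun t => complex.Re (f t)) + nrm X (fun t => complex.Im (f t)).
Proof.
move=> [Xr Xi] l1; rewrite rot.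
apply: le_trans (rs_tri rX (rsZ rX _ Xr) (rsZ rX _ Xi)) _.
rewrite !(rs_hom rX)// normrN; apply: lerD; rewrite ler_piMl ?(rs_ge0 rX)//.
  by rewrite -l1 Re_le_normc.
by rewrite -l1 Im_le_normc.
Qed.

Lemma cnrm_ub f M : (forall l, normc l = 1 -> nrm X (fun t => complex.Re (l * f t)) <= M) ->
  nrm XC f <= M.
Proof.
move=> H; apply: ge_sup.
  by exists (nrm X (fun t => complex.Re (1 * f t))), 1 => //=; rewrite normr1.
by move=> _ [l /= /normC1 l1 <-]; exact: H.
Qed.

Lemma crot_le_nrm l f : carrier XC f -> normc l = 1 ->
  nrm X (fun t => complex.Re (l * f t)) <= nrm XC f.
Proof.
move=> Xf l1.
apply: (@mem_le_sup _ _ _ (nrm X (fun t => complex.Re (f t)) + nrm X (fun t => complex.Im (f t)))).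
  by move=> _ [l' /= /normC1 l'1 <-]; exact: crot_le.
by exists l => //=; apply/normC1.
Qed.

Lemma cnrm_le_add f : carrier XC f ->
  nrm XC f <= nrm X (fun t => complex.Re (f t)) + nrm X (fun t => complex.Im (f t)).
Proof. by move=> Xf; apply: cnrm_ub => l; exact: crot_le. Qed.

Lemma cnrm_Re f : carrier XC f -> nrm X (fun t => complex.Re (f t)) <= nrm XC f.
Proof.
move=> Xf; have l1 : normc (1 : R[i]) = 1 by rewrite -[1]/(1%:C) normc_real normr1.
by have := crot_le_nrm Xf l1; under eq_fun do rewrite mul1r.
Qed.

Lemma cnrm_Im f : carrier XC f -> nrm X (fun t => complex.Im (f t)) <= nrm XC f.
Proof.
move=> Xf; have l1 : normc (0 -i* 1 : R[i]) = 1 by rewrite /normc expr0n/= add0r sqrrN expr1n sqrtr1.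
have := crot_le_nrm Xf l1.
rewrite (_ : (fun t => complex.Re (_ * f t)) = (fun t => complex.Im (f t)))//.
by apply/funext => t; case: (f t) => a b /=; rewrite mul0r sub0r mulN1r opprK.
Qed.

Lemma cnrm_ge0 f : 0 <= nrm XC f.
Proof. by apply: sup_nneg => _ [l _ <-]; exact: rs_ge0. Qed.

Lemma ccarrierD f g : carrier XC f -> carrier XC g -> carrier XC (fun t => f t + g t).
Proof.
move=> [fr fi] [gr gi]; split.
  have := rsD rX fr gr.
  rewrite (_ : (fun t => complex.Re (f t + g t)) = (fun t => complex.Re (f t) + complex.Re (g t)))//.
  by apply/funext => t; case: (f t) => a b; case: (g t).
have := rsD rX fi gi.
rewrite (_ : (fun t => complex.Im (f t + g t)) = (fun t => complex.Im (f t) + complex.Im (g t)))//.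
by apply/funext => t; case: (f t) => a b; case: (g t).
Qed.

Lemma cnrm_tri f g : carrier XC f -> carrier XC g ->
  nrm XC (fun t => f t + g t) <= nrm XC f + nrm XC g.
Proof.
move=> Xf Xg; apply: cnrm_ub => l l1.
have cl h : carrier XC h -> carrier X (fun t => complex.Re (l * h t)).
  move=> [hr hi]; have := rsD rX (rsZ rX (complex.Re l) hr) (rsZ rX (- complex.Im l) hi).
  rewrite (_ : (fun t => complex.Re (l * h t)) = (fun t => complex.Re l * complex.Re (h t) + - complex.Im l * complex.Im (h t)))//.
  by apply/funext => t; case: l {l1} => a b; case: (h t) => x y /=; rewrite mulNr.
have := rs_tri rX (cl _ Xf) (cl _ Xg).
rewrite (_ : (fun t => complex.Re (l * (f t + g t))) = (fun t => complex.Re (l * f t) + complex.Re (l * g t))).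
  by move/le_trans; apply; apply: lerD; exact: crot_le_nrm.
apply/funext => t; rewrite mulrDr.
by case: (l * f t) => a b; case: (l * g t).
Qed.

End Complexification.

Section SumSpace.
Variables (R : realType) (V : lmodType R[i]) (X0 X1 : nspace R V).
Hypotheses (n0 : forall x, 0 <= nrm X0 x) (n1 : forall x, 0 <= nrm X1 x).

Lemma sum_ge0 x : 0 <= nrm (sum_space X0 X1) x.
Proof. by apply: inf_nneg => _ [a [b [_ _ _ ->]]]; rewrite addr_ge0. Qed.

Lemma sum_le a b : carrier X0 a -> carrier X1 b ->
  nrm (sum_space X0 X1) (a + b) <= nrm X0 a + nrm X1 b.
Proof.
move=> Xa Xb; apply: inf_le_mem; last by exists a, b.
by move=> _ [a' [b' [_ _ _ ->]]]; rewrite addr_ge0.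
Qed.

Lemma sum_split x e : carrier (sum_space X0 X1) x -> 0 < e -> exists a b,
  [/\ carrier X0 a, carrier X1 b, x = a + b & nrm X0 a + nrm X1 b < nrm (sum_space X0 X1) x + e].
Proof.
move=> [a [b [Xa Xb xab]]] e0.
pose E := [set r | exists x0 x1,
     [/\ carrier X0 x0, carrier X1 x1, x = x0 + x1 & r = nrm X0 x0 + nrm X1 x1]].
have E0 y : E y -> 0 <= y by move=> [a' [b' [_ _ _ ->]]]; rewrite addr_ge0.
have Eab : E (nrm X0 a + nrm X1 b) by exists a, b.
have [_ [a' [b' [Xa' Xb' xab' ->]]] H] := inf_approx E0 Eab e0.
by exists a', b'.
Qed.

End SumSpace.

(** * The analytic family of powers of t *)

Section SmoothComplex.
Variable R : realType.
Definition smoothc (G G' : R -> R[i]) := [/\ forall n, posC n (fun t => complex.Re (G t)),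
  forall n, posC n (fun t => complex.Im (G t)),
  forall t : R, 0 < t -> is_derive t (1 : R) (fun t => complex.Re (G t)) (complex.Re (G' t)) &
  forall t : R, 0 < t -> is_derive t (1 : R) (fun t => complex.Im (G t)) (complex.Im (G' t))].

Lemma complexReM (a b : R[i]) : complex.Re (a * b) = complex.Re a * complex.Re b + -1 * (complex.Im a * complex.Im b).
Proof. by case: a b => [a1 a2] [b1 b2] /=; rewrite mulN1r. Qed.

Lemma complexImM (a b : R[i]) : complex.Im (a * b) = complex.Re a * complex.Im b + complex.Im a * complex.Re b.
Proof. by case: a b => [a1 a2] [b1 b2] /=. Qed.

Lemma complexReD (a b : R[i]) : complex.Re (a + b) = complex.Re a + complex.Re b.
Proof. by case: a b => [a1 a2] [b1 b2]. Qed.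

Lemma complexImD (a b : R[i]) : complex.Im (a + b) = complex.Im a + complex.Im b.
Proof. by case: a b => [a1 a2] [b1 b2]. Qed.

Lemma smoothc_real (m m' : R -> R) : (forall n, posC n m) ->
  (forall t : R, 0 < t -> is_derive t (1 : R) m (m' t)) ->
  smoothc (fun t => (m t)%:C) (fun t => (m' t)%:C).
Proof.
move=> cm dm; split => //=; first by move=> n; exact: posC_cst.
by move=> t t0; exact: is_derive_cst.
Qed.

Lemma smoothc_cst (c : R[i]) : smoothc (fun=> c) (fun=> 0).
Proof.
by split => [n|n|t t0|t t0]; do ?exact: posC_cst; exact: is_derive_cst.
Qed.

Lemma smoothcD (G H G' H' : R -> R[i]) : smoothc G G' -> smoothc H H' ->
  smoothc (fun t => G t + H t) (fun t => G' t + H' t).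
Proof.
move=> [g1 g2 g3 g4] [h1 h2 h3 h4]; split.
- by move=> n; apply: posC_eq (posCD (g1 n) (h1 n)) => t _; rewrite complexReD.
- by move=> n; apply: posC_eq (posCD (g2 n) (h2 n)) => t _; rewrite complexImD.
- move=> t t0; under eq_fun do rewrite complexReD; rewrite complexReD; exact: is_deriveD (g3 t t0) (h3 t t0).
- move=> t t0; under eq_fun do rewrite complexImD; rewrite complexImD; exact: is_deriveD (g4 t t0) (h4 t t0).
Qed.

Lemma smoothcM (G H G' H' : R -> R[i]) : smoothc G G' -> smoothc H H' ->
  smoothc (fun t => G t * H t) (fun t => G' t * H t + G t * H' t).
Proof.
move=> [g1 g2 g3 g4] [h1 h2 h3 h4]; split.
- move=> n; apply: posC_eq (posCD (posCM (g1 n) (h1 n)) (posCM (posC_cst n (-1)) (posCM (g2 n) (h2 n)))) => t _.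
  by rewrite complexReM.
- move=> n; apply: posC_eq (posCD (posCM (g1 n) (h2 n)) (posCM (g2 n) (h1 n))) => t _.
  by rewrite complexImM.
- move=> t t0; under eq_fun do rewrite complexReM.
  apply: (is_derive_eq (is_deriveD (is_deriveM (g3 t t0) (h3 t t0)) (is_deriveZ (-1) (is_deriveM (g4 t t0) (h4 t t0))))).
  by rewrite complexReD !complexReM /GRing.scale/=; ring.
- move=> t t0; under eq_fun do rewrite complexImM.
  apply: (is_derive_eq (is_deriveD (is_deriveM (g3 t t0) (h4 t t0)) (is_deriveM (g4 t t0) (h3 t t0)))).
  by rewrite complexImD !complexImM /GRing.scale/=; ring.
Qed.

Lemma smoothc_ln (k : R) : smoothc (fun t => (k * ln t)%:C) (fun t => (k / t)%:C).
Proof.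
have d (t : R) : 0 < t -> is_derive t (1 : R) (fun t => k * ln t) (k / t).
  by move=> t0; apply: (is_derive_eq (is_deriveZ k (is_derive1_ln t0))).
apply: smoothc_real => // -[//|n]; exists (fun t => k / t) => //.
apply: posCM; first exact: posC_cst.
apply: posC_eq (@powcos_posC R n (-1) 0 0) => t t0.
by rewrite /powcos mul0r addr0 cos0 mulr1 mulN1r expRN lnK.
Qed.

Lemma smoothc_exp (z : R[i]) (k : R) :
  smoothc (fun t => cexp (z * (k * ln t)%:C)) (fun t => z * (k / t)%:C * cexp (z * (k * ln t)%:C)).
Proof.
pose a := complex.Re z * k; pose b := complex.Im z * k.
have reE t : complex.Re (cexp (z * (k * ln t)%:C)) = powcos a b 0 t.
  by rewrite /cexp /powcos /a /b; case: z {a b} => x y /=; rewrite !mulr0 subr0 add0r addr0 !mulrA.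
have imE t : complex.Im (cexp (z * (k * ln t)%:C)) = -1 * powcos a b (pi / 2) t.
  rewrite /cexp /powcos /a /b; case: z {a b reE} => x y /=; rewrite !mulr0 subr0 add0r !mulrA.
  by rewrite cosDpihalf mulN1r mulrN mulNr opprK.
have pcS c t : 0 < t -> powcos (a - 1) b c t = powcos a b c t / t.
  by move=> t0; rewrite /powcos mulrBl mul1r expRD expRN lnK ?posrE// mulrAC.
have pcpi t : powcos a b pi t = - powcos a b 0 t.
  by rewrite /powcos cosDpi addr0 mulrN.
split.
- by move=> n; apply: posC_eq (powcos_posC n a b 0) => t _; rewrite reE.
- move=> n; apply: posC_eq (posCM (posC_cst n (-1)) (powcos_posC n a b (pi / 2))) => t _.
  by rewrite imE.
- move=> t t0; under eq_fun do rewrite reE.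
  apply: (is_derive_eq (powcos_is_derive a b 0 t0)).
  rewrite !complexReM !complexImM reE imE /= add0r !pcS// /a /b; ring.
- move=> t t0; under eq_fun do rewrite imE.
  apply: (is_derive_eq (is_deriveZ (-1) (powcos_is_derive a b (pi / 2) t0))).
  rewrite !complexImM !complexReM reE imE /= !pcS// -splitr pcpi /GRing.scale/= /a /b; ring.
Qed.

End SmoothComplex.

Section ComplexMultiplier.
Variables (R : realType) (p : R).
Hypothesis p1 : 1 < p.

(** For |l| = 1, Re (l G x) = Re (l G) Re x - Im (l G) Im x: two products, to each of which
    [smooth_multiplier0] applies with constant 5 A. *)
Lemma complex_multiplier (b b' g A : R) (G G' : R -> R[i]) (x : R -> R[i]) :
  b' + g * p = b -> 0 <= A -> smoothc G G' ->
  (forall t, 0 < t -> normc (G t) <= A * t `^ g) ->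
  (forall t, 0 < t -> t * normc (G' t) <= A * t `^ g) ->
  carrier (complexification (Y1p p b)) x ->
  carrier (complexification (W1p0 p b')) (fun t => G t * x t) /\
  nrm (complexification (W1p0 p b')) (fun t => G t * x t) <=
    10 * A * nrm (complexification (Y1p p b)) x.
Proof.
move=> bb A0 sG GA GA' Yx; have [Yr Yi] := Yx.
have rW := W1p0_rspace p1 b'; have rY := Y1p_rspace p1 b.
have key (l : R[i]) : normc l = 1 ->
    carrier (W1p0 p b') (fun t => complex.Re (l * (G t * x t))) /\
    nrm (W1p0 p b') (fun t => complex.Re (l * (G t * x t))) <=
      10 * A * nrm (complexification (Y1p p b)) x.
  move=> l1; have [s1 s2 s3 s4] := smoothcM (smoothc_cst l) sG.
  have lG t : normc (l * G t) = normc (G t) by rewrite normcM l1 mul1r.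
  have lG' t : normc (0 * G t + l * G' t) = normc (G' t) by rewrite mul0r add0r normcM l1 mul1r.
  have bRe t : 0 < t -> `|complex.Re (l * G t)| <= A * t `^ g.
    by move=> t0; apply: (le_trans (Re_le_normc _)); rewrite lG GA.
  have bIm t : 0 < t -> `|complex.Im (l * G t)| <= A * t `^ g.
    by move=> t0; apply: (le_trans (Im_le_normc _)); rewrite lG GA.
  have bRe' t : 0 < t -> `|t * complex.Re (0 * G t + l * G' t)| <= A * t `^ g.
    move=> t0; apply: (le_trans _ (GA' t t0)); rewrite normrM (gtr0_norm t0) ler_wpM2l ?(ltW t0)//.
    by apply: (le_trans (Re_le_normc _)); rewrite lG'.
  have bIm' t : 0 < t -> `|t * complex.Im (0 * G t + l * G' t)| <= A * t `^ g.
    move=> t0; apply: (le_trans _ (GA' t t0)); rewrite normrM (gtr0_norm t0) ler_wpM2l ?(ltW t0)//.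
    by apply: (le_trans (Im_le_normc _)); rewrite lG'.
  have [c1 k1] := smooth_multiplier0 p1 bb A0 s1 s3 bRe bRe' Yr.
  have [c2 k2] := smooth_multiplier0 p1 bb A0 s2 s4 bIm bIm' Yi.
  have E : (fun t => complex.Re (l * (G t * x t))) = (fun t =>
      complex.Re (l * G t) * complex.Re (x t) + -1 * (complex.Im (l * G t) * complex.Im (x t))).
    by apply/funext => t; rewrite mulrA complexReM.
  have c2' := rsZ rW (-1) c2.
  rewrite E; split; first exact: (rsD rW c1 c2').
  apply: (le_trans (rs_tri rW c1 c2')).
  have h2 := rs_hom rW (-1) c2; rewrite normrN normr1 mul1r in h2.
  rewrite h2.
  have hr := ler_wpM2l (mulr_ge0 (ler0n R 5) A0) (cnrm_Re rY Yx).
  have hi := ler_wpM2l (mulr_ge0 (ler0n R 5) A0) (cnrm_Im rY Yx).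
  apply: (le_trans (lerD k1 k2)); apply: (le_trans (lerD hr hi)).
  by rewrite -!mulrDl -natrD.
split; last by apply: cnrm_ub => l /key[].
split.
  have l1 : normc (1 : R[i]) = 1 by rewrite -[1]/(1%:C) normc_real normr1.
  by have [+ _] := key 1 l1; under eq_fun do rewrite mul1r.
have l1 : normc (0 -i* 1 : R[i]) = 1 by rewrite /normc expr0n/= add0r sqrrN expr1n sqrtr1.
have [+ _] := key _ l1.
rewrite (_ : (fun t => complex.Re (_ * (_ * _))) = (fun t => complex.Im (G t * x t)))//.
by apply/funext => t; case: (G t * x t) => c d /=; rewrite mul0r sub0r mulN1r opprK.
Qed.

End ComplexMultiplier.

Section ExponentialFamily.
Variable R : realType.
Implicit Types (z w h d : R[i]) (b : R[i] -> R[i]) (s th j c r e : R).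

(** The power t^(kap (z - th)), in the variable s = kap ln t. *)
Definition expfam th z s : R[i] := cexp ((z - th%:C) * s%:C).

Lemma Re_mul_real z s : complex.Re (z * s%:C) = complex.Re z * s.
Proof. by case: z => x y /=; rewrite mulr0 subr0. Qed.

(** The first factor is the size of the family on the line Re z = j. *)
Lemma normc_expfam th z s j :
  normc (expfam th z s) = expR ((j - th) * s) * expR ((complex.Re z - j) * s).
Proof.
rewrite /expfam normc_cexp Re_mul_real -expRD; congr expR.
by case: z => x y /=; ring.
Qed.

Lemma expfam_add th z h s : expfam th (z + h) s = expfam th z s * cexp (h * s%:C).
Proof. by rewrite /expfam -cexpD; congr cexp; ring. Qed.

Lemma normc_mul_real h s : normc (h * s%:C) = normc h * `|s|.
Proof. by rewrite normcM normc_real. Qed.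

Lemma normc_cexp_le w : normc (cexp w) <= expR (normc w).
Proof. by rewrite normc_cexp ler_expR; apply: (le_trans (ler_norm _)); exact: Re_le_normc. Qed.

(** Continuity in z, uniformly for bounded s. *)
Lemma expfam_cont b th z j (S0 : R) : `|complex.Re z - j| <= 1 -> 0 <= S0 ->
  (forall e : R, 0 < e -> exists2 d : R, 0 < d & forall w, normc (w - z) < d -> normc (b w - b z) < e) ->
  forall e : R, 0 < e -> exists2 d : R, 0 < d & forall w, normc (w - z) < d -> forall s, `|s| <= S0 ->
    normc (b w * expfam th w s - b z * expfam th z s) <= e * expR ((j - th) * s).
Proof.
move=> zj S00 cb e e0.
pose E := expR S0; have E0 : 0 < E by exact: expR_gt0.
pose L := S0 + 4 * S0 ^+ 2 * E.
have L0 : 0 <= L by rewrite addr_ge0// !mulr_ge0 ?sqr_ge0// ltW.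
pose B := normc (b z); have B0 : 0 <= B by exact: normc_ge0.
have eE0 : 0 < e / (2 * E * E) by rewrite divr_gt0// !mulr_gt0.
have [d1 d10 H1] := cb _ eE0.
pose d2 := e / (2 * E * (B * L + 1)).
have d20 : 0 < d2 by rewrite divr_gt0// !mulr_gt0// ltr_wpDl// mulr_ge0.
exists (Num.min 1 (Num.min d1 d2)); first by rewrite !lt_min ltr01 d10.
move=> w; rewrite !lt_min => /and3P[h1 hd1 hd2] s sS.
set h := w - z in h1 hd1 hd2.
have wE : w = z + h by rewrite /h addrC subrK.
rewrite wE expfam_add.
have -> : b (z + h) * (expfam th z s * cexp (h * s%:C)) - b z * expfam th z s =
  expfam th z s * ((b (z + h) - b z) * cexp (h * s%:C) + b z * ((cexp (h * s%:C) - 1 - h * s%:C) + h * s%:C)) by ring.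
rewrite normcM (normc_expfam th z s j).
have hs : normc (h * s%:C) <= S0.
  by rewrite normc_mul_real -[leRHS]mul1r ler_pM ?normc_ge0// ltW.
have x1 : expR ((complex.Re z - j) * s) <= E.
  rewrite ler_expR; apply: (le_trans (ler_norm _)); rewrite normrM -[leRHS]mul1r.
  exact: ler_pM.
have x2 : normc (cexp (h * s%:C)) <= E.
  by apply: (le_trans (normc_cexp_le _)); rewrite ler_expR.
have x3 : normc ((cexp (h * s%:C) - 1 - h * s%:C) + h * s%:C) <= normc h * L.
  apply: (le_trans (le_normcD _ _)); rewrite addrC /L mulrDr; apply: lerD.
    by rewrite normc_mul_real ler_wpM2l ?normc_ge0.
  apply: (le_trans (cexp_taylor _)).
  have -> : normc h * (4 * S0 ^+ 2 * E) = 4 * (normc h * S0 ^+ 2) * E by ring.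
  apply: ler_pM; rewrite ?mulr_ge0 ?sqr_ge0 ?expR_ge0 ?ler_expR ?normc_ge0//.
  rewrite ler_pM2l// normc_mul_real exprMn; apply: ler_pM; rewrite ?sqr_ge0//.
    by rewrite expr2 ler_piMl ?normc_ge0// ltW.
  by rewrite lerXn2r ?nnegrE.
have x4 : normc (b (z + h) - b z) <= e / (2 * E * E) by rewrite -wE ltW// H1.
have tot : normc ((b (z + h) - b z) * cexp (h * s%:C) + b z * ((cexp (h * s%:C) - 1 - h * s%:C) + h * s%:C)) <= e / E.
  apply: (le_trans (le_normcD _ _)); rewrite !normcM.
  have y1 : normc (b (z + h) - b z) * normc (cexp (h * s%:C)) <= e / (2 * E * E) * E.
    by apply: ler_pM; rewrite ?normc_ge0.
  have y2 : normc (b z) * normc (cexp (h * s%:C) - 1 - h * s%:C + h * s%:C) <= B * (d2 * L).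
    rewrite ler_wpM2l//; apply: (le_trans x3); rewrite ler_wpM2r//; exact: ltW.
  have y3 : B * (d2 * L) <= e / (2 * E).
    have -> : B * (d2 * L) = e / (2 * E) * (B * L / (B * L + 1)).
      by rewrite /d2; field; rewrite !gt_eqF// ltr_wpDl// mulr_ge0.
    rewrite ler_piMr ?divr_ge0 ?mulr_ge0 ?(ltW e0) ?(ltW E0)// ler_pdivrMr ?mul1r ?lerDl//.
    by rewrite ltr_wpDl// mulr_ge0.
  have -> : e / E = e / (2 * E * E) * E + e / (2 * E) by field; rewrite gt_eqF.
  by apply: lerD => //; exact: le_trans y3.
have e_ge := expR_ge0 ((j - th) * s).
rewrite [leRHS]mulrC -mulrA ler_wpM2l//.
have -> : e = E * (e / E) by field; rewrite gt_eqF.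
by apply: ler_pM; rewrite ?expR_ge0 ?normc_ge0.
Qed.

(** Uniform complex differentiability in z over all s: the remainder is quadratic in h s, and the
    hypothesis gives a margin e^(- r |s|) that absorbs every power of s and the factor e^(|h s|). *)
Lemma expfam_diff b d th z j c r : 0 < r -> 0 <= c -> cdiff b z d ->
  forall e : R, 0 < e -> exists2 dl : R, 0 < dl & forall h, h != 0 -> normc h < dl ->
    forall s, (complex.Re z - j) * s <= c - r * `|s| ->
    normc (h^-1 * (b (z + h) * expfam th (z + h) s - b z * expfam th z s) -
      (d + b z * s%:C) * expfam th z s) <= e * expR ((j - th) * s).
Proof.
move=> r0 c0 db e e0.
pose E := expR c; have E0 : 0 < E by exact: expR_gt0.
pose B := normc (b z) + 1; have B0 : 0 < B by rewrite ltr_wpDl ?normc_ge0.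
have r4 : 0 < 1 + 4 / r by rewrite addr_gt0// divr_gt0.
pose e1 := e / (3 * E * (1 + 4 / r)).
have e10 : 0 < e1 by rewrite divr_gt0// !mulr_gt0.
have [d1 d10 H1] := db e1 e10.
have me0 : 0 < Num.min 1 e1 by rewrite lt_min ltr01.
have [d2 d20 H2] := cdiff_cont db me0.
pose d3 := e * r ^+ 2 / (192 * B * E).
have d30 : 0 < d3 by rewrite divr_gt0 ?mulr_gt0 ?exprn_gt0.
exists (Num.min (Num.min d1 d2) (Num.min d3 (r / 2))).
  by rewrite !lt_min d10 d20 d30 divr_gt0.
move=> h hn0; rewrite !lt_min => /andP[/andP[hd1 hd2] /andP[hd3 hr]] s hs.
set N := normc h in hd1 hd2 hd3 hr *.
have N0 : 0 < N.
  rewrite lt_neqAle normc_ge0 andbT eq_sym; apply/negP => /eqP/eq0_normc/eqP.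
  by rewrite (negbTE hn0).
have := H2 (z + h); rewrite addrAC subrr add0r => /(_ hd2); rewrite lt_min => /andP[hb1 hbe].
have -> : h^-1 * (b (z + h) * expfam th (z + h) s - b z * expfam th z s) - (d + b z * s%:C) * expfam th z s =
  expfam th z s * (b (z + h) * (h^-1 * (cexp (h * s%:C) - 1 - h * s%:C)) +
    h^-1 * (b (z + h) - b z - d * h) + (b (z + h) - b z) * s%:C).
  by rewrite expfam_add; field.
rewrite normcM (normc_expfam th z s j) -mulrA [leRHS]mulrC ler_wpM2l ?expR_ge0//.
pose sg := `|s|; have sg0 : 0 <= sg by exact: normr_ge0.
pose y := expR (r * sg / 4).
have y1 : 1 <= y by rewrite -expR0 ler_expR divr_ge0// mulr_ge0// ltW.
have y0 : 0 < y by exact: expR_gt0.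
have sy : sg <= 4 * y / r.
  rewrite ler_pdivlMr//; have := expR_ge1Dx (r * sg / 4); rewrite -/y => hy.
  have -> : sg * r = 4 * (r * sg / 4) by field.
  by rewrite ler_pM2l//; lra.
have x1 : expR ((complex.Re z - j) * s) <= E / y ^+ 4.
  rewrite /E /y -expRM_natl -expRN -expRD ler_expR; apply: (le_trans hs).
  by rewrite /sg le_eqVlt; apply/orP; left; apply/eqP; field.
have nh : normc h^-1 = N^-1.
  have E1 : normc h^-1 * N = 1 by rewrite -normcM mulVf// -[1]/(1%:C) normc_real normr1.
  by rewrite -[RHS]mul1r -E1 mulfK// gt_eqF.
have bB : normc (b (z + h)) <= B.
  have -> : b (z + h) = b z + (b (z + h) - b z) by ring.
  by apply: (le_trans (le_normcD _ _)); rewrite lerD2l ltW.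
have t1 : normc (b (z + h) * (h^-1 * (cexp (h * s%:C) - 1 - h * s%:C))) <= 64 * B * N / r ^+ 2 * y ^+ 4.
  rewrite !normcM nh.
  have c1 : normc (cexp (h * s%:C) - 1 - h * s%:C) <= 4 * (N * (4 * y / r)) ^+ 2 * y ^+ 2.
    apply: (le_trans (cexp_taylor _)).
    have h1 : normc (h * s%:C) <= N * (4 * y / r) by rewrite normc_mul_real ler_wpM2l// ltW.
    apply: ler_pM; rewrite ?mulr_ge0 ?sqr_ge0 ?expR_ge0 ?normc_ge0//.
      by rewrite ler_pM2l// lerXn2r ?nnegrE ?normc_ge0// (le_trans _ h1) ?normc_ge0.
    rewrite /y -expRM_natl ler_expR normc_mul_real -/sg -/N.
    have -> : 2%:R * (r * sg / 4) = (r / 2) * sg by field.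
    by rewrite ler_wpM2r// ltW.
  have -> : 64 * B * N / r ^+ 2 * y ^+ 4 = B * (N^-1 * (4 * (N * (4 * y / r)) ^+ 2 * y ^+ 2)).
    by field; rewrite !gt_eqF.
  apply: ler_pM; rewrite ?mulr_ge0 ?normc_ge0 ?invr_ge0 ?(ltW N0)//.
  by rewrite ler_wpM2l// invr_ge0 ltW.
have t2 : normc (h^-1 * (b (z + h) - b z - d * h)) <= e1.
  rewrite normcM nh mulrC ler_pdivrMr//; exact: H1.
have t3 : normc ((b (z + h) - b z) * s%:C) <= e1 * (4 * y / r).
  by rewrite normc_mul_real ler_pM ?normc_ge0// ltW.
have tot : normc (b (z + h) * (h^-1 * (cexp (h * s%:C) - 1 - h * s%:C)) +
    h^-1 * (b (z + h) - b z - d * h) + (b (z + h) - b z) * s%:C) <=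
    (64 * B * N / r ^+ 2 + e1 + e1 * (4 / r)) * y ^+ 4.
  apply: (le_trans (le_normcD _ _)); rewrite [leRHS]mulrDl; apply: lerD.
    apply: (le_trans (le_normcD _ _)); rewrite [leRHS]mulrDl; apply: lerD => //.
    by apply: (le_trans t2); rewrite ler_peMr ?(ltW e10)// exprn_ege1.
  apply: (le_trans t3); have -> : e1 * (4 * y / r) = e1 * (4 / r) * y by ring.
  have e40 : 0 <= e1 * (4 / r) by apply: mulr_ge0; [exact: ltW|rewrite divr_ge0// ltW].
  by rewrite (ler_wpM2l e40)// ler_eXnr.
apply: (@le_trans _ _ (E / y ^+ 4 * ((64 * B * N / r ^+ 2 + e1 + e1 * (4 / r)) * y ^+ 4))).
  by apply: ler_pM; rewrite ?expR_ge0 ?normc_ge0.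
have -> : E / y ^+ 4 * ((64 * B * N / r ^+ 2 + e1 + e1 * (4 / r)) * y ^+ 4) =
  E * (64 * B / r ^+ 2) * N + E * (e1 * (1 + 4 / r)) by field; rewrite !gt_eqF.
have z1 : E * (64 * B / r ^+ 2) * N <= e / 3.
  have -> : e / 3 = E * (64 * B / r ^+ 2) * d3 by rewrite /d3; field; rewrite !gt_eqF.
  rewrite ler_wpM2l ?(ltW hd3)// !mulr_ge0 ?invr_ge0 ?exprn_ge0 ?(ltW E0) ?(ltW B0) ?(ltW r0)//.
have z2 : E * (e1 * (1 + 4 / r)) = e / 3.
  by rewrite /e1; move: (1 + 4 / r) r4 => X X0; field; rewrite !gt_eqF.
by rewrite z2; lra.
Qed.

(** Equal to 1 at th. The square of 1 / (z + 2) leaves one power of 1 / |z| after the factor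
    (1 + |z|) coming from differentiation in t. *)
Definition decay th z : R[i] := ((th + 2)%:C * (z + 2%:C)^-1) * ((th + 2)%:C * (z + 2%:C)^-1).

Lemma decay_th th : 0 < th -> decay th th%:C = 1.
Proof.
move=> th0; rewrite /decay -rmorphD/= mulfV ?mul1r//.
by apply/eqP => /(congr1 (@complex.Re R)) /=; lra.
Qed.

Lemma normc2_ge z : 0 <= complex.Re z -> 2 <= normc (z + 2%:C) /\ normc z <= normc (z + 2%:C) /\
  `|complex.Im z| <= normc (z + 2%:C).
Proof.
move=> z0; split; [|split].
- apply: le_trans (Re_le_normc _); apply: le_trans (ler_norm _).
  by rewrite complexReD /= lerDr.
- rewrite -(@ler_pXn2r _ 2) ?nnegrE ?normc_ge0// !sqr_normc complexReD complexImD /= addr0 lerD2r.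
  by rewrite lerXn2r ?nnegrE ?addr_ge0// lerDl.
by apply: le_trans (Im_le_normc _); rewrite complexImD /= addr0.
Qed.

Lemma add2_neq0 z : 0 <= complex.Re z -> z + 2%:C != 0.
Proof.
move=> /normc2_ge[h _]; apply/eqP => E.
by move: h; rewrite E normc0 leNgt ltr0n.
Qed.

Lemma decay_cdiff th z : 0 <= complex.Re z -> exists d, cdiff (decay th) z d.
Proof.
move=> z0.
have dV := @cdiffV R (fun w => w + 2%:C) z _ (add2_neq0 z0) (cdiffD (cdiff_id z) (cdiff_cst 2%:C z)).
have dZ := cdiffZ (th + 2)%:C dV.
by eexists; exact: (cdiffM dZ dZ).
Qed.

Lemma decay_le th z : 0 < th < 1 -> 0 <= complex.Re z ->
  normc (decay th z) * (1 + normc z) <= 18 / normc (z + 2%:C).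
Proof.
move=> /andP[th0 th1] z0; have [h2 [hz _]] := normc2_ge z0.
have n0 : 0 < normc (z + 2%:C) by exact: lt_le_trans h2.
have nV : normc (z + 2%:C)^-1 = (normc (z + 2%:C))^-1.
  have E1 : normc (z + 2%:C)^-1 * normc (z + 2%:C) = 1.
    by rewrite -normcM mulVf ?add2_neq0// -[1]/(1%:C) normc_real normr1.
  by apply: (mulIf (negbT (gt_eqF n0))); rewrite E1 mulVf// gt_eqF.
rewrite /decay !normcM nV normc_real ger0_norm; last by lra.
have m0 := normc_ge0 z.
move: (normc (z + 2%:C)) (normc z) h2 hz n0 m0 {nV} => n m h2 hz n0 m0.
have -> : (th + 2) / n * ((th + 2) / n) * (1 + m) = (th + 2) ^+ 2 * ((1 + m) / n) / n.
  by field; rewrite gt_eqF.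
rewrite ler_pM2r ?invr_gt0//; apply: (@le_trans _ _ (9 * 2)); last by rewrite -natrM.
apply: ler_pM; rewrite ?sqr_ge0//.
- by rewrite divr_ge0 ?(ltW n0)// addr_ge0.
- have -> : 9 = 3 ^+ 2 :> R by rewrite -natrX.
  by rewrite lerXn2r ?nnegrE//; lra.
by rewrite ler_pdivrMr//; lra.
Qed.

End ExponentialFamily.

(** * Truncated analytic multiples of a function of Y *)

Section Pieces.
Variables (R : realType) (p th kap j bt b' : R).
Hypotheses (p1 : 1 < p) (hth : 0 < th < 1) (hb : b' + (j - th) * kap * p = bt).
Local Notation YC := (complexification (Y1p p bt)).
Local Notation XC := (complexification (W1p0 p b')).
Implicit Types (z w d : R[i]) (b : R[i] -> R[i]) (t s c r e : R).

Local Notation sg t := (kap * ln t).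

Lemma smoothc_der (G G' G'' : R -> R[i]) : (forall t, 0 < t -> G' t = G'' t) ->
  smoothc G G' -> smoothc G G''.
Proof.
move=> E [g1 g2 g3 g4]; split => // t t0; rewrite -E//; [exact: g3|exact: g4].
Qed.

(** This shape covers the family itself (b = 0), its z-derivative, and, by
    [affine_expfam_smooth], is stable under t d/dt. *)
Definition affine_expfam d b z t : R[i] := (d + b z * (sg t)%:C) * expfam th z (sg t).
Definition affine_der1 b z : R[i] := kap%:C * (z - th%:C) * b z.
Definition affine_der0 d b z : R[i] := kap%:C * b z + kap%:C * (z - th%:C) * d.

Lemma affine_expfam_smooth d b z : smoothc (affine_expfam d b z)
  (fun t => affine_expfam (affine_der0 d b z) (affine_der1 b) z t * (t^-1)%:C).
Proof.
have s1 := smoothcD (smoothc_cst d) (smoothcM (smoothc_cst (b z)) (smoothc_ln kap)).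
apply: smoothc_der (smoothcM s1 (smoothc_exp (z - th%:C) kap)) => t t0.
by rewrite /affine_expfam /affine_der0 /affine_der1 /expfam rmorphM /=; ring.
Qed.

Lemma powR_expR_ln t : 0 < t -> t `^ ((j - th) * kap) = expR ((j - th) * sg t).
Proof. by move=> t0; rewrite /powR gt_eqF// mulrA. Qed.

Variables (eta eta' : R -> R) (K : R) (S : R -> Prop).
Hypotheses (K0 : 0 <= K) (ceta : forall n, posC n eta)
  (deta : forall t : R, 0 < t -> is_derive t (1 : R) eta (eta' t))
  (eta1 : forall t, 0 < t -> `|eta t| <= 1) (etaK : forall t, 0 < t -> `|t * eta' t| <= K)
  (etaS : forall t, 0 < t -> ~ S t -> eta t = 0 /\ eta' t = 0).

(** [complex_multiplier] for a multiplier that is controlled only on the support S of a smooth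
    cut-off. The exponent is the one that turns the weight t^bt into t^b'. *)
Lemma cutoff_multiplier (A : R) (H H' : R -> R[i]) (x : R -> R[i]) : 0 <= A -> smoothc H H' ->
  (forall t, 0 < t -> S t -> normc (H t) <= A * t `^ ((j - th) * kap)) ->
  (forall t, 0 < t -> S t -> t * normc (H' t) <= A * t `^ ((j - th) * kap)) ->
  carrier YC x -> carrier XC (fun t => (eta t)%:C * H t * x t) /\
    nrm XC (fun t => (eta t)%:C * H t * x t) <= 10 * ((K + 1) * A) * nrm YC x.
Proof.
move=> A0 sH HA HA' Yx.
have KA : 0 <= (K + 1) * A by rewrite mulr_ge0// addr_ge0.
have sG := smoothcM (smoothc_real ceta deta) sH.
have b1 t : 0 < t -> normc ((eta t)%:C * H t) <= (K + 1) * A * t `^ ((j - th) * kap).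
  move=> t0; have g0 := powR_ge0 t ((j - th) * kap); have [St|nSt] := pselect (S t); last first.
    by have [-> _] := etaS t0 nSt; rewrite mul0r normc0 mulr_ge0.
  rewrite normcM normc_real -[leLHS]/(_ * _); apply: (@le_trans _ _ (1 * (A * t `^ ((j - th) * kap)))).
    by apply: ler_pM; rewrite ?normc_ge0// ?eta1// HA.
  by rewrite mul1r -mulrA ler_peMl ?mulr_ge0// lerDr.
apply: (complex_multiplier p1 hb KA sG b1 _ Yx) => t t0.
have g0 := powR_ge0 t ((j - th) * kap); have [St|nSt] := pselect (S t); last first.
  by have [-> ->] := etaS t0 nSt; rewrite !mul0r addr0 normc0 mulr0 mulr_ge0.
apply: (@le_trans _ _ (`|t * eta' t| * normc (H t) + 1 * (t * normc (H' t)))).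
  apply: (le_trans (ler_wpM2l (ltW t0) (le_normcD _ _))).
  rewrite !normcM !normc_real mulrDr normrM (gtr0_norm t0) -mulrA lerD2l.
  by rewrite mulrCA ler_wpM2r ?eta1// mulr_ge0 ?normc_ge0// ltW.
rewrite mulrDl mulrDl; apply: lerD; last by rewrite !mul1r HA'.
by rewrite -mulrA; apply: ler_pM; rewrite ?normc_ge0// ?etaK// HA.
Qed.

Lemma piece_bound d b z c x : 0 <= c -> (forall t, 0 < t -> S t -> (complex.Re z - j) * sg t <= c) ->
  b z = 0 -> carrier YC x ->
  carrier XC (fun t => (eta t)%:C * affine_expfam d b z t * x t) /\
  nrm XC (fun t => (eta t)%:C * affine_expfam d b z t * x t) <=
    10 * ((K + 1) * (normc d * (1 + normc z) * (1 + `|kap|) * expR c)) * nrm YC x.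
Proof.
move=> c0 hS bz Yx.
have n1 : 1 <= 1 + normc z by rewrite lerDl normc_ge0.
have k1 : 1 <= 1 + `|kap| by rewrite lerDl.
have A0 : 0 <= normc d * (1 + normc z) * (1 + `|kap|) * expR c.
  by rewrite !mulr_ge0 ?normc_ge0 ?expR_ge0// (le_trans ler01).
have E t : 0 < t -> S t -> normc (expfam th z (sg t)) <= expR c * t `^ ((j - th) * kap).
  by move=> t0 St; rewrite (normc_expfam th z _ j) -powR_expR_ln// mulrC ler_wpM2r ?powR_ge0// ler_expR hS.
apply: (cutoff_multiplier A0 (affine_expfam_smooth d b z)) => // t t0 St.
  rewrite /affine_expfam bz mul0r addr0 normcM -!mulrA; apply: ler_pM; rewrite ?normc_ge0//.
  apply: (le_trans (E t t0 St)); rewrite mulrA ler_peMl//.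
    by rewrite mulr_ge0 ?expR_ge0 ?powR_ge0.
  exact: mulr_ege1.
rewrite normcM normc_real gtr0_norm ?invr_gt0// mulrC mulfVK ?gt_eqF//.
rewrite /affine_expfam /affine_der0 /affine_der1 bz !mulr0 mul0r !addr0 add0r normcM -!mulrA !normcM normc_real.
have -> : normc d * ((1 + normc z) * ((1 + `|kap|) * (expR c * t `^ ((j - th) * kap)))) =
  (1 + `|kap|) * ((1 + normc z) * normc d) * (expR c * t `^ ((j - th) * kap)) by ring.
apply: ler_pM; rewrite ?mulr_ge0 ?normc_ge0//; last exact: E.
apply: ler_pM; rewrite ?mulr_ge0 ?normc_ge0//; first by rewrite lerDr.
rewrite ler_wpM2r ?normc_ge0//; apply: (le_trans (ler_normcB _ _)).
by rewrite addrC lerD2r normc_real ger0_norm; case/andP: hth => ? ?; exact: ltW.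
Qed.

(** When kap ln t is bounded on the support, the multipliers converge uniformly, by
    [expfam_cont]. *)
Lemma piece_cont_cutoff z (S0 : R) : `|complex.Re z - j| <= 1 -> 0 <= S0 -> 0 <= complex.Re z ->
  (forall t, 0 < t -> S t -> `|sg t| <= S0) -> forall e : R, 0 < e ->
  exists2 dl : R, 0 < dl & forall w, normc (w - z) < dl -> forall x, carrier YC x ->
    carrier XC (fun t => (eta t)%:C *
      (affine_expfam (decay th w) (fun=> 0) w t - affine_expfam (decay th z) (fun=> 0) z t) * x t) /\
    nrm XC (fun t => (eta t)%:C *
      (affine_expfam (decay th w) (fun=> 0) w t - affine_expfam (decay th z) (fun=> 0) z t) * x t) <= e * nrm YC x.
Proof.
move=> zj S00 z0 hS e e0.
pose e1 := e / (10 * (K + 1)).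
have K1 : 0 < K + 1 by rewrite ltr_wpDl.
have e10 : 0 < e1 by rewrite divr_gt0// mulr_gt0.
have [d da] := decay_cdiff th z0.
pose B w := kap%:C * (w - th%:C) * decay th w.
have [d' db] : exists d', cdiff B z d'.
  by eexists; exact: (cdiffM (cdiffZ kap%:C (cdiffD (cdiff_id z) (cdiff_cst (- th%:C) z))) da).
have [d1 d10 H1] := expfam_cont th zj S00 (cdiff_cont da) e10.
have [d2 d20 H2] := expfam_cont th zj S00 (cdiff_cont db) e10.
exists (Num.min d1 d2); first by rewrite lt_min d10.
move=> w; rewrite lt_min => /andP[w1 w2] x Yx.
have U0 v t : affine_expfam (decay th v) (fun=> 0) v t = decay th v * expfam th v (sg t).
  by rewrite /affine_expfam mul0r addr0.
have U1 v t : affine_expfam (affine_der0 (decay th v) (fun=> 0) v) (affine_der1 (fun=> 0)) v t = B v * expfam th v (sg t).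
  by rewrite /affine_expfam /affine_der0 /affine_der1 !mulr0 mul0r addr0 add0r.
have sH := smoothcD (affine_expfam_smooth (decay th w) (fun=> 0) w)
  (smoothcM (smoothc_cst (-1)) (affine_expfam_smooth (decay th z) (fun=> 0) z)).
have -> : (fun t => (eta t)%:C * (affine_expfam (decay th w) (fun=> 0) w t - affine_expfam (decay th z) (fun=> 0) z t) * x t) =
  (fun t => (eta t)%:C * (affine_expfam (decay th w) (fun=> 0) w t + -1 * affine_expfam (decay th z) (fun=> 0) z t) * x t).
  by apply/funext => t; rewrite mulN1r.
have -> : e = 10 * ((K + 1) * e1) by rewrite /e1; field; rewrite gt_eqF.
apply: (cutoff_multiplier (ltW e10) sH) => // t t0 St.
  by rewrite mulN1r !U0 powR_expR_ln//; apply: H1 => //; exact: hS.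
rewrite !U1 mul0r add0r mulN1r -mulNr -mulrDl normcM normc_real gtr0_norm ?invr_gt0//.
rewrite mulrC mulfVK ?gt_eqF// powR_expR_ln//; apply: H2 => //; exact: hS.
Qed.

(** With a margin r |kap ln t| on the support, the difference quotients of the multipliers
    converge uniformly, by [expfam_diff]. *)
Lemma piece_diff z r c : 0 < r -> 0 <= c -> 0 <= complex.Re z ->
  (forall t, 0 < t -> S t -> (complex.Re z - j) * sg t <= c - r * `|sg t|) ->
  exists D : R -> R[i], forall x, carrier YC x -> carrier XC (fun t => (eta t)%:C * D t * x t) /\
    forall e : R, 0 < e -> exists2 dl : R, 0 < dl & forall h, h != 0 -> normc h < dl ->
    carrier XC (fun t => (eta t)%:C * (h^-1 * (affine_expfam (decay th (z + h)) (fun=> 0) (z + h) t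
      - affine_expfam (decay th z) (fun=> 0) z t) - D t) * x t) /\
    nrm XC (fun t => (eta t)%:C * (h^-1 * (affine_expfam (decay th (z + h)) (fun=> 0) (z + h) t
      - affine_expfam (decay th z) (fun=> 0) z t) - D t) * x t) <= e.
Proof.
move=> r0 c0 z0 hS.
have [d da] := decay_cdiff th z0.
have K1 : 0 < K + 1 by rewrite ltr_wpDl.
pose B w := kap%:C * (w - th%:C) * decay th w.
have db : cdiff B z (affine_der0 d (decay th) z).
  have := cdiffM (cdiffZ kap%:C (cdiffD (cdiff_id z) (cdiff_cst (- th%:C) z))) da.
  rewrite /affine_der0 (_ : _ + _ = kap%:C * decay th z + kap%:C * (z - th%:C) * d)//.
  by rewrite addr0 mulr1; ring.
have ufE d' b v t : affine_expfam d' b v t = (d' + b v * (sg t)%:C) * expfam th v (sg t) by [].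
have U0 v t : affine_expfam (decay th v) (fun=> 0) v t = decay th v * expfam th v (sg t).
  by rewrite /affine_expfam mul0r addr0.
have U1 v t : affine_expfam (affine_der0 (decay th v) (fun=> 0) v) (affine_der1 (fun=> 0)) v t = B v * expfam th v (sg t).
  by rewrite /affine_expfam /affine_der0 /affine_der1 !mulr0 mul0r addr0 add0r.
have Bd : affine_der1 (decay th) z = B z by [].
exists (affine_expfam d (decay th) z) => x Yx; split.
  (* The factor |kap ln t| is absorbed by the margin, since r y <= e^(r y). *)
  pose A d' (b : R[i]) := (normc d' + normc b / r) * expR c.
  have A0 (d' b : R[i]) : 0 <= A d' b.
    by rewrite mulr_ge0 ?expR_ge0// addr_ge0 ?divr_ge0 ?normc_ge0// ltW.
  have bd d' b (t : R) : 0 < t -> S t -> normc (affine_expfam d' b z t) <= A d' (b z) * t `^ ((j - th) * kap).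
    move=> t0 St; rewrite ufE normcM (normc_expfam th z _ j) -powR_expR_ln// mulrCA [leRHS]mulrC.
    rewrite ler_wpM2l ?powR_ge0//.
    have x1 : expR ((complex.Re z - j) * sg t) <= expR c * expR (- (r * `|sg t|)).
      by rewrite -expRD ler_expR hS.
    apply: (@le_trans _ _ ((normc d' + normc (b z) * `|sg t|) * (expR c * expR (- (r * `|sg t|))))).
      apply: ler_pM; rewrite ?normc_ge0 ?expR_ge0//.
      by apply: (le_trans (le_normcD _ _)); rewrite normc_mul_real.
    have y0 : 0 < expR (r * `|sg t|) by exact: expR_gt0.
    have y1 : 1 + r * `|sg t| <= expR (r * `|sg t|) by exact: expR_ge1Dx.
    have ra : 0 <= r * `|sg t| by rewrite mulr_ge0// ltW.
    rewrite expRN mulrCA /A [leRHS]mulrC; apply: ler_pM => //.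
      by rewrite divr_ge0 ?(ltW y0)// addr_ge0 ?normc_ge0// mulr_ge0 ?normc_ge0.
    rewrite mulrDl; apply: lerD.
      by rewrite ler_piMr ?normc_ge0// invf_le1//; lra.
    rewrite -mulrA ler_wpM2l ?normc_ge0// ler_pdivrMr// [leRHS]mulrC ler_pdivlMr// mulrC.
    by apply: le_trans y1; rewrite lerDr.
  have [] := @cutoff_multiplier (A d (decay th z) + A (affine_der0 d (decay th) z) (B z)) _ _ x
     (addr_ge0 (A0 _ _) (A0 _ _)) (affine_expfam_smooth d (decay th) z) _ _ Yx => //.
  - move=> t t0 St; apply: (le_trans (bd _ _ t t0 St)).
    by rewrite ler_wpM2r ?powR_ge0// lerDl.
  - move=> t t0 St; rewrite normcM normc_real gtr0_norm ?invr_gt0// mulrC mulfVK ?gt_eqF//.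
    by apply: (le_trans (bd _ _ t t0 St)); rewrite ler_wpM2r ?powR_ge0// Bd lerDr.
move=> e e0.
have rY := Y1p_rspace p1 bt.
pose e1 := e / (10 * (K + 1) * (nrm YC x + 1)).
have N1 : 0 < nrm YC x + 1 by rewrite ltr_wpDl// cnrm_ge0.
have e10 : 0 < e1 by rewrite divr_gt0// !mulr_gt0.
have [d1 d10 H1] := expfam_diff th j r0 c0 da e10.
have [d2 d20 H2] := expfam_diff th j r0 c0 db e10.
exists (Num.min d1 d2); first by rewrite lt_min d10.
move=> h hn0; rewrite lt_min => /andP[h1 h2].
have sH := smoothcD (smoothcM (smoothc_cst h^-1) (smoothcD (affine_expfam_smooth (decay th (z + h)) (fun=> 0) (z + h))
  (smoothcM (smoothc_cst (-1)) (affine_expfam_smooth (decay th z) (fun=> 0) z))))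
  (smoothcM (smoothc_cst (-1)) (affine_expfam_smooth d (decay th) z)).
set F := (fun t => (eta t)%:C * (h^-1 * _ - _) * x t).
have FE : F = (fun t => (eta t)%:C * (h^-1 * (affine_expfam (decay th (z + h)) (fun=> 0) (z + h) t +
    -1 * affine_expfam (decay th z) (fun=> 0) z t) + -1 * affine_expfam d (decay th) z t) * x t).
  by apply/funext => t; rewrite /F !mulN1r.
have [] := cutoff_multiplier (ltW e10) sH _ _ Yx.
- move=> t t0 St; rewrite !mulN1r !U0 powR_expR_ln//; apply: H1 => //; exact: hS.
- move=> t t0 St; rewrite !U1 !mul0r !add0r !mulN1r.
  rewrite (_ : _ - _ = (h^-1 * (B (z + h) * expfam th (z + h) (sg t) - B z * expfam th z (sg t)) -
    (affine_der0 d (decay th) z + B z * (sg t)%:C) * expfam th z (sg t)) * (t^-1)%:C); last first.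
    by rewrite ufE Bd; ring.
  rewrite normcM normc_real gtr0_norm ?invr_gt0// mulrC mulfVK ?gt_eqF// powR_expR_ln//.
  by apply: H2 => //; exact: hS.
rewrite -FE => cF nF; split => //; apply: (le_trans nF).
have -> : 10 * ((K + 1) * e1) * nrm YC x = e * (nrm YC x / (nrm YC x + 1)).
  by rewrite /e1; move: (nrm YC x) N1 => N N1; field; rewrite !gt_eqF.
by rewrite ler_piMr ?(ltW e0)// ler_pdivrMr// mul1r lerDl.
Qed.

End Pieces.

Section Localisation.
Variable R : realType.
Implicit Types (phi zeta : R -> R).

Lemma dist_unit_interval (a b : R) : 0 <= a <= 1 -> 0 <= b <= 1 -> `|a - b| <= 1.
Proof. by move=> /andP[? ?] /andP[? ?]; rewrite ler_norml; apply/andP; split; lra. Qed.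

(** A test function equal to 1 on the supports of two given ones, with the bounds that
    [piece_cont_cutoff] asks for. *)
Lemma test_plateau (phi psi : R -> R) : test_function phi -> test_function psi ->
  exists zeta, exists S0 : R, exists S : R -> Prop, exists K : R,
  [/\ test_function zeta, forall t, 0 <= zeta t <= 1, 0 <= K & 0 <= S0] /\
  [/\ forall t, 0 < t -> `|t * derive1 zeta t| <= K,
     forall t, 0 < t -> ~ S t -> zeta t = 0 /\ derive1 zeta t = 0,
     forall t, 0 < t -> S t -> `|ln t| <= S0 &
     forall t, zeta t * phi t = phi t /\ zeta t * psi t = psi t].
Proof.
move=> tphi tpsi.
have [a [b [a0 ab ho]]] := test_supp tphi; have [a' [b' [a'0 ab' ho']]] := test_supp tpsi.
have [K [zeta [K0 Hz]]] := plateau_family R.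
pose n := (Num.truncn (2 / a + b + 2 / a' + b')).+1.
have b0 : 0 < b by exact: lt_trans ab.
have b'0 : 0 < b' by exact: lt_trans ab'.
have a2 : 0 < 2 / a by rewrite divr_gt0.
have a'2 : 0 < 2 / a' by rewrite divr_gt0.
have [tz z01 zK z1] := Hz n.
have nb : 2 / a + b + 2 / a' + b' < n.+1%:R.
  apply: (@lt_trans _ _ n%:R); last by rewrite ltr_nat.
  by rewrite /n truncnS_gt.
have [c [d [c0 cd oz]]] := test_supp tz; have [c' [d' [c'0 cd' oz']]] := test_supp (test_derive1 tz).
pose m := Num.min c c'; pose M := Num.max d d'.
have m0 : 0 < m by rewrite lt_min c0.
exists (zeta n), (`|ln m| + `|ln M|), (fun t => m <= t <= M), K; split; split => //.
- by move=> t t0 ntm; split; [apply: oz|apply: oz'] => /andP[x1 x2]; apply: ntm;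
    rewrite /m /M ge_min le_max x1 x2 ?orbT.
- move=> t t0 /andP[mt tM]; have [t1|t1] := leP 1 t.
    rewrite ger0_norm ?ln_ge0//; apply: (@le_trans _ _ (ln M)).
      by rewrite ler_ln ?posrE//; exact: lt_le_trans tM.
    by rewrite (le_trans (ler_norm _))// lerDr.
  rewrite ler0_norm; last by rewrite ln_le0// ltW.
  apply: (@le_trans _ _ (- ln m)); first by rewrite lerN2 ler_ln ?posrE.
  by rewrite (le_trans (ler_norm _))// normrN lerDl.
move=> t.
have big (u v : R) : 0 < u -> 2 / u < n.+1%:R -> v < n.+1%:R -> u <= t <= v -> zeta n t = 1.
  move=> u0 un vn /andP[ut tv]; have [] // := z1 t; rewrite (le_lt_trans tv)// andbT.
  apply: lt_le_trans ut; rewrite ltr_pdivrMr// mulrC -ltr_pdivrMr//.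
split.
  have [tab|tab] := boolP (a <= t <= b); last by rewrite (ho t (negP tab)) mulr0.
  rewrite (big a b) ?mul1r//; lra.
have [tab|tab] := boolP (a' <= t <= b'); last by rewrite (ho' t (negP tab)) mulr0.
rewrite (big a' b') ?mul1r//; lra.
Qed.

End Localisation.

Section PieceContinuity.
Variables (R : realType) (p th kap j bt b' : R).
Hypotheses (p1 : 1 < p) (hth : 0 < th < 1) (hb : b' + (j - th) * kap * p = bt).
Local Notation YC := (complexification (Y1p p bt)).
Local Notation XC := (complexification (W1p0 p b')).
Local Notation sg t := (kap * ln t).
Variables (eta eta' : R -> R) (K c : R) (S : R -> Prop) (P : R[i] -> Prop).
Hypotheses (K0 : 0 <= K) (ceta : forall n, posC n eta)
  (deta : forall t : R, 0 < t -> is_derive t (1 : R) eta (eta' t))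
  (eta1 : forall t, 0 < t -> `|eta t| <= 1) (etaK : forall t, 0 < t -> `|t * eta' t| <= K)
  (etaS : forall t, 0 < t -> ~ S t -> eta t = 0 /\ eta' t = 0).
Hypotheses (c0 : 0 <= c) (j01 : 0 <= j <= 1) (P01 : forall z, P z -> 0 <= complex.Re z <= 1)
  (PS : forall z, P z -> forall t, 0 < t -> S t -> (complex.Re z - j) * sg t <= c).
Implicit Types (z w : R[i]) (e : R) (x : R -> R[i]).

Local Notation U z t := (affine_expfam th kap (decay th z) (fun=> 0) z t).
(** The constant of [piece_bound] for the factor [decay], up to 1 / |z + 2|. *)
Definition piece_const := 10 * ((K + 1) * (18 * (1 + `|kap|) * expR c)).

Lemma piece_const_gt0 : 0 < piece_const.
Proof.
have k1 : 0 < 1 + `|kap| by rewrite ltr_pwDl.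
by rewrite /piece_const !mulr_gt0 ?expR_gt0// ltr_wpDl.
Qed.

Lemma piece_scaled (l : R[i]) z x : normc l = 1 -> P z -> carrier YC x ->
  carrier XC (fun t => (eta t)%:C * (l * U z t) * x t) /\
  nrm XC (fun t => (eta t)%:C * (l * U z t) * x t) <= piece_const / normc (z + 2%:C) * nrm YC x.
Proof.
move=> l1 Pz Yx; have /andP[z0 z1] := P01 Pz.
have E : (fun t => (eta t)%:C * (l * U z t) * x t) =
  (fun t => (eta t)%:C * affine_expfam th kap (l * decay th z) (fun=> 0) z t * x t).
  apply/funext => t; rewrite /affine_expfam !mul0r !addr0; ring.
have [cX nX] := piece_bound p1 hth hb K0 ceta deta eta1 etaK etaS (l * decay th z) (b := fun=> 0)
  c0 (PS Pz) erefl Yx.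
rewrite E; split => //; apply: (le_trans nX).
rewrite ler_wpM2r//; first by apply: cnrm_ge0; exact: Y1p_rspace.
rewrite /piece_const -!mulrA ler_wpM2l// ler_wpM2l ?addr_ge0//.
have D := decay_le hth z0.
rewrite normcM l1 mul1r [leLHS]mulrA [leRHS](_ : _ = 18 / normc (z + 2%:C) * ((1 + `|kap|) * expR c)); last by ring.
by rewrite ler_wpM2r// mulr_ge0 ?expR_ge0// addr_ge0.
Qed.

Lemma piece_decay z x : P z -> carrier YC x ->
  carrier XC (fun t => (eta t)%:C * U z t * x t) /\
  nrm XC (fun t => (eta t)%:C * U z t * x t) <= piece_const / normc (z + 2%:C) * nrm YC x.
Proof.
move=> Pz Yx; have n1 : normc (1 : R[i]) = 1 by rewrite -[1]/(1%:C) normc_real normr1.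
have := piece_scaled n1 Pz Yx.
by under eq_fun do rewrite mul1r.
Qed.

(** The multipliers do not converge uniformly up to the boundary lines, so replace x by a test
    function, which localises to a compact part of the half-line where [piece_cont_cutoff] applies;
    the error is uniformly small by [piece_scaled]. *)
Lemma piece_cont z x : P z -> carrier YC x -> forall e, 0 < e ->
  exists2 dl : R, 0 < dl & forall w, P w -> normc (w - z) < dl ->
    carrier XC (fun t => (eta t)%:C * (U w t - U z t) * x t) /\
    nrm XC (fun t => (eta t)%:C * (U w t - U z t) * x t) <= e.
Proof.
move=> Pz Yx e e0; have [xr xi] := Yx; have C0 := piece_const_gt0.
have rY := Y1p_rspace p1 bt; have rX := W1p0_rspace p1 b'.
pose e1 := e / (4 * piece_const).
have e10 : 0 < e1 by rewrite divr_gt0// mulr_gt0.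
have [phi [tphi [cphi nphi]]] := test_dense_Y p1 xr e10.
have [psi [tpsi [cpsi npsi]]] := test_dense_Y p1 xi e10.
(* y is the test function and r the small remainder. *)
pose y t : R[i] := phi t +i* psi t; pose r t : R[i] := x t - y t.
have Yr : carrier YC r.
  split; [rewrite (_ : (fun t => _) = (fun t => complex.Re (x t) - phi t))//
         |rewrite (_ : (fun t => _) = (fun t => complex.Im (x t) - psi t))//];
  by apply/funext => t; rewrite /r; case: (x t).
have nr : nrm YC r <= e1 + e1.
  apply: (le_trans (cnrm_le_add rY Yr)).
  rewrite (_ : (fun t => complex.Re (r t)) = (fun t => complex.Re (x t) - phi t)); last first.
    by apply/funext => t; rewrite /r; case: (x t).
  rewrite (_ : (fun t => complex.Im (r t)) = (fun t => complex.Im (x t) - psi t)); last first.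
    by apply/funext => t; rewrite /r; case: (x t).
  exact: (lerD nphi npsi).
have Yy : carrier YC y.
  have back u g : carrier (Y1p p bt) u -> carrier (Y1p p bt) (fun t => u t - g t) -> carrier (Y1p p bt) g.
    move=> cu cg; have := rsD rY cu (rsZ rY (-1) cg); rewrite (_ : (fun t => _) = g)//.
    by apply/funext => t; rewrite mulN1r opprB addrC subrK.
  by split; [exact: back cphi|exact: back cpsi].
have [zeta [S0 [S1 [Kz [[tz z01 Kz0 S00] [zK zS zln zphi]]]]]] := test_plateau tphi tpsi.
have cez n : posC n (fun t => eta t * zeta t) by apply: posCM => //; exact: test_posC.
have dez (t : R) : 0 < t -> is_derive t (1 : R) (fun t => eta t * zeta t)
    (eta' t * zeta t + eta t * derive1 zeta t).
  move=> t0; apply: is_derive_eq (is_deriveM (deta t0) (test_is_derive t tz)) _.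
  by rewrite addrC [zeta t *: _]mulrC.
have zn t : `|zeta t| <= 1 by have /andP[? ?] := z01 t; rewrite ger0_norm.
have ez1 (t : R) : 0 < t -> `|eta t * zeta t| <= 1.
  by move=> t0; rewrite normrM mulr_ile1// eta1.
have ezK (t : R) : 0 < t -> `|t * (eta' t * zeta t + eta t * derive1 zeta t)| <= K + Kz.
  move=> t0; rewrite mulrDr; apply: (le_trans (ler_normD _ _)); apply: lerD.
    by rewrite mulrA normrM; apply: le_trans (ler_piMr _ (zn t)) (etaK t0).
  by rewrite mulrCA normrM; apply: le_trans (ler_piMl _ (eta1 t0)) (zK _ t0).
have ezS (t : R) : 0 < t -> ~ S1 t -> eta t * zeta t = 0 /\ eta' t * zeta t + eta t * derive1 zeta t = 0.
  by move=> t0 nS; have [-> ->] := zS t t0 nS; rewrite !mulr0 addr0.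
have /andP[Pz0 Pz1] := P01 Pz; have /andP[j0 j1] := j01.
have zj : `|complex.Re z - j| <= 1 by apply: dist_unit_interval; [exact: P01|].
have S0' (t : R) : 0 < t -> S1 t -> `|sg t| <= `|kap| * S0.
  by move=> t0 St; rewrite normrM ler_wpM2l// zln.
pose N := nrm YC y + 1; have N0 : 0 < N by rewrite ltr_wpDl// (cnrm_ge0 rY).
have e20 : 0 < e / 2 / N by rewrite !divr_gt0.
have [dl dl0 Hdl] := piece_cont_cutoff p1 hb (addr_ge0 K0 Kz0) cez dez ez1 ezK ezS zj
  (mulr_ge0 (normr_ge0 kap) S00) Pz0 S0' e20.
exists dl; first exact: dl0.
move=> w Pw wz.
have [cy ny] := Hdl w wz y Yy.
have n1 : normc (-1 : R[i]) = 1 by rewrite normcN -[1]/(1%:C) normc_real normr1.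
have [cw nw] := piece_decay Pw Yr; have [cz nz] := piece_scaled n1 Pz Yr.
have zy t : (zeta t)%:C * y t = y t.
  by rewrite /y; have [e1' e2'] := zphi t; apply/eqP; rewrite eq_complex /= !mul0r subr0 addr0 e1' e2' !eqxx.
have -> : (fun t => (eta t)%:C * (U w t - U z t) * x t) = (fun t =>
    ((eta t)%:C * U w t * r t + (eta t)%:C * (-1 * U z t) * r t)
    + (eta t * zeta t)%:C * (U w t - U z t) * y t).
  apply/funext => t; have -> : (eta t * zeta t)%:C * (U w t - U z t) * y t = (eta t)%:C * (U w t - U z t) * y t.
    by rewrite -[in RHS](zy t) rmorphM /=; ring.
  by rewrite /r; ring.
have cwz := ccarrierD rX cw cz.
split; first exact: (ccarrierD rX cwz cy).
apply: (le_trans (cnrm_tri rX cwz cy)).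
have h2 v : P v -> piece_const / normc (v + 2%:C) * nrm YC r <= e / 4.
  move=> Pv; have /andP[v0 _] := P01 Pv; have [v2 _] := normc2_ge v0.
  have -> : e / 4 = piece_const / 2 * (e1 + e1) by rewrite /e1; field; rewrite gt_eqF.
  apply: ler_pM => //; first by rewrite divr_ge0 ?(ltW C0)// (le_trans _ v2).
    exact: (cnrm_ge0 rY).
  by rewrite ler_pM2l// lef_pV2 ?posrE//; exact: lt_le_trans v2.
have hy : e / 2 / N * nrm YC y <= e / 2.
  rewrite -mulrA ler_piMr ?divr_ge0 ?(ltW e0)// mulrC ler_pdivrMr// mul1r.
  by rewrite /N lerDl.
have -> : e = (e / 4 + e / 4) + e / 2 by field.
apply: lerD; last exact: (le_trans ny hy).
apply: (le_trans (cnrm_tri rX cw cz)); apply: lerD.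
  exact: (le_trans nw (h2 w Pw)).
exact: (le_trans nz (h2 z Pz)).
Qed.

End PieceContinuity.

(** * From Y to the interpolation space *)

Section CalderonClass.
Variables (R : realType) (V : lmodType R[i]) (X0 X1 : nspace R V).
Hypotheses (n0 : forall x, 0 <= nrm X0 x) (n1 : forall x, 0 <= nrm X1 x).
Implicit Types (z w h : R[i]) (e t s : R).

Local Notation Sg := (sum_space X0 X1).
Local Notation strip z := (closed_strip z).

Lemma cvg0_le (T : Type) (F : set_system T) (FF : Filter F) (g : T -> R) :
  (forall x, 0 <= g x) -> (forall e, 0 < e -> F [set x | g x <= e]) -> g x @[x --> F] --> (0 : R).
Proof.
move=> g0 H; apply/cvgrPdist_le => e e0; apply: filterS (H e e0) => x /=.
by rewrite sub0r normrN ger0_norm.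
Qed.

(** The decay |t| |g t| <= C gives the limits at infinity. *)
Lemma boundary_build (X : nspace R V) (g : R -> V) (C : R) : (forall x, 0 <= nrm X x) ->
  (forall t, carrier X (g t)) ->
  (forall t e, 0 < e -> exists2 dl, 0 < dl & forall s, `|s - t| < dl -> nrm X (g s - g t) <= e) ->
  (forall t, nrm X (g t) * `|t| <= C) -> boundary_in X g.
Proof.
move=> nX cX gc gd.
have far e t : 0 < e -> 0 < `|t| -> C / e <= `|t| -> nrm X (g t) <= e.
  move=> e0 t0; rewrite ler_pdivrMr// mulrC => Ct.
  by rewrite -(ler_pM2r t0); exact: le_trans (gd t) Ct.
split => //.
- move=> t; apply: cvg0_le => // e e0; have [dl dl0 H] := gc t e e0.
  apply/nbhs_ballP; exists dl => //= s; rewrite /ball /= distrC => st; exact: H.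
- apply: cvg0_le => // e e0; exists (Num.max 1 (C / e)); split; first exact: num_real.
  move=> t; rewrite gt_max => /andP[t1 tC]; have t0 : 0 < t by exact: lt_trans t1.
  by apply: far => //; rewrite gtr0_norm// ltW.
- apply: cvg0_le => // e e0; exists (- Num.max 1 (C / e)); split; first exact: num_real.
  move=> t; rewrite ltrNr gt_max => /andP[t1 tC]; have t0 : t < 0 by rewrite -oppr_gt0 (lt_trans _ t1).
  by apply: far => //; rewrite ltr0_norm// ?oppr_gt0// ltW.
Qed.

Lemma sum_nrm_le a b (x : V) r s : carrier X0 a -> carrier X1 b -> x = a + b ->
  nrm X0 a <= r -> nrm X1 b <= s -> nrm Sg x <= r + s.
Proof. by move=> ca cb -> ra sb; apply: (le_trans (sum_le n0 n1 ca cb)); exact: lerD. Qed.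

(** Admissibility, checked on a decomposition f = f0 + f1 with f0 and f1 having values in the two
    spaces; the boundary values of f are not split. *)
Lemma calderon_build (f f0 f1 : R[i] -> V) (M : R) : (forall z, f z = f0 z + f1 z) ->
  (forall z, strip z -> (carrier X0 (f0 z) /\ nrm X0 (f0 z) <= M) /\
     (carrier X1 (f1 z) /\ nrm X1 (f1 z) <= M)) ->
  (forall z, strip z -> forall e, 0 < e -> exists2 dl, 0 < dl & forall w, strip w -> normc (w - z) < dl ->
     (carrier X0 (f0 w - f0 z) /\ nrm X0 (f0 w - f0 z) <= e) /\
     (carrier X1 (f1 w - f1 z) /\ nrm X1 (f1 w - f1 z) <= e)) ->
  (forall z, open_strip z -> exists d0 d1, (carrier X0 d0 /\ carrier X1 d1) /\
     forall e, 0 < e -> exists2 dl, 0 < dl & forall h, h != 0 -> normc h < dl ->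
     (carrier X0 (h^-1 *: (f0 (z + h) - f0 z) - d0) /\ nrm X0 (h^-1 *: (f0 (z + h) - f0 z) - d0) <= e) /\
     (carrier X1 (h^-1 *: (f1 (z + h) - f1 z) - d1) /\ nrm X1 (h^-1 *: (f1 (z + h) - f1 z) - d1) <= e)) ->
  boundary_in X0 (fun t => f (0 +i* t)) -> boundary_in X1 (fun t => f (1 +i* t)) ->
  carrier (calderon_class X0 X1) f.
Proof.
move=> fE fb fc fd b0 b1; split => //.
  split.
  - by move=> z sz; have [[c0 _] [c1 _]] := fb z sz; exists (f0 z), (f1 z).
  - exists (M + M) => z sz; have [[c0 m0] [c1 m1]] := fb z sz.
    exact: (sum_nrm_le c0 c1 (fE z) m0 m1).
  - move=> z sz; apply: cvg0_le => [w|e e0]; first exact: sum_ge0.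
    have e2 : 0 < e / 2 by rewrite divr_gt0.
    have [dl dl0 H] := fc z sz _ e2.
    apply/nbhs_complexP; exists dl => // w wz sw; have [[c0 m0] [c1 m1]] := H w sw wz.
    rewrite /= (splitr e); apply: (sum_nrm_le c0 c1 _ m0 m1).
    by rewrite !fE opprD addrACA.
move=> z oz; have [d0 [d1 [[cd0 cd1] H]]] := fd z oz.
exists (d0 + d1); first by exists d0, d1.
apply: cvg0_le => [w|e e0]; first exact: sum_ge0.
have e2 : 0 < e / 2 by rewrite divr_gt0.
have [dl dl0 H'] := H _ e2.
apply/nbhs_complexP; exists dl => // h hz hn0; rewrite subr0 in hz.
have [[c0 m0] [c1 m1]] := H' h hn0 hz.
rewrite /= (splitr e); apply: (sum_nrm_le c0 c1 _ m0 m1).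
by rewrite !fE !opprD addrACA scalerDr addrACA.
Qed.

Lemma calderon_nrm_le (f : R[i] -> V) C : (forall t, nrm X0 (f (0 +i* t)) <= C) ->
  (forall t, nrm X1 (f (1 +i* t)) <= C) -> nrm (calderon_class X0 X1) f <= C.
Proof.
move=> H0 H1; rewrite /= ge_max; apply/andP; split; apply: ge_sup.
- by exists (nrm X0 (f (0 +i* 0))); exists 0.
- by move=> _ [t _ <-].
- by exists (nrm X1 (f (1 +i* 0))); exists 0.
- by move=> _ [t _ <-].
Qed.

Lemma calderon_ge0 (f : R[i] -> V) : 0 <= nrm (calderon_class X0 X1) f.
Proof. by rewrite /= le_max sup_nneg// => _ [t _ <-]. Qed.

Lemma interp_le (f : R[i] -> V) th : carrier (calderon_class X0 X1) f ->
  carrier (complex_interp X0 X1 th) (f th%:C) /\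
  nrm (complex_interp X0 X1 th) (f th%:C) <= nrm (calderon_class X0 X1) f.
Proof.
move=> cf; split; first by exists f.
apply: inf_le_mem; first by move=> _ [g _ <-]; exact: calderon_ge0.
by exists f.
Qed.

Lemma interp_approx th x e : carrier (complex_interp X0 X1 th) x -> 0 < e ->
  exists f, [/\ carrier (calderon_class X0 X1) f, f th%:C = x &
    nrm (calderon_class X0 X1) f < nrm (complex_interp X0 X1 th) x + e].
Proof.
move=> [f cf fx] e0.
pose E := [set nrm (calderon_class X0 X1) f
  | f in [set f | carrier (calderon_class X0 X1) f /\ f th%:C = x]].
have E0 y : E y -> 0 <= y by move=> [g _ <-]; exact: calderon_ge0.
have Ef : E (nrm (calderon_class X0 X1) f) by exists f.
by have [_ [g [cg gx] <-] gl] := inf_approx E0 Ef e0; exists g.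
Qed.

Lemma interp_ge0 th x : 0 <= nrm (complex_interp X0 X1 th) x.
Proof. by apply: inf_nneg => _ [g _ <-]; exact: calderon_ge0. Qed.

End CalderonClass.

Section Partition.
Variable R : realType.

(** A smooth cut-off and its complement, ordered by the sign of kap: on the support of the first
    kap ln t is bounded above, on the support of the second it is bounded below. *)
Lemma log_partition (kap : R) : exists eta0 eta0' eta1 eta1' : R -> R, exists c K : R,
  [/\ 0 <= c, 0 <= K & forall t, eta0 t + eta1 t = 1] /\
  ([/\ forall n, posC n eta0, forall t : R, 0 < t -> is_derive t (1 : R) eta0 (eta0' t),
     forall t, 0 < t -> `|eta0 t| <= 1, forall t, 0 < t -> `|t * eta0' t| <= K &
     forall t, 0 < t -> ~ (kap * ln t <= c) -> eta0 t = 0 /\ eta0' t = 0] /\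
   [/\ forall n, posC n eta1, forall t : R, 0 < t -> is_derive t (1 : R) eta1 (eta1' t),
     forall t, 0 < t -> `|eta1 t| <= 1, forall t, 0 < t -> `|t * eta1' t| <= K &
     forall t, 0 < t -> ~ (- c <= kap * ln t) -> eta1 t = 0 /\ eta1' t = 0]).
Proof.
have [chi [chi' [K [[cchi dchi chi01 chiK] [chi1 chi0 chi'0 cchi']]]]] := cutoff_exists R.
have K0 : 0 <= K by apply: le_trans (chiK 0).
have sK s : 0 < s -> `|s * chi' s| <= 2 * K.
  move=> s0; have [/andP[s1 s2]|sI] := boolP (1 <= s <= 2); last first.
    by rewrite chi'0 ?mulr0 ?normr0 ?mulr_ge0//; exact/negP.
  by rewrite normrM ler_pM// gtr0_norm.
have ln20 : 0 <= ln 2 :> R by rewrite ln_ge0// ler1n.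
pose A (eta eta' : R -> R) := [/\ forall n, posC n eta,
  forall t : R, 0 < t -> is_derive t (1 : R) eta (eta' t),
  forall t, 0 < t -> `|eta t| <= 1 & forall t, 0 < t -> `|t * eta' t| <= 2 * K].
have A0 : A chi chi'.
  by split => // t t0; have /andP[? ?] := chi01 t; rewrite ger0_norm.
have A1 : A (fun t => 1 - chi t) (fun t => - chi' t).
  split.
  - move=> n; apply: posC_eq (posCD (posC_cst n 1) (posCM (posC_cst n (-1)) (cchi n))) => t _.
    by rewrite mulN1r.
  - by move=> t t0; have := is_deriveB (is_derive_cst (1 : R) t (1 : R)) (dchi t t0); rewrite sub0r.
  - by move=> t t0; have /andP[? ?] := chi01 t; rewrite ger0_norm; lra.
  - by move=> t t0; rewrite mulrN normrN; exact: sK.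
have big t : 0 < t -> 2 < t -> chi t = 0 /\ chi' t = 0.
  by move=> t0 t2; split; [apply: chi0; lra|apply: chi'0 => /andP[]; lra].
have small t : 0 < t -> t < 1 -> 1 - chi t = 0 /\ - chi' t = 0.
  by move=> t0 t1; rewrite chi1// ?ltW// subrr chi'0 ?oppr0// => /andP[]; lra.
have lnlt (t : R) : 0 < t -> ln t < 0 -> t < 1.
  by move=> t0; rewrite !ltNge; apply: contra => /ln_ge0.
have lnle2 (t : R) : 0 < t -> t <= 2 -> ln t <= ln 2 by move=> *; rewrite ler_ln// posrE.
have [k0|k0] := leP 0 kap.
  exists chi, chi', (fun t => 1 - chi t), (fun t => - chi' t), (kap * ln 2), (2 * K).
  split; first by split; rewrite ?mulr_ge0// => t; rewrite addrC subrK.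
  have [a1 a2 a3 a4] := A0; have [b1 b2 b3 b4] := A1; split; split => // t t0.
    by move=> nk; apply: big => //; rewrite ltNge; apply/negP => t2; apply: nk; rewrite ler_wpM2l// lnle2.
  move=> nk; apply: small => //; apply: lnlt => //; rewrite ltNge; apply/negP => l0; apply: nk.
  by apply: (@le_trans _ _ 0); rewrite ?oppr_le0 mulr_ge0.
exists (fun t => 1 - chi t), (fun t => - chi' t), chi, chi', (- kap * ln 2), (2 * K).
have nk0 : 0 <= - kap by rewrite oppr_ge0 ltW.
split; first by split; rewrite ?mulr_ge0// => t; rewrite subrK.
have [a1 a2 a3 a4] := A0; have [b1 b2 b3 b4] := A1; split; split => // t t0.
  move=> nk; apply: small => //; apply: lnlt => //; rewrite ltNge; apply/negP => l0; apply: nk.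
  by apply: (@le_trans _ _ 0); rewrite ?mulr_ge0// nmulr_rle0.
move=> nk; apply: big => //; rewrite ltNge; apply/negP => t2; apply: nk.
by rewrite mulNr opprK ler_wnM2l ?(ltW k0)// lnle2.
Qed.

End Partition.

Section FromY.
Variables (R : realType) (p th b0 b1 : R).
Hypotheses (p1 : 1 < p) (hth : 0 < th < 1).
Let kap := (b0 - b1) / p.
Let bt := (1 - th) * b0 + th * b1.
Local Notation YC := (complexification (Y1p p bt)).
Local Notation X0 := (complexification (W1p0 p b0)).
Local Notation X1 := (complexification (W1p0 p b1)).

Let hb0 : b0 + (0 - th) * kap * p = bt.
Proof. by rewrite /kap /bt; field; rewrite gt_eqF// (lt_trans ltr01). Qed.
Let hb1 : b1 + (1 - th) * kap * p = bt.
Proof. by rewrite /kap /bt; field; rewrite gt_eqF// (lt_trans ltr01). Qed.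

Local Notation U z t := (affine_expfam th kap (decay th z) (fun=> 0) z t).

(** On the line Re z = j the multiplier has exactly the size that matches the weights, so no
    truncation is made: the cut-off is the constant 1. *)
Lemma edge_boundary j b (hb : b + (j - th) * kap * p = bt) (x : R -> R[i]) :
  0 <= j <= 1 -> carrier YC x ->
  boundary_in (complexification (W1p0 p b)) (fun s t => U (j +i* s) t * x t) /\
  forall s, nrm (complexification (W1p0 p b)) (fun t => U (j +i* s) t * x t) <= piece_const kap 0 0 * nrm YC x.
Proof.
move=> j01 Yx; have rY := Y1p_rspace p1 bt; have rX := W1p0_rspace p1 b.
pose P (z : R[i]) := complex.Re z = j.
have ceta n : posC n (fun=> 1 : R) by exact: posC_cst.
have deta (t : R) : 0 < t -> is_derive t (1 : R) (fun=> 1 : R) 0 by move=> _; exact: is_derive_cst.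
have eta1 (t : R) : 0 < t -> `|1 : R| <= 1 by rewrite normr1.
have etaK (t : R) : 0 < t -> `|t * 0| <= (0 : R) by rewrite mulr0 normr0.
have etaS (t : R) : 0 < t -> ~ True -> (1 : R) = 0 /\ (0 : R) = 0 by [].
have P01 z : P z -> 0 <= complex.Re z <= 1 by move=> ->.
have PS z : P z -> forall t : R, 0 < t -> True -> (complex.Re z - j) * (kap * ln t) <= 0.
  by move=> -> t _ _; rewrite subrr mul0r.
have one z : (fun t => (1 : R)%:C * U z t * x t) = (fun t => U z t * x t).
  by apply/funext => t; rewrite mul1r.
have dec z : P z -> carrier (complexification (W1p0 p b)) (fun t => U z t * x t) /\
  nrm (complexification (W1p0 p b)) (fun t => U z t * x t) <= piece_const kap 0 0 / normc (z + 2%:C) * nrm YC x.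
  move=> Pz; rewrite -one.
  exact: (piece_decay p1 hth hb (lexx 0) ceta deta eta1 etaK etaS (lexx 0) P01 PS Pz Yx).
have C0 : 0 < piece_const kap 0 0 by apply: piece_const_gt0.
have Cx : 0 <= piece_const kap 0 0 * nrm YC x by rewrite mulr_ge0 ?(ltW C0)// (cnrm_ge0 rY).
have /andP[j0 j1] := j01.
split.
  apply: (@boundary_build _ _ _ _ (piece_const kap 0 0 * nrm YC x)); first exact: (cnrm_ge0 rX).
  - by move=> s; have [] := dec (j +i* s) erefl.
  - move=> s e e0.
    have [dl dl0 H] := piece_cont p1 hth hb (lexx 0) ceta deta eta1 etaK etaS (lexx 0) j01 P01 PS
      (z := j +i* s) erefl Yx e0.
    exists dl; first exact: dl0.
    move=> r rs; have [] := H (j +i* r) erefl.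
      by rewrite (_ : _ - _ = 0 +i* (r - s)) ?normc_le_ReIm /normc/= ?expr0n/= ?add0r ?sqrtr_sqr// /GRing.add/= subrr.
    move=> _; rewrite (_ : (fun t => _) = (fun t => U (j +i* r) t * x t) - (fun t => U (j +i* s) t * x t))//.
    by apply/funext => t; rewrite mul1r mulrBl.
  move=> s; have [_ n] := dec (j +i* s) erefl.
  have [n2 [_ nI]] := @normc2_ge R (j +i* s) j0.
  have np : 0 < normc ((j +i* s) + 2%:C) by exact: lt_le_trans n2.
  apply: (@le_trans _ _ (piece_const kap 0 0 / normc ((j +i* s) + 2%:C) * nrm YC x * normc ((j +i* s) + 2%:C))).
    apply: ler_pM => //; exact: (cnrm_ge0 rX).
  by rewrite mulrAC divfK ?gt_eqF.
move=> s; have [_ n] := dec (j +i* s) erefl; apply: (le_trans n).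
have [n2 _] := @normc2_ge R (j +i* s) j0.
have np : 0 < normc ((j +i* s) + 2%:C) by exact: lt_le_trans n2.
by rewrite mulrAC ler_pdivrMr// ler_peMr// (le_trans _ n2)// ler1n.
Qed.

(** The admissible function is f(z) = decay(z) t^(kap (z - th)) x(t). *)
Lemma Y_sub_interp : exists2 C : R, 0 < C & forall x, carrier YC x ->
  carrier (complex_interp X0 X1 th) x /\ nrm (complex_interp X0 X1 th) x <= C * nrm YC x.
Proof.
have rY := Y1p_rspace p1 bt; have rX0 := W1p0_rspace p1 b0; have rX1 := W1p0_rspace p1 b1.
exists (piece_const kap 0 0); first by apply: piece_const_gt0.
move=> x Yx; have Nx := cnrm_ge0 rY x.
have [eta0 [eta0' [eta1 [eta1' [c [K [[c0 K0 eta01] [[h1 h2 h3 h4 h5] [g1 g2 g3 g4 g5]]]]]]]]] := log_partition kap.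
pose f : R[i] -> R -> R[i] := fun z t => U z t * x t.
pose f0 : R[i] -> R -> R[i] := fun z t => (eta0 t)%:C * U z t * x t.
pose f1 : R[i] -> R -> R[i] := fun z t => (eta1 t)%:C * U z t * x t.
have P01 (z : R[i]) : closed_strip z -> 0 <= complex.Re z <= 1 by [].
have mulc (a s : R) : 0 <= a <= 1 -> s <= c -> a * s <= c.
  move=> /andP[a0 a1] sc; have [s0|s0] := leP 0 s; first exact: le_trans (ler_piMl s0 a1) sc.
  by apply: le_trans c0; rewrite mulr_ge0_le0// ltW.
have PS0 z : closed_strip z -> forall t : R, 0 < t -> kap * ln t <= c -> (complex.Re z - 0) * (kap * ln t) <= c.
  by move=> sz t t0 tc; rewrite subr0; apply: mulc.
have PS1 z : closed_strip z -> forall t : R, 0 < t -> - c <= kap * ln t -> (complex.Re z - 1) * (kap * ln t) <= c.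
  move=> /P01/andP[z0 z1] t t0 tc; rewrite -mulrNN opprB; apply: mulc; last by rewrite lerNl.
  by apply/andP; split; lra.
have in0 : 0 <= (0 : R) <= 1 by rewrite lexx ler01.
have in1 : 0 <= (1 : R) <= 1 by rewrite lexx ler01.
have fE (z : R[i]) : f z = f0 z + f1 z.
  apply/funext => t; rewrite /f -[RHS]/((eta0 t)%:C * U z t * x t + (eta1 t)%:C * U z t * x t).
  by rewrite -!mulrDl -rmorphD/= eta01 mul1r.
have dec0 z sz := piece_decay p1 hth hb0 K0 h1 h2 h3 h4 h5 c0 P01 PS0 (z := z) sz Yx.
have dec1 z sz := piece_decay p1 hth hb1 K0 g1 g2 g3 g4 g5 c0 P01 PS1 (z := z) sz Yx.
have con0 z sz := piece_cont p1 hth hb0 K0 h1 h2 h3 h4 h5 c0 in0 P01 PS0 (z := z) sz Yx.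
have con1 z sz := piece_cont p1 hth hb1 K0 g1 g2 g3 g4 g5 c0 in1 P01 PS1 (z := z) sz Yx.
have [bd0 bn0] := edge_boundary hb0 in0 Yx; have [bd1 bn1] := edge_boundary hb1 in1 Yx.
have cf : carrier (calderon_class X0 X1) f.
  apply: (@calderon_build _ _ _ _ _ _ _ f0 f1 (piece_const kap K c * nrm YC x)).
  - exact: (cnrm_ge0 rX0).
  - exact: (cnrm_ge0 rX1).
  - exact: fE.
  - move=> z sz; have /andP[z0 _] := P01 z sz; have [n2 _] := normc2_ge z0.
    have le : piece_const kap K c / normc (z + 2%:C) * nrm YC x <= piece_const kap K c * nrm YC x.
      rewrite ler_wpM2r// ler_pdivrMr; last exact: lt_le_trans n2.
      rewrite ler_peMr ?(le_trans _ n2) ?ler1n//; exact: ltW (piece_const_gt0 kap c K0).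
    have [c0' m0] := dec0 z sz; have [c1' m1] := dec1 z sz.
    by split; split; [exact: c0'|exact: (le_trans m0 le)|exact: c1'|exact: (le_trans m1 le)].
  - move=> z sz e e0; have [d0 d00 H0] := con0 z sz e e0; have [d1 d10 H1] := con1 z sz e e0.
    exists (Num.min d0 d1); first by rewrite lt_min d00.
    move=> w sw; rewrite lt_min => /andP[w0 w1].
    have E (eta : R -> R) : (fun t => (eta t)%:C * (U w t - U z t) * x t) =
       (fun t => (eta t)%:C * U w t * x t) - (fun t => (eta t)%:C * U z t * x t).
      by apply/funext => t; rewrite mulrBr mulrBl.
    move: (H0 w sw w0) (H1 w sw w1); rewrite !E => h0' h1'; exact: (conj h0' h1').
  - move=> z /= /andP[z0 z1].
    (* The distance of z to the two boundary lines is the margin of [piece_diff]. *)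
    pose r := Num.min (complex.Re z) (1 - complex.Re z).
    have r0 : 0 < r by rewrite lt_min z0 subr_gt0.
    have c' : 0 <= c * (1 + r) by rewrite mulr_ge0// addr_ge0// ltW.
    have mulr' (a s : R) : r <= a -> a <= 1 -> s <= c -> a * s <= c * (1 + r) - r * `|s|.
      move=> ra a1 sc; have [s0|s0] := leP 0 s.
        rewrite (ger0_norm s0); have ? : a * s <= s by rewrite ler_piMl.
        have ? : r * s <= r * c by rewrite ler_wpM2l// ltW.
        lra.
      have ? : a * s <= r * s by rewrite ler_wnM2r// ltW.
      rewrite (ltr0_norm s0) mulrN opprK; lra.
    have r1 : r <= complex.Re z /\ r <= 1 - complex.Re z by split; rewrite ge_min lexx ?orbT.
    have q0 (t : R) : 0 < t -> kap * ln t <= c ->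
        (complex.Re z - 0) * (kap * ln t) <= c * (1 + r) - r * `|kap * ln t|.
      by move=> t0 tc; rewrite subr0; apply: mulr' => //; [case: r1|exact: ltW].
    have q1 (t : R) : 0 < t -> - c <= kap * ln t ->
        (complex.Re z - 1) * (kap * ln t) <= c * (1 + r) - r * `|kap * ln t|.
      move=> t0 tc; rewrite -mulrNN opprB -normrN; apply: mulr'; last by rewrite lerNl.
        by case: r1.
      lra.
    have [D0 HD0] := piece_diff p1 hb0 K0 h1 h2 h3 h4 h5 r0 c' (ltW z0) q0.
    have [D1 HD1] := piece_diff p1 hb1 K0 g1 g2 g3 g4 g5 r0 c' (ltW z0) q1.
    have [cD0 H0] := HD0 x Yx; have [cD1 H1] := HD1 x Yx.
    exists (fun t => (eta0 t)%:C * D0 t * x t), (fun t => (eta1 t)%:C * D1 t * x t); split; first exact: (conj cD0 cD1).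
    move=> e e0; have [d0 d00 H0'] := H0 e e0; have [d1 d10 H1'] := H1 e e0.
    exists (Num.min d0 d1); first by rewrite lt_min d00.
    move=> h hn0; rewrite lt_min => /andP[w0 w1].
    have E (eta : R -> R) D : (fun t => (eta t)%:C * (h^-1 * (U (z + h) t - U z t) - D t) * x t) =
       h^-1 *: ((fun t => (eta t)%:C * U (z + h) t * x t) - (fun t => (eta t)%:C * U z t * x t))
       - (fun t => (eta t)%:C * D t * x t).
      apply/funext => t; rewrite -[RHS]/(h^-1 * ((eta t)%:C * U (z + h) t * x t - (eta t)%:C * U z t * x t)
        - (eta t)%:C * D t * x t); ring.
    move: (H0' h hn0 w0) (H1' h hn0 w1); rewrite !E => h0' h1'; exact: (conj h0' h1').
  - exact: bd0.
  - exact: bd1.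
have fth : f th%:C = x.
  apply/funext => t; rewrite /f /affine_expfam decay_th; last by case/andP: hth.
  by rewrite /expfam subrr !mul0r cexp0 addr0 !mul1r.
rewrite -fth; have [cth nth] := interp_le (cnrm_ge0 rX0) th cf.
split; first exact: cth.
rewrite fth in nth *; exact: (le_trans nth (calderon_nrm_le bn0 bn1)).
Qed.

End FromY.

Record cspace (R : realType) (V : lmodType R[i]) (X : nspace R V) : Prop := CSpace {
  csB : forall a b, carrier X a -> carrier X b -> carrier X (a - b) ;
  csZ : forall (c : R[i]) a, carrier X a -> carrier X (c *: a) ;
  cs_ge0 : forall a, 0 <= nrm X a ;
  cs_opp : forall a, carrier X a -> nrm X (- a) = nrm X a ;
  cs_tri : forall a b, carrier X a -> carrier X b -> nrm X (a + b) <= nrm X a + nrm X b }.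

(** * Functionals on the Calderon class *)

Section ThreeLines.
Variables (R : realType).
Implicit Types (z w h : R[i]) (e t s r : R).

Lemma cvg0_near (T : Type) (F : set_system T) {FF : Filter F} (g : T -> R) e :
  g x @[x --> F] --> (0 : R) -> 0 < e -> F [set x | g x < e].
Proof.
move=> /cvgrPdist_lt H e0; apply: filterS (H e e0) => x /=.
by rewrite sub0r normrN; exact: le_lt_trans (ler_norm _).
Qed.

Definition strip_continuous (F : R[i] -> R[i]) z := forall e, 0 < e -> exists2 r, 0 < r &
  forall w, 0 <= complex.Re w <= 1 -> normc (w - z) < r -> normc (F w - F z) < e.

Lemma strip_continuousD F G z : strip_continuous F z -> strip_continuous G z -> strip_continuous (fun w => F w + G w) z.
Proof.
move=> cF cG e e0; have e2 : 0 < e / 2 by rewrite divr_gt0.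
have [r1 r10 H1] := cF _ e2; have [r2 r20 H2] := cG _ e2.
exists (Num.min r1 r2); first by rewrite lt_min r10.
move=> w sw; rewrite lt_min => /andP[w1 w2]; rewrite opprD addrACA.
apply: (le_lt_trans (le_normcD _ _)); rewrite (splitr e).
exact: (ltrD (H1 w sw w1) (H2 w sw w2)).
Qed.

Lemma strip_continuousM F G z : strip_continuous F z -> strip_continuous G z -> strip_continuous (fun w => F w * G w) z.
Proof.
move=> cF cG e e0.
have small (a b : R) : 0 < b -> a < b -> e / 2 / b * a < e / 2.
  move=> b0 ab; rewrite -[ltRHS]mulr1 -[ltLHS]mulrA ltr_pM2l ?divr_gt0//.
  by rewrite mulrC ltr_pdivrMr// mul1r.
have pos (c : R[i]) : 0 < normc c + 1 by rewrite ltr_wpDl ?normc_ge0.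
have eF : 0 < e / 2 / (normc (F z) + 1) by rewrite !divr_gt0.
have eG : 0 < e / 2 / (normc (G z) + 1 + 1) by rewrite !divr_gt0// addr_gt0.
have [r1 r10 H1] := cF _ eG; have [r2 r20 H2] := cG _ eF; have [r3 r30 H3] := cG _ ltr01.
exists (Num.min r1 (Num.min r2 r3)); first by rewrite !lt_min r10 r20.
move=> w sw; rewrite !lt_min => /and3P[w1 w2 w3].
have -> : F w * G w - F z * G z = (F w - F z) * G w + F z * (G w - G z) by ring.
apply: (le_lt_trans (le_normcD _ _)); rewrite !normcM (splitr e).
have Gw : normc (G w) <= normc (G z) + 1.
  have -> : G w = G z + (G w - G z) by ring.
  by apply: (le_trans (le_normcD _ _)); rewrite lerD2l ltW// H3.
apply: ler_ltD.
  apply: (@le_trans _ _ (e / 2 / (normc (G z) + 1 + 1) * (normc (G z) + 1))).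
    by apply: ler_pM; rewrite ?normc_ge0// ltW// H1.
  by rewrite ltW// small ?ltrDl// addr_gt0.
apply: (@le_lt_trans _ _ (normc (F z) * (e / 2 / (normc (F z) + 1)))).
  by rewrite ler_wpM2l ?normc_ge0// ltW// H2.
by rewrite mulrC small// ltrDl.
Qed.

Lemma strip_continuous_sum n (F : 'I_n -> R[i] -> R[i]) z : (forall i, strip_continuous (F i) z) ->
  strip_continuous (fun w => \sum_i F i w) z.
Proof.
elim: n F => [|n IH] F HF.
  by move=> e e0; exists 1 => // w _ _; rewrite !big_ord0 subrr normc0.
have := strip_continuousD (IH _ (fun i => HF (widen_ord (leqnSn n) i))) (HF ord_max).
by congr strip_continuous; apply/funext => w; rewrite big_ord_recr.
Qed.

Lemma cdiff_strip_continuous F z d : cdiff F z d -> strip_continuous F z.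
Proof. by move=> /cdiff_cont H e /H[r r0 Hr]; exists r => // w _; exact: Hr. Qed.

Lemma open_strip_near z : 0 < complex.Re z < 1 -> exists2 r, 0 < r & forall h, normc h < r -> closed_strip (z + h).
Proof.
move=> /andP[z0 z1]; exists (Num.min (complex.Re z) (1 - complex.Re z)).
  by rewrite lt_min z0 subr_gt0.
move=> h; rewrite lt_min => /andP[hz hz']; have := Re_le_normc h; rewrite ler_norml => /andP[h1 h2].
by rewrite /closed_strip /= complexReD; apply/andP; split; lra.
Qed.

Variable V : lmodType R[i].

Lemma cs_sub (X : nspace R V) a b : cspace X -> carrier X a -> carrier X b ->
  nrm X a <= nrm X b + nrm X (a - b).
Proof. by move=> cX ca cb; rewrite -[in leLHS](subrKC b a); apply: (cs_tri cX) => //; exact: (csB cX). Qed.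

(** A continuous function tending to 0 at both ends of the line is bounded: the suprema in the
    norm of the Calderon class are genuine. *)
Lemma boundary_bounded (X : nspace R V) (g : R -> V) : cspace X -> boundary_in X g ->
  exists B : R, forall t, nrm X (g t) <= B.
Proof.
move=> cX [cg gc gp gm].
have [M1 [_ H1]] := cvg0_near gp ltr01.
have [M2 [_ H2]] := cvg0_near gm ltr01.
have cn : continuous (fun t => nrm X (g t)).
  move=> t; apply/cvgrPdist_lt => e e0.
  have [dl dl0 Hd] := (nbhs_ballP _ _).1 (cvg0_near (gc t) e0).
  apply/nbhs_ballP; exists dl => //= s /Hd /=.
  move=> ss.
  have := cs_sub cX (cg s) (cg t); have := cs_sub cX (cg t) (cg s).
  have -> : nrm X (g t - g s) = nrm X (g s - g t) by rewrite -opprB (cs_opp cX)//; exact: (csB cX).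
  by rewrite ltr_norml; lra.
pose a := Num.min M2 0 - 1; pose b := Num.max M1 0 + 1.
have [m0 m2] : Num.min M2 0 <= 0 /\ Num.min M2 0 <= M2 by rewrite !ge_min !lexx ?orbT.
have [x0 x1] : 0 <= Num.max M1 0 /\ M1 <= Num.max M1 0 by rewrite !le_max !lexx ?orbT.
have a0 : a < 0 by rewrite /a; lra.
have b0 : 0 < b by rewrite /b; lra.
have ab : a <= b by lra.
have [c _ Hc] := EVT_max ab (continuous_subspaceT cn).
exists (Num.max 1 (nrm X (g c))) => t; rewrite le_max.
have [ta|ta] := ltP t a.
  rewrite (ltW (H2 _ _))//; rewrite /a in ta; lra.
have [tb|tb] := ltP b t.
  rewrite (ltW (H1 _ _))//; rewrite /b in tb; lra.
by rewrite Hc ?orbT// in_itv/= ta tb.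
Qed.

Variables (X0 X1 : nspace R V).
Hypotheses (c0 : cspace X0) (c1 : cspace X1).
Local Notation Sg := (sum_space X0 X1).

Lemma sum_csB a b : carrier Sg a -> carrier Sg b -> carrier Sg (a - b).
Proof.
move=> [a0 [a1 [A0 A1 ->]]] [b0 [b1 [B0 B1 ->]]]; exists (a0 - b0), (a1 - b1); split.
- exact: (csB c0). - exact: (csB c1). - by rewrite opprD addrACA.
Qed.

Lemma sum_csZ (l : R[i]) a : carrier Sg a -> carrier Sg (l *: a).
Proof.
move=> [a0 [a1 [A0 A1 ->]]]; exists (l *: a0), (l *: a1); split.
- exact: (csZ c0). - exact: (csZ c1). - by rewrite scalerDr.
Qed.

Lemma calderon_boundary f : carrier (calderon_class X0 X1) f ->
  (forall t, nrm X0 (f (0 +i* t)) <= nrm (calderon_class X0 X1) f) /\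
  (forall t, nrm X1 (f (1 +i* t)) <= nrm (calderon_class X0 X1) f).
Proof.
move=> [_ _ /(boundary_bounded c0)[B0 H0] /(boundary_bounded c1)[B1 H1]].
split=> t; rewrite /= le_max; apply/orP; [left|right].
  by apply: (@mem_le_sup _ _ _ B0); [move=> _ [s _ <-]|exists t].
by apply: (@mem_le_sup _ _ _ B1); [move=> _ [s _ <-]|exists t].
Qed.

(** The sum is the value at th of F(z) = sum_k exp (lam_k (b0 + (b1 - b0) z)) L_k (f z), which
    satisfies the hypotheses of the three lines theorem; on the line Re z = j the exponential has
    modulus e^(lam_k b_j). *)
Lemma calderon_functional f th n (L : 'I_n -> V -> R[i]) (lam : 'I_n -> R) (b0 b1 M : R) :
  0 < th < 1 -> carrier (calderon_class X0 X1) f -> 0 <= M ->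
  (forall k a b, carrier Sg a -> carrier Sg b -> L k (a - b) = L k a - L k b) ->
  (forall k (l : R[i]) a, carrier Sg a -> L k (l *: a) = l * L k a) ->
  (forall k, exists2 C : R, 0 <= C & forall a, carrier Sg a -> normc (L k a) <= C * nrm Sg a) ->
  (forall a, carrier X0 a -> \sum_k expR (lam k * b0) * normc (L k a) <= M * nrm X0 a) ->
  (forall a, carrier X1 a -> \sum_k expR (lam k * b1) * normc (L k a) <= M * nrm X1 a) ->
  normc (\sum_k (expR (lam k * ((1 - th) * b0 + th * b1)))%:C * L k (f th%:C)) <=
    M * nrm (calderon_class X0 X1) f.
Proof.
move=> /andP[th0 th1] cf M0 LB LZ LC L0 L1.
pose ek k z := cexp ((lam k)%:C * (b0%:C + (b1 - b0)%:C * z)).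
pose F z := \sum_k ek k z * L k (f z).
have [bnd0 bnd1] := calderon_boundary cf.
have [[fs [K fK] fc] fd [f0 _ _ _] [f1 _ _ _]] := cf.
have ekd k z : exists d, cdiff (ek k) z d.
  have dl := cdiffZ (lam k)%:C (cdiffD (cdiff_cst b0%:C z) (cdiffZ (b1 - b0)%:C (cdiff_id z))).
  by eexists; exact: (cdiff_comp dl (cdiff_cexp _)).
have ekn k z : normc (ek k z) = expR (lam k * (b0 + (b1 - b0) * complex.Re z)).
  by rewrite normc_cexp; congr expR; case: z => u v; rewrite /= !mul0r !subr0.
have ekR k (t : R) : ek k t%:C = (expR (lam k * (b0 + (b1 - b0) * t)))%:C.
  by rewrite /ek -cexp_real -!(rmorphM, rmorphD).
have FN z : normc (F z) <= \sum_k normc (ek k z) * normc (L k (f z)).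
  rewrite /F; elim/big_ind2 : _ => [|x1 x2 y1 y2 h1 h2|k _]; first by rewrite normc0.
    by apply: le_trans (le_normcD _ _) (lerD h1 h2).
  by rewrite normcM.
have := @three_lines R F (M * nrm (calderon_class X0 X1) f).
have -> : \sum_k (expR (lam k * ((1 - th) * b0 + th * b1)))%:C * L k (f th%:C) = F th%:C.
  by apply: eq_bigr => k _; rewrite ekR; congr ((expR (_ * _))%:C * _); ring.
apply.
- move=> z oz; apply: cdiff_sum => k.
  have sz : closed_strip z by case/andP: oz => u v; rewrite /closed_strip /= !ltW.
  have [d cd dd] := fd z oz; have [de dek] := ekd k z.
  have [C C0 HC] := LC k.
  suff Ld : cdiff (fun w => L k (f w)) z (L k d) by eexists; exact: (cdiffM dek Ld).
  move=> e e0; have e1 : 0 < e / (C + 1) by rewrite divr_gt0// ltr_wpDl.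
  have [r1 r10 H1] := open_strip_near oz.
  have [r2 r20 H2] := (nbhs_complexP _ _).1 (cvg0_near dd e1).
  exists (Num.min r1 r2); first by rewrite lt_min r10.
  move=> h; rewrite lt_min => /andP[hr1 hr2].
  have [->|hn0] := eqVneq h 0; first by rewrite addr0 mulr0 subrr subr0 normc0 mulr0.
  have cq : carrier Sg (h^-1 *: (f (z + h) - f z)).
    by apply: sum_csZ; apply: sum_csB; [apply: fs; exact: H1|exact: fs].
  have -> : L k (f (z + h)) - L k (f z) - L k d * h = h * L k (h^-1 *: (f (z + h) - f z) - d).
    rewrite LB// LZ; last by apply: sum_csB; [apply: fs; exact: H1|exact: fs].
    rewrite LB; [|by apply: fs; exact: H1|exact: fs].
    by rewrite mulrBr mulVKf// [h * _]mulrC.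
  rewrite normcM mulrC ler_wpM2r ?normc_ge0//.
  apply: (le_trans (HC _ (sum_csB cq cd))).
  have := H2 h; rewrite subr0 => /(_ hr2 hn0) /ltW H; apply: (@le_trans _ _ (C * (e / (C + 1)))); first by rewrite ler_wpM2l.
  by rewrite mulrCA ler_piMr ?(ltW e0)// ler_pdivrMr ?mul1r ?lerDl// ltr_wpDl.
- move=> z sz; apply: strip_continuous_sum => k; apply: strip_continuousM; first by have [d] := ekd k z; exact: cdiff_strip_continuous.
  have [C C0 HC] := LC k; move=> e e0.
  have e1 : 0 < e / (C + 1) by rewrite divr_gt0// ltr_wpDl.
  have [r r0 H] := (nbhs_complexP _ _).1 (cvg0_near (fc z sz) e1).
  exists r => // w sw wz; rewrite -LB; [|exact: fs|exact: fs].
  apply: (le_lt_trans (HC _ (sum_csB (fs _ sw) (fs _ sz)))).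
  have Hw := H w wz sw; apply: (@le_lt_trans _ _ (C * (e / (C + 1)))); first by rewrite ler_wpM2l// ltW.
  by rewrite mulrCA gtr_pMr// ltr_pdivrMr ?mul1r ?ltrDl// ltr_wpDl.
- have /choice[C HC] : forall k, exists C : R, 0 <= C /\ forall a, carrier Sg a -> normc (L k a) <= C * nrm Sg a.
    by move=> k; have [C ? ?] := LC k; exists C.
  exists (\sum_k expR (`|lam k| * (`|b0| + `|b1 - b0|)) * (C k * K)) => z sz.
  apply: (le_trans (FN z)); apply: ler_sum => k _; have [Ck Hk] := HC k.
  apply: ler_pM; rewrite ?normc_ge0//; last first.
    by apply: (le_trans (Hk _ (fs z sz))); rewrite ler_wpM2l// fK.
  rewrite ekn ler_expR; apply: (le_trans (ler_norm _)); rewrite normrM ler_wpM2l//.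
  apply: (le_trans (ler_normD _ _)); rewrite lerD2l normrM ler_piMr//.
  by case/andP: sz => u v; rewrite ger0_norm.
- move=> t; apply: (le_trans (FN _)); apply: (@le_trans _ _ (M * nrm X0 (f (0 +i* t)))).
    apply: le_trans (L0 _ (f0 t)); apply: ler_sum => k _.
    by rewrite ekn /= mulr0 addr0.
  by rewrite ler_wpM2l.
- move=> t; apply: (le_trans (FN _)); apply: (@le_trans _ _ (M * nrm X1 (f (1 +i* t)))).
    apply: le_trans (L1 _ (f1 t)); apply: ler_sum => k _.
    by rewrite ekn /= mulr1 addrC subrK.
  by rewrite ler_wpM2l.
- by rewrite /= !ltW.
Qed.

End ThreeLines.

Section InterpMono.
Variables (R : realType) (V : lmodType R[i]) (X0 X1 Z0 Z1 : nspace R V).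
Hypotheses (x0 : cspace X0) (x1 : cspace X1) (z0 : cspace Z0) (z1 : cspace Z1).
Hypotheses (s0 : forall a, carrier X0 a -> carrier Z0 a) (s1 : forall a, carrier X1 a -> carrier Z1 a)
  (e0 : forall a, nrm Z0 a = nrm X0 a) (e1 : forall a, nrm Z1 a = nrm X1 a).

Lemma sum_mono a : carrier (sum_space X0 X1) a -> carrier (sum_space Z0 Z1) a /\
  nrm (sum_space Z0 Z1) a <= nrm (sum_space X0 X1) a.
Proof.
move=> ca; split.
  by have [a0 [a1 [c0 c1 E]]] := ca; exists a0, a1; split; [exact: s0|exact: s1|].
apply/ler_addgt0Pr => e ep.
have [a0 [a1 [c0 c1 E H]]] := sum_split (cs_ge0 x0) (cs_ge0 x1) ca ep.
rewrite E in H *.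
apply: (le_trans (sum_le (cs_ge0 z0) (cs_ge0 z1) (s0 c0) (s1 c1))).
by rewrite e0 e1 ltW.
Qed.

Lemma cvg0_mono (T : Type) (F : set_system T) {FF : Filter F} (g h : T -> R) :
  (forall t, 0 <= g t) -> (F [set t | g t <= h t]) ->
  h x @[x --> F] --> (0 : R) -> g x @[x --> F] --> (0 : R).
Proof.
move=> g0 gh h0; apply: cvg0_le => // e ep.
by apply: filterS2 gh (cvg0_near h0 ep) => t /= H1 H2; rewrite (le_trans H1)// ltW.
Qed.

Lemma calderon_mono f : carrier (calderon_class X0 X1) f ->
  carrier (calderon_class Z0 Z1) f /\
  nrm (calderon_class Z0 Z1) f = nrm (calderon_class X0 X1) f.
Proof.
move=> [[fs [M fM] fc] fd [b00 b01 b02 b03] [b10 b11 b12 b13]].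
have Sge := sum_ge0 (cs_ge0 z0) (cs_ge0 z1).
split; last first.
  have E0 : (fun t => nrm Z0 (f (0 +i* t))) = (fun t => nrm X0 (f (0 +i* t))) by apply/funext.
  have E1 : (fun t => nrm Z1 (f (1 +i* t))) = (fun t => nrm X1 (f (1 +i* t))) by apply/funext.
  by rewrite /= E0 E1.
split.
- split.
  + by move=> z sz; have [] := sum_mono (fs z sz).
  + by exists M => z sz; have [_ H] := sum_mono (fs z sz); exact: le_trans H (fM z sz).
  + move=> z sz; apply: cvg0_mono (fc z sz) => //.
    apply/nbhs_complexP; exists 1 => // w _ sw.
    by have [] := sum_mono (sum_csB x0 x1 (fs w sw) (fs z sz)).
- move=> z oz; have [d cd dd] := fd z oz; have [cd' _] := sum_mono cd.
  exists d => //; apply: cvg0_mono dd => //.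
  have sz : closed_strip z by case/andP: oz => u v; rewrite /closed_strip /= !ltW.
  have [r r0 Hr] := open_strip_near oz.
  apply/nbhs_complexP; exists r => // h; rewrite subr0 => hr _ /=.
  have cq : carrier (sum_space X0 X1) (h^-1 *: (f (z + h) - f z)).
    by apply: sum_csZ => //; apply: sum_csB => //; apply: fs => //; exact: Hr.
  by have [] := sum_mono (sum_csB x0 x1 cq cd).
- split=> [t|t||]; [exact: s0|..]; under eq_fun do rewrite e0.
  + exact: b01. + exact: b02. + exact: b03.
- split=> [t|t||]; [exact: s1|..]; under eq_fun do rewrite e1.
  + exact: b11. + exact: b12. + exact: b13.
Qed.

(** Larger spaces with the same norms: the sum norm can only decrease, and the boundary norms are
    unchanged. *)
Lemma interp_mono th a : carrier (complex_interp X0 X1 th) a ->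
  carrier (complex_interp Z0 Z1 th) a /\
  nrm (complex_interp Z0 Z1 th) a <= nrm (complex_interp X0 X1 th) a.
Proof.
move=> ca; have sub f : carrier (calderon_class X0 X1) f -> f th%:C = a ->
    carrier (complex_interp Z0 Z1 th) a /\
    nrm (complex_interp Z0 Z1 th) a <= nrm (calderon_class X0 X1) f.
  by move=> /calderon_mono[cf <-] <-; exact: (interp_le (cs_ge0 z0)).
split; first by have [f cf fa] := ca; have [] := sub f cf fa.
apply/ler_addgt0Pr => e ep; have [f [cf fa fe]] := interp_approx (cs_ge0 x0) ca ep.
by have [_ H] := sub f cf fa; rewrite (le_trans H)// ltW.
Qed.

End InterpMono.

Section ComplexificationSpace.
Variables (R : realType) (X : nspace R (R -> R)).
Hypothesis rX : rspace X.

Lemma ccarrierZ (l : R[i]) (f : R -> R[i]) : carrier (complexification X) f ->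
  carrier (complexification X) (fun t => l * f t).
Proof.
move=> [fr fi]; split.
  have := rsD rX (rsZ rX (complex.Re l) fr) (rsZ rX (-1 * complex.Im l) fi).
  by congr (carrier X _); apply/funext => t; rewrite -[RHS]/(complex.Re (l * f t)) complexReM mulrA.
have := rsD rX (rsZ rX (complex.Re l) fi) (rsZ rX (complex.Im l) fr).
by congr (carrier X _); apply/funext => t; rewrite -[RHS]/(complex.Im (l * f t)) complexImM.
Qed.

Lemma complexification_cspace : @cspace R (R -> R[i]) (complexification X).
Proof.
have opp (f : R -> R[i]) : carrier (complexification X) f ->
    carrier (complexification X) (- f).
  by move=> /(ccarrierZ (-1)); congr (carrier _ _); apply/funext => t; rewrite mulN1r.
split.
- by move=> f g cf cg; exact: (ccarrierD rX cf (opp g cg)).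
- by move=> l f; exact: ccarrierZ.
- exact: (cnrm_ge0 rX).
- move=> f cf; have half g : carrier (complexification X) g ->
      nrm (complexification X) (- g) <= nrm (complexification X) g.
    move=> cg; apply: cnrm_ub => l l1.
    rewrite (_ : (fun t => _) = (fun t => complex.Re (- l * g t))); last first.
      by apply/funext => t; rewrite mulNr -mulrN.
    by apply: (crot_le_nrm rX cg); rewrite normcN.
  apply: le_anti; rewrite half// -[X in nrm _ X <= _]opprK half//; exact: opp.
- exact: (cnrm_tri rX).
Qed.

End ComplexificationSpace.

(** * Duality on the half-line *)

Section Duality.
Variable R : realType.
Notation mu := (@lebesgue_measure R).
Local Notation Rplus := (`]0, +oo[%classic : set R).
Implicit Types (u v g h : R -> R) (a b c t : R).

Lemma ln_window a t : 0 < t -> expR (- a) <= t < expR a -> `|ln t| <= a.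
Proof.
move=> t0 /andP[t1 t2]; rewrite ler_norml -(ler_expR (- a)) -(ler_expR (ln t)) lnK ?posrE// t1.
exact: ltW.
Qed.

Lemma Rintegral_off (A B : set R) (f : R -> R) : measurable A -> measurable B -> A `<=` B ->
  (forall t, B t -> ~ A t -> f t = 0) -> \int[mu]_(t in A) f t = \int[mu]_(t in B) f t.
Proof.
move=> mA mB AB f0; rewrite /Rintegral integral_mkcond [in RHS]integral_mkcond.
congr fine; apply: eq_integral => t _; rewrite /patch.
have [tA|tA] := boolP (t \in A); first by rewrite mem_set//; apply: AB; exact: set_mem.
case: ifPn => // tB; rewrite f0//; first exact: set_mem.
by move=> tA'; move: tA; rewrite mem_set.
Qed.

(** Test against g = sign h |h|^(p-1) t^(b/q) on the set where e^-n <= t < e^n and |h| <= n: the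
    pairing and the q-th power of the norm of g are both the mass B of h on this set, so that
    B <= C B^(1/q), that is, B <= C^p. Let n tend to infinity. *)
Lemma mass_duality p q b C h : 1 < p -> 1 < q -> p^-1 + q^-1 = 1 -> 0 <= C ->
  locally_integrable Rplus h ->
  (forall (n : nat) g (G M : R), measurable_fun Rplus g -> (forall t, 0 < t -> `|g t| <= M) ->
     (forall t, 0 < t -> ~ (expR (- n%:R) <= t < expR n%:R) -> g t = 0) ->
     (forall t, 0 < t -> 0 <= h t * g t) -> 0 <= G -> (weighted_norm q (fun=> 1%R) g <= G%:E)%E ->
     \int[mu]_(t in Rplus) (h t * g t * t `^ (b / p)) <= C * G) ->
  (mass p (fun t => (t `^ b)%R) h <= (C `^ p)%:E)%E.
Proof.
move=> p1 q1 pq C0 lh H.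
have p0 : 0 < p by lra. have q0 : 0 < q by lra.
have mh := loc_measurable lh.
pose J (n : nat) := `[expR (- n%:R), expR n%:R[%classic : set R.
pose E (n : nat) := J n `&` (Rplus `&` h @^-1` `[- n%:R, n%:R]%classic).
have mE n : measurable (E n).
  by apply: measurableI; [exact: measurable_itv|apply: mh => //; exact: mRplus].
have EP n t : E n t <-> [/\ 0 < t, expR (- n%:R) <= t < expR n%:R & `|h t| <= n%:R].
  rewrite /E /J /= !in_itv /= andbT ler_norml; split=> [[? [? ?]]|[? ? ?]] //.
pose phi t := `|h t| `^ p * t `^ b.
have phi0 t : 0 <= phi t by rewrite mulr_ge0 ?powR_ge0.
have mphi : measurable_fun Rplus phi by exact: mass_measurable (weight_powR b) mh.
apply: (@ge0_exhaust _ E) => //.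
- apply/nondecreasing_seqP => n; apply/subsetPset => t /EP[t0 /andP[t1 t2] hn]; apply/EP; split => //.
    have nn : n%:R <= n.+1%:R :> R by rewrite ler_nat.
    by rewrite (le_trans _ t1) ?ler_expR ?lerN2//= (lt_le_trans t2)// ler_expR.
  by rewrite (le_trans hn)// ler_nat.
- rewrite eqEsubset; split=> t; first by move=> [n _ /EP[t0 _ _]]; exact/RplusE.
  move=> /RplusE t0; exists (Num.truncn (`|ln t| + `|h t|)).+1 => //; apply/EP.
  have big : `|ln t| + `|h t| < (Num.truncn (`|ln t| + `|h t|)).+1%:R by exact: truncnS_gt.
  have [lt1 lt2] : `|ln t| < (Num.truncn (`|ln t| + `|h t|)).+1%:R /\
     `|h t| < (Num.truncn (`|ln t| + `|h t|)).+1%:R.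
    by split; apply: le_lt_trans big; rewrite ?lerDl ?lerDr.
  split => //; last exact: ltW.
  move: lt1; rewrite ltr_norml => /andP[l1 l2].
  by rewrite -[t]lnK ?posrE// ler_expR ltr_expR lnK ?posrE// l2 ltW.
- by move=> t _; exact: phi0.
move=> n.
(* sign h |h|^(p-1), written without the sign; at h = 0 the product is 0 whatever the power. *)
pose g t := (\1_(E n) t * (h t * `|h t| `^ (p - 2))) * t `^ (b / q).
have hh t : h t * (h t * `|h t| `^ (p - 2)) = `|h t| `^ p.
  have [->|hn] := eqVneq (h t) 0; first by rewrite mul0r normr0 powR0// gt_eqF.
  rewrite mulrA -expr2 -real_normK ?num_real// -powR_mulrn// -powRD; last by rewrite normr_eq0 hn implybT.
  by congr (_ `^ _); ring.
have ha t : `|h t * `|h t| `^ (p - 2)| = `|h t| `^ (p - 1).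
  have [->|hn] := eqVneq (h t) 0.
    by rewrite mul0r !normr0 powR0// subr_eq0 gt_eqF.
  rewrite normrM [`|_ `^ _|]ger0_norm ?powR_ge0// -{1}[`|h t|]powRr1// -powRD; last by rewrite normr_eq0 hn implybT.
  by congr (_ `^ _); ring.
have pqE : (p - 1) * q = p.
  have e1 : p * q * (p^-1 + q^-1) = p * q by rewrite pq mulr1.
  move: e1; rewrite mulrDr mulrAC mulfV ?gt_eqF// mul1r -mulrA mulfV ?gt_eqF// mulr1 => e1.
  by rewrite mulrBl mul1r -e1 addrAC subrr add0r.
have bb : b / p + b / q = b by rewrite -mulrDr pq mulr1.
have gq t : 0 < t -> `|g t| `^ q = \1_(E n) t * phi t.
  move=> t0; rewrite /g /phi indicE; case: (t \in E n) => /=; last first.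
    by rewrite !mul0r normr0 powR0// gt_eqF.
  rewrite !mul1r normrM ha [`|_ `^ (b / q)|]ger0_norm ?powR_ge0// powRM ?powR_ge0//.
  by rewrite -!powRrM pqE divfK// gt_eqF.
have hg t : 0 < t -> h t * g t * t `^ (b / p) = \1_(E n) t * phi t.
  move=> t0; have tb : t `^ (b / q) * t `^ (b / p) = t `^ b.
    by rewrite -powRD; [rewrite addrC bb|apply/implyP => _; rewrite gt_eqF].
  by rewrite /phi -hh -tb /g; ring.
have mg : measurable_fun Rplus g.
  apply: measurable_funM; last by case: (weight_powR (b / q)).
  apply: measurable_funM; first exact: measurable_indic.
  apply: measurable_funM => //.
  by apply: (measurableT_comp (measurable_powR _)) => //; exact: measurableT_comp.
have gb t : 0 < t -> `|g t| <= n%:R `^ (p - 1) * expR (n%:R * `|b / q|).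
  move=> t0; rewrite /g indicE; have [tE|tE] := boolP (t \in E n); last first.
    by rewrite !mul0r normr0 mulr_ge0 ?powR_ge0 ?expR_ge0.
  have /EP[_ /andP[t1 t2] hn] := set_mem tE.
  rewrite mul1r normrM ha; apply: ler_pM => //.
    by apply: ge0_ler_powR; rewrite ?nnegrE ?normr_ge0// subr_ge0 ltW.
  rewrite ger0_norm ?powR_ge0// /powR gt_eqF// ler_expR mulrC.
  have l1 : `|ln t| <= n%:R by apply: ln_window; rewrite ?t1.
  by apply: (le_trans (ler_norm _)); rewrite normrM ler_wpM2r.
have goff t : 0 < t -> ~ (expR (- n%:R) <= t < expR n%:R) -> g t = 0.
  move=> t0 nt; rewrite /g indicE memNset ?mul0r// => /EP[]; by [].
have hg0 t : 0 < t -> 0 <= h t * g t.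
  move=> t0; have -> : h t * g t = \1_(E n) t * `|h t| `^ p * t `^ (b / q).
    by rewrite -hh /g; ring.
  by rewrite !mulr_ge0 ?powR_ge0// indicE.
have iB : mu.-integrable Rplus (EFin \o (fun t => h t * (g t * t `^ (b / p)))).
  have gbb t : 0 < t -> `|g t * t `^ (b / p)| <= n%:R `^ (p - 1) * expR (n%:R * `|b / q|) * expR (n%:R * `|b / p|).
    move=> t0; have [tJ|tJ] := boolP (expR (- n%:R) <= t < expR n%:R); last first.
      by rewrite goff// ?mul0r ?normr0 ?mulr_ge0 ?powR_ge0 ?expR_ge0//; exact/negP.
    rewrite normrM; apply: ler_pM => //; first exact: gb.
    have /andP[t1 t2] := tJ; rewrite ger0_norm ?powR_ge0// /powR gt_eqF// ler_expR mulrC.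
    have l1 : `|ln t| <= n%:R by apply: ln_window; rewrite ?t1.
    by apply: (le_trans (ler_norm _)); rewrite normrM ler_wpM2r.
  apply: (integrable_mul_bounded (a := expR (- n%:R)) (b := expR n%:R) lh _ _ gbb) => //.
  - by apply: measurable_funM => //; case: (weight_powR (b / p)).
  - move=> t t0 nt; rewrite goff ?mul0r// => /andP[t1 t2]; apply: nt; rewrite t1 ltW//.
pose B := \int[mu]_(t in Rplus) (h t * g t * t `^ (b / p)).
have BE : (B%:E = \int[mu]_(t in Rplus) (\1_(E n) t * phi t)%:E)%E.
  rewrite /B /Rintegral; under [in RHS]eq_integral => t /set_mem/RplusE t0 do rewrite -hg//.
  rewrite fineK//; apply: integrable_fin_num => //; apply: eq_integrable iB => //.
  by move=> t _ /=; rewrite mulrA.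
have B0 : 0 <= B.
  by rewrite -lee_fin BE; apply: integral_ge0 => t _; rewrite lee_fin mulr_ge0// indicE.
have gB : (weighted_norm q (fun=> 1%R) g = (B `^ q^-1)%:E)%E.
  rewrite weighted_normE (_ : mass q (fun=> 1%R) g = B%:E) ?poweR_EFin//.
  by rewrite BE; apply: eq_integral => t /set_mem/RplusE t0; rewrite mulr1 gq.
have BC : B <= C * B `^ q^-1.
  by apply: (H n g _ _ mg gb goff hg0) => //; [exact: powR_ge0|rewrite gB].
have BCp : B <= C `^ p.
  have [B00|Bn] := eqVneq B 0; first by rewrite B00 powR_ge0.
  have Bp : 0 < B by rewrite lt_neqAle eq_sym Bn.
  have e1 : B = B `^ p^-1 * B `^ q^-1 by rewrite -powRD ?pq ?powRr1// Bn implybT.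
  have B1 : B `^ p^-1 <= C by move: BC; rewrite {1}e1 ler_pM2r// powR_gt0.
  have -> : B = (B `^ p^-1) `^ p by rewrite -powRrM mulVf ?gt_eqF// powRr1.
  by apply: ge0_ler_powR; rewrite ?nnegrE ?powR_ge0// ltW.
apply: (@le_trans _ _ B%:E); last by rewrite lee_fin.
rewrite BE; have -> : (\int[mu]_(t in E n) (phi t)%:E = \int[mu]_(t in E n) (\1_(E n) t * phi t)%:E)%E.
  by apply: eq_integral => t tE; rewrite indicE tE mul1r.
apply: ge0_subset_integral => //.
- exact: mE.
- by apply/measurable_EFinP; apply: measurable_funM => //; apply: measurable_indic; exact: mE.
- by move=> t _; rewrite lee_fin mulr_ge0// indicE.
- by move=> t /EP[t0 _ _]; exact/RplusE.
Qed.

End Duality.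

(** The identity and the weak derivative share what is needed to pair a function with a bounded
    compactly supported weight. *)
Record local_op (R : realType) (p : R) (T : (R -> R) -> R -> R) : Prop := LocalOp {
  lo_loc : forall u, W11loc u -> locally_integrable (`]0, +oo[%classic : set R) (T u) ;
  lo_lin : forall (c d : R) u v, W11loc u -> W11loc v ->
    T (fun t => c * u t + d * v t) = (fun t => c * T u t + d * T v t)
      %[ae (@lebesgue_measure R) in (`]0, +oo[%classic : set R)] ;
  lo_norm : forall (b : R) u, carrier (W1p p b) u ->
    (weighted_norm p (fun t => (t `^ b)%R) (T u) <= (nrm (W1p p b) u)%:E)%E }.

Section LocalOps.
Variables (R : realType) (p : R).
Hypothesis p1 : 1 < p.
Notation mu := (@lebesgue_measure R).
Local Notation Rplus := (`]0, +oo[%classic : set R).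
Implicit Types (u v g h : R -> R) (a b c d t : R).

Lemma W11loc_lin c d u v : W11loc u -> W11loc v ->
  weak_derivative (fun t => c * u t + d * v t) (fun t => c * wderiv u t + d * wderiv v t) /\
  W11loc (fun t => c * u t + d * v t).
Proof.
move=> Wu Wv; have du := wderivP Wu; have dv := wderivP Wv.
have lZ (k : R) w : locally_integrable Rplus w -> locally_integrable Rplus (fun t => k * w t).
  by move=> lw; apply: (@locally_integrable_mull _ (fun=> k)) => // t _; exact: cst_continuous.
have [lu _] := Wu; have [lv _] := Wv.
have D := weak_derivativeD (lZ c u lu) (lZ d v lv) (weak_derivativeZ c lu du) (weak_derivativeZ d lv dv).
split => //; split; first exact: (locally_integrableD (lZ c u lu) (lZ d v lv)).
by eexists; exact: D.
Qed.

Lemma norm_parts b u : carrier (W1p p b) u ->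
  (weighted_norm p (fun t => (t `^ b)%R) u <= (nrm (W1p p b) u)%:E)%E /\
  (weighted_norm p (fun t => (t `^ b)%R) (wderiv u) <= (nrm (W1p p b) u)%:E)%E.
Proof.
move=> [_ fin]; rewrite /= fineK.
  by split; [rewrite leeDl ?weighted_norm_ge0|rewrite leeDr ?weighted_norm_ge0].
by rewrite ge0_fin_numE// adde_ge0 ?weighted_norm_ge0.
Qed.

Lemma local_op_id : local_op p id.
Proof.
split.
- by move=> u [].
- by move=> c d u v _ _; exact: aeW.
- by move=> b u /norm_parts[].
Qed.

Lemma local_op_wderiv : local_op p (@wderiv R).
Proof.
split.
- by move=> u /wderivP[].
- move=> c d u v Wu Wv; have [D W] := W11loc_lin c d Wu Wv.
  exact: (weak_derivative_unique (wderivP W) D).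
- by move=> b u /norm_parts[].
Qed.

End LocalOps.

Section PiecePairing.
Variables (R : realType) (p q : R) (T : (R -> R) -> R -> R) (n : nat) (g : R -> R) (G M : R).
Notation mu := (@lebesgue_measure R).
Local Notation Rplus := (`]0, +oo[%classic : set R).
Hypotheses (p1 : 1 < p) (q1 : 1 < q) (pq : p^-1 + q^-1 = 1) (lT : local_op p T).
Hypotheses (mg : measurable_fun Rplus g) (gM : forall t, 0 < t -> `|g t| <= M)
  (goff : forall t, 0 < t -> ~ (expR (- n%:R) <= t < expR n%:R) -> g t = 0)
  (G0 : 0 <= G) (gG : (weighted_norm q (fun=> 1%R) g <= G%:E)%E).
Implicit Types (u v : R -> R) (b c d t : R).

(** The pieces run over the window [e^-n, e^n) as k runs from 0 to 2 n. *)
Definition node (k : nat) : R := k%:R - n%:R.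
Definition piece k := `[expR (node k), expR (node k.+1)[%classic : set R.
Definition pairing k u := \int[mu]_(t in piece k) (T u t * g t).

Lemma measurable_piece k : measurable (piece k). Proof. exact: measurable_itv. Qed.

Lemma piece_Rplus k : piece k `<=` Rplus.
Proof.
by move=> t /=; rewrite in_itv/= => /andP[t1 _]; apply/RplusE; exact: lt_le_trans (expR_gt0 _) t1.
Qed.

Lemma pair_integrable c u : W11loc u -> mu.-integrable Rplus (EFin \o (fun t => T u t * (g t * t `^ c))).
Proof.
move=> Wu; have gb t : 0 < t -> `|g t * t `^ c| <= M * expR (n%:R * `|c|).
  move=> t0; have [tJ|tJ] := boolP (expR (- n%:R) <= t < expR n%:R); last first.
    rewrite goff// ?mul0r ?normr0 ?mulr_ge0 ?expR_ge0//; [exact: le_trans (gM t0)|exact/negP].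
  rewrite normrM; apply: ler_pM => //; first exact: gM.
  rewrite ger0_norm ?powR_ge0// /powR gt_eqF// ler_expR mulrC.
  by apply: (le_trans (ler_norm _)); rewrite normrM ler_wpM2r// ln_window.
apply: (integrable_mul_bounded (a := expR (- n%:R)) (b := expR n%:R) (lo_loc lT Wu) _ _ gb) => //.
- by apply: measurable_funM => //; case: (weight_powR c).
- by move=> t t0 nt; rewrite goff ?mul0r// => /andP[t1 t2]; apply: nt; rewrite t1 ltW.
Qed.

Lemma pair_integrable0 u : W11loc u -> mu.-integrable Rplus (EFin \o (fun t => T u t * g t)).
Proof.
move=> Wu; have -> : (fun t => T u t * g t) = (fun t => T u t * (g t * t `^ 0)).
  by apply/funext => t; rewrite powRr0 mulr1.
exact: pair_integrable.
Qed.

Lemma sum_pieces (f : R -> R) m : mu.-integrable Rplus (EFin \o f) ->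
  \sum_(k < m) \int[mu]_(t in piece k) f t = \int[mu]_(t in `[expR (node 0), expR (node m)[%classic) f t.
Proof.
move=> fi; elim: m => [|m IH].
  by rewrite big_ord0 set_itv_ge ?Rintegral_set0// bnd_simp ltxx.
have le1 : expR (node 0) <= expR (node m) by rewrite ler_expR lerD2r ler0n.
have le2 : expR (node m) <= expR (node m.+1) by rewrite ler_expR lerD2r ler_nat.
rewrite big_ord_recr /= IH -Rintegral_setU.
- by congr (Rintegral _ _ _); rewrite /piece -itv_bndbnd_setU// bnd_simp.
- exact: measurable_itv.
- exact: measurable_piece.
- apply: (integrable_sub _ (@mRplus R) _ fi).
    by apply: measurableU; [exact: measurable_itv|exact: measurable_piece].
  move=> t [|/piece_Rplus//] /=; rewrite in_itv/= => /andP[t1 _].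
  by apply/RplusE; exact: lt_le_trans (expR_gt0 _) t1.
- apply/disj_setPS => t [] /=; rewrite !in_itv/= => /andP[_ t1] /andP[t2 _].
  by move: (lt_le_trans t1 t2); rewrite ltxx.
Qed.

Lemma node_weight c k t : piece k t -> expR (node k * c) <= expR `|c| * t `^ c /\
  t `^ c <= expR `|c| * expR (node k * c).
Proof.
move=> kt; have /RplusE t0 := piece_Rplus kt.
move: kt; rewrite /piece /= in_itv/= => /andP[t1 t2].
have l1 : node k <= ln t by rewrite -ler_expR lnK ?posrE.
have l2 : ln t <= node k + 1.
  by rewrite -ler_expR lnK ?posrE// ltW// (lt_le_trans t2)// ler_expR /node -natr1 addrAC.
have d1 : `|ln t - node k| <= 1 by rewrite ler_norml; apply/andP; split; lra.
have d2 : `|(ln t - node k) * c| <= `|c| by rewrite normrM ler_piMl.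
move: d2; rewrite ler_norml mulrBl => /andP[e1 e2].
rewrite /powR gt_eqF// -!expRD !ler_expR (mulrC c); split; lra.
Qed.

Lemma pairing_lin k c d u v : W11loc u -> W11loc v ->
  pairing k (fun t => c * u t + d * v t) = c * pairing k u + d * pairing k v.
Proof.
move=> Wu Wv; have [_ W] := W11loc_lin c d Wu Wv.
have iu := integrable_sub (measurable_piece k) (@mRplus R) (@piece_Rplus k) (pair_integrable0 Wu).
have iv := integrable_sub (measurable_piece k) (@mRplus R) (@piece_Rplus k) (pair_integrable0 Wv).
have iw := integrable_sub (measurable_piece k) (@mRplus R) (@piece_Rplus k) (pair_integrable0 W).
have mk := measurable_piece k.
rewrite /pairing -RintegralZl// -RintegralZl// -RintegralD//; try exact: integrableZ.
rewrite /Rintegral; congr fine; apply: ae_eq_integral => //.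
- by case/integrableP: iw.
- by case/integrableP: (integrable_add mk (integrableZ c mk iu) (integrableZ d mk iv)).
- apply: ae_imply (lo_lin lT c d Wu Wv) => t Ht /piece_Rplus /Ht E.
  by rewrite E; congr EFin; ring.
Qed.

Lemma pair_holder b u : carrier (W1p p b) u ->
  \int[mu]_(t in Rplus) `|T u t * (g t * t `^ (b / p))| <= nrm (W1p p b) u * G.
Proof.
move=> Wu; have Wl : W11loc u by case: Wu.
have i1 := pair_integrable (b / p) Wl.
have p0 : 0 < p := lt_trans ltr01 p1.
have q0 : 0 < q := lt_trans ltr01 q1.
have N0 := rs_ge0 (W1p_rspace p1 b) u.
have mT := loc_measurable (lo_loc lT Wl).
have mTt : measurable_fun Rplus (fun t => T u t * t `^ (b / p)).
  by apply: measurable_funM => //; case: (weight_powR (b / p)).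
rewrite -lee_fin /Rintegral fineK; last first.
  by apply: integrable_fin_num => //; exact: integrable_norm.
have := hoelder_Rplus p0 q0 pq mTt mg.
have -> : weighted_norm p (cst 1) (fun t => T u t * t `^ (b / p)) = weighted_norm p (fun t => (t `^ b)%R) (T u).
  rewrite !weighted_normE /mass; congr (_ `^ _)%E; apply: eq_integral => t /set_mem/RplusE t0.
  rewrite mulr1 normrM [`|_ `^ (b / p)|]ger0_norm ?powR_ge0// powRM ?powR_ge0//.
  by rewrite -powRrM divfK// gt_eqF.
move=> H; apply: (@le_trans _ _ (weighted_norm p (fun t => (t `^ b)%R) (T u) * weighted_norm q (cst 1%R) g)%E).
  apply: le_trans H; rewrite le_eqVlt; apply/orP; left; apply/eqP; apply: eq_integral => t _.
  by rewrite -mulrA [g t * _]mulrC.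
rewrite EFinM; apply: lee_pmul; rewrite ?weighted_norm_ge0//; exact: (lo_norm lT).
Qed.

(** Replace the constants by t^(b/p) at the cost of a factor, and apply Hoelder's inequality to the
    whole window. *)
Lemma pairing_sum b u m : carrier (W1p p b) u ->
  \sum_(k < m) expR (node k * (b / p)) * `|pairing k u| <= expR `|b / p| * (nrm (W1p p b) u * G).
Proof.
move=> Wu; have Wl : W11loc u by case: Wu.
have i1 := integrable_norm (pair_integrable (b / p) Wl).
apply: (@le_trans _ _ (\sum_(k < m) expR `|b / p| * \int[mu]_(t in piece k) `|T u t * (g t * t `^ (b / p))|)).
  apply: ler_sum => k _; have mk := measurable_piece k.
  have iu := integrable_sub mk (@mRplus R) (@piece_Rplus k) (pair_integrable0 Wl).
  have ik := integrable_sub mk (@mRplus R) (@piece_Rplus k) i1.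
  apply: (@le_trans _ _ (expR (node k * (b / p)) * \int[mu]_(t in piece k) `|T u t * g t|)).
    by rewrite ler_wpM2l ?expR_ge0//; exact: le_normr_Rintegral.
  rewrite -!RintegralZl//; try exact: integrable_norm.
  apply: le_Rintegral => //; try by apply: integrableZ => //; exact: integrable_norm.
  move=> t kt; have [H _] := node_weight (b / p) kt.
  have -> : `|T u t * (g t * t `^ (b / p))| = t `^ (b / p) * `|T u t * g t|.
    by rewrite mulrA normrM [`|_ `^ _|]ger0_norm ?powR_ge0// mulrC.
  by rewrite [leRHS]mulrA ler_wpM2r.
rewrite -mulr_sumr ler_wpM2l ?expR_ge0// (sum_pieces m i1).
apply: le_trans (pair_holder Wu); apply: subset_Rintegral => //.
  move=> t /=; rewrite in_itv/= => /andP[t1 _].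
  by apply/RplusE; exact: lt_le_trans (expR_gt0 _) t1.
by move=> t /=.
Qed.

Lemma pairing_lower b u : W11loc u -> (forall t, 0 < t -> 0 <= T u t * g t) ->
  \int[mu]_(t in Rplus) (T u t * g t * t `^ (b / p)) <=
    expR `|b / p| * \sum_(k < n + n) expR (node k * (b / p)) * pairing k u.
Proof.
move=> Wl pos; have i1 := pair_integrable (b / p) Wl.
rewrite -(@Rintegral_off _ `[expR (node 0), expR (node (n + n))[%classic) //; first last.
- move=> t /RplusE t0; rewrite /= in_itv/= /node sub0r natrD addrK => nt.
  by rewrite goff ?mulr0 ?mul0r.
- move=> t /=; rewrite in_itv/= => /andP[t1 _].
  by apply/RplusE; exact: lt_le_trans (expR_gt0 _) t1.
under eq_Rintegral do rewrite -mulrA.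
rewrite -(sum_pieces _ i1) mulr_sumr; apply: ler_sum => k _; have mk := measurable_piece k.
have iu := integrable_sub mk (@mRplus R) (@piece_Rplus k) (pair_integrable0 Wl).
have ik := integrable_sub mk (@mRplus R) (@piece_Rplus k) i1.
rewrite mulrA /pairing -RintegralZl//; apply: le_Rintegral => //; first exact: integrableZ.
move=> t kt; have [_ H] := node_weight (b / p) kt.
by rewrite mulrA mulrC ler_wpM2r// pos//; exact/RplusE/(piece_Rplus kt).
Qed.

End PiecePairing.

(** Pass to nearly optimal decompositions. *)
Lemma sum_functional_bounded (R : realType) (V : lmodType R[i]) (X0 X1 : nspace R V)
    (L : V -> R[i]) (K0 K1 : R) : cspace X0 -> cspace X1 -> 0 <= K0 -> 0 <= K1 ->
  (forall a b, carrier (sum_space X0 X1) a -> carrier (sum_space X0 X1) b -> L (a - b) = L a - L b) ->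
  (forall a, carrier X0 a -> normc (L a) <= K0 * nrm X0 a) ->
  (forall a, carrier X1 a -> normc (L a) <= K1 * nrm X1 a) ->
  forall a, carrier (sum_space X0 X1) a -> normc (L a) <= (K0 + K1) * nrm (sum_space X0 X1) a.
Proof.
move=> cs0 cs1 K00 K10 LB L0 L1 a Wa; apply/ler_addgt0Pr => e ep.
have K' : 0 < K0 + K1 + 1 by rewrite ltr_wpDl// addr_ge0.
have [a0 [a1 [A0 A1 E H]]] := sum_split (cs_ge0 cs0) (cs_ge0 cs1) Wa (divr_gt0 ep K').
have Z0 := csB cs0 A0 A0; have Z1 := csB cs1 A1 A1; rewrite !subrr in Z0 Z1.
have S0 : carrier (sum_space X0 X1) a0 by exists a0, 0; rewrite addr0.
have S1 : carrier (sum_space X0 X1) a1 by exists 0, a1; rewrite add0r.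
have SZ : carrier (sum_space X0 X1) 0 by exists 0, 0; rewrite addr0.
have LZ : L 0 = 0 by rewrite -(subrr 0) LB// subrr.
have -> : L a = L a0 + L a1.
  have -> : a = a0 - (0 - a1) by rewrite sub0r opprK.
  by rewrite LB ?LB ?LZ ?sub0r ?opprK//; exists 0, (- a1); rewrite !add0r; split => //;
    rewrite -[- a1]add0r; exact: (csB cs1).
apply: (le_trans (le_normcD _ _)); apply: (le_trans (lerD (L0 _ A0) (L1 _ A1))).
have N0 := cs_ge0 cs0 a0; have N1 := cs_ge0 cs1 a1.
apply: (@le_trans _ _ ((K0 + K1) * (nrm X0 a0 + nrm X1 a1))).
  by rewrite mulrDr; apply: lerD; rewrite ler_wpM2r// ?lerDl ?lerDr.
apply: (@le_trans _ _ ((K0 + K1) * (nrm (sum_space X0 X1) a + e / (K0 + K1 + 1)))).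
  by apply: ler_wpM2l; [exact: addr_ge0|exact: ltW].
rewrite mulrDr lerD2l mulrCA ler_piMr ?(ltW ep)// ler_pdivrMr// mul1r lerDl.
exact: ler01.
Qed.

Lemma sum_W11loc (R : realType) (p b0 b1 : R) (x : R -> R[i]) :
  carrier (sum_space (complexification (W1p p b0)) (complexification (W1p p b1)) : nspace R (R -> R[i])) x ->
  W11loc (fun t => complex.Re (x t)) /\ W11loc (fun t => complex.Im (x t)).
Proof.
move=> [x0 [x1 [[r0 i0] [r1 i1] ->]]].
have W u v : carrier (W1p p b0) u -> carrier (W1p p b1) v -> W11loc (fun t => u t + v t).
  move=> [Wu _] [Wv _]; have [_] := W11loc_lin 1 1 Wu Wv.
  by under eq_fun do rewrite !mul1r.
by split; [have := W _ _ r0 r1|have := W _ _ i0 i1]; congr (W11loc _); apply/funext => t;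
  [rewrite -complexReD|rewrite -complexImD].
Qed.

Section ComplexPairing.
Variables (R : realType) (p q : R) (T : (R -> R) -> R -> R) (n : nat) (g : R -> R) (G M : R).
Notation mu := (@lebesgue_measure R).
Local Notation Rplus := (`]0, +oo[%classic : set R).
Hypotheses (p1 : 1 < p) (q1 : 1 < q) (pq : p^-1 + q^-1 = 1) (lT : local_op p T).
Hypotheses (mg : measurable_fun Rplus g) (gM : forall t, 0 < t -> `|g t| <= M)
  (goff : forall t, 0 < t -> ~ (expR (- n%:R) <= t < expR n%:R) -> g t = 0)
  (G0 : 0 <= G) (gG : (weighted_norm q (fun=> 1%R) g <= G%:E)%E).
Local Notation elk := (pairing T n g).
Local Notation WC b := (complexification (W1p p b)).

Definition cpairing k (x : R -> R[i]) : R[i] :=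
  elk k (fun t => complex.Re (x t)) +i* elk k (fun t => complex.Im (x t)).

Let W11C (x : R -> R[i]) := W11loc (fun t => complex.Re (x t)) /\ W11loc (fun t => complex.Im (x t)).

Lemma cpairingB k x y : W11C x -> W11C y -> cpairing k (x - y) = cpairing k x - cpairing k y.
Proof.
move=> [xr xi] [yr yi]; have lin := pairing_lin lT mg gM goff k 1 (-1).
rewrite /cpairing -[RHS]/((_ - _) +i* (_ - _)).
rewrite (_ : (fun t => complex.Re ((x - y) t)) = (fun t => 1 * complex.Re (x t) + -1 * complex.Re (y t))); last first.
  by apply/funext => t; rewrite mul1r mulN1r -[LHS]/(complex.Re (x t - y t)); case: (x t); case: (y t).
rewrite (_ : (fun t => complex.Im ((x - y) t)) = (fun t => 1 * complex.Im (x t) + -1 * complex.Im (y t))); last first.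
  by apply/funext => t; rewrite mul1r mulN1r -[LHS]/(complex.Im (x t - y t)); case: (x t); case: (y t).
by rewrite !lin// !mul1r !mulN1r.
Qed.

Lemma cpairingZ k (l : R[i]) x : W11C x -> cpairing k (fun t => l * x t) = l * cpairing k x.
Proof.
move=> [xr xi]; rewrite /cpairing.
rewrite (_ : (fun t => complex.Re (l * x t)) =
  (fun t => complex.Re l * complex.Re (x t) + (- complex.Im l) * complex.Im (x t))); last first.
  by apply/funext => t; rewrite complexReM mulN1r mulNr.
rewrite (_ : (fun t => complex.Im (l * x t)) =
  (fun t => complex.Re l * complex.Im (x t) + complex.Im l * complex.Re (x t))); last first.
  by apply/funext => t; rewrite complexImM.
rewrite !(pairing_lin lT mg gM goff)//; apply/eqP; rewrite eq_complex; case: l => l1 l2 /=.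
by rewrite mulNr !eqxx.
Qed.

Lemma cpairing_sum b x m : carrier (WC b) x ->
  \sum_(k < m) expR (node R n k * (b / p)) * normc (cpairing k x) <=
    2 * expR `|b / p| * G * nrm (WC b) x.
Proof.
move=> Wx; have [xr xi] := Wx; have rW := W1p_rspace p1 b.
have sr := pairing_sum p1 q1 pq lT mg gM goff gG m xr.
have si := pairing_sum p1 q1 pq lT mg gM goff gG m xi.
apply: (@le_trans _ _ (\sum_(k < m) (expR (node R n k * (b / p)) * `|elk k (fun t => complex.Re (x t))|
   + expR (node R n k * (b / p)) * `|elk k (fun t => complex.Im (x t))|))).
  apply: ler_sum => k _; rewrite -mulrDr ler_wpM2l ?expR_ge0//; exact: normc_le_ReIm.
rewrite big_split /=; apply: (le_trans (lerD sr si)).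
have E0 : 0 <= expR `|b / p| * G by rewrite mulr_ge0 ?expR_ge0.
have -> : 2 * expR `|b / p| * G * nrm (WC b) x =
  expR `|b / p| * (nrm (WC b) x * G) + expR `|b / p| * (nrm (WC b) x * G) by ring.
by apply: lerD; rewrite ler_wpM2l ?expR_ge0// ler_wpM2r//; [exact: cnrm_Re|exact: cnrm_Im].
Qed.

Lemma complexRe_sum m (F : 'I_m -> R[i]) : complex.Re (\sum_k F k) = \sum_k complex.Re (F k) /\
  complex.Im (\sum_k F k) = \sum_k complex.Im (F k).
Proof.
elim/big_rec3 : _ => // k a b c _ [<- <-]; split; first exact: complexReD.
exact: complexImD.
Qed.

(** [calderon_functional] applied to the pairings on the pieces, with lam_k = node k; the real and the
    imaginary part of the sum are the pairings of the two parts of f th. *)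
Lemma interp_pairing b0 b1 th f : 0 < th < 1 -> carrier (calderon_class (WC b0) (WC b1)) f ->
  let bt := (1 - th) * b0 + th * b1 in
  let C := 2 * expR (`|b0 / p| + `|b1 / p|) * G * nrm (calderon_class (WC b0) (WC b1)) f in
  \sum_(k < n + n) expR (node R n k * (bt / p)) * elk k (fun t => complex.Re (f th%:C t)) <= C /\
  \sum_(k < n + n) expR (node R n k * (bt / p)) * elk k (fun t => complex.Im (f th%:C t)) <= C.
Proof.
move=> hth cf bt C; have rW0 := W1p_rspace p1 b0; have rW1 := W1p_rspace p1 b1.
have cs0 := complexification_cspace rW0; have cs1 := complexification_cspace rW1.
have WSg x : carrier (sum_space (WC b0) (WC b1)) x -> W11C x by exact: sum_W11loc.
pose M' := 2 * expR (`|b0 / p| + `|b1 / p|) * G.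
have M0 : 0 <= M' by rewrite !mulr_ge0 ?expR_ge0.
have edge b x : `|b / p| <= `|b0 / p| + `|b1 / p| -> carrier (WC b) x ->
    \sum_(k < n + n) expR (node R n k * (b / p)) * normc (cpairing k x) <= M' * nrm (WC b) x.
  move=> bb Wx; apply: (le_trans (cpairing_sum _ Wx)).
  rewrite ler_wpM2r ?(cnrm_ge0 (W1p_rspace p1 b))// ler_wpM2r// ler_wpM2l// ler_expR//.
have [l0 l1] : `|b0 / p| <= `|b0 / p| + `|b1 / p| /\ `|b1 / p| <= `|b0 / p| + `|b1 / p|.
  by rewrite lerDl lerDr !normr_ge0.
have e0 x := @edge b0 x l0; have e1 x := @edge b1 x l1.
have one (b : R) (k : 'I_(n + n)) x : \sum_(k < n + n) expR (node R n k * (b / p)) * normc (cpairing k x) <= M' * nrm (WC b) x ->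
    normc (cpairing k x) <= expR (- (node R n k * (b / p))) * M' * nrm (WC b) x.
  move=> H; rewrite expRN -mulrA mulrC ler_pdivlMr ?expR_gt0// mulrC; apply: le_trans H.
  by rewrite (bigD1 k)//= lerDl sumr_ge0// => i _; rewrite mulr_ge0 ?expR_ge0 ?normc_ge0.
have LB (k : 'I_(n + n)) (a c : R -> R[i]) : carrier (sum_space (WC b0) (WC b1)) a ->
    carrier (sum_space (WC b0) (WC b1)) c -> cpairing k (a - c) = cpairing k a - cpairing k c.
  by move=> /WSg Wa /WSg Wc; exact: cpairingB.
have LZ (k : 'I_(n + n)) (l : R[i]) (a : R -> R[i]) : carrier (sum_space (WC b0) (WC b1)) a ->
    cpairing k (l *: a) = l * cpairing k a.
  by move=> /WSg Wa; exact: cpairingZ.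
have LC (k : 'I_(n + n)) : exists2 C : R, 0 <= C & forall a, carrier (sum_space (WC b0) (WC b1)) a ->
    normc (cpairing k a) <= C * nrm (sum_space (WC b0) (WC b1)) a.
  pose K0 := expR (- (node R n k * (b0 / p))) * M'; pose K1 := expR (- (node R n k * (b1 / p))) * M'.
  have K00 : 0 <= K0 by rewrite mulr_ge0 ?expR_ge0.
  have K10 : 0 <= K1 by rewrite mulr_ge0 ?expR_ge0.
  exists (K0 + K1); first exact: addr_ge0.
  apply: (sum_functional_bounded cs0 cs1 K00 K10 (LB k)) => a Wa; [exact: (one _ _ _ (e0 _ Wa))|exact: (one _ _ _ (e1 _ Wa))].
have := @calderon_functional R _ (WC b0) (WC b1) cs0 cs1 f th (n + n) (fun k => cpairing k)
  (fun k => node R n k) (b0 / p) (b1 / p) M' hth cf M0 LB LZ LC e0 e1.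
have -> : (1 - th) * (b0 / p) + th * (b1 / p) = bt / p by rewrite /bt [RHS]mulrDl !mulrA.
move=> H; have [ER EI] := complexRe_sum (fun k : 'I_(n + n) => (expR (node R n k * (bt / p)))%:C * cpairing k (f th%:C)).
split.
  apply: le_trans H; apply: le_trans (le_trans (ler_norm _) (Re_le_normc _)); rewrite ER.
  by apply: ler_sum => k _; rewrite /= mul0r subr0.
apply: le_trans H; apply: le_trans (le_trans (ler_norm _) (Im_le_normc _)); rewrite EI.
by apply: ler_sum => k _; rewrite /= mul0r addr0.
Qed.

End ComplexPairing.

(** * The chain of inclusions *)

Section Chain.
Variables (R : realType) (p th b0 b1 : R).
Hypotheses (p1 : 1 < p) (hth : 0 < th < 1).
Let bt := (1 - th) * b0 + th * b1.
Local Notation WC b := (complexification (W1p p b)).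
Local Notation W0C b := (complexification (W1p0 p b)).
Local Notation YC b := (complexification (Y1p p b)).

(** By [interp_pairing], [pairing_lower] and [mass_duality], applied to the identity and to the weak
    derivative. *)
Lemma interp_sub_W : exists2 C : R, 0 < C & forall x, carrier (complex_interp (WC b0) (WC b1) th) x ->
  carrier (WC bt) x /\ nrm (WC bt) x <= C * nrm (complex_interp (WC b0) (WC b1) th) x.
Proof.
have rW := W1p_rspace p1 bt.
have cs0 := complexification_cspace (W1p_rspace p1 b0).
have cs1 := complexification_cspace (W1p_rspace p1 b1).
pose C1 := expR `|bt / p| * (2 * expR (`|b0 / p| + `|b1 / p|)).
have C10 : 0 < C1 by rewrite !mulr_gt0 ?expR_gt0.
have p0 : 0 < p := lt_trans ltr01 p1.
pose q := p / (p - 1).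
have pm : 0 < p - 1 by rewrite subr_gt0.
have q1 : 1 < q by rewrite ltr_pdivlMr// mul1r ltrBlDr ltrDl.
have pq : p^-1 + q^-1 = 1 by rewrite /q; field; rewrite !gt_eqF.
have key f x : carrier (calderon_class (WC b0) (WC b1)) f -> f th%:C = x ->
    carrier (WC bt) x /\ nrm (WC bt) x <= 4 * C1 * nrm (calderon_class (WC b0) (WC b1)) f.
  move=> cf fx; set A := nrm _ f.
  have A0 : 0 <= A by apply: calderon_ge0; exact: (cs_ge0 cs0).
  have CA : 0 <= C1 * A by rewrite mulr_ge0// ltW.
  have [Wr Wi] : W11loc (fun t => complex.Re (x t)) /\ W11loc (fun t => complex.Im (x t)).
    apply: (@sum_W11loc _ p b0 b1); rewrite -fx; have [[fs _ _] _ _ _] := cf; apply: fs.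
    by rewrite /closed_strip /=; case/andP: hth => ? ?; rewrite !ltW.
  have bound T : local_op p T ->
      (weighted_norm p (fun t => (t `^ bt)%R) (T (fun t => complex.Re (x t))) <= (C1 * A)%:E)%E /\
      (weighted_norm p (fun t => (t `^ bt)%R) (T (fun t => complex.Im (x t))) <= (C1 * A)%:E)%E.
    move=> lT.
    have H (u : R -> R) : W11loc u -> (forall (n : nat) (g : R -> R) (G M : R), measurable_fun (`]0, +oo[%classic : set R) g ->
        (forall t, 0 < t -> `|g t| <= M) ->
        (forall t, 0 < t -> ~ (expR (- n%:R) <= t < expR n%:R) -> g t = 0) -> 0 <= G ->
        (weighted_norm q (fun=> 1%R) g <= G%:E)%E ->
        \sum_(k < n + n) expR (node R n k * (bt / p)) * pairing T n g k u <=
          2 * expR (`|b0 / p| + `|b1 / p|) * G * A) ->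
        (weighted_norm p (fun t => (t `^ bt)%R) (T u) <= (C1 * A)%:E)%E.
      move=> Wu H; rewrite weighted_normE.
      have -> : C1 * A = ((C1 * A) `^ p) `^ p^-1 by rewrite -powRrM mulfV ?gt_eqF// powRr1.
      apply: poweR_le_root => //; [exact: powR_ge0|exact: (mass_ge0 _ _ (weight_powR bt))|].
      apply: (mass_duality p1 q1 pq CA (lo_loc lT Wu)) => n g G M mg gM goff pos G0 gG.
      apply: (le_trans (pairing_lower lT mg gM goff _ Wu pos)).
      apply: (@le_trans _ _ (expR `|bt / p| * (2 * expR (`|b0 / p| + `|b1 / p|) * G * A))).
        by rewrite ler_wpM2l ?expR_ge0//; exact: (H n g G M).
      by rewrite /C1 le_eqVlt; apply/orP; left; apply/eqP; ring.
    split; apply: H => // n g G M mg gM goff G0 gG; rewrite -fx.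
      by have [] := interp_pairing p1 q1 pq lT mg gM goff G0 gG hth cf.
    by have [] := interp_pairing p1 q1 pq lT mg gM goff G0 gG hth cf.
  have [r0 i0] := bound _ (@local_op_id R p); have [r1 i1] := bound _ (@local_op_wderiv R p).
  have part u : W11loc u -> (weighted_norm p (fun t => (t `^ bt)%R) u <= (C1 * A)%:E)%E ->
      (weighted_norm p (fun t => (t `^ bt)%R) (wderiv u) <= (C1 * A)%:E)%E ->
      carrier (W1p p bt) u /\ nrm (W1p p bt) u <= C1 * A + C1 * A.
    move=> Wu u0 u1.
    have S : (sobolev_norm p (fun t => (t `^ bt)%R) (fun t => (t `^ bt)%R) u <= (C1 * A + C1 * A)%:E)%E.
      by rewrite EFinD; exact: (leeD u0 u1).
    split; first by split => //; apply: le_lt_trans S (ltry _).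
    rewrite /= -lee_fin fineK//; rewrite ge0_fin_numE; first exact: le_lt_trans S (ltry _).
    by rewrite adde_ge0 ?weighted_norm_ge0.
  have [cr nr] := part _ Wr r0 r1; have [ci ni] := part _ Wi i0 i1.
  have cx : carrier (WC bt) x := conj cr ci.
  split; first exact: cx.
  apply: (le_trans (cnrm_le_add rW cx)); apply: (le_trans (lerD nr ni)).
  by rewrite le_eqVlt; apply/orP; left; apply/eqP; ring.
exists (4 * C1); first by rewrite mulr_gt0.
move=> x cx; split; first by have [f cf fx] := cx; have [] := key f x cf fx.
apply/ler_addgt0Pr => e e0; have C4 : 0 < 4 * C1 by rewrite mulr_gt0.
have [f [cf fx fe]] := interp_approx (cs_ge0 cs0) cx (divr_gt0 e0 C4).
have [_ H] := key f x cf fx; apply: (le_trans H).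
apply: (@le_trans _ _ (4 * C1 * (nrm (complex_interp (WC b0) (WC b1) th) x + e / (4 * C1)))).
  by apply: ler_wpM2l; exact: ltW.
by rewrite mulrDr lerD2l mulrC divfK// gt_eqF.
Qed.

Lemma interp_W0_sub x : carrier (complex_interp (W0C b0) (W0C b1) th) x ->
  carrier (complex_interp (WC b0) (WC b1) th) x /\
  nrm (complex_interp (WC b0) (WC b1) th) x <= nrm (complex_interp (W0C b0) (W0C b1) th) x.
Proof.
have sub b (a : R -> R[i]) : carrier (W0C b) a -> carrier (WC b) a by move=> [[? _] [? _]].
apply: interp_mono.
- exact: (complexification_cspace (W1p0_rspace p1 b0)).
- exact: (complexification_cspace (W1p0_rspace p1 b1)).
- exact: (complexification_cspace (W1p_rspace p1 b0)).
- exact: (complexification_cspace (W1p_rspace p1 b1)).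
- exact: sub.
- exact: sub.
- by [].
- by [].
Qed.

Lemma complexification_sub (X Z : nspace R (R -> R)) (C : R) : rspace X -> rspace Z -> 0 <= C ->
  (forall u, carrier X u -> carrier Z u /\ nrm Z u <= C * nrm X u) ->
  forall x, carrier (complexification X) x -> carrier (complexification Z) x /\
    nrm (complexification Z) x <= (C + C) * nrm (complexification X) x.
Proof.
move=> rX rZ C0 H x Xx; have [xr xi] := Xx.
have [zr nr] := H _ xr; have [zi ni] := H _ xi.
have Zx : carrier (complexification Z) x := conj zr zi.
split; first exact: Zx.
apply: (le_trans (cnrm_le_add rZ Zx)); rewrite mulrDl; apply: lerD.
  by apply: (le_trans nr); apply: ler_wpM2l => //; exact: cnrm_Re.
by apply: (le_trans ni); apply: ler_wpM2l => //; exact: cnrm_Im.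
Qed.

End Chain.

Lemma space_eq_sandwich (R : realType) (V : Type) (A B : nspace R V) (a b : R) : 0 < a -> 0 < b ->
  (forall x, 0 <= nrm A x) -> (forall x, 0 <= nrm B x) ->
  (forall x, carrier A x -> carrier B x /\ nrm B x <= a * nrm A x) ->
  (forall x, carrier B x -> carrier A x /\ nrm A x <= b * nrm B x) -> space_eq A B.
Proof.
move=> a0 b0 nA nB AB BA; split.
  by rewrite eqEsubset; split=> x; [move=> /AB[]|move=> /BA[]].
exists (a + b) => [|x Ax]; first exact: addr_gt0.
have [Bx H1] := AB x Ax; have [_ H2] := BA x Bx; split.
  by apply: (le_trans H2); apply: ler_wpM2r => //; rewrite lerDr ltW.
by apply: (le_trans H1); apply: ler_wpM2r => //; rewrite lerDl ltW.
Qed.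

Theorem theorem4p5 (R : realType) (p theta beta0 beta1 : R)
    (hp : 1 < p) (htheta : 0 < theta < 1)
    (hbeta : (1 - theta) * beta0 + theta * beta1 <= -1 \/
             p - 1 < (1 - theta) * beta0 + theta * beta1) :
  let betat := (1 - theta) * beta0 + theta * beta1 in
  let W0C beta := complexification (W1p0 p beta) in
  let WC beta := complexification (W1p p beta) in
  let YC beta := complexification (Y1p p beta) in
  [/\ space_eq (complex_interp (W0C beta0) (W0C beta1) theta)
               (complex_interp (WC beta0) (WC beta1) theta),
      space_eq (complex_interp (WC beta0) (WC beta1) theta) (WC betat)
    & space_eq (WC betat) (YC betat)].
Proof.
move=> betat W0C WC YC.
have rW := W1p_rspace hp betat; have rY := Y1p_rspace hp betat.
have [C1 C10 IW] := interp_sub_W beta0 beta1 hp htheta.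
have [C2 C20 WY'] := W1p_sub_Y1p hp hbeta.
have WY := complexification_sub rW rY (ltW C20) WY'.
have YW := complexification_sub rY rW (ler0n R 2) (fun u => @Y1p_sub_W1p R p hp betat u).
have [C3 C30 YI] := Y_sub_interp beta0 beta1 hp htheta.
have I0I := @interp_W0_sub R p theta beta0 beta1 hp.
have nW0 := cnrm_ge0 (W1p0_rspace hp beta0); have nW0' := cnrm_ge0 (W1p_rspace hp beta0).
have ltr0Sn2 : (0 : R) < 2 by rewrite ltr0n.
have C22 : 0 < C2 + C2 by rewrite addr_gt0.
have WI0 x : carrier (WC betat) x -> carrier (complex_interp (W0C beta0) (W0C beta1) theta) x /\
    nrm (complex_interp (W0C beta0) (W0C beta1) theta) x <= C3 * (C2 + C2) * nrm (WC betat) x.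
  move=> /WY[Yx ny]; have [Ix ni] := YI x Yx; split; first exact: Ix.
  by rewrite -mulrA; apply: (le_trans ni); apply: ler_wpM2l; [exact: ltW|exact: ny].
have C320 : 0 < C3 * (C2 + C2) by rewrite mulr_gt0.
split.
- apply: (space_eq_sandwich ltr01 (mulr_gt0 C320 C10)).
  + by move=> x; apply: interp_ge0.
  + by move=> x; apply: interp_ge0.
  + by move=> x /I0I; rewrite mul1r.
  + move=> x /IW[Wx nx]; have [Ix ni] := WI0 x Wx; split; first exact: Ix.
    by rewrite -mulrA; apply: (le_trans ni); apply: ler_wpM2l; [exact: ltW|exact: nx].
- apply: (space_eq_sandwich C10 C320).
  + by move=> x; apply: interp_ge0.
  + exact: (cnrm_ge0 rW).
  + exact: IW.
  + move=> x /WI0[/I0I[Ix n1] n2]; split; first exact: Ix.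
    exact: (le_trans n1 n2).
- apply: (space_eq_sandwich C22 (addr_gt0 ltr0Sn2 ltr0Sn2)).
  + exact: (cnrm_ge0 rW).
  + exact: (cnrm_ge0 rY).
  + exact: WY.
  + exact: YW.
Qed.
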